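(* Let $h>1$, $d\in\mathbb{N}=\{1,2,\dots\}$, $0<\beta<2$, and let $m=(\cos\phi,\sin\phi)\in\mathcal{A}_h(-d)$ be a minimiser of $E_h$ in $\mathcal{A}_h(-d)$, with continuous lifting $\phi:\mathbb{R}\to\mathbb{R}$ such that $\lim_{x_1\to\infty}\phi(x_1)=0$. Then there exist $a\in\mathbb{R}$ and $c,C>0$ such that for all $x_1\ge a$: $\phi'(x_1)\le0$ and $$\max\{|\phi(x_1)|,|\phi'(x_1)|,|\phi''(x_1)|\}\le e^{c(a-x_1)},$$ and, for all $x_1>a$, $$|\Lambda(m_1-1)(x_1)|\le\frac{C}{(x_1-a)^\beta}.$$
   Context: Let $h>1$. $\mathbb{S}^1$ is the unit circle in $\mathbb{R}^2$, and $W(m)=\frac12(m_1^2-2hm_1+2h-1)$ for $m=(m_1,m_2)\in\mathbb{S}^1$. Let $\mathbb{R}^2_+=\mathbb{R}\times(0,\infty)$ and let $\dot H^1(\mathbb{R}^2_+)$ be the completion of $C_0^\infty(\overline{\mathbb{R}^2_+})$ with respect to the inner product $\int_{\mathbb{R}^2_+}\nabla\phi\cdot\nabla\psi\,dx$. For $m:\mathbb{R}\to\mathbb{S}^1$ with $m_1-1\in H^1(\mathbb{R})$, let $u\in\dot H^1(\mathbb{R}^2_+)$ be the unique solution of $\Delta u=0$ in $\mathbb{R}^2_+$, $\partial u/\partial x_2=-m_1'$ on $\mathbb{R}\times\{0\}$, i.e. $\int_{\mathbb{R}^2_+}\nabla u\cdot\nabla\zeta\,dx=\int_{\mathbb{R}}m_1'\,\zeta(\cdot,0)\,dx_1$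 for all $\zeta\in C_0^\infty(\mathbb{R}^2)$. Equivalently $\int_{\mathbb{R}^2_+}|\nabla u|^2dx=\int_{\mathbb{R}}|\xi|\,|\mathcal{F}(m_1-1)(\xi)|^2d\xi$, with unitary Fourier transform $\mathcal{F}$. Energy: $E_h(m)=\frac12\int_{-\infty}^\infty(|m'|^2+2W(m))\,dx_1+\frac12\int_{\mathbb{R}^2_+}|\nabla u|^2\,dx$. For $m\in H^1_{loc}(\mathbb{R};\mathbb{S}^1)$, $E_h(m)<\infty$ means that $m_1-1\in H^1(\mathbb{R})\cap L^1(\mathbb{R})$ and $m_2'\in L^2(\mathbb{R})$. Winding number: if $E_h(m)<\infty$, then $m=(\cos\phi,\sin\phi)$ for a continuous lifting $\phi:\mathbb{R}\to\mathbb{R}$ whose limits $\phi(\pm\infty)$ exist and lie in $2\pi\mathbb{Z}$, and $\deg(m)=\frac{\phi(+\infty)-\phi(-\infty)}{2\pi}\in\mathbb{Z}$. For $d\in\mathbb{Z}$, $\mathcal{A}_h(d)=\{m\in H^1_{loc}(\mathbb{R};\mathbb{S}^1): E_h(m)<\infty,\ \deg(m)=d\}$; a minimiser of $E_h$ in $\mathcal{A}_h(d)$ is an $m\in\mathcal{A}_h(d)$ with $E_h(m)=\inf_{\mathcal{A}_h(d)}E_h$. It is known that liftings $\phi$ of such minimisers belong to $C^\infty(\mathbb{R})$. The operator $\Lambda=-(-\frac{d^2}{dx_1^2})^{1/2}$ is given by $\mathcal{F}(\Lambda f)(\xi)=-|\xi|\mathcal{F}f(\xi)$, equivalently $\Lambda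 f(x_1)=\frac1\pi\,\mathrm{PV}\!\int_{-\infty}^\infty\frac{f(t)-f(x_1)}{(t-x_1)^2}\,dt$. *)

(* Defs.v *)
From HB Require Import structures.
From mathcomp Require Import all_boot all_order all_algebra.
From mathcomp Require Import all_classical all_reals all_analysis.

Set Implicit Arguments.
Unset Strict Implicit.
Unset Printing Implicit Defensive.

Import Order.TTheory GRing.Theory Num.Theory.
Import numFieldNormedType.Exports.

Local Open Scope ring_scope.
Local Open Scope classical_set_scope.

Section TestFunctions.
Context {R : realType}.

Definition compactly_supported (V : topologicalType) (f : V -> R) :=
  compact (closure [set x | f x != 0]).

Definition smooth (f : R -> R) := forall n x, derivable f^`(n) x 1.

Definition test_function (z : R -> R) := smooth z /\ compactly_supported z.

Definition e1 : R * R := (1, 0).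
Definition e2 : R * R := (0, 1).

Definition partial1 (f : R * R -> R) : R * R -> R := fun p => 'D_e1 f p.
Definition partial2 (f : R * R -> R) : R * R -> R := fun p => 'D_e2 f p.

(* [w] lists partial derivatives to be taken: [true] for the first variable,
   [false] for the second. *)
Definition partials (w : seq bool) (f : R * R -> R) : R * R -> R :=
  foldr (fun b g => if b then partial1 g else partial2 g) f w.

Definition smooth2 (f : R * R -> R) := forall w,
  continuous (partials w f) /\
  forall p, derivable (partials w f) p e1 /\ derivable (partials w f) p e2.

Definition test_function2 (z : R * R -> R) :=
  smooth2 z /\ compactly_supported z.

End TestFunctions.

Section Energy.
Context {R : realType}.

Local Notation mu := (@lebesgue_measure R).
Local Notation mu2 := (@lebesgue_measure R \x @lebesgue_measure R)%E.

Definition sq_integrable d (T : measurableType d)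
    (nu : {measure set T -> \bar R}) (D : set T) (f : T -> R) :=
  measurable_fun D f /\ (\int[nu]_(x in D) ((f x) ^+ 2)%:E < +oo)%E.

Definition is_weak_derivative (f g : R -> R) :=
  [/\ locally_integrable setT f, locally_integrable setT g &
      forall z, test_function z ->
        \int[mu]_x (f x * (z^`())%classic x) = - \int[mu]_x (g x * z x)].

(* A representative of the weak derivative when there is one, which is then
   unique up to a null set; the zero function otherwise. *)
Definition weak_derivative (f : R -> R) : R -> R :=
  xget (cst 0) [set g | is_weak_derivative f g].

Definition H1loc (f : R -> R) := exists g, is_weak_derivative f g /\
  forall K : set R, compact K -> sq_integrable mu K f /\ sq_integrable mu K g.

Definition H1 (f : R -> R) := exists g, is_weak_derivative f g /\
  sq_integrable mu setT f /\ sq_integrable mu setT g.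

Definition comp1 (m : R -> R * R) : R -> R := fun x => (m x).1.
Definition comp2 (m : R -> R * R) : R -> R := fun x => (m x).2.

Definition H1loc_circle (m : R -> R * R) :=
  [/\ H1loc (comp1 m), H1loc (comp2 m) &
      forall x, (m x).1 ^+ 2 + (m x).2 ^+ 2 = 1].

Definition half_plane : set (R * R) := [set p | 0 < p.2].

(* The completion of C_0^oo of the closed half-plane (restrictions of test
   functions of the plane) for the Dirichlet inner product.  An element u of
   the completion is represented by its gradient G = (G1, G2): u |-> grad u is
   an isometry onto the L^2-closure of the gradients of test functions. *)
Definition homogeneous_H1_gradient (G : (R * R -> R) * (R * R -> R)) :=
  [/\ sq_integrable mu2 half_plane G.1,
      sq_integrable mu2 half_plane G.2 &
      exists z : nat -> R * R -> R, (forall n, test_function2 (z n)) /\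
        (\int[mu2]_(p in half_plane)
            ((G.1 p - partial1 (z n) p) ^+ 2 +
             (G.2 p - partial2 (z n) p) ^+ 2)%:E)%E @[n --> \oo] --> 0%E].

(* G is the gradient of the weak solution u of
   Delta u = 0 in the half-plane, du/dx2 = - m1' on its boundary. *)
Definition is_stray_field (m : R -> R * R)
    (G : (R * R -> R) * (R * R -> R)) :=
  homogeneous_H1_gradient G /\
  forall z, test_function2 z ->
    \int[mu2]_(p in half_plane) (G.1 p * partial1 z p + G.2 p * partial2 z p) =
    \int[mu]_x (weak_derivative (comp1 m) x * z (x, 0)).

(* Exists, and is unique up to a null set, as soon as m1 - 1 is in H^1. *)
Definition stray_field (m : R -> R * R) : (R * R -> R) * (R * R -> R) :=
  xget (cst 0, cst 0) [set G | is_stray_field m G].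

Definition anisotropy (h : R) (v : R * R) : R :=
  2^-1 * (v.1 ^+ 2 - 2 * h * v.1 + 2 * h - 1).

Definition energy (h : R) (m : R -> R * R) : \bar R :=
  ((2^-1)%:E * \int[mu]_x
     ((weak_derivative (comp1 m) x) ^+ 2 + (weak_derivative (comp2 m) x) ^+ 2
      + 2 * anisotropy h (m x))%:E
   + (2^-1)%:E * \int[mu2]_(p in half_plane)
     (((stray_field m).1 p) ^+ 2 + ((stray_field m).2 p) ^+ 2)%:E)%E.

(* The condition E_h(m) < +oo for m in H^1_loc(R; S^1), independent of h > 1. *)
Definition finite_energy (m : R -> R * R) :=
  [/\ H1 (fun x => comp1 m x - 1),
      mu.-integrable setT (fun x => (comp1 m x - 1)%:E) &
      sq_integrable mu setT (weak_derivative (comp2 m))].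

Definition is_lifting (m : R -> R * R) (phi : R -> R) :=
  continuous phi /\ forall x, m x = (cos (phi x), sin (phi x)).

Definition has_degree (m : R -> R * R) (d : int) :=
  exists (phi : R -> R) (k l : int),
    [/\ is_lifting m phi,
        phi x @[x --> -oo] --> 2 * pi * k%:~R,
        phi x @[x --> +oo] --> 2 * pi * l%:~R &
        d = l - k].

(* [is_lifting] forces m to be continuous: elements of H^1_loc are
   taken through their continuous representatives. *)
Definition admissible (d : int) : set (R -> R * R) :=
  [set m | [/\ H1loc_circle m, finite_energy m & has_degree m d]].

Definition is_minimiser (h : R) (d : int) (m : R -> R * R) :=
  admissible d m /\
  energy h m = ereal_inf [set energy h m' | m' in admissible d].

Definition Lambda_truncated (f : R -> R) (x eps : R) : R :=
  pi^-1 * \int[mu]_(t in [set t | eps < `|t - x|]) ((f t - f x) / (t - x) ^+ 2).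

(* The principal value at x exists and equals l. *)
Definition is_Lambda (f : R -> R) (x l : R) :=
  Lambda_truncated f x eps @[eps --> 0^'+] --> l.

End Energy.

(* Main.v *)
Require Import Defs.
From HB Require Import structures.
From mathcomp Require Import all_boot all_order all_algebra.
From mathcomp Require Import all_classical all_reals all_analysis.
From mathcomp Require Import measurable_realfun ring lra.

Import Order.TTheory GRing.Theory Num.Theory.
Import numFieldNormedType.Exports.

(** Write [f = cos phi - 1] and let [H] be the Hilbert transform of [f]; then
    [H'] is the Hilbert transform of [f'], and [Lambda f = - H'].  The proof
    turns minimality into the pointwise equation
    [phi'' = sin phi * (h - cos phi - H')] and then studies it near infinity.

    The stray field.  The gradient [G] of the stray field of [m] is the harmonic
    field whose pairing with [grad z] is the integral of [f' z (., 0)].  It exists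
    as the projection of an explicit square-integrable field onto the closure of
    the gradients ([gradient_projection], [harmonic_exists]).  The only thing the
    variation of the energy requires is the mixed term: for absolutely continuous
    [g] of compact support, with harmonic field [D], [<< D, G >>] equals minus the
    integral of [g' H] ([harmonic_pairing]).  This is obtained by testing [G]
    against conjugate Poisson kernels with poles below the boundary, which are
    limits of test functions ([harmonic_nk]): this identifies the Poisson averages
    of the trace of [G] with conjugate Poisson integrals of [f'], up to an error
    which is uniform in the pole, and the mollification is then removed.

    The Hilbert transform.  A function with square-integrable derivative is Holder
    continuous of exponent 1/2.  Conjugate Poisson integrals at the heights
    [4^-n] differ between consecutive heights by convolutions with kernels of mean
    zero, so they converge uniformly with geometric rate, and the limit inherits
    the Holder modulus ([Hilb_hold]) and vanishes at infinity ([Hilb_vanish]).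

    The equation.  Varying the lifting by [t eta] and dividing by [t] gives the
    weak equation ([euler_lagrange_weak]); du Bois-Reymond's argument shows that
    [phi'] is Holder continuous ([least_C1]), hence so is [f'], hence [H] is
    differentiable and the equation holds pointwise ([least_C2]).

    The sign of the lifting.  At a zero of [phi], the lifting can be reflected
    beyond that zero: the first component of [m], and with it the energy, does not
    change, so the reflected lifting is again minimal and therefore has no corner.
    The derivative then vanishes at the zero too, and uniqueness for the
    second-order equation makes [phi] identically zero, which contradicts its
    limit [2 pi d] at minus infinity.  Hence [phi > 0] ([least_positive]).

    The tail.  Since [H'] vanishes at infinity and [h > 1], eventually
    [phi'' >= s^2 phi] with [s > 0].  A positive solution tending to zero is then
    decreasing and decays exponentially with its first two derivatives
    ([least_decay]).

    The half Laplacian.  Symmetrising the principal value expresses it through the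
    second difference [f (x + u) + f (x - u) - 2 f x] divided by [u^2].  For [u] up
    to half the distance from [x] to [a] this is exponentially small, and beyond it
    the kernel is bounded by the inverse square of that distance; this yields
    quadratic decay, which is stronger than every power less than 2
    ([decaying_half_laplacian]). *)

Set Implicit Arguments.
Unset Strict Implicit.
Unset Printing Implicit Defensive.

Local Open Scope ring_scope.
Local Open Scope classical_set_scope.

(** * Real-valued integrals and square-integrable functions *)

Section RealIntegrals.
Context d (T : measurableType d) (R : realType).
Variable nu : {measure set T -> \bar R}.
Variable D : set T.
Hypothesis mD : measurable D.
Local Notation integ f := (nu.-integrable D (EFin \o f)).
Implicit Types f g : T -> R.

Lemma integ_meas f : integ f -> measurable_fun D f.
Proof. by move=> /measurable_int /measurable_EFinP. Qed.

Lemma integ_le f g : measurable_fun D f -> integ g ->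
  (forall x, D x -> `|f x| <= g x) -> integ f.
Proof.
move=> mf ig fg; apply: (le_integrable mD _ _ ig) => //=.
  exact/measurable_EFinP.
move=> x Dx /=; rewrite lee_fin (le_trans (fg x Dx))//.
exact: ler_norm.
Qed.

Lemma integD f g : integ f -> integ g -> integ (fun x => f x + g x).
Proof. move=> h1 h2; exact: (integrableD mD h1 h2). Qed.

Lemma integB f g : integ f -> integ g -> integ (fun x => f x - g x).
Proof. move=> h1 h2; exact: (integrableB mD h1 h2). Qed.

Lemma integN f : integ f -> integ (fun x => - f x).
Proof. move=> h1; exact: (integrableN h1). Qed.

Lemma integZ (c : R) f : integ f -> integ (fun x => c * f x).
Proof. move=> h1; exact: (integrableZl mD c h1). Qed.

Lemma integ_norm f : integ f -> integ (fun x => `|f x|).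
Proof. move=> h; exact: (integrable_norm h). Qed.

Lemma eq_integ f g : (forall x, D x -> f x = g x) -> integ f -> integ g.
Proof.
move=> fg; apply: (eq_integrable mD) => x /set_mem Dx /=.
by rewrite fg.
Qed.

Lemma integM_bounded (M : R) f g : integ f -> measurable_fun D g ->
  (forall x, D x -> `|g x| <= M) -> integ (fun x => f x * g x).
Proof.
move=> fi mg gM; apply: (@integ_le _ (fun x => M * `|f x|)).
- by apply: measurable_funM => //; exact: integ_meas.
- by apply: integZ; exact: integ_norm.
- move=> x Dx; rewrite normrM mulrC ler_wpM2r//; exact: gM.
Qed.

Lemma integ_ltyP f : measurable_fun D f -> (forall x, D x -> 0 <= f x) ->
  (\int[nu]_(x in D) (f x)%:E < +oo)%E -> integ f.
Proof.
move=> mf f0 h; apply/integrableP; split; first exact/measurable_EFinP.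
under eq_integral => x /set_mem Dx do rewrite /= ger0_norm ?f0//.
exact: h.
Qed.

Lemma integ_lty f : integ f -> (\int[nu]_(x in D) (f x)%:E < +oo)%E.
Proof. by move=> fi; have := integrable_fin_num mD fi; rewrite ltey => /fin_numPlt /andP[_]; rewrite ltey. Qed.

Lemma EFin_Rint f : integ f ->
  ((\int[nu]_(x in D) f x)%:E = \int[nu]_(x in D) (f x)%:E)%E.
Proof. by move=> fi; rewrite /Rintegral fineK//; exact: (integrable_fin_num mD fi). Qed.

Lemma RintN f : integ f -> \int[nu]_(x in D) (- f x) = - \int[nu]_(x in D) f x.
Proof.
move=> fi; rewrite -mulN1r -RintegralZl//.
by apply: eq_Rintegral => x _; rewrite mulN1r.
Qed.

Lemma Rint_norm_le f g : integ f -> integ g ->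
  (forall x, D x -> `|f x| <= g x) ->
  `|\int[nu]_(x in D) f x| <= \int[nu]_(x in D) g x.
Proof.
move=> fi gi fg; apply: (le_trans (le_normr_Rintegral mD fi)).
by apply: le_Rintegral => //; exact: integ_norm.
Qed.

Lemma ae_eq_Rint f g : measurable_fun D f -> measurable_fun D g ->
  {ae nu, forall x, D x -> f x = g x} ->
  \int[nu]_(x in D) f x = \int[nu]_(x in D) g x.
Proof.
move=> mf mg fg; rewrite /Rintegral; congr fine; apply: ae_eq_integral => //.
- exact/measurable_EFinP.
- exact/measurable_EFinP.
- by apply: filterS fg => x /[apply] ->.
Qed.

Lemma Rint_dominated (f_ : nat -> T -> R) f g :
  (forall n, measurable_fun D (f_ n)) -> integ g ->
  (forall n x, D x -> `|f_ n x| <= g x) ->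
  (forall x, D x -> f_ ^~ x @ \oo --> f x) ->
  integ f /\ \int[nu]_(x in D) f_ n x @[n --> \oo] --> \int[nu]_(x in D) f x.
Proof.
move=> mf_ ig fg cf.
have mf : measurable_fun D f by apply: (measurable_fun_cvg mf_).
have [] := @dominated_convergence _ _ _ nu D mD (fun n x => (f_ n x)%:E)
   (EFin \o f) (EFin \o g).
- by move=> n; exact/measurable_EFinP.
- exact/measurable_EFinP.
- by apply: aeW => x Dx; apply: cvg_EFin; [exact: nearW|exact: cf].
- by [].
- by apply: aeW => x n Dx /=; rewrite lee_fin fg.
move=> fi _ h; split => //.
by apply: fine_cvg; rewrite /Rintegral fineK//; exact: (integrable_fin_num mD fi).
Qed.

Lemma Rint_zero f : (forall x, D x -> f x = 0) -> \int[nu]_(x in D) f x = 0.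
Proof.
move=> f0; rewrite (@eq_Rintegral _ _ _ nu D (cst 0)).
  by rewrite /Rintegral /= integral0.
by move=> x /set_mem Dx; rewrite f0.
Qed.

Lemma Rint_ge0 f : (forall x, D x -> 0 <= f x) -> 0 <= \int[nu]_(x in D) f x.
Proof. exact: Rintegral_ge0. Qed.

Local Notation sqI f := (sq_integrable nu D f).

Lemma sqI_integ f : sqI f -> integ (fun x => f x ^+ 2).
Proof.
move=> [mf h]; apply: integ_ltyP => //; first exact: measurable_funX.
by move=> x _; exact: sqr_ge0.
Qed.

Lemma integ_sqI f : measurable_fun D f -> integ (fun x => f x ^+ 2) -> sqI f.
Proof. by move=> mf h; split => //; exact: (integ_lty h). Qed.

Lemma sqI_le f g : measurable_fun D f -> sqI g ->
  (forall x, D x -> `|f x| <= `|g x|) -> sqI f.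
Proof.
move=> mf gi fg; apply: integ_sqI => //.
apply: (integ_le _ (sqI_integ gi)); first exact: measurable_funX.
move=> x Dx; rewrite normrX -(real_normK (num_real (g x))).
by rewrite lerXn2r ?nnegrE// fg.
Qed.

Lemma sqIM f g : sqI f -> sqI g -> integ (fun x => f x * g x).
Proof.
move=> fi gi; have [mf _] := fi; have [mg _] := gi.
apply: (@integ_le _ (fun x => f x ^+ 2 + g x ^+ 2)).
- exact: measurable_funM.
- by apply: integD; exact: sqI_integ.
- move=> x Dx; rewrite ler_norml; apply/andP; split; nra.
Qed.

Lemma sqIZ c f : sqI f -> sqI (fun x => c * f x).
Proof.
move=> fi; have [mf _] := fi; apply: integ_sqI; first exact: measurable_funM.
apply: eq_integ (integZ (c ^+ 2) (sqI_integ fi)) => x _; ring.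
Qed.

Lemma sqID f g : sqI f -> sqI g -> sqI (fun x => f x + g x).
Proof.
move=> fi gi; have [mf _] := fi; have [mg _] := gi.
apply: integ_sqI; first exact: measurable_funD.
apply: (@eq_integ (fun x => f x ^+ 2 + g x ^+ 2 + 2 * (f x * g x))).
  by move=> x _; ring.
apply: integD; first by apply: integD; exact: sqI_integ.
by apply: integZ; exact: sqIM.
Qed.

Lemma sqIB f g : sqI f -> sqI g -> sqI (fun x => f x - g x).
Proof.
move=> fi gi; have := sqID fi (sqIZ (-1) gi).
by congr sq_integrable; apply/funext => x; rewrite mulN1r.
Qed.

(** * Square-integrable vector fields *)

Definition field := ((T -> R) * (T -> R))%type.
Implicit Types G H K : field.

Definition L2field G := sqI G.1 /\ sqI G.2.
Definition dotp G H := fun x => G.1 x * H.1 x + G.2 x * H.2 x.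
Definition ip G H := \int[nu]_(x in D) dotp G H x.
Definition lincomb (a : R) G (b : R) H : field :=
  (fun x => a * G.1 x + b * H.1 x, fun x => a * G.2 x + b * H.2 x).

Lemma L2_dotp G H : L2field G -> L2field H -> integ (dotp G H).
Proof. by move=> [? ?] [? ?]; apply: integD; exact: sqIM. Qed.

Lemma L2_lincomb a G b H : L2field G -> L2field H -> L2field (lincomb a G b H).
Proof. by move=> [? ?] [? ?]; split; apply: sqID; exact: sqIZ. Qed.

Lemma ipC G H : ip G H = ip H G.
Proof. by apply: eq_Rintegral => x _; rewrite /dotp; ring. Qed.

Lemma ip_ge0 G : 0 <= ip G G.
Proof. by apply: Rint_ge0 => x _; rewrite /dotp -!expr2 addr_ge0 ?sqr_ge0. Qed.

Lemma ip_lincomb a G b H K : L2field G -> L2field H -> L2field K ->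
  ip (lincomb a G b H) K = a * ip G K + b * ip H K.
Proof.
move=> g h k; rewrite /ip -RintegralZl//; last exact: L2_dotp.
rewrite -RintegralZl//; last exact: L2_dotp.
rewrite -RintegralD//; [|by apply: integZ; exact: L2_dotp..].
by apply: eq_Rintegral => x _; rewrite /dotp /lincomb /=; ring.
Qed.

Lemma ip_lincombr a G b H K : L2field G -> L2field H -> L2field K ->
  ip K (lincomb a G b H) = a * ip K G + b * ip K H.
Proof. by move=> g h k; rewrite ipC ip_lincomb// (ipC G) (ipC H). Qed.

Lemma ip_lincomb2 a G b H : L2field G -> L2field H ->
  ip (lincomb a G b H) (lincomb a G b H) =
  a ^+ 2 * ip G G + 2 * a * b * ip G H + b ^+ 2 * ip H H.
Proof.
move=> g h; rewrite ip_lincomb//; last exact: L2_lincomb.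
by rewrite !ip_lincombr// (ipC H G); ring.
Qed.

Lemma discriminant (a b c : R) :
  (forall t, 0 <= a + 2 * t * b + t ^+ 2 * c) -> b ^+ 2 <= a * c.
Proof.
move=> h; have [c0|c0] := ltP 0 c.
  have := h (- b / c).
  rewrite -(ler_pM2r c0) mul0r => h1.
  have e : (a + 2 * (- b / c) * b + (- b / c) ^+ 2 * c) * c = a * c - b ^+ 2.
    by field; rewrite gt_eqF.
  by move: h1; rewrite e subr_ge0.
have a0 : 0 <= a by have := h 0; rewrite mulr0 mul0r expr0n mul0r !addr0.
have [b0|b0] := eqVneq b 0.
  have [->|cn] := eqVneq c 0; first by rewrite b0 mulr0 expr0n.
  have {}c0 : c < 0 by rewrite lt_neqAle cn.
  exfalso; have := h ((a + 1) / - c + 1); rewrite b0 mulr0 addr0.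
  have e : 0 < (a + 1) / - c by rewrite divr_gt0// ?ltr_wpDl// oppr_gt0.
  have : (a + 1) / - c * - c = a + 1 by rewrite mulfVK// oppr_eq0 lt_eqF.
  move: e; set u := _ / _ => u0 uc; nra.
exfalso; have b2 : 0 < b ^+ 2 by rewrite exprn_even_gt0.
have := h (- (a + 1) * b / b ^+ 2).
have -> : 2 * (- (a + 1) * b / b ^+ 2) * b = - 2 * (a + 1).
  by field.
set u := (X in X * c); have : 0 <= u by exact: sqr_ge0.
nra.
Qed.

Lemma ip_CS G H : L2field G -> L2field H -> ip G H ^+ 2 <= ip G G * ip H H.
Proof.
move=> g h; apply: discriminant => t.
have := ip_ge0 (lincomb 1 G t H); rewrite ip_lincomb2//.
by rewrite expr1n mul1r mulr1.
Qed.

(** Along a rapidly Cauchy subsequence the series of the squared increments,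
    weighted by [4 ^+ k], has finite integral; so the subsequence converges
    almost everywhere, and Fatou's lemma bounds the distance to its limit. *)
Lemma L2_complete (f : nat -> T -> R) : (forall n, sqI (f n)) ->
  (forall e, 0 < e -> exists N, forall n m, (N <= n)%N -> (N <= m)%N ->
     \int[nu]_(x in D) ((f n x - f m x) ^+ 2) <= e) ->
  exists g, sqI g /\ forall e, 0 < e -> exists N, forall n, (N <= n)%N ->
     \int[nu]_(x in D) ((f n x - g x) ^+ 2) <= e.
Proof.
move=> fi cf.
have mf n : measurable_fun D (f n) by case: (fi n).
have /choice[N NP] : forall k, exists N, forall n m, (N <= n)%N -> (N <= m)%N ->
     \int[nu]_(x in D) ((f n x - f m x) ^+ 2) <= 8^-1 ^+ k.+1.
  by move=> k; apply: cf; rewrite exprn_gt0.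
pose s k := (\sum_(i < k.+1) (N i).+1)%N.
have sS k : (s k <= s k.+1)%N by rewrite /s [X in (_ <= X)%N]big_ord_recr leq_addr.
have sN k : (N k <= s k)%N.
  by rewrite /s big_ord_recr /=; apply: (leq_trans (leqnSn _)); exact: leq_addl.
have sk k : (k <= s k)%N.
  by rewrite /s -[leqLHS](card_ord k) -sum1_card big_ord_recr /=;
    apply: leq_trans (leq_addr _ _); apply: leq_sum.
have s_homo : {homo s : a b / (a <= b)%N} by apply: homo_leq => // ? ? ?; exact: leq_trans.
pose w k x := (4 ^+ k * (f (s k.+1) x - f (s k) x) ^+ 2)%:E.
have mw k : measurable_fun D (w k).
  apply/measurable_EFinP; apply: measurable_funM => //.
  by apply: measurable_funX; exact: measurable_funB.
have w0 k x : D x -> (0 <= w k x)%E.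
  by move=> _; rewrite lee_fin; apply: mulr_ge0; [exact: exprn_ge0|exact: sqr_ge0].
pose h x := (\sum_(k <oo) w k x)%E.
have mh : measurable_fun D h.
  by apply: ge0_emeasurable_sum => // k x Dx _; exact: w0.
have h0 x : D x -> (0 <= h x)%E by move=> Dx; apply: nneseries_ge0 => k _ _; exact: w0.
have ih : nu.-integrable D h.
  apply/integrableP; split => //.
  under eq_integral => x /set_mem Dx do rewrite gee0_abs ?h0//.
  rewrite integral_nneseries//.
  apply: (@le_lt_trans _ _ (\sum_(k <oo) (1 / (2 ^ (k + 1))%:R)%:E)%E).
    apply: lee_nneseries => [k _ _|k _].
      by apply: integral_ge0 => x Dx; exact: w0.
    rewrite -EFin_Rint//; last first.
      by apply: integZ; apply: sqI_integ; exact: sqIB.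
    rewrite RintegralZl//; last by apply: sqI_integ; exact: sqIB.
    rewrite lee_fin addn1 (le_trans (ler_wpM2l _ (NP k _ _ _ _)))//.
    - by rewrite (leq_trans (sN k)).
    rewrite natrX div1r exprS -exprVn [X in _ <= X]exprS.
    have -> : (8^-1 : R) = 4^-1 * 2^-1 by field.
    have e : (4 : R) ^+ k * 4^-1 ^+ k = 1 by rewrite exprVn divff// expf_neq0.
    rewrite exprMn.
    have -> : 4 ^+ k * (4^-1 * 2^-1 * (4^-1 ^+ k * 2^-1 ^+ k)) =
      (4^-1 * 2^-1 * 2^-1 ^+ k) * (4 ^+ k * 4^-1 ^+ k) :> R by ring.
    rewrite e mulr1 ler_wpM2r// ?exprn_ge0//; lra.
  have /cvg_lim -> // := @cvg_geometric_eseries_half R 1 0.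
  by rewrite ltry.
pose E := D `&` [set x | h x \is a fin_num].
have mE : measurable E by exact: emeasurable_fin_num.
pose u k x := f (s k) x * \1_E x.
have mu_ k : measurable_fun D (u k).
  by apply: measurable_funM => //; exact: measurable_indic.
have ucv x : D x -> cvgn (u ^~ x).
  move=> Dx; have [Ex|nEx] := pselect (E x); last first.
    rewrite (_ : u ^~ x = cst 0); first exact: is_cvg_cst.
    by apply/funext => k; rewrite /u indicE memNset// mulr0.
  have [_ /= hx] := Ex.
  rewrite (_ : u ^~ x = (fun k => f (s k) x)); last first.
    by apply/funext => k; rewrite /u indicE mem_set// mulr1.
  pose v := telescope (fun k => f (s k) x).
  suff cv : cvgn (series v).
    have -> : (fun k => f (s k) x) = (fun k => f (s 0%N) x + series v k).
      by apply/funext => k; rewrite -eq_sum_telescope.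
    by apply: is_cvgD => //; exact: is_cvg_cst.
  apply: normed_cvg.
  pose M := fine (h x) + 1.
  have M0 : 0 < M by rewrite /M ltr_wpDl// fine_ge0// h0.
  apply: (@series_le_cvg _ _ (geometric M 2^-1)) => //.
  - by move=> n /=; exact: normr_ge0.
  - by move=> n; rewrite /geometric /= mulr_ge0// ?ltW// exprn_gt0.
  - move=> n; rewrite /geometric /= /v /telescope /=.
    have wh : 4 ^+ n * (f (s n.+1) x - f (s n) x) ^+ 2 <= fine (h x).
      rewrite -lee_fin fineK//.
      apply: (@le_trans _ _ (\sum_(0 <= i < n.+1) w i x)%E).
        rewrite big_nat_recr//= leeDr//.
        by apply: sume_ge0 => i _; exact: w0.
      by apply: nneseries_lim_ge => i _ _; exact: w0.
    set z := _ - _ in wh *.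
    have e : 4 ^+ n * z ^+ 2 = (2 ^+ n * `|z|) ^+ 2.
      by rewrite exprMn real_normK ?num_real// -exprM mulnC exprM; congr (_ ^+ _ * _); ring.
    have zM : 2 ^+ n * `|z| <= M.
      rewrite leNgt; apply/negP => zM.
      have : M ^+ 2 < (2 ^+ n * `|z|) ^+ 2.
        by move: M0 zM; set y := _ * `|z|; rewrite !expr2; nra.
      rewrite -e ltNge => /negP; apply; apply: (le_trans wh).
      have hx0 : 0 <= fine (h x) by rewrite fine_ge0// h0.
      rewrite /M; nra.
    rewrite exprVn ler_pdivlMr ?exprn_gt0// mulrC//.
  - by apply: is_cvg_geometric_series; rewrite ger0_norm//; lra.
pose g x := limn (u ^~ x).
have ug x : D x -> u ^~ x @ \oo --> g x by move=> Dx; exact: ucv.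
have mg : measurable_fun D g by apply: (measurable_fun_cvg mu_ ug).
have aeE k : {ae nu, forall x, D x -> u k x = f (s k) x}.
  have := integrable_ae mD ih; apply: filterS => x hx Dx.
  by rewrite /u indicE mem_set ?mulr1//; split => //=; exact: hx.
have key e : 0 < e -> exists N, forall n, (N <= n)%N ->
    (\int[nu]_(x in D) ((f n x - g x) ^+ 2)%:E <= e%:E)%E.
  move=> e0; have [K KP] := cf e e0; exists K => n Kn.
  pose F k x := ((f n x - u (k + K)%N x) ^+ 2)%:E.
  have mF k : measurable_fun D (F k).
    by apply/measurable_EFinP; apply: measurable_funX; exact: measurable_funB.
  have F0 k x : D x -> (0 <= F k x)%E by move=> _; rewrite lee_fin sqr_ge0.
  have FI k : (\int[nu]_(x in D) F k x <= e%:E)%E.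
    rewrite (_ : (\int[nu]_(x in D) F k x)%E =
      (\int[nu]_(x in D) ((f n x - f (s (k + K)%N) x) ^+ 2)%:E)%E); last first.
      apply: ae_eq_integral => //.
        by apply/measurable_EFinP; apply: measurable_funX; exact: measurable_funB.
      by apply: filterS (aeE (k + K)%N) => x + Dx; rewrite /F => ->.
    rewrite -EFin_Rint//; last by apply: sqI_integ; exact: sqIB.
    by rewrite lee_fin KP// (leq_trans _ (sk _))// leq_addl.
  have := fatou nu mD mF F0.
  rewrite (_ : (\int[nu]_(x in D) limn_einf (F ^~ x))%E =
     (\int[nu]_(x in D) ((f n x - g x) ^+ 2)%:E)%E); last first.
    apply: eq_integral => x /set_mem Dx.
    suff h1 : F ^~ x @ \oo --> ((f n x - g x) ^+ 2)%:E.
      rewrite is_cvg_limn_einfE; last by apply/cvg_ex; eexists; exact: h1.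
      by apply/cvg_lim.
    apply: cvg_EFin; first exact: nearW.
    rewrite /F /=.
    apply: (@cvg_comp _ _ _ (fun k => f n x - u (k + K)%N x) (fun y => y ^+ 2) _ (nbhs (f n x - g x))).
      apply: cvgB; first exact: cvg_cst.
      rewrite (cvg_shiftn K (u ^~ x)); exact: ug.
    exact: exprn_continuous.
  move=> /le_trans; apply.
  rewrite limn_einf_lim; apply: lime_le.
    exact: is_cvg_einfs.
  apply: nearW => k; apply: (le_trans _ (FI k)).
  by apply: ereal_inf_lbound; exists k => /=.
have sqg e n : 0 < e -> (\int[nu]_(x in D) ((f n x - g x) ^+ 2)%:E <= e%:E)%E -> sqI (fun x => f n x - g x).
  move=> e0 le; split; first exact: measurable_funB.
  exact: (le_lt_trans le (ltry _)).
exists g; split.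
  have [N1 N1P] := key 1 ltr01.
  have := sqIB (fi N1) (sqg _ _ ltr01 (N1P N1 (leqnn _))).
  by congr sq_integrable; apply/funext => x; ring.
move=> e e0; have [N1 N1P] := key e e0; exists N1 => n nN1.
by rewrite -lee_fin EFin_Rint ?N1P//; apply: sqI_integ; exact: (sqg _ _ e0 (N1P n nN1)).
Qed.

End RealIntegrals.

(** * Derivatives on the line *)

Section RealDerivatives.
Context {R : realType}.
Implicit Types (f g : R -> R) (x df dg : R).

Lemma is_derive_ext f g x df : (forall y, f y = g y) -> is_derive x 1 f df -> is_derive x 1 g df.
Proof. by move=> /funext ->. Qed.

Lemma is_derive_val f x df dg : is_derive x 1 f df -> df = dg -> is_derive x 1 f dg.
Proof. by move=> h <-. Qed.

Lemma derD f g x df dg : is_derive x 1 f df -> is_derive x 1 g dg ->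
  is_derive x 1 (fun y => f y + g y) (df + dg).
Proof. by move=> h1 h2; exact: (is_deriveD h1 h2). Qed.

Lemma derB f g x df dg : is_derive x 1 f df -> is_derive x 1 g dg ->
  is_derive x 1 (fun y => f y - g y) (df - dg).
Proof. by move=> h1 h2; exact: (is_deriveB h1 h2). Qed.

Lemma derN f x df : is_derive x 1 f df -> is_derive x 1 (fun y => - f y) (- df).
Proof. by move=> h1; exact: (is_deriveN h1). Qed.

Lemma derM f g x df dg : is_derive x 1 f df -> is_derive x 1 g dg ->
  is_derive x 1 (fun y => f y * g y) (df * g x + f x * dg).
Proof.
move=> h1 h2; apply: is_derive_val (is_deriveM h1 h2) _.
by rewrite /GRing.scale /=; ring.
Qed.

Lemma derZ (k : R) f x df : is_derive x 1 f df -> is_derive x 1 (fun y => k * f y) (k * df).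
Proof.
move=> h1; by apply: is_derive_val (derM (is_derive_cst k x 1) h1) _; rewrite mul0r add0r.
Qed.

Lemma der_id x : is_derive x 1 (fun y => y) 1.
Proof. exact: is_derive_id. Qed.

Lemma der_cst (k x : R) : is_derive x 1 (fun _ => k) 0.
Proof. exact: is_derive_cst. Qed.

Lemma der_comp f g x df dg : is_derive x 1 g dg -> is_derive (g x) 1 f df ->
  is_derive x 1 (fun y => f (g y)) (df * dg).
Proof. by move=> h1 h2; exact: is_derive1_comp h2 h1. Qed.

Lemma derV f x df : f x != 0 -> is_derive x 1 f df ->
  is_derive x 1 (fun y => (f y)^-1) (- (f x)^-2 * df).
Proof.
move=> fx h1; apply: is_derive_val (is_deriveV fx h1) _.
by rewrite /GRing.scale /=.
Qed.

Lemma derX f x df n : is_derive x 1 f df ->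
  is_derive x 1 (fun y => f y ^+ n.+1) (n.+1%:R * f x ^+ n * df).
Proof.
move=> h1; elim: n => [|n IH]; first by rewrite expr0 mulr1 mul1r.
apply: (is_derive_ext _ (is_derive_val (derM h1 IH) _)).
  by move=> y; rewrite -exprS.
rewrite -[n.+2]addn1 natrD exprS; ring.
Qed.

Lemma der_exp x : is_derive x 1 (@expR R) (expR x).
Proof. exact: is_derive_expR. Qed.

Lemma der_cont f x df : is_derive x 1 f df -> {for x, continuous f}.
Proof.
by move=> [df' _]; apply: differentiable_continuous; apply/derivable1_diffP.
Qed.

Lemma der_local f g x df : (\forall y \near x, f y = g y) -> is_derive x 1 f df ->
  is_derive x 1 g df.
Proof.
by move=> e h; apply: near_eq_is_derive h.
Qed.
End RealDerivatives.

(** * Absolutely continuous functions *)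

Section Primitives.
Context {R : realType}.
Local Notation mu := (@lebesgue_measure R).
Local Notation meas g := (measurable_fun (setT : set (measurableTypeR R)) g).
Implicit Types (f g F G : R -> R) (a b c x y M e r : R).

Definition loc g := forall a b, mu.-integrable `[a, b] (EFin \o g).
(** Absolute continuity, carried together with a choice of density; the
    density plays the part of the weak derivative. *)
Definition prim F g := loc g /\
  forall a b, a <= b -> F b - F a = \int[mu]_(x in `[a, b]) g x.

Lemma mitv a b : measurable (`[a, b]%classic : set (measurableTypeR R)). Proof. exact: measurable_itv. Qed.
Hint Resolve mitv : core.

Lemma loc_meas g : loc g -> meas g.
Proof.
move=> lg; have -> : setT = \bigcup_n `[- n%:R, n%:R]%classic :> set R.
  apply/seteqP; split => // x _.
  exists (Num.truncn `|x|).+1 => //=.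
  rewrite in_itv /= -ler_norml ltW//; exact: truncnS_gt.
apply/measurable_fun_bigcup => // n; exact: integ_meas (lg _ _).
Qed.

Lemma meas_loc_bnd g (M : R -> R -> R) : meas g ->
  (forall a b x, a <= x <= b -> `|g x| <= M a b) -> loc g.
Proof.
move=> mg h a b; apply: (measurable_bounded_integrable (mitv a b)).
- by rewrite /= lebesgue_measure_itv /=; case: ifP => _; rewrite ?ltry// -EFinD ltry.
- exact: measurable_funS mg.
- exists (M a b); split; first exact: num_real.
  move=> N MN x /=; rewrite in_itv /= => /h /le_trans; apply; exact: ltW.
Qed.

Lemma loc_cont f : continuous f -> loc f.
Proof.
move=> cf a b; apply: continuous_compact_integrable; first exact: segment_compact.
exact: continuous_subspaceT.
Qed.

Lemma loc_integ f : mu.-integrable setT (EFin \o f) -> loc f.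
Proof. by move=> fi a b; apply: integrableS fi => //; exact: measurableT. Qed.

Lemma locD f g : loc f -> loc g -> loc (fun x => f x + g x).
Proof. by move=> h1 h2 a b; apply: integD. Qed.
Lemma locB f g : loc f -> loc g -> loc (fun x => f x - g x).
Proof. by move=> h1 h2 a b; apply: integB. Qed.
Lemma locZ (k : R) f : loc f -> loc (fun x => k * f x).
Proof. by move=> h1 a b; apply: integZ. Qed.

Lemma loc_norm f : loc f -> loc (fun x => `|f x|).
Proof. by move=> h1 a b; apply: integ_norm. Qed.
Lemma locMb (M : R) f g : loc f -> meas g -> (forall x, `|g x| <= M) ->
  loc (fun x => f x * g x).
Proof.
move=> lf mg gM a b; apply: (@integM_bounded _ _ _ _ _ _ M) => //.
exact: measurable_funS mg.
Qed.

Lemma cont_bounded f a b : continuous f -> exists M, forall x, a <= x <= b -> `|f x| <= M.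
Proof.
move=> cf; have [ab|ba] := leP a b; last first.
  by exists 0 => x /andP[ax xb]; move: (lt_le_trans ba (le_trans ax xb)); rewrite ltxx.
have cnf : {within `[a, b], continuous (fun x => `|f x|)}.
  by apply: continuous_subspaceT => x; apply: continuous_comp; [exact: cf|exact: norm_continuous].
have [c _ h] := EVT_max ab cnf.
by exists `|f c| => x xab; apply: h; rewrite in_itv.
Qed.

Lemma locM f g : loc f -> continuous g -> loc (fun x => f x * g x).
Proof.
move=> lf cg a b; have [M h] := cont_bounded a b cg.
apply: (@integM_bounded _ _ _ _ _ _ M) => //.
exact: measurable_funS (continuous_measurable_fun cg).
Qed.

Lemma eq_loc f g : (forall x, f x = g x) -> loc f -> loc g.
Proof. by move=> /funext ->. Qed.

Lemma IntS f a b c : loc f -> a <= b -> b <= c ->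
  \int[mu]_(x in `[a, c]) f x =
  \int[mu]_(x in `[a, b]) f x + \int[mu]_(x in `[b, c]) f x.
Proof.
move=> lf ab bc.
have := @Rintegral_itvB R f (BLeft a) (BRight c) b (lf a c).
rewrite !bnd_simp => /(_ ab bc) h.
rewrite -[X in _ = _ + X]Rintegral_itv_obnd_cbnd; last first.
  by apply: integrableS (lf b c) => //; apply: subset_itvr; rewrite bnd_simp.
by rewrite -h addrC subrK.
Qed.

Lemma Int0 f a : \int[mu]_(x in `[a, a]) f x = 0.
Proof. by rewrite set_itv1 Rintegral_set1. Qed.

Lemma Int_sub f (A : set R) a b : loc f -> measurable A -> A `<=` `[a, b] ->
  mu.-integrable A (EFin \o f).
Proof. by move=> lf mA Ab; apply: integrableS (lf a b). Qed.

Lemma Int_norm_le f g a b : loc f -> loc g -> (forall x, a <= x <= b -> `|f x| <= g x) ->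
  `|\int[mu]_(x in `[a, b]) f x| <= \int[mu]_(x in `[a, b]) g x.
Proof. by move=> lf lg h; apply: Rint_norm_le => // x /=; rewrite in_itv; exact: h. Qed.

Lemma Int_cst k a b : a <= b -> \int[mu]_(x in `[a, b]) k = k * (b - a).
Proof.
move=> ab; rewrite Rintegral_cst//. rewrite /= lebesgue_measure_itv /= lte_fin.
by case: ltP => [//|ba]; rewrite (@le_anti _ _ a b) ?ab//= subrr.
Qed.

Lemma Int_bound f M a b : a <= b -> loc f -> (forall x, a <= x <= b -> `|f x| <= M) ->
  `|\int[mu]_(x in `[a, b]) f x| <= M * (b - a).
Proof.
move=> ab lf h; rewrite -(Int_cst M ab); apply: Int_norm_le => //.
by apply: loc_cont => x; exact: cvg_cst.
Qed.

(** The bound [|D a b| <= e * G a b] is propagated from [a] to [b] by a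
    supremum argument, for every [e > 0].  It turns first-order identities
    between increments of absolutely continuous functions into exact ones. *)
Lemma additive_vanish (D G : R -> R -> R) :
  (forall x y z, x <= y -> y <= z -> D x z = D x y + D y z) ->
  (forall x y z, x <= y -> y <= z -> G x z = G x y + G y z) ->
  (forall e x, 0 < e -> exists2 r : R, 0 < r & forall u v : R, u <= x -> x <= v ->
     x - r < u -> v < x + r -> `|D u v| <= e * G u v) ->
  forall a b, a <= b -> D a b = 0.
Proof.
move=> aD aG loc_small a b ab.
have D0 x : D x x = 0 by have := aD x x x (lexx _) (lexx _); lra.
have G0 x : G x x = 0 by have := aG x x x (lexx _) (lexx _); lra.
have main e : 0 < e -> `|D a b| <= e * G a b.
  move=> e0.
  pose A := [set t | a <= t <= b /\ `|D a t| <= e * G a t].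
  have Aa : A a by split; rewrite ?lexx// D0 G0 mulr0 normr0.
  have hA : has_sup A by split; [exists a|exists b => t [/andP[]]].
  have as_ : a <= sup A by apply: ub_le_sup => //; case: hA.
  have sb : sup A <= b by apply: ge_sup; [exists a|move=> t [/andP[]]].
  have [r r0 h] := loc_small e (sup A) e0.
  have [u [/andP[au ub] Au] su] := sup_adherent r0 hA.
  have us : u <= sup A by apply: ub_le_sup; [case: hA|split => //; rewrite au].
  pose v := Num.min b (sup A + r / 2).
  have sv : sup A <= v by rewrite /v le_min sb lerDl divr_ge0// ltW.
  have vb : v <= b by rewrite /v ge_min lexx.
  have vr : v < sup A + r by rewrite /v gt_min; apply/orP; right; lra.
  have uv := le_trans us sv.
  have Av : A v.
    split; first by rewrite vb (le_trans au).
    rewrite (aD _ u)// (aG _ u)// mulrDr; apply: (le_trans (ler_normD _ _)).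
    by apply: lerD => //; exact: h.
  have vs : v <= sup A by apply: ub_le_sup => //; case: hA.
  have <- : v = b.
    have [bs|sb'] := leP b (sup A + r / 2); first by rewrite /v min_l.
    by exfalso; move: vs; rewrite /v (min_r (ltW sb')) => vs'; lra.
  by case: Av.
apply/eqP; rewrite -normr_le0; apply/ler_addgt0Pr => e e0; rewrite add0r.
have [G_le0|G_gt0] := leP (G a b) 0.
  by apply: (le_trans (main _ e0)); nra.
have := main (e / G a b) (divr_gt0 e0 G_gt0).
by rewrite mulfVK// gt_eqF.
Qed.

Lemma prim_cont F g : prim F g -> continuous F.
Proof.
move=> [lg h] x.
have x1 : x - 1 <= x + 1 by lra.
have c := parameterized_integral_continuous x1 (lg (x - 1) (x + 1)).
have {}c : {in `](x - 1), (x + 1)[%R, continuous (fun y => \int[mu]_(t in `[(x - 1), y]) g t)}.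
  have x1' : x - 1 < x + 1 by lra.
  move=> y yI; have [c' _ _] := (continuous_within_itvP _ x1').1 c.
  exact: c'.
have xin : x \in `](x - 1), (x + 1)[%R by rewrite in_itv /=; apply/andP; split; lra.
have {}c := c x xin.
have e : \forall y \near x, F (x - 1) + \int[mu]_(t in `[(x - 1), y]) g t = F y.
  near=> y; have xy : x - 1 <= y.
    by near: y; apply: lt_le_nbhsr; lra.
  by rewrite -h// addrC subrK.
rewrite /continuous_at -(nbhs_singleton e).
have hc : F (x - 1) + \int[mu]_(t in `[(x - 1), y]) g t @[y --> x] -->
    F (x - 1) + \int[mu]_(t in `[(x - 1), x]) g t by apply: cvgD; [exact: cvg_cst|exact: c].
exact: cvg_trans (near_eq_cvg e) hc.
Unshelve. all: by end_near. Qed.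

Lemma eq_prim F G f g : (forall x, F x = G x) -> (forall x, f x = g x) -> prim F f -> prim G g.
Proof. by move=> /funext -> /funext ->. Qed.

Lemma primD F G f g : prim F f -> prim G g -> prim (fun x => F x + G x) (fun x => f x + g x).
Proof.
move=> [lf hF] [lg hG]; split; first exact: locD.
by move=> a b ab; rewrite RintegralD// -hF// -hG//; ring.
Qed.

Lemma primZ (k : R) F f : prim F f -> prim (fun x => k * F x) (fun x => k * f x).
Proof.
move=> [lf hF]; split; first exact: locZ.
by move=> a b ab; rewrite RintegralZl// -hF//; ring.
Qed.

Lemma prim_cst k : prim (cst k) (cst 0).
Proof.
split; first by apply: loc_cont => x; exact: cvg_cst.
by move=> a b ab; rewrite Int_cst// mul0r subrr.
Qed.

Lemma primB F G f g : prim F f -> prim G g -> prim (fun x => F x - G x) (fun x => f x - g x).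
Proof.
move=> hF hG; apply: eq_prim (primD hF (primZ (-1) hG)) => x; ring.
Qed.

Lemma derive_cont (P p : R -> R) : (forall x, is_derive x 1 P (p x)) -> continuous P.
Proof.
move=> dP x; apply: differentiable_continuous; apply/derivable1_diffP.
by have [] := dP x.
Qed.

(** Chain rule for an absolutely continuous function: by the mean value and
    intermediate value theorems the error over a short interval is an integral
    of the oscillation of [p \o F] against [f]. *)
Lemma prim_comp (P p : R -> R) F f : (forall x, is_derive x 1 P (p x)) -> continuous p ->
  prim F f -> prim (P \o F) (fun x => p (F x) * f x).
Proof.
move=> dP cp pF; have [lf hF] := pF; have cF := prim_cont pF.
have cpF : continuous (p \o F) by move=> x; apply: continuous_comp; [exact: cF|exact: cp].
have lpf : loc (fun x => p (F x) * f x).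
  by apply: eq_loc (locM lf cpF) => x /=; rewrite mulrC.
split => // a b ab; apply/eqP; rewrite -subr_eq0; apply/eqP.
pose D x y := P (F y) - P (F x) - \int[mu]_(t in `[x, y]) (p (F t) * f t).
pose G x y := \int[mu]_(t in `[x, y]) `|f t|.
apply: (@additive_vanish D G) => //.
- by move=> x y z xy yz; rewrite /D (IntS lpf xy yz); ring.
- by move=> x y z xy yz; rewrite /G (IntS (loc_norm lf) xy yz).
move=> e x e0.
have /cvgrPdist_lt /(_ (e / 2) (divr_gt0 e0 (ltr0n _ 2))) := cpF x.
move=> /nbhs_ballP [r /= r0 hr]; exists r => // u v ux xv ru vr.
have uv := le_trans ux xv.
have osc t : u <= t <= v -> `|p (F x) - p (F t)| <= e / 2.
  move=> /andP[ut tv]; apply/ltW/(hr t); rewrite /ball /= ltr_norml.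
  by apply/andP; split; lra.
have [s /andP[us sv] sE] : exists2 s, u <= s <= v & P (F v) - P (F u) = p (F s) * (F v - F u).
  have cPs (l k : R) : {within `[l, k], continuous P}.
    by apply: continuous_subspaceT; exact: derive_cont dP.
  have cFs (l k : R) : {within `[l, k], continuous F} by exact: continuous_subspaceT.
  have [FF|FF] := leP (F u) (F v).
    have [z] := MVT_segment FF (fun x _ => dP x) (cPs _ _).
    rewrite in_itv /= => zz ->.
    have [] := @IVT R F u v z uv (cFs _ _); first by rewrite min_l// max_r.
    by move=> s; rewrite in_itv /= => ss <-; exists s.
  have [z] := MVT_segment (ltW FF) (fun x _ => dP x) (cPs _ _).
  rewrite in_itv /= => zz E.
  have [] := @IVT R F u v z uv (cFs _ _); first by rewrite min_r ?max_l// ltW.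
  by move=> s; rewrite in_itv /= => ss sz; exists s => //; rewrite sz; lra.
have -> : D u v = \int[mu]_(t in `[u, v]) ((p (F s) - p (F t)) * f t).
  rewrite /D sE (hF _ _ uv) -RintegralZl// -RintegralB//; last exact: integZ.
  by apply: eq_Rintegral => t _; ring.
rewrite /G -RintegralZl//; last exact: loc_norm.
apply: Rint_norm_le => //.
- have : loc (fun t => (p (F s) - p (F t)) * f t); last exact.
  apply: eq_loc (locB (locZ (p (F s)) lf) lpf) => t; ring.
- by apply: integZ => //; exact: loc_norm.
move=> t /=; rewrite in_itv /= => tuv; rewrite normrM ler_wpM2r//.
have := osc t tuv; have := osc s; rewrite us sv => /(_ isT).
have -> : p (F s) - p (F t) = (p (F x) - p (F t)) - (p (F x) - p (F s)) by ring.
move=> h1 h2; apply: (le_trans (ler_normB _ _)); lra.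
Qed.

Lemma is_derive_sqr x : is_derive x 1 (fun y : R => y ^+ 2) (2 * x).
Proof.
apply: is_derive_eq; rewrite /GRing.scale /=; ring.
Qed.

(** Polarisation reduces the product to the chain rule for the square. *)
Lemma primM F G f g : prim F f -> prim G g ->
  prim (fun x => F x * G x) (fun x => f x * G x + F x * g x).
Proof.
have sq H k : prim H k -> prim (fun x => H x ^+ 2) (fun x => 2 * H x * k x).
  move=> pH; apply: (@prim_comp (fun y => y ^+ 2) (fun y => 2 * y)) pH => //.
    exact: is_derive_sqr.
  by move=> x; apply: cvgM; [exact: cvg_cst|exact: cvg_id].
move=> pF pG.
apply: eq_prim (primZ 2^-1 (primB (sq _ _ (primD pF pG)) (primD (sq _ _ pF) (sq _ _ pG)))).
  by move=> x; field.
by move=> x; field.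
Qed.

Lemma prim_C1 F f : (forall x, is_derive x 1 F (f x)) -> continuous f -> prim F f.
Proof.
move=> dF cf; split; first exact: loc_cont.
move=> a b; rewrite le_eqVlt => /orP[/eqP <-|ab]; first by rewrite Int0 subrr.
rewrite /Rintegral (@continuous_FTC2 _ f F a b ab)//.
- exact: continuous_subspaceT.
- split.
  + by move=> x _; have [] := dF x.
  + apply: cvg_at_right_filter; exact: (derive_cont dF).
  + apply: cvg_at_left_filter; exact: (derive_cont dF).
- by move=> x _; rewrite derive1E; apply: derive_val.
Qed.

Lemma prim_derive F f x : prim F f -> {for x, continuous f} -> is_derive x 1 F (f x).
Proof.
move=> [lf hF] cf.
have x1 : x < x + 1 by lra.
have [] := @continuous_FTC1_closed R f (x - 1) x (x + 1) x1 (lf _ _) _ cf; first by lra.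
set H := (fun y => \int[mu]_(t in _) f t).
move=> dH H'.
have e : \forall y \near x, F (x - 1) + H y = F y.
  near=> y; have xy : x - 1 <= y by near: y; apply: lt_le_nbhsr; lra.
  by rewrite /H -hF// addrC subrK.
have dFH : is_derive x 1 (fun y => F (x - 1) + H y) (f x).
  have h1 : is_derive x 1 H (f x) by rewrite -H' derive1E; apply: DeriveDef.
  exact: is_derive_val (derD (der_cst _ _) h1) (add0r _).
exact: der_local e dFH.
Unshelve. all: by end_near. Qed.


Lemma Rint_supp f M : (forall x, M < `|x| -> f x = 0) ->
  \int[mu]_x f x = \int[mu]_(x in `[(- M), M]) f x.
Proof.
move=> h; rewrite [RHS]Rintegral_mkcond; apply: eq_Rintegral => x _.
rewrite patchE; case: ifPn => // /negP xM; apply: h.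
rewrite ltNge; apply/negP => xM'; apply: xM; rewrite inE /= in_itv /=.
by rewrite -ler_norml.
Qed.

Lemma integ_supp f M : loc f -> (forall x, M < `|x| -> f x = 0) ->
  mu.-integrable setT (EFin \o f).
Proof.
move=> lf h; have := (@integrable_mkcond _ (measurableTypeR R) R mu _ (EFin \o f) (mitv (- M) M)).1 (lf _ _).
congr (_.-integrable _ _); apply/funext => x.
rewrite patchE /=; case: ifPn => // /negP xM; rewrite h//.
rewrite ltNge; apply/negP => xM'; apply: xM; rewrite inE /= in_itv /=.
by rewrite -ler_norml.
Qed.

Lemma Rint_limn f : mu.-integrable setT (EFin \o f) ->
  \int[mu]_(x in `[(- n%:R), n%:R]) f x @[n --> \oo] --> \int[mu]_x f x.
Proof.
move=> fi.
have mT : measurable (setT : set (measurableTypeR R)) by exact: measurableT.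
have mf := integ_meas fi.
have [] := @Rint_dominated _ _ R mu setT mT
  (fun n x => f x * \1_(`[(- n%:R), n%:R]) x) f (fun x => `|f x|).
- by move=> n; apply: measurable_funM => //; exact: measurable_indic.
- exact: integ_norm.
- move=> n x _; rewrite normrM ler_piMr// indicE.
  by case: (_ \in _); rewrite ?normr1// normr0.
- move=> x _; apply: cvg_near_cst; near=> n.
  rewrite indicE mem_set ?mulr1//= in_itv /= -ler_norml.
  near: n; exact: nbhs_infty_ger.
move=> _; apply: cvg_trans; apply: near_eq_cvg; apply: nearW => n.
rewrite [RHS]Rintegral_mkcond; apply: eq_Rintegral => x _.
by rewrite patchE indicE; case: ifP => _; rewrite ?mulr1 ?mulr0.
Unshelve. all: by end_near. Qed.

Lemma prim_ibp F G f g a b : prim F f -> prim G g -> a <= b ->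
  \int[mu]_(x in `[a, b]) (f x * G x) =
  F b * G b - F a * G a - \int[mu]_(x in `[a, b]) (F x * g x).
Proof.
move=> pF pG ab; have [lfg h] := primM pF pG.
have [lf _] := pF; have [lg _] := pG.
have l1 : loc (fun x => f x * G x) by exact: locM (prim_cont pG).
have l2 : loc (fun x => F x * g x).
  by apply: eq_loc (locM lg (prim_cont pF)) => x; rewrite mulrC.
by rewrite (h _ _ ab) RintegralD// addrK.
Qed.

Lemma prim_ibpT F G f g : prim F f -> prim G g ->
  mu.-integrable setT (EFin \o (fun x => f x * G x)) ->
  mu.-integrable setT (EFin \o (fun x => F x * g x)) ->
  (fun n : nat => F n%:R * G n%:R) @ \oo --> 0 ->
  (fun n : nat => F (- n%:R) * G (- n%:R)) @ \oo --> 0 ->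
  \int[mu]_x (f x * G x) = - \int[mu]_x (F x * g x).
Proof.
move=> pF pG i1 i2 c1 c2; have h1 := Rint_limn i1; have h2 := Rint_limn i2.
apply: (cvg_unique _ h1); first exact: Rhausdorff.
have hc : (fun n : nat => F n%:R * G n%:R - F (- n%:R) * G (- n%:R) -
    \int[mu]_(x in `[(- n%:R), n%:R]) (F x * g x)) @ \oo -->
    0 - 0 - \int[mu]_x (F x * g x) by apply: cvgB => //; exact: cvgB.
rewrite subr0 sub0r in hc; apply: cvg_trans hc; apply: near_eq_cvg; apply: nearW => n /=.
by rewrite (prim_ibp pF pG)// -subr_ge0 opprK addr_ge0.
Qed.

Lemma nat_gt_near (M : R) : \forall n \near \oo, M < n%:R.
Proof.
near=> n; apply: (@lt_le_trans _ _ (M + 1)); first lra.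
near: n; exact: nbhs_infty_ger.
Unshelve. all: by end_near. Qed.

Lemma prim_ibp_supp F G f g M : prim F f -> prim G g ->
  (forall x, M < `|x| -> G x = 0) -> (forall x, M < `|x| -> g x = 0) ->
  \int[mu]_x (f x * G x) = - \int[mu]_x (F x * g x).
Proof.
move=> pF pG G0 g0; have [lf _] := pF; have [lg _] := pG.
apply: (prim_ibpT pF pG).
- apply: (@integ_supp _ M); first exact: locM (prim_cont pG).
  by move=> x xM; rewrite G0// mulr0.
- apply: (@integ_supp _ M).
    by apply: eq_loc (locM lg (prim_cont pF)) => x; rewrite mulrC.
  by move=> x xM; rewrite g0// mulr0.
- apply: cvg_near_cst; apply: filterS (nat_gt_near M) => n nM.
  by rewrite G0 ?mulr0// normr_nat.
- apply: cvg_near_cst; apply: filterS (nat_gt_near M) => n nM.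
  by rewrite G0 ?mulr0// normrN normr_nat.
Qed.

Lemma compact_bdd (K : set R) : compact K -> exists2 M, 0 < M & forall x, K x -> `|x| < M.
Proof.
move=> /compact_bounded [M0 [_ h]]; exists (`|M0| + 2); first by rewrite ltr_pwDr.
move=> x Kx; apply: (@le_lt_trans _ _ (`|M0| + 1)); last by rewrite ltrD2l; lra.
by apply: h => //; have := ler_norm M0; lra.
Qed.

Lemma loc_locally f : loc f <-> locally_integrable setT f.
Proof.
split=> [lf|[mf _ h] a b].
  split; [exact: loc_meas|exact: openT|].
  move=> K _ cK; have [M M0 KM] := compact_bdd cK.
  have /integrableP[_] : mu.-integrable K (EFin \o f).
    apply: (Int_sub (a := - M) (b := M) lf); first exact: compact_measurable.
    by move=> x /KM /ltW; rewrite /= in_itv /= ler_norml.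
  by [].
apply/integrableP; split.
  by apply/measurable_EFinP; apply: measurable_funS mf => //; exact: measurableT.
by apply: h => //; exact: segment_compact.
Qed.

(** The difference of the densities has a constant primitive, whose derivative
    is that difference almost everywhere by Lebesgue's theorem. *)
Lemma prim_unique F f g : prim F f -> prim F g -> {ae mu, forall x, f x = g x}.
Proof.
move=> [lf hf] [lg hg].
pose h x := f x - g x.
have lh : loc h by exact: locB.
have h0 a b : \int[mu]_(x in `[a, b]) h x = 0.
  have [ab|ba] := leP a b; first by rewrite RintegralB// -hf// -hg// subrr.
  by rewrite set_itv_ge ?Rintegral_set0// bnd_simp -ltNge.
have key (n : nat) : {ae mu, forall x, - n%:R < x -> f x = g x}.
  have := @FTC1 R h (BLeft (- n%:R)) (fun y => lh _ y) ((loc_locally h).1 lh).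
  apply: filterS; first exact: (ae_filter_ringOfSetsType mu).
  move=> x hx nx.
  have hn : ((- n%:R)%:E < x%:E)%E by rewrite lte_fin.
  have [_] := hx hn.
  rewrite (_ : (fun _ => _) = cst 0); last by apply/funext => y; rewrite h0.
  by rewrite derive1_cst => /eqP; rewrite eq_sym subr_eq0 => /eqP.
have : {ae mu, forall x, forall n : nat, - n%:R < x -> f x = g x} := ae_foralln key.
apply: filterS; first exact: (ae_filter_ringOfSetsType mu).
move=> x hx; apply: (hx (Num.truncn `|x|).+1).
rewrite ltrNl; apply/(le_lt_trans _ (truncnS_gt _)).
by rewrite -normrN; exact: ler_norm.
Qed.

End Primitives.

(** * Real sequences *)

Section RealSequences.
Context {R : realType}.
Implicit Types (u v : nat -> R) (a b l : R).

Lemma cvg_ext u v l : (forall n, u n = v n) -> u @ \oo --> l -> v @ \oo --> l.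
Proof. by move=> /funext ->. Qed.

Lemma cvg_uniq u a b : u @ \oo --> a -> u @ \oo --> b -> a = b.
Proof. by move=> h1 h2; apply: (cvg_unique _ h1 h2); exact: Rhausdorff. Qed.

Lemma cvg_add u v a b : u @ \oo --> a -> v @ \oo --> b -> (fun n => u n + v n) @ \oo --> a + b.
Proof. exact: cvgD. Qed.

Lemma cvg_sub u v a b : u @ \oo --> a -> v @ \oo --> b -> (fun n => u n - v n) @ \oo --> a - b.
Proof. exact: cvgB. Qed.

Lemma cvg_opp u a : u @ \oo --> a -> (fun n => - u n) @ \oo --> - a.
Proof. exact: cvgN. Qed.

Lemma cvg_mul u v a b : u @ \oo --> a -> v @ \oo --> b -> (fun n => u n * v n) @ \oo --> a * b.
Proof. exact: cvgM. Qed.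

Lemma cvg_const a : (fun _ : nat => a) @ \oo --> a.
Proof. exact: cvg_cst. Qed.

End RealSequences.

Section TestFunctions.
Context {R : realType}.
Local Notation mu := (@lebesgue_measure R).
Implicit Types (f g z : R -> R) (x y t a b c d e r M K : R).

(** * Smooth functions of one variable *)

(** Smoothness is coinductive: it suffices to exhibit a class of functions
    that is closed under differentiation. *)
Lemma smooth_class (P : (R -> R) -> Prop) :
  (forall f, P f -> exists2 f', P f' & forall x, is_derive x 1 f (f' x)) ->
  forall f, P f -> smooth f.
Proof.
move=> h f Pf n x.
suff [k Pk <-] : exists2 k, P k & k = (f^`(n))%classic.
  by have [k' _ dk] := h k Pk; have [] := dk x.
elim: n => [|n [k Pk kE]]; first by exists f.
have [k' Pk' dk] := h k Pk; exists k' => //.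
rewrite derive1nS -kE; apply/funext => y.
by rewrite derive1E; apply/esym; have [] := dk y.
Qed.

Lemma smooth_derive f : smooth f -> forall x, is_derive x 1 f ((f^`())%classic x).
Proof. by move=> sf x; rewrite derive1E; apply: DeriveDef => //; exact: (sf 0%N x). Qed.

Lemma smooth_deriv1 f : smooth f -> smooth (f^`())%classic.
Proof. by move=> sf n x; rewrite -derive1Sn; exact: sf. Qed.

Lemma smooth_cont f : smooth f -> continuous f.
Proof. by move=> sf; apply: derive_cont (smooth_derive sf). Qed.

(** A syntactic class closed under differentiation, which gives all the
    closure properties of smoothness at once through [smooth_class]. *)
Inductive smooth_expr : (R -> R) -> Prop :=
| SEbase f : smooth f -> smooth_expr f
| SEadd f g : smooth_expr f -> smooth_expr g -> smooth_expr (fun x => f x + g x)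
| SEmul f g : smooth_expr f -> smooth_expr g -> smooth_expr (fun x => f x * g x)
| SEcst k : smooth_expr (fun _ => k)
| SEinv f : smooth_expr f -> (forall x, f x != 0) -> smooth_expr (fun x => (f x)^-1)
| SEaff f a b : smooth_expr f -> smooth_expr (fun x => f (a * x + b)).

Lemma smooth_exprP f : smooth_expr f -> smooth f.
Proof.
apply: smooth_class => {}f; elim => {f}.
- move=> f sf; exists (f^`())%classic; last exact: smooth_derive.
  by apply: SEbase; exact: smooth_deriv1.
- move=> f g sf [f' sf' df] sg [g' sg' dg]; exists (fun x => f' x + g' x).
    exact: SEadd.
  by move=> x; exact: derD.
- move=> f g sf [f' sf' df] sg [g' sg' dg].
  exists (fun x => f' x * g x + f x * g' x).
    by apply: SEadd; exact: SEmul.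
  by move=> x; exact: derM.
- by move=> k; exists (fun _ => 0); [exact: SEcst|move=> x; exact: der_cst].
- move=> f sf [f' sf' df] f0.
  exists (fun x => (-1) * ((f x)^-1 * (f x)^-1) * f' x).
    do 2 (apply: SEmul => //); first exact: SEcst.
    by apply: SEmul; exact: SEinv.
  move=> x; apply: is_derive_val (derV (f0 x) (df x)) _.
  by rewrite expr2 invfM mulN1r.
- move=> f a b sf [f' sf' df].
  exists (fun x => a * f' (a * x + b)).
    by apply: SEmul; [exact: SEcst|exact: SEaff].
  move=> x; have h : is_derive x 1 (fun x => a * x + b) a.
    by apply: is_derive_val (derD (derZ a (der_id x)) (der_cst b x)) _; rewrite mulr1 addr0.
  by apply: is_derive_val (der_comp h (df _)) _; rewrite mulrC.
Qed.

(** The derivatives of [exp (- 1 / x)], extended by [0], are combinations of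
    these functions: the family is closed under differentiation. *)
Definition flat (k : nat) x : R := if 0 < x then x^-1 ^+ k * expR (- x^-1) else 0.

Lemma flat_bound k x : `|flat k x| <= k.+2`!%:R * x ^+ 2.
Proof.
rewrite /flat; case: ifPn => x0; last by rewrite normr0 mulr_ge0// sqr_ge0.
have y0 : 0 < x^-1 by rewrite invr_gt0.
rewrite ger0_norm ?mulr_ge0 ?exprn_ge0 ?expR_ge0 ?(ltW y0)//.
have := @expR_ge1Dxn R x^-1 k.+1 (ltW y0).
rewrite expRN; set E := expR _ => h.
have E0 : 0 < E by exact: expR_gt0.
have f0 : 0 < k.+2`!%:R :> R by rewrite ltr0n fact_gt0.
rewrite ler_pdivrMr//.
have {}h : x^-1 ^+ k.+2 <= k.+2`!%:R * E.
  by rewrite -ler_pdivrMl// mulrC; lra.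
have -> : x^-1 ^+ k = x ^+ 2 * x^-1 ^+ k.+2.
  by rewrite -(addn2 k) exprD mulrCA -exprMn divff ?gt_eqF// expr1n mulr1.
by have := ler_wpM2l (sqr_ge0 x) h; lra.
Qed.

Lemma flat_derive k x :
  is_derive x 1 (flat k) (flat k.+2 x - k%:R * flat k.+1 x).
Proof.
have [x0|x0|->] := ltgtP x 0.
- rewrite /flat ltNge (ltW x0) mulr0 subrr.
  apply: (@der_local _ (fun _ => 0) _ _ _ _ (der_cst 0 x)).
  near=> y; have y0 : y <= 0 by near: y; exact: lt_le_nbhsl.
  by rewrite ltNge y0.
- apply: (@der_local _ (fun y => y^-1 ^+ k * expR (- y^-1))).
    near=> y; have y0 : 0 < y by near: y; exact: lt_nbhsr.
    by rewrite /flat y0.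
  have dV : is_derive x 1 (fun y : R => y^-1) (- x^-2).
    by apply: is_derive_val (derV _ (der_id x)) _; rewrite ?mulr1 ?gt_eqF.
  have dE : is_derive x 1 (fun y : R => expR (- y^-1)) (expR (- x^-1) * x^-2).
    by apply: is_derive_val (der_comp (derN dV) (der_exp _)) _; rewrite opprK.
  rewrite /flat x0.
  case: k => [|k].
    by apply: is_derive_val (derM (der_cst _ _) dE) _; rewrite !mul0r subr0 add0r mul1r mulrC exprVn.
  apply: is_derive_val (derM (derX k dV) dE) _.
  by rewrite -exprVn !exprS; ring.
- have D0 : flat k.+2 0 - k%:R * flat k.+1 0 = 0 by rewrite /flat ltxx mulr0 subrr.
  rewrite D0.
  suff h : (fun h => h^-1 *: ((flat k \o shift 0) (h *: 1) - flat k 0)) @ 0^' --> 0.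
    apply: DeriveDef; first by apply/cvg_ex; exists 0.
    exact/cvg_lim.
  apply/cvgr0Pnorm_le => e e0; near=> t.
  have t0 : t != 0 by near: t; exact: nbhs_dnbhs_neq.
  have te : `|t| <= e / k.+2`!%:R.
    near: t; apply: dnbhs0_le; rewrite divr_gt0// ltr0n fact_gt0//.
  rewrite /GRing.scale /= mulr1 addr0 [flat k 0]/flat ltxx subr0 normrM normfV.
  rewrite mulrC ler_pdivrMr ?normr_gt0//; apply: (le_trans (flat_bound _ _)).
  rewrite -real_normK ?num_real// expr2 mulrA ler_wpM2r//.
  by rewrite mulrC -ler_pdivlMr// ltr0n fact_gt0.
Unshelve. all: by end_near. Qed.

Lemma smooth_flat k : smooth (flat k).
Proof.
pose P f := exists (s : seq (R * nat)), f = (fun x => \sum_(i <- s) i.1 * flat i.2 x).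
apply: (@smooth_class P); last first.
  by exists [:: (1, k)]; apply/funext => x; rewrite big_seq1 mul1r.
move=> _ [s ->]; elim: s => [|[c i] s [f' [s' ->] IH]].
  exists (fun _ => 0); first by exists [::]; apply/funext => x; rewrite big_nil.
  by move=> x; apply: is_derive_ext (der_cst 0 x) => y; rewrite big_nil.
exists (fun x => c * (flat i.+2 x - i%:R * flat i.+1 x) + \sum_(i <- s') i.1 * flat i.2 x).
  exists [:: (c, i.+2), (- (c * i%:R), i.+1) & s'].
  by apply/funext => x; rewrite !big_cons /=; ring.
move=> x; apply: is_derive_ext (derD (derZ c (flat_derive i x)) (IH x)) => y.
by rewrite big_cons.
Qed.

Lemma flat_gt0 k x : 0 < x -> 0 < flat k x.
Proof. by move=> x0; rewrite /flat x0 mulr_gt0 ?expR_gt0// exprn_gt0// invr_gt0. Qed.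
Lemma flat0 k x : x <= 0 -> flat k x = 0.
Proof. by move=> x0; rewrite /flat ltNge x0. Qed.
Lemma flat_ge0 k x : 0 <= flat k x.
Proof. by have [x0|x0] := ltP 0 x; [exact/ltW/flat_gt0|rewrite flat0]. Qed.

(** A smooth step from [0] on [x <= 0] to [1] on [x >= 1]. *)
Definition step x := flat 0 x / (flat 0 x + flat 0 (1 - x)).

Let step_den x : 0 < flat 0 x + flat 0 (1 - x).
Proof.
have [x0|x0] := ltP 0 x; first by rewrite ltr_pwDl ?flat_gt0 ?flat_ge0.
by rewrite ltr_wpDl ?flat_ge0// flat_gt0//; lra.
Qed.

Lemma smooth_step : smooth step.
Proof.
have h0 : smooth_expr (flat 0) by apply: SEbase; exact: smooth_flat.
apply: smooth_exprP; apply: SEmul => //; apply: (SEinv (f := fun x => flat 0 x + flat 0 (1 - x))).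
  apply: SEadd => //; have := SEaff (-1) 1 h0; congr smooth_expr.
  by apply/funext => x; congr flat; ring.
by move=> x; rewrite gt_eqF.
Qed.

Lemma step0 x : x <= 0 -> step x = 0.
Proof. by move=> x0; rewrite /step flat0 ?mul0r. Qed.
Lemma step1 x : 1 <= x -> step x = 1.
Proof.
move=> x1; rewrite /step [X in _ + X]flat0 ?addr0 ?divff ?gt_eqF//; last lra.
by apply: flat_gt0; lra.
Qed.
Lemma step_bound x : 0 <= step x <= 1.
Proof.
rewrite divr_ge0 ?flat_ge0 ?(ltW (step_den x))//=.
by rewrite ler_pdivrMr ?step_den// mul1r lerDl flat_ge0.
Qed.

(** * Test functions and weak derivatives *)

Lemma closure_compact (V : topologicalType) (f : V -> R) (K : set V) :
  closed K -> compact K -> (forall x : V, f x != 0 -> K x) -> compactly_supported f.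
Proof.
move=> cK kK h; apply: (subclosed_compact _ kK); first exact: closed_closure.
by have := closure_subset (h : [set x | f x != 0] `<=` K); rewrite -(closure_id K).1.
Qed.

Lemma supp_bounded z : compactly_supported z -> exists2 M : R, 0 < M & forall x, M < `|x| -> z x = 0.
Proof.
move=> /compact_bdd [M M0 h]; exists M => // x Mx; apply/eqP; apply: contraTT Mx => zx.
by rewrite -leNgt ltW// h//; exact: subset_closure.
Qed.

Lemma supp_compact z M : (forall x, M < `|x| -> z x = 0) -> compactly_supported z.
Proof.
move=> h; apply: (@closure_compact _ _ `[- M, M]%classic).
- exact: itv_closed.
- exact: segment_compact.
move=> x zx; rewrite /= in_itv /= -ler_norml leNgt; apply/negP => /h zx0.
by rewrite zx0 eqxx in zx.
Qed.

Lemma test_prim z : test_function z -> prim z (z^`())%classic.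
Proof.
move=> [sz _]; apply: prim_C1; first exact: smooth_derive.
exact: smooth_cont (smooth_deriv1 sz).
Qed.

Lemma test_supp z : test_function z -> exists2 M : R, 0 < M &
  (forall x, M < `|x| -> z x = 0) /\ (forall x, M < `|x| -> (z^`())%classic x = 0).
Proof.
move=> [sz /supp_bounded[M M0 h]]; exists M => //; split => // x xM.
have d0 : is_derive x 1 z 0.
  apply: (@der_local _ (fun _ => 0) _ _ _ _ (der_cst 0 x)).
  have : \forall y \near x, M < `|y|.
    by apply: (cvgr_gt _ (@norm_continuous _ _ x) _ xM).
  by apply: filterS => y /= /h ->.
by rewrite derive1E; have [] := d0.
Qed.

Lemma prim_weak (F g : R -> R) : prim F g -> is_weak_derivative F g.
Proof.
move=> pF; have [lg _] := pF; split.
- by apply/loc_locally; apply: loc_cont; exact: prim_cont pF.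
- exact/loc_locally.
move=> z tz; have [M M0 [z0 z'0]] := test_supp tz.
by rewrite (prim_ibp_supp pF (test_prim tz) z0 z'0) opprK.
Qed.

(** Test against the difference of two rescaled steps: it tends to the
    indicator of [[a, b]], while its derivative concentrates at the endpoints. *)
Lemma weak_prim f g : continuous f -> is_weak_derivative f g -> prim f g.
Proof.
move=> cf [_ /loc_locally lg wd]; split => // a b; rewrite le_eqVlt => /orP[/eqP <-|ab].
  by rewrite Int0 subrr.
pose S (n : nat) c x := step (n.+1%:R * (x - c)).
pose S' (n : nat) c x := n.+1%:R * (step^`())%classic (n.+1%:R * (x - c)).
have dS n c x : is_derive x 1 (S n c) (S' n c x).
  have h : is_derive x 1 (fun x => n.+1%:R * (x - c)) n.+1%:R.
    by apply: is_derive_val (derZ n.+1%:R (derB (der_id x) (der_cst c x))) _; rewrite subr0 mulr1.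
  by apply: is_derive_val (der_comp h (smooth_derive smooth_step _)) _; rewrite mulrC.
have sS n c : smooth (S n c).
  apply: smooth_exprP; have := SEaff n.+1%:R (- n.+1%:R * c) (SEbase smooth_step).
  by congr smooth_expr; apply/funext => x; rewrite /S; congr step; ring.
have cS' n c : continuous (S' n c).
  have -> : S' n c = ((S n c)^`())%classic.
    by apply/funext => x; rewrite derive1E; apply/esym; have [] := dS n c x.
  exact: smooth_cont (smooth_deriv1 (sS _ _)).
have S_0 n c x : x <= c -> S n c x = 0.
  by move=> xc; rewrite /S step0// mulr_ge0_le0// subr_le0.
have S_1 n c x : c + n.+1%:R^-1 <= x -> S n c x = 1.
  move=> xc; rewrite /S step1// -ler_pdivrMl// mulr1.
  by move: xc; set k := n.+1%:R^-1 => xc; lra.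
have n1 (n : nat) : 0 < n.+1%:R^-1 :> R by rewrite invr_gt0.
have n1' (n : nat) : n.+1%:R^-1 <= 1 :> R by rewrite invf_le1// ler1n.
have S_1' n c x : c + 1 <= x -> S n c x = 1.
  by move=> xc; apply: S_1; apply: le_trans xc; rewrite lerD2l.
have S'_0 n c x : x < c \/ c + n.+1%:R^-1 < x -> S' n c x = 0.
  move=> xc; suff h : is_derive x 1 (S n c) 0.
    by have [_ <-] := dS n c x; have [_ ->] := h.
  case: xc => xc.
    apply: (@der_local _ (fun _ => 0) _ _ _ _ (der_cst 0 x)).
    near=> y; rewrite S_0//; near: y; exact: lt_le_nbhsl.
  apply: (@der_local _ (fun _ => 1) _ _ _ _ (der_cst 1 x)).
  near=> y; rewrite S_1//; near: y; exact: lt_le_nbhsr.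
have lfS n c : loc (fun x => f x * S' n c x).
  by apply: loc_cont => x; apply: cvgM; [exact: cf|exact: cS'].
have S'_0' n c x : x < c \/ c + 1 < x -> S' n c x = 0.
  move=> xc; apply: S'_0; case: xc => xc; [by left|right].
  by apply: le_lt_trans xc; rewrite lerD2l.
(* mass at an endpoint *)
have mass c : \int[mu]_x (f x * S' n c x) @[n --> \oo] --> f c.
  have [K hK] : exists K, forall t, 0 <= t <= 1 -> `|(step^`())%classic t| <= K.
    apply: cont_bounded; exact: smooth_cont (smooth_deriv1 smooth_step).
  have K0 : 0 <= K by apply: le_trans (hK 0 _); rewrite ?lexx ?ler01.
  have E n : \int[mu]_x (f x * S' n c x) = \int[mu]_(x in `[c, c + n.+1%:R^-1]) (f x * S' n c x).
    rewrite [RHS]Rintegral_mkcond; apply: eq_Rintegral => x _; rewrite patchE.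
    case: ifPn => // /negP xI; rewrite S'_0 ?mulr0//.
    have [|cx] := ltP x c; [by left|right; rewrite ltNge; apply/negP => xn].
    by apply: xI; rewrite inE /= in_itv /= cx.
  apply/cvgrPdist_le => e e0.
  have /cvgrPdist_le /(_ (e / (K + 1))) := cf c.
  have K1 : 0 < K + 1 by lra.
  move=> /(_ (divr_gt0 e0 K1)) /nbhs_ballP [r /= r0 hr].
  near=> n.
  have nr : n.+1%:R^-1 < r.
    rewrite invf_plt ?posrE//; apply: (@lt_trans _ _ n%:R); last by rewrite ltr_nat.
    by near: n; exact: nat_gt_near.
  have c1 : c <= c + n.+1%:R^-1 by rewrite lerDl ltW.
  rewrite E.
  have -> : f c = \int[mu]_(x in `[c, c + n.+1%:R^-1]) (f c * S' n c x).
    rewrite RintegralZl//; last exact: loc_cont.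
    have [_ <-] := prim_C1 (dS n c) (cS' n c); rewrite // S_1// S_0// subr0 mulr1//.
  rewrite -RintegralB//; [|by apply: integZ => //; exact: loc_cont|exact: lfS].
  have -> : e = (e * n.+1%:R) * (c + n.+1%:R^-1 - c).
    by rewrite addrAC subrr add0r mulfK// pnatr_eq0.
  apply: Int_bound => //.
    by apply: locB => //; apply: locZ; exact: loc_cont.
  move=> x /andP[cx xc].
  rewrite -mulrBl normrM /S' normrM (ger0_norm (ler0n _ _)).
  have h1 : `|f c - f x| <= e / (K + 1).
    apply: (hr x); rewrite /ball /= ltr_norml; move: nr xc.
    by set q := n.+1%:R^-1 => nr xc; apply/andP; split; lra.
  have h2 : `|(step^`())%classic (n.+1%:R * (x - c))| <= K.
    apply: hK; rewrite mulr_ge0 ?subr_ge0//= -ler_pdivlMl// mulr1; move: xc.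
    by set q := n.+1%:R^-1 => xc; lra.
  rewrite mulrCA [leRHS]mulrC; apply: ler_wpM2l => //.
  apply: (@le_trans _ _ (e / (K + 1) * K)); first exact: ler_pM.
  by rewrite mulrAC ler_pdivrMr// ler_wpM2l ?(ltW e0)//; lra.
pose z n x := S n a x - S n b x.
have zT n : test_function (z n).
  split.
    apply: smooth_exprP; have h c : smooth_expr (S n c) by exact: SEbase.
    have := SEadd (h a) (SEmul (SEcst (-1)) (h b)); congr smooth_expr.
    by apply/funext => x; rewrite /z mulN1r.
  apply: (@supp_compact _ (`|a| + `|b| + 1)) => x xM.
  have := ler_norm a; have := ler_norm (- a); have := ler_norm b; have := ler_norm (- b).
  have [x0|x0] := ltP x 0.
    move: xM; rewrite (ltr0_norm x0) !normrN => *.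
    by rewrite /z !S_0 ?subrr//; lra.
  move: xM; rewrite (ger0_norm x0) !normrN => *.
  by rewrite /z !S_1' ?subrr//; lra.
have zE n x : ((z n)^`())%classic x = S' n a x - S' n b x.
  by rewrite derive1E; have [] := derB (dS n a x) (dS n b x).
have iS n c : mu.-integrable setT (EFin \o (fun x => f x * S' n c x)).
  apply: (@integ_supp _ _ (`|c| + 1)) => // x xM; rewrite S'_0' ?mulr0//.
  have := ler_norm c; have := ler_norm (- c).
  by have [x0|x0] := ltP x 0; move: xM; rewrite ?(ltr0_norm x0) ?(ger0_norm x0) normrN => *;
    [left|right]; lra.
have lhs : \int[mu]_x (f x * ((z n)^`())%classic x) @[n --> \oo] --> f a - f b.
  apply: (cvg_ext _ (cvg_sub (mass a) (mass b))) => n.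
  rewrite /= -RintegralB//; apply: eq_Rintegral => x _; rewrite zE; ring.
have rhs : \int[mu]_x (g x * z n x) @[n --> \oo] --> \int[mu]_(x in `[a, b]) g x.
  have mT : measurable (setT : set (measurableTypeR R)) by exact: measurableT.
  have mI c d : measurable (`]c, d]%classic : set (measurableTypeR R)) by exact: measurable_itv.
  have [] := @Rint_dominated _ _ R mu setT mT (fun n x => g x * z n x)
     (fun x => g x * \1_(`]a, b]) x) (fun x => `|g x| * \1_(`]a, b + 1]) x).
  - move=> n; apply: measurable_funM; first exact: loc_meas.
    by apply: continuous_measurable_fun; apply: smooth_cont; case: (zT n).
  - have := (@integrable_mkcond _ (measurableTypeR R) R mu _ (EFin \o (fun x => `|g x|)) (mI a (b + 1))).1.
    have ig : mu.-integrable `]a, (b + 1)] (EFin \o (fun x => `|g x|)).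
      by apply: (Int_sub (a := a) (b := b + 1) (loc_norm lg) (mI _ _)); exact: subset_itv_oc_cc.
    move=> /(_ ig); congr (_.-integrable _ _); apply/funext => x.
    by rewrite patchE /= indicE; case: ifP => _; rewrite ?mulr1 ?mulr0.
  - move=> n x _; rewrite normrM ler_wpM2l// indicE.
    have zb : `|z n x| <= 1.
      have := step_bound (n.+1%:R * (x - a)); have := step_bound (n.+1%:R * (x - b)).
      by rewrite /z /S ler_norml => /andP[? ?] /andP[? ?]; apply/andP; split; lra.
    case: (boolP (x \in _)) => //= /negP xI.
    rewrite /z; have [xa|ax] := leP x a; first by rewrite !S_0 ?subrr ?normr0//; lra.
    rewrite !S_1' ?subrr ?normr0//.
      rewrite leNgt; apply/negP => h; apply: xI; rewrite inE /= in_itv /= ax.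
      lra.
    rewrite leNgt; apply/negP => h; apply: xI; rewrite inE /= in_itv /= ax.
    lra.
  - move=> x _; apply: cvgM; first exact: cvg_cst.
    apply: cvg_near_cst; near=> n; rewrite /z indicE.
    have [xa|ax] := leP x a.
      rewrite !S_0 ?subrr//; last lra.
      by rewrite memNset//= in_itv /= ltNge xa.
    have Sa : S n a x = 1.
      rewrite S_1// -lerBrDl invf_ple ?posrE ?subr_gt0//.
      apply: (@le_trans _ _ n%:R); last by rewrite ler_nat.
      by near: n; exact: nbhs_infty_ger.
    have [xb|bx] := leP x b; first by rewrite Sa S_0// subr0 mem_set//= in_itv /= ax.
    rewrite Sa S_1 ?subrr ?memNset//= ?in_itv /= ?ax ?leNgt ?bx//.
    rewrite -leNgt -lerBrDl invf_ple ?posrE ?subr_gt0//.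
    apply: (@le_trans _ _ n%:R); last by rewrite ler_nat.
    by near: n; exact: nbhs_infty_ger.
  move=> _; congr (_ --> _); rewrite -Rintegral_itv_obnd_cbnd; last first.
    by apply: (Int_sub (a := a) (b := b) lg (mI _ _)); exact: subset_itv_oc_cc.
  rewrite [RHS]Rintegral_mkcond; apply: eq_Rintegral => x _.
  by rewrite patchE indicE; case: ifP => _; rewrite ?mulr1 ?mulr0.
have h : \int[mu]_x (f x * ((z n)^`())%classic x) @[n --> \oo] --> - \int[mu]_(x in `[a, b]) g x.
  by apply: (cvg_ext _ (cvg_opp rhs)) => n; rewrite (wd _ (zT n)).
have := cvg_uniq lhs h; lra.
Unshelve. all: by end_near. Qed.

End TestFunctions.

(** * Smooth functions of two variables *)

Section Plane.
Context {R : realType}.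
Local Notation mu := (@lebesgue_measure R).
Local Notation mu2 := (@lebesgue_measure R \x @lebesgue_measure R)%E.
Local Notation RM := (measurableTypeR R).
Local Notation meas2 g := (measurable_fun (setT : set (RM * RM)) g).
Implicit Types (z f g : R * R -> R) (a b : R -> R) (p : R * R) (x y t l K M : R).

Lemma slice_derive1 f x y l :
  is_derive x 1 (fun t => f (t, y)) l <-> is_derive (x, y) e1 f l.
Proof.
have E : (fun h : R => h^-1 *: ((f \o shift (x, y)) (h *: (e1 : R * R)) - f (x, y))) =
   (fun h : R => h^-1 *: (((fun t => f (t, y)) \o shift x) (h *: (1 : R)) - f (x, y))).
  apply/funext => h; congr (_ *: (f _ - _)).
  by rewrite /e1 /shift /=; congr pair; rewrite /= scaler0 add0r.
by split => -[h1 h2]; split; [rewrite /derivable E|rewrite /derive E|rewrite /derivable -E|rewrite /derive -E].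
Qed.

Lemma slice_derive2 f x y l :
  is_derive y 1 (fun t => f (x, t)) l <-> is_derive (x, y) e2 f l.
Proof.
have E : (fun h : R => h^-1 *: ((f \o shift (x, y)) (h *: (e2 : R * R)) - f (x, y))) =
   (fun h : R => h^-1 *: (((fun t => f (x, t)) \o shift y) (h *: (1 : R)) - f (x, y))).
  apply/funext => h; congr (_ *: (f _ - _)).
  by rewrite /e2 /shift /=; congr pair; rewrite /= scaler0 add0r.
by split => -[h1 h2]; split; [rewrite /derivable E|rewrite /derive E|rewrite /derivable -E|rewrite /derive -E].
Qed.

(** The analogue of [smooth_class] for iterated partial derivatives. *)
Lemma smooth2_class (P : (R * R -> R) -> Prop) :
  (forall f, P f -> continuous f /\ exists f1 f2, [/\ P f1, P f2,
     forall p, is_derive p e1 f (f1 p) & forall p, is_derive p e2 f (f2 p)]) ->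
  forall f, P f -> smooth2 f.
Proof.
move=> h f Pf w.
suff Pw : P (partials w f).
  have [cw [f1 [f2 [_ _ d1 d2]]]] := h _ Pw; split => // p.
elim: w => [//|b w IH]; have [_ [f1 [f2 [P1 P2 d1 d2]]]] := h _ IH.
case: b => /=.
  suff -> : partial1 (partials w f) = f1 by [].
  by apply/funext => p; have [] := d1 p.
suff -> : partial2 (partials w f) = f2 by [].
by apply/funext => p; have [] := d2 p.
Qed.

Lemma smooth2_cont z : smooth2 z -> continuous z.
Proof. by move=> /(_ [::]) []. Qed.

Lemma smooth2_d1 z : smooth2 z -> forall p, is_derive p e1 z (partial1 z p).
Proof. by move=> sz p; have [_ /(_ p) [d1 _]] := sz [::]; exact: DeriveDef. Qed.

Lemma smooth2_d2 z : smooth2 z -> forall p, is_derive p e2 z (partial2 z p).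
Proof. by move=> sz p; have [_ /(_ p) [_ d2]] := sz [::]; exact: DeriveDef. Qed.

Lemma smooth2_p1 z : smooth2 z -> smooth2 (partial1 z).
Proof. by move=> sz w; have := sz (rcons w true); rewrite /partials foldr_rcons. Qed.

Lemma smooth2_p2 z : smooth2 z -> smooth2 (partial2 z).
Proof. by move=> sz w; have := sz (rcons w false); rewrite /partials foldr_rcons. Qed.

Lemma smooth2_slice1 z x y : smooth2 z -> is_derive x 1 (fun t => z (t, y)) (partial1 z (x, y)).
Proof. by move=> sz; apply/slice_derive1; exact: smooth2_d1. Qed.

Lemma smooth2_slice2 z x y : smooth2 z -> is_derive y 1 (fun t => z (x, t)) (partial2 z (x, y)).
Proof. by move=> sz; apply/slice_derive2; exact: smooth2_d2. Qed.

Lemma cont_slice1 f y : continuous f -> continuous (fun t => f (t, y)).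
Proof.
move=> cf x; apply: (continuous_comp (f := fun t => (t, y))); last exact: cf.
exact: cvg_pair cvg_id (cvg_cst _).
Qed.

Lemma cont_slice2 f x : continuous f -> continuous (fun t => f (x, t)).
Proof.
move=> cf y; apply: (continuous_comp (f := fun t => (x, t))); last exact: cf.
exact: cvg_pair (cvg_cst _) cvg_id.
Qed.

Inductive smooth2_expr : (R * R -> R) -> Prop :=
| S2base z : smooth2 z -> smooth2_expr z
| S2fst a : smooth a -> smooth2_expr (fun p => a p.1)
| S2snd b : smooth b -> smooth2_expr (fun p => b p.2)
| S2add f g : smooth2_expr f -> smooth2_expr g -> smooth2_expr (fun p => f p + g p)
| S2mul f g : smooth2_expr f -> smooth2_expr g -> smooth2_expr (fun p => f p * g p)
| S2inv f : smooth2_expr f -> (forall p, f p != 0) -> smooth2_expr (fun p => (f p)^-1).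

Lemma smooth_const (k : R) : smooth (fun _ : R => k).
Proof. exact/smooth_exprP/SEcst. Qed.

Lemma smooth2_exprP f : smooth2_expr f -> smooth2 f.
Proof.
apply: smooth2_class => {}f; elim => {f}.
- move=> z sz; split; first exact: smooth2_cont.
  exists (partial1 z), (partial2 z); split; [apply/S2base/smooth2_p1|apply/S2base/smooth2_p2|
    exact: smooth2_d1|exact: smooth2_d2] => //.
- move=> a sa; split.
    by move=> p; apply: (continuous_comp (f := fst)); [exact: cvg_fst|exact: smooth_cont].
  exists (fun p => (a^`())%classic p.1), (fun p => (fun _ => 0) p.1); split.
  + exact/S2fst/smooth_deriv1.
  + exact: (S2fst (@smooth_const 0)).
  + by move=> [x y]; apply/slice_derive1; exact: smooth_derive.
  + by move=> [x y]; apply/slice_derive2; exact: (der_cst (a x) y).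
- move=> a sa; split.
    by move=> p; apply: (continuous_comp (f := snd)); [exact: cvg_snd|exact: smooth_cont].
  exists (fun p => (fun _ => 0) p.1), (fun p => (a^`())%classic p.2); split.
  + exact: (S2fst (@smooth_const 0)).
  + exact/S2snd/smooth_deriv1.
  + by move=> [x y]; apply/slice_derive1; exact: (der_cst (a y) x).
  + by move=> [x y]; apply/slice_derive2; exact: smooth_derive.
- move=> f g sf [cf [f1 [f2 [sf1 sf2 df1 df2]]]] sg [cg [g1 [g2 [sg1 sg2 dg1 dg2]]]]; split.
    by move=> p; apply: cvgD; [exact: cf|exact: cg].
  exists (fun p => f1 p + g1 p), (fun p => f2 p + g2 p); split; [exact: S2add|exact: S2add| |].
  + move=> [x y]; apply/slice_derive1.
    exact: (derD ((slice_derive1 _ _ _ _).2 (df1 (x, y))) ((slice_derive1 _ _ _ _).2 (dg1 (x, y)))).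
  + move=> [x y]; apply/slice_derive2.
    exact: (derD ((slice_derive2 _ _ _ _).2 (df2 (x, y))) ((slice_derive2 _ _ _ _).2 (dg2 (x, y)))).
- move=> f g sf [cf [f1 [f2 [sf1 sf2 df1 df2]]]] sg [cg [g1 [g2 [sg1 sg2 dg1 dg2]]]]; split.
    by move=> p; apply: cvgM; [exact: cf|exact: cg].
  exists (fun p => f1 p * g p + f p * g1 p), (fun p => f2 p * g p + f p * g2 p); split;
    [by apply: S2add; exact: S2mul|by apply: S2add; exact: S2mul| |].
  + move=> [x y]; apply/slice_derive1.
    exact: (derM ((slice_derive1 _ _ _ _).2 (df1 (x, y))) ((slice_derive1 _ _ _ _).2 (dg1 (x, y)))).
  + move=> [x y]; apply/slice_derive2.
    exact: (derM ((slice_derive2 _ _ _ _).2 (df2 (x, y))) ((slice_derive2 _ _ _ _).2 (dg2 (x, y)))).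
- move=> f sf [cf [f1 [f2 [sf1 sf2 df1 df2]]]] f0; split.
    by move=> p; apply: cvgV; [exact: f0|exact: cf].
  pose g p := - ((f p)^-1 * (f p)^-1).
  have sg : smooth2_expr g.
    have := S2mul (S2fst (@smooth_const (-1))) (S2mul (S2inv sf f0) (S2inv sf f0)).
    by congr smooth2_expr; apply/funext => p; rewrite mulN1r.
  exists (fun p => g p * f1 p), (fun p => g p * f2 p); split; [exact: S2mul|exact: S2mul| |].
  + move=> [x y]; apply/slice_derive1.
    apply: is_derive_val (derV (f0 (x, y)) ((slice_derive1 _ _ _ _).2 (df1 (x, y)))) _.
    by rewrite /g expr2 invfM.
  + move=> [x y]; apply/slice_derive2.
    apply: is_derive_val (derV (f0 (x, y)) ((slice_derive2 _ _ _ _).2 (df2 (x, y)))) _.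
    by rewrite /g expr2 invfM.
Qed.

Lemma partial1_eq f l p : is_derive p e1 f l -> partial1 f p = l.
Proof. by case. Qed.
Lemma partial2_eq f l p : is_derive p e2 f l -> partial2 f p = l.
Proof. by case. Qed.

(** * Boundedness, support and measurability *)

Definition in_box M p := `|p.1| <= M /\ `|p.2| <= M.

Lemma box_compact M : compact [set p : R * R | in_box M p].
Proof.
have -> : [set p : R * R | in_box M p] = (`[- M, M] `*` `[- M, M])%classic.
  by apply/seteqP; split => -[x y] [] /=; rewrite !in_itv /= -!ler_norml.
by apply: compact_setX; exact: segment_compact.
Qed.

Lemma cont_box_bounded f M : continuous f -> exists2 K : R, 0 < K & forall p, in_box M p -> `|f p| <= K.
Proof.
move=> cf.
have : compact (f @` [set p | in_box M p]).
  by apply: continuous_compact; [exact: continuous_subspaceT|exact: box_compact].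
move=> /compact_bdd [K K0 h]; exists K => // p pM; apply/ltW/h; by exists p.
Qed.

Lemma test2_supp z : test_function2 z -> exists2 M : R, 0 < M & forall p, ~ in_box M p ->
  [/\ z p = 0, partial1 z p = 0 & partial2 z p = 0].
Proof.
move=> [sz /compact_bounded [M0 [_ hM]]].
pose M := `|M0| + 2.
have M_gt0 : 0 < M by rewrite ltr_wpDl.
have zM p : ~ in_box (M - 1) p -> z p = 0.
  move=> pM; apply/eqP; apply/negP => /negP zp; apply: pM.
  have : `|p| <= `|M0| + 1.
    by apply: (hM (`|M0| + 1)) => /=; [have := ler_norm M0; lra|exact: subset_closure].
  have -> : `|M0| + 1 = M - 1 by rewrite /M; lra.
  rewrite prod_normE ge_max => /andP[h1 h2]; split => //.
exists M => // -[x y] pM; split.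
- apply: zM => -[h1 h2]; apply: pM; split => /=; move: h1 h2 => /=; lra.
- apply: partial1_eq; apply/slice_derive1.
  apply: (@der_local _ (fun _ => 0) _ _ _ _ (der_cst 0 x)).
  near=> t; rewrite zM// => -[/= h1 h2]; apply: pM; split => /=; last lra.
  have h : `|x - t| <= 1.
    near: t; apply: (@cvgr_dist_le _ _ _ (nbhs x) _ id x) => //.
  have -> : x = (x - t) + t by ring.
  by apply: (le_trans (ler_normD _ _)); lra.
- apply: partial2_eq; apply/slice_derive2.
  apply: (@der_local _ (fun _ => 0) _ _ _ _ (der_cst 0 y)).
  near=> t; rewrite zM// => -[/= h1 h2]; apply: pM; split => /=; first lra.
  have h : `|y - t| <= 1.
    near: t; apply: (@cvgr_dist_le _ _ _ (nbhs y) _ id y) => //.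
  have -> : y = (y - t) + t by ring.
  by apply: (le_trans (ler_normD _ _)); lra.
Unshelve. all: by end_near. Qed.

Lemma box_test2 z M : smooth2 z -> (forall p, ~ in_box M p -> z p = 0) -> test_function2 z.
Proof.
move=> sz h; split => //; apply: (@closure_compact _ _ _ [set p | in_box M p]).
- have -> : [set p : R * R | in_box M p] = ([set p | `|p.1| <= M] `&` [set p | `|p.2| <= M])%classic.
    by apply/seteqP; split => -[x y].
  apply: closedI.
    apply: (@preimage_closed _ _ (fun p : R * R => `|p.1|) [set t | t <= M]); last exact: closed_le.
    by move=> p _; apply: (continuous_comp (f := fst)); [exact: cvg_fst|exact: norm_continuous].
  apply: (@preimage_closed _ _ (fun p : R * R => `|p.2|) [set t | t <= M]); last exact: closed_le.
  by move=> p _; apply: (continuous_comp (f := snd)); [exact: cvg_snd|exact: norm_continuous].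
- exact: box_compact.
- by move=> p zp; apply: contrapT => /h zp0; rewrite zp0 eqxx in zp.
Qed.

Lemma open2_meas (U : set (R * R)) : open U -> measurable (U : set (RM * RM)).
Proof.
move=> oU.
pose B (q1 q2 : rat) (n : nat) : set (RM * RM) :=
  ((ball (ratr q1 : R) n.+1%:R^-1) `*` (ball (ratr q2 : R) n.+1%:R^-1))%classic.
pose B' q1 q2 n := if `[< B q1 q2 n `<=` U >] then B q1 q2 n else set0.
have -> : U = \bigcup_q1 \bigcup_q2 \bigcup_n B' q1 q2 n.
  apply/seteqP; split; last first.
    by move=> p [q1 _ [q2 _ [n _]]]; rewrite /B'; case: asboolP => // BU /BU.
  move=> [x y] /= Uxy.
  have /nbhs_ballP [e /= e0 eU] : nbhs (x, y) U by exact: open_nbhs_nbhs.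
  pose n := Num.truncn (2 / e).
  have ne : n.+1%:R^-1 + n.+1%:R^-1 < e.
    have : n.+1%:R^-1 < e / 2.
      by rewrite invf_plt ?posrE ?divr_gt0// invf_div; exact: truncnS_gt.
    by set q := n.+1%:R^-1; lra.
  have n0 : 0 < n.+1%:R^-1 :> R by rewrite invr_gt0.
  rewrite /B' /B; move: (n) ne n0 => {}n; set q := n.+1%:R^-1 => ne n0.
  have [q1] := @rat_in_itvoo R (x - q) (x + q) ltac:(lra).
  rewrite in_itv /= => /andP[l1 r1].
  have [q2] := @rat_in_itvoo R (y - q) (y + q) ltac:(lra).
  rewrite in_itv /= => /andP[l2 r2].
  exists q1 => //; exists q2 => //; exists n => //.
  rewrite -/q; case: asboolP => [_|].
    split; rewrite /ball /= ltr_norml; apply/andP; split; lra.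
  case; move=> [x' y'] [/=]; rewrite /ball /= !ltr_norml => /andP[h1 h2] /andP[h3 h4].
  apply: eU; split; rewrite /ball /= ltr_norml; apply/andP; split; lra.
do 2 (apply: bigcupT_measurable_rat => ?).
apply: bigcupT_measurable => n; rewrite /B'; case: asboolP => // _.
by apply: measurableX; exact: measurable_ball.
Qed.

Lemma cont2_meas f : continuous f -> meas2 f.
Proof.
move=> cf; apply: (measurability (@RGenOInfty.G R)); first exact: RGenOInfty.measurableE.
move=> _ [_ [a ->] <-]; rewrite setTI.
apply: open2_meas; apply: open_comp => //; exact: interval_open.
Qed.

Lemma meas_half_plane : measurable (half_plane : set (RM * RM)).
Proof.
apply: open2_meas.
have -> : (half_plane : set (R * R)) = snd @^-1` [set t : R | 0 < t] by [].
apply: open_comp; last exact: open_gt.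
by move=> p _; exact: cvg_snd.
Qed.

Lemma box_integrable f K M : meas2 f -> (forall p, in_box M p -> `|f p| <= K) ->
  (forall p, ~ in_box M p -> f p = 0) -> mu2.-integrable setT (EFin \o f).
Proof.
move=> mf fK f0.
pose A : set (RM * RM) := [set p | in_box M p].
have AE : A = (`[- M, M] `*` `[- M, M])%classic.
  by apply/seteqP; split => -[x y] [] /=; rewrite !in_itv /= -!ler_norml.
have mA : measurable A by rewrite AE; apply: measurableX; exact: measurable_itv.
have muA : (mu2 A < +oo)%E.
  rewrite AE product_measure1E; [|exact: measurable_itv..].
  rewrite /= lebesgue_measure_itv /=.
  by case: ifP => _; rewrite ?mul0e// -EFinD -EFinM ltry.
have : mu2.-integrable A (EFin \o f).
  apply: measurable_bounded_integrable => //; first exact: measurable_funS mf.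
  exists K; split; first exact: num_real.
  by move=> N KN p /= pM; exact: le_trans (fK _ pM) (ltW KN).
move=> /((@integrable_mkcond _ (RM * RM)%type R mu2 _ (EFin \o f) mA).1); congr (_.-integrable _ _).
apply/funext => p; rewrite patchE /=; case: ifPn => // /negP pA.
by rewrite f0// => pM; apply: pA; rewrite inE.
Qed.

End Plane.

(** * Integration over the half-plane *)

Section HalfPlane.
Context {R : realType}.
Local Notation mu := (@lebesgue_measure R).
Local Notation mu2 := (@lebesgue_measure R \x @lebesgue_measure R)%E.
Local Notation RM := (measurableTypeR R).
Local Notation meas g := (measurable_fun (setT : set RM) g).
Local Notation meas2 g := (measurable_fun (setT : set (RM * RM)) g).
Implicit Types (z : R * R -> R) (A B C f : R * R -> R) (p : R * R) (x y t K M : R).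

Let mH : measurable (half_plane : set (RM * RM)). Proof. exact: meas_half_plane. Qed.
Let mT1 : measurable (setT : set RM). Proof. exact: measurableT. Qed.
Let mT2 : measurable (setT : set (RM * RM)). Proof. exact: measurableT. Qed.
Let mPos : measurable (`]0, +oo[%classic : set RM). Proof. exact: measurable_itv. Qed.
Hint Resolve mH mT1 mT2 mPos : core.

Lemma Fubini12 f : mu2.-integrable setT (EFin \o f) ->
  \int[mu2]_p f p = \int[mu]_x \int[mu]_y f (x, y).
Proof.
move=> fi; rewrite /Rintegral -(integral12_prod_meas1 fi); congr fine.
have iF := integrable_fubini_F fi.
apply: ae_eq_integral => //.
- exact: measurable_fubini_F fi.
- by apply/measurable_EFinP; apply: measurableT_comp => //; exact: measurable_fubini_F fi.
- have := integrable_ae mT1 iF; apply: filterS => x /(_ I) h _.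
  by rewrite /= fineK.
Qed.

Lemma fubini_G_integrable f : mu2.-integrable setT (EFin \o f) ->
  mu.-integrable setT (fubini_G mu (EFin \o f)).
Proof.
move=> fi; apply/integrableP; split; first exact: measurable_fubini_G fi.
have [mf] := integrableP _ _ _ fi.
move=> _; have := (integrable21ltyP mu mu mf).1 fi; apply: le_lt_trans.
apply: ge0_le_integral => //.
- by apply: measurableT_comp => //; exact: measurable_fubini_G fi.
- apply: (@measurable_fun_fubini_tonelli_G _ _ RM RM R mu (abse \o (EFin \o f))) => //=.
  exact: measurableT_comp.
- move=> y _; apply: le_abse_integral => //.
  exact: measurable_fun_pair1.
Qed.

Lemma Fubini21 f : mu2.-integrable setT (EFin \o f) ->
  \int[mu2]_p f p = \int[mu]_y \int[mu]_x f (x, y).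
Proof.
move=> fi; rewrite /Rintegral -(integral21_prod_meas1 fi); congr fine.
have iF := fubini_G_integrable fi.
apply: ae_eq_integral => //.
- exact: measurable_fubini_G fi.
- by apply/measurable_EFinP; apply: measurableT_comp => //; exact: measurable_fubini_G fi.
- have := integrable_ae mT1 iF; apply: filterS => x /(_ I) h _.
  by rewrite /= fineK.
Qed.

Lemma prod_integrable (a b : R -> R) : mu.-integrable setT (EFin \o a) ->
  mu.-integrable setT (EFin \o b) -> mu2.-integrable setT (EFin \o (fun p => a p.1 * b p.2)).
Proof.
move=> ia ib.
have ma := integ_meas ia; have mb := integ_meas ib.
have mf : meas2 (fun p => a p.1 * b p.2).
  apply: measurable_funM; first by apply: (measurableT_comp ma).
  by apply: (measurableT_comp mb).
apply/(integrable12ltyP _ _ _).2; first exact/measurable_EFinP.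
rewrite /=.
under eq_integral => x _.
  under eq_integral => y _ do rewrite normrM EFinM.
  rewrite ge0_integralZl//; last first.
    by apply/measurable_EFinP; apply: measurableT_comp.
  over.
have /integrableP[_ hb] := ib.
have fb : (\int[mu]_x (`|b x|)%:E)%E \is a fin_num.
  by rewrite ge0_fin_numE// integral_ge0.
rewrite -(fineK fb).
under eq_integral => x _ do rewrite -EFinM.
have : mu.-integrable setT (EFin \o (fun x => `|a x| * fine (\int[mu]_x (`|b x|)%:E)%E)).
  apply: (eq_integ mT1 _ (integZ mT1 (fine (\int[mu]_x (`|b x|)%:E)%E) (integ_norm ia))) => x _.
  by rewrite mulrC.
by move=> /(integ_lty mT1).
Qed.

Lemma half_setT f : \int[mu2]_(p in half_plane) f p = \int[mu2]_p (f p * \1_(half_plane) p).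
Proof.
rewrite Rintegral_mkcond; apply: eq_Rintegral => p _.
by rewrite patchE indicE; case: ifP; rewrite ?mulr1 ?mulr0.
Qed.

Lemma half_integ f : mu2.-integrable half_plane (EFin \o f) ->
  mu2.-integrable setT (EFin \o (fun p => f p * \1_(half_plane) p)).
Proof.
move=> /((@integrable_mkcond _ (RM * RM)%type R mu2 _ (EFin \o f) mH).1).
congr (_.-integrable _ _); apply/funext => p.
by rewrite patchE /= indicE; case: ifP; rewrite ?mulr1 ?mulr0.
Qed.

Lemma indic_half x y : \1_(half_plane) (x, y) = \1_(`]0, +oo[) y :> R.
Proof. by rewrite !indicE; congr ((nat_of_bool _)%:R); apply/idP/idP; rewrite !inE /= in_itv /= andbT. Qed.

Lemma Fubini_half12 f : mu2.-integrable half_plane (EFin \o f) ->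
  \int[mu2]_(p in half_plane) f p = \int[mu]_x \int[mu]_(y in `]0, +oo[) f (x, y).
Proof.
move=> fi; rewrite half_setT Fubini12; last exact: half_integ.
apply: eq_Rintegral => x _; rewrite [RHS]Rintegral_mkcond; apply: eq_Rintegral => y _.
by rewrite indic_half patchE indicE; case: ifP; rewrite ?mulr1 ?mulr0.
Qed.

Lemma Fubini_half21 f : mu2.-integrable half_plane (EFin \o f) ->
  \int[mu2]_(p in half_plane) f p = \int[mu]_(y in `]0, +oo[) \int[mu]_x f (x, y).
Proof.
move=> fi; rewrite half_setT Fubini21; last exact: half_integ.
rewrite [RHS]Rintegral_mkcond; apply: eq_Rintegral => y _; rewrite patchE.
case: ifPn => yP.
  by apply: eq_Rintegral => x _; rewrite indic_half indicE yP mulr1.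
by apply: Rint_zero => x _; rewrite indic_half indicE (negbTE yP) mulr0.
Qed.

Lemma prod_half (a b : R -> R) : mu.-integrable setT (EFin \o a) ->
  mu.-integrable `]0, +oo[ (EFin \o b) ->
  mu2.-integrable half_plane (EFin \o (fun p => a p.1 * b p.2)) /\
  \int[mu2]_(p in half_plane) (a p.1 * b p.2) =
    (\int[mu]_x a x) * \int[mu]_(y in `]0, +oo[) b y.
Proof.
move=> ia ib.
have ib' : mu.-integrable setT (EFin \o (b \_ `]0, +oo[)).
  have := (@integrable_mkcond _ RM R mu _ (EFin \o b) mPos).1 ib.
  by congr (_.-integrable _ _); rewrite restrict_EFin.
have i2 : mu2.-integrable half_plane (EFin \o (fun p => a p.1 * b p.2)).
  have : mu2.-integrable half_plane (EFin \o (fun p => a p.1 * (b \_ `]0, +oo[) p.2)).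
    exact: integrableS (prod_integrable ia ib').
  apply: eq_integ => // -[x y] /= y0; rewrite patchE mem_set//=.
  by rewrite in_itv /= andbT.
split => //; rewrite Fubini_half12// -RintegralZr//.
by apply: eq_Rintegral => x _ /=; rewrite RintegralZl.
Qed.

Definition grad z : field (RM * RM)%type R := (partial1 z, partial2 z).

Lemma test2_p1 z : test_function2 z -> continuous (partial1 z).
Proof. by move=> [sz _]; apply: smooth2_cont; exact: smooth2_p1. Qed.
Lemma test2_p2 z : test_function2 z -> continuous (partial2 z).
Proof. by move=> [sz _]; apply: smooth2_cont; exact: smooth2_p2. Qed.

Lemma L2_grad z : test_function2 z -> L2field mu2 half_plane (grad z).
Proof.
move=> tz; have [M M0 hM] := test2_supp tz.
have aux f : continuous f -> (forall p, ~ in_box M p -> f p = 0) -> sq_integrable mu2 half_plane f.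
  move=> cf f0; have mf := cont2_meas cf.
  have [K K0 fK] := cont_box_bounded M cf.
  apply: integ_sqI => //; first exact: measurable_funS mf.
  apply: (integrableS mT2 mH) => //.
  apply: (@box_integrable _ _ (K ^+ 2) M); first exact: measurable_funX.
    by move=> p pM; rewrite normrX lerXn2r ?nnegrE ?(ltW K0)// fK.
  by move=> p /f0 ->; rewrite expr0n.
split; apply: aux; [exact: test2_p1| |exact: test2_p2|];
  by move=> p /hM [].
Qed.

Lemma Rint_pos_supp (f : R -> R) M : loc f -> 0 <= M -> (forall y, M < y -> f y = 0) ->
  \int[mu]_(y in `]0, +oo[) f y = \int[mu]_(y in `[0, M]) f y.
Proof.
move=> lf M0 f0.
rewrite -Rintegral_itv_obnd_cbnd; last first.
  by apply: (Int_sub (a := 0) (b := M) lf); [exact: measurable_itv|exact: subset_itv_oc_cc].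
rewrite Rintegral_mkcond [RHS]Rintegral_mkcond; apply: eq_Rintegral => y _.
rewrite !patchE; case: ifPn => /= y0; case: ifPn => /= yM => //.
  rewrite f0// ltNge; apply/negP => yM'; move: yM; rewrite notin_setE; apply.
  by move: y0; rewrite inE /= !in_itv /= andbT => ->.
by exfalso; move: y0 yM; rewrite notin_setE inE /= !in_itv /= andbT => y0 /andP[].
Qed.

(** Green's identity: after integration by parts in each variable the two
    interior terms [C z] cancel.  With [A] and [B] the partial derivatives of
    a function in the second and the first variable, it pairs a tangential
    derivative on the boundary with a test function. *)
Lemma boundary_pairing A B C z : test_function2 z ->
  (forall y, 0 < y -> prim (fun x => A (x, y)) (fun x => C (x, y))) ->
  (forall x, prim (fun y => B (x, y)) (fun y => C (x, y))) ->
  mu2.-integrable half_plane (EFin \o (fun p => C p * z p)) ->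
  mu2.-integrable half_plane (EFin \o (fun p => A p * partial1 z p)) ->
  mu2.-integrable half_plane (EFin \o (fun p => B p * partial2 z p)) ->
  mu.-integrable setT (EFin \o (fun x => B (x, 0) * z (x, 0))) ->
  \int[mu]_x (B (x, 0) * z (x, 0)) =
  \int[mu2]_(p in half_plane) (A p * partial1 z p - B p * partial2 z p).
Proof.
move=> tz pA pB iC iA iB i0.
have [sz _] := tz; have [M M0 hM] := test2_supp tz.
have cz := smooth2_cont sz.
have z1 x y : M < `|x| -> [/\ z (x, y) = 0, partial1 z (x, y) = 0 & partial2 z (x, y) = 0].
  by move=> xM; apply: hM => -[] /=; rewrite leNgt xM.
have z2 x y : M < `|y| -> [/\ z (x, y) = 0, partial1 z (x, y) = 0 & partial2 z (x, y) = 0].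
  by move=> xM; apply: hM => -[] _ /=; rewrite leNgt xM.
have pz1 y : prim (fun x => z (x, y)) (fun x => partial1 z (x, y)).
  apply: prim_C1; first by move=> x; exact: smooth2_slice1.
  by apply: cont_slice1; exact: test2_p1.
have pz2 x : prim (fun y => z (x, y)) (fun y => partial2 z (x, y)).
  apply: prim_C1; first by move=> y; exact: smooth2_slice2.
  by apply: cont_slice2; exact: test2_p2.
have E1 : \int[mu2]_(p in half_plane) (C p * z p + A p * partial1 z p) = 0.
  rewrite Fubini_half21; last exact: integD.
  apply: Rint_zero => y /=; rewrite in_itv /= andbT => y0.
  have [l1 h1] := primM (pA y y0) (pz1 y).
  rewrite (@Rint_supp _ _ (M + 1)); last first.
    by move=> x xM; have [|-> -> _] := z1 x y; [lra|rewrite !mulr0 addr0].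
  rewrite -h1; last lra.
  have [| -> _ _] := z1 (M + 1) y; first by rewrite ger0_norm; lra.
  have [| -> _ _] := z1 (- (M + 1)) y; first by rewrite normrN ger0_norm; lra.
  by rewrite !mulr0 subrr.
have E2 : \int[mu2]_(p in half_plane) (C p * z p + B p * partial2 z p) =
   - \int[mu]_x (B (x, 0) * z (x, 0)).
  rewrite Fubini_half12; last exact: integD.
  rewrite -RintN//; apply: eq_Rintegral => x _.
  have [l2 h2] := primM (pB x) (pz2 x).
  rewrite (@Rint_pos_supp _ (M + 1))//; [|lra|]; last first.
    move=> y yM; have [|-> _ ->] := z2 x y; last by rewrite !mulr0 addr0.
    by rewrite ger0_norm; lra.
  rewrite -h2; last lra.
  have [|-> _ _] := z2 x (M + 1); first by rewrite ger0_norm; lra.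
  by rewrite mulr0 sub0r.
have -> : \int[mu2]_(p in half_plane) (A p * partial1 z p - B p * partial2 z p) =
   \int[mu2]_(p in half_plane) ((C p * z p + A p * partial1 z p) - (C p * z p + B p * partial2 z p)).
  by apply: eq_Rintegral => p _; ring.
have i1 := integD mH iC iA; have i2 := integD mH iC iB.
by rewrite (RintegralB mH i1 i2) E1 E2 sub0r opprK.
Qed.

End HalfPlane.

(** * Fields of finite Dirichlet energy *)

Section StrayField.
Context {R : realType}.
Local Notation mu := (@lebesgue_measure R).
Local Notation mu2 := (@lebesgue_measure R \x @lebesgue_measure R)%E.
Local Notation RM := (measurableTypeR R).
Local Notation meas g := (measurable_fun (setT : set RM) g).
Local Notation meas2 g := (measurable_fun (setT : set (RM * RM)) g).
Local Notation L2 G := (L2field mu2 half_plane G).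
Local Notation "<< G , H >>" := (ip mu2 half_plane G H).
Local Notation sqI f := (sq_integrable mu (setT : set RM) f).
Implicit Types (z : R * R -> R) (p : R * R) (x y t K M l e : R) (w : R -> R).
Implicit Types (G H V X Y : field (RM * RM)%type R).

Let mH : measurable (half_plane : set (RM * RM)). Proof. exact: meas_half_plane. Qed.
Let mT1 : measurable (setT : set RM). Proof. exact: measurableT. Qed.
Let mT2 : measurable (setT : set (RM * RM)). Proof. exact: measurableT. Qed.
Let mPos : measurable (`]0, +oo[%classic : set RM). Proof. exact: measurable_itv. Qed.
Hint Resolve mH mT1 mT2 mPos : core.

Definition fieldB G H := lincomb 1 G (-1) H.
Definition dist2 G H := << fieldB G H, fieldB G H >>.

Lemma L2_diff G H : L2 G -> L2 H -> L2 (fieldB G H).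
Proof. by move=> g h; exact: L2_lincomb. Qed.

Lemma ip_diffr G H X : L2 G -> L2 H -> L2 X -> << X, fieldB G H >> = << X, G >> - << X, H >>.
Proof. by move=> g h x; rewrite ip_lincombr// mul1r mulN1r. Qed.

Lemma ip_diffl G H X : L2 G -> L2 H -> L2 X -> << fieldB G H, X >> = << G, X >> - << H, X >>.
Proof. by move=> g h x; rewrite ip_lincomb// mul1r mulN1r. Qed.

Lemma dist2E G H : L2 G -> L2 H -> dist2 G H = << G, G >> - 2 * << G, H >> + << H, H >>.
Proof. by move=> g h; rewrite /dist2 ip_lincomb2//; ring. Qed.

(** * Linear combinations of test functions *)

Definition comb (a : R) z1 (b : R) z2 : R * R -> R := fun p => a * z1 p + b * z2 p.

Lemma comb_test a z1 b z2 : test_function2 z1 -> test_function2 z2 -> test_function2 (comb a z1 b z2).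
Proof.
move=> t1 t2; have [s1 _] := t1; have [s2 _] := t2.
have [M1 M10 h1] := test2_supp t1; have [M2 M20 h2] := test2_supp t2.
apply: (@box_test2 _ _ (Num.max M1 M2)).
  apply: smooth2_exprP.
  exact: (S2add (S2mul (S2fst (@smooth_const _ a)) (S2base s1))
                (S2mul (S2fst (@smooth_const _ b)) (S2base s2))).
move=> p pM; rewrite /comb.
have -> : z1 p = 0.
  have [|//] := h1 p => -[a1 a2]; apply: pM; split; by rewrite le_max ?a1 ?a2.
have -> : z2 p = 0.
  have [|//] := h2 p => -[a1 a2]; apply: pM; split; by rewrite le_max ?a1 ?a2 orbT.
by rewrite !mulr0 addr0.
Qed.

Lemma grad_comb a z1 b z2 : test_function2 z1 -> test_function2 z2 ->
  grad (comb a z1 b z2) = lincomb a (grad z1) b (grad z2).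
Proof.
move=> [s1 _] [s2 _]; congr pair; apply/funext => -[x y] /=.
  apply: partial1_eq; apply/slice_derive1.
  by apply: derD; apply: derZ; exact: smooth2_slice1.
apply: partial2_eq; apply/slice_derive2.
by apply: derD; apply: derZ; exact: smooth2_slice2.
Qed.

(** * The closure of the gradients *)

Definition grad_approx (zn : nat -> R * R -> R) G :=
  (forall n, test_function2 (zn n)) /\ (fun n => dist2 G (grad (zn n))) @ \oo --> 0.

Lemma dist2_ereal G z : L2 G -> test_function2 z ->
  (\int[mu2]_(p in half_plane) ((G.1 p - partial1 z p) ^+ 2 + (G.2 p - partial2 z p) ^+ 2)%:E
   = (dist2 G (grad z))%:E)%E.
Proof.
move=> g tz; have gz := L2_grad tz; have h := L2_diff g gz.
rewrite /dist2 /ip EFin_Rint//; last exact: L2_dotp.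
by apply: eq_integral => p _; rewrite /dotp /fieldB /lincomb /grad /=; congr EFin; ring.
Qed.

Lemma hom_approx G : homogeneous_H1_gradient G <-> L2 G /\ exists zn, grad_approx zn G.
Proof.
split=> [[g1 g2 [zn [tz cz]]]|[[g1 g2] [zn [tz cz]]]].
  have g : L2 G by [].
  split=> //; exists zn; split=> //.
  apply: (@cvg_ext _ (fun n => fine ((dist2 G (grad (zn n)))%:E))) => //.
  apply: fine_cvg; apply: cvg_trans cz; apply: near_eq_cvg; apply: nearW => n.
  by rewrite dist2_ereal.
have g : L2 G by [].
split=> //; exists zn; split=> //.
rewrite (_ : (fun _ => _) = EFin \o (fun n => dist2 G (grad (zn n)))); last first.
  by apply/funext => n /=; rewrite dist2_ereal.
by apply: cvg_EFin; [exact: nearW|exact: cz].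
Qed.

Lemma sqr_cvg0 (u v : nat -> R) K : v @ \oo --> 0 ->
  (forall n, u n ^+ 2 <= K * v n) -> u @ \oo --> 0.
Proof.
move=> v0 uv; apply/cvgr0Pnorm_lt => e e0.
have : (fun n => K * v n) @ \oo --> K * 0 by apply: cvg_mul => //; exact: cvg_const.
rewrite mulr0 => /cvgr0Pnorm_lt /(_ (e ^+ 2)) /(_ (exprn_gt0 _ e0)).
apply: filterS => n h.
rewrite -(ltr_pXn2r (n := 2)) ?nnegrE// ?(ltW e0)// real_normK ?num_real//.
exact: le_lt_trans (uv n) (le_lt_trans (ler_norm _) h).
Qed.

(** Cauchy-Schwarz: pairings are continuous for the distance in which
    gradients approximate [G]. *)
Lemma approx_ip zn G X : L2 G -> L2 X -> grad_approx zn G ->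
  (fun n => << X, grad (zn n) >>) @ \oo --> << X, G >>.
Proof.
move=> g x [tz cz].
have h : (fun n => << X, G >> - << X, grad (zn n) >>) @ \oo --> 0.
  apply: (sqr_cvg0 (K := << X, X >>) cz) => n; have gz := L2_grad (tz n).
  by rewrite -ip_diffr//; apply: ip_CS => //; exact: L2_diff.
have := cvg_sub (@cvg_const R (<< X, G >>)) h; rewrite subr0; apply: cvg_ext => n; ring.
Qed.

Lemma closure_ip G X Y : homogeneous_H1_gradient G -> L2 X -> L2 Y ->
  (forall z, test_function2 z -> << X, grad z >> = << Y, grad z >>) ->
  << X, G >> = << Y, G >>.
Proof.
move=> /hom_approx [g [zn az]] x y h.
apply: (cvg_uniq (approx_ip g x az)).
by apply: cvg_ext (approx_ip g y az) => n; rewrite h//; case: az.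
Qed.

Lemma dist2_sum X Y : L2 X -> L2 Y ->
  << fieldB X Y, fieldB X Y >> <= 2 * << X, X >> + 2 * << Y, Y >>.
Proof.
move=> x y; have := ip_ge0 mu2 half_plane (lincomb 1 X 1 Y).
rewrite (ip_lincomb2 mH _ _ x y).
have -> : << fieldB X Y, fieldB X Y >> = << X, X >> - 2 * << X, Y >> + << Y, Y >> := dist2E x y.
move: << X, X >> << Y, Y >> << X, Y >> => a b c; lra.
Qed.

Lemma dist2_shift V X Y t : L2 V -> L2 X -> L2 Y ->
  dist2 V (lincomb 1 X (- t) Y) = dist2 V X + 2 * t * (<< Y, V >> - << Y, X >>) + t ^+ 2 * << Y, Y >>.
Proof.
move=> v x y; rewrite (dist2E v (L2_lincomb mH 1 (- t) x y)) (dist2E v x).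
rewrite (ip_lincombr mH _ _ x y v) (ip_lincomb2 mH _ _ x y) (ipC _ _ Y V) (ipC _ _ Y X).
by move: << V, V >> << V, X >> << V, Y >> << X, X >> << Y, Y >> << X, Y >> => *; ring.
Qed.

Lemma hom_diff G H : homogeneous_H1_gradient G -> homogeneous_H1_gradient H ->
  homogeneous_H1_gradient (fieldB G H).
Proof.
move=> /hom_approx [g [zn [tz cz]]] /hom_approx [h [zn' [tz' cz']]].
apply/hom_approx; split; first exact: (L2_diff g h).
exists (fun n => comb 1 (zn n) (-1) (zn' n)); split.
  by move=> n; exact: (comb_test 1 (-1) (tz n) (tz' n)).
have b := cvg_add (cvg_mul (@cvg_const R 2) cz) (cvg_mul (@cvg_const R 2) cz').
rewrite mulr0 addr0 in b.
apply: (squeeze_cvgr _ (@cvg_const R 0) b); apply: nearW => n; apply/andP; split; first exact: ip_ge0.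
have gz := L2_grad (tz n); have gz' := L2_grad (tz' n).
apply: (le_trans _ (dist2_sum (L2_diff g gz) (L2_diff h gz'))).
rewrite /dist2 (grad_comb 1 (-1) (tz n) (tz' n)).
have -> : fieldB (fieldB G H) (lincomb 1 (grad (zn n)) (-1) (grad (zn' n))) =
   fieldB (fieldB G (grad (zn n))) (fieldB H (grad (zn' n))).
  by congr pair; apply/funext => p; rewrite /fieldB /lincomb /=; ring.
exact: lexx.
Qed.

(** Projection of a square-integrable field onto the closed span of the
    gradients: a minimising sequence of the distance is Cauchy by the
    parallelogram identity. *)
Lemma gradient_projection V : L2 V -> exists G, homogeneous_H1_gradient G /\
  forall z, test_function2 z -> << G, grad z >> = << V, grad z >>.
Proof.
move=> v.
pose S := [set r | exists2 z, test_function2 z & r = dist2 V (grad z)].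
have z0T : test_function2 (fun _ : R * R => 0 : R).
  apply: (@box_test2 _ _ 0) => //; apply: smooth2_exprP; exact: (S2fst (@smooth_const _ 0)).
have hS : has_inf S.
  split; first by exists (dist2 V (grad (fun _ => 0))), (fun _ => 0).
  by exists 0 => r [z _ ->]; exact: ip_ge0.
have mS z : test_function2 z -> inf S <= dist2 V (grad z).
  by move=> tz; apply: ge_inf; [case: hS|exists z].
have /choice[zn znP] : forall n : nat, exists z, test_function2 z /\
    dist2 V (grad z) < inf S + n.+1%:R^-1.
  move=> n; have [r [z tz rE] rlt] := @inf_adherent R S n.+1%:R^-1 ltac:(by rewrite invr_gt0) hS.
  by exists z; split => //; rewrite -rE.
have tz n : test_function2 (zn n) by case: (znP n).
have gz n := L2_grad (tz n).
have cauchy n m : dist2 (grad (zn n)) (grad (zn m)) <= 2 * n.+1%:R^-1 + 2 * m.+1%:R^-1.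
  have := mS _ (comb_test 2^-1 2^-1 (tz n) (tz m)).
  rewrite dist2E//; last by apply: L2_grad; exact: comb_test.
  rewrite grad_comb// ip_lincombr// ip_lincomb2//.
  have [_ h1] := znP n; have [_ h2] := znP m; move: h1 h2; rewrite !dist2E//.
  move: << V, V >> << V, grad (zn n) >> << V, grad (zn m) >> << grad (zn n), grad (zn n) >>
    << grad (zn m), grad (zn m) >> << grad (zn n), grad (zn m) >> => a b c d f g.
  move: n.+1%:R^-1 m.+1%:R^-1 => u1 u2; lra.
have small e : 0 < e -> exists N, forall n m, (N <= n)%N -> (N <= m)%N ->
    dist2 (grad (zn n)) (grad (zn m)) <= e.
  move=> e0; have [N _ hN] := nat_gt_near (4 / e).
  exists N => n m Nn Nm; apply: (le_trans (cauchy n m)).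
  have bnd k : (N <= k)%N -> k.+1%:R^-1 <= e / 4.
    move=> Nk; rewrite invf_ple ?posrE ?divr_gt0// invf_div.
    apply: (le_trans (ltW (hN k Nk))); by rewrite ler_nat.
  have := bnd _ Nn; have := bnd _ Nm; move: n.+1%:R^-1 m.+1%:R^-1 => u1 u2; lra.
have comp_le (H : field (RM * RM)%type R) : L2 H ->
   \int[mu2]_(p in half_plane) (H.1 p ^+ 2) <= << H, H >> /\
   \int[mu2]_(p in half_plane) (H.2 p ^+ 2) <= << H, H >>.
  move=> h2; have [h21 h22] := h2.
  by split; apply: le_Rintegral => //; try exact: sqI_integ; try exact: L2_dotp;
    move=> p _; rewrite /dotp -!expr2 ?lerDl ?lerDr sqr_ge0.
have dE n m p : (fieldB (grad (zn n)) (grad (zn m))).1 p = partial1 (zn n) p - partial1 (zn m) p.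
  by rewrite /fieldB /lincomb /=; ring.
have dE2 n m p : (fieldB (grad (zn n)) (grad (zn m))).2 p = partial2 (zn n) p - partial2 (zn m) p.
  by rewrite /fieldB /lincomb /=; ring.
have small1 (e : R) : 0 < e -> exists N : nat, forall n m, (N <= n)%N -> (N <= m)%N ->
    \int[mu2]_(p in half_plane) ((partial1 (zn n) p - partial1 (zn m) p) ^+ 2) <= e.
  move=> e0; have [N hN] := small e e0; exists N => n m Nn Nm.
  apply: (le_trans _ (hN n m Nn Nm)).
  have [h1 h2] := comp_le _ (L2_diff (gz n) (gz m)); apply: (le_trans _ h1).
  by rewrite le_eqVlt; apply/orP; left; apply/eqP; apply: eq_Rintegral => p _; rewrite dE.
have [G1 [sG1 cG1]] := @L2_complete _ _ R mu2 half_plane mH (fun n => partial1 (zn n))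
  (fun n => (gz n).1) small1.
have small2 (e : R) : 0 < e -> exists N : nat, forall n m, (N <= n)%N -> (N <= m)%N ->
    \int[mu2]_(p in half_plane) ((partial2 (zn n) p - partial2 (zn m) p) ^+ 2) <= e.
  move=> e0; have [N hN] := small e e0; exists N => n m Nn Nm.
  apply: (le_trans _ (hN n m Nn Nm)).
  have [h1 h2] := comp_le _ (L2_diff (gz n) (gz m)); apply: (le_trans _ h2).
  by rewrite le_eqVlt; apply/orP; left; apply/eqP; apply: eq_Rintegral => p _; rewrite dE2.
have [G2 [sG2 cG2]] := @L2_complete _ _ R mu2 half_plane mH (fun n => partial2 (zn n))
  (fun n => (gz n).2) small2.
pose G : field (RM * RM)%type R := (G1, G2).
have g : L2 G by [].
have az : grad_approx zn G.
  split=> //; apply/cvgrPdist_le => e e0.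
  have e2 : 0 < e / 2 by rewrite divr_gt0.
  have [N1 h1] := cG1 _ e2; have [N2 h2] := cG2 _ e2.
  exists (maxn N1 N2) => // n /=; rewrite geq_max => /andP[n1 n2].
  rewrite sub0r normrN ger0_norm; last exact: ip_ge0.
  have -> : dist2 G (grad (zn n)) =
     \int[mu2]_(p in half_plane) ((partial1 (zn n) p - G1 p) ^+ 2) +
     \int[mu2]_(p in half_plane) ((partial2 (zn n) p - G2 p) ^+ 2).
    have i1 := sqI_integ (sqIB mH (gz n).1 sG1).
    have i2 := sqI_integ (sqIB mH (gz n).2 sG2).
    rewrite -(RintegralD mH i1 i2).
    by apply: eq_Rintegral => p _; rewrite /dotp /fieldB /lincomb /=; ring.
  by have := h1 n n1; have := h2 n n2; lra.
exists G; split; first by apply/hom_approx; split => //; exists zn.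
move=> z tZ; have gZ := L2_grad tZ.
rewrite (ipC _ _ G) (ipC _ _ V).
have lim : (fun n => << grad z, grad (zn n) >>) @ \oo --> << grad z, V >>.
  have h : (fun n => << grad z, V >> - << grad z, grad (zn n) >>) @ \oo --> 0.
    have inv0 : (fun n : nat => n.+1%:R^-1 : R) @ \oo --> 0 by exact: cvg_harmonic.
    apply: (sqr_cvg0 (K := << grad z, grad z >>) inv0) => n.
    rewrite mulrC; apply: discriminant => t.
    have := mS _ (comb_test 1 (- t) (tz n) tZ).
    rewrite (grad_comb 1 (- t) (tz n) tZ) (dist2_shift t v (gz n) gZ).
    have [_ h1] := znP n; move: h1.
    move: (dist2 V _) << grad z, V >> << grad z, grad (zn n) >> << grad z, grad z >> => a b c k.
    move: n.+1%:R^-1 => u; lra.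
  have := cvg_sub (@cvg_const R (<< grad z, V >>)) h; rewrite subr0; apply: cvg_ext => n; ring.
exact: (cvg_uniq (approx_ip g gZ az) lim).
Qed.

End StrayField.

(** * Boundary values and harmonic fields *)

Section Traces.
Context {R : realType}.
Local Notation mu := (@lebesgue_measure R).
Local Notation mu2 := (@lebesgue_measure R \x @lebesgue_measure R)%E.
Local Notation RM := (measurableTypeR R).
Local Notation meas g := (measurable_fun (setT : set RM) g).
Local Notation meas2 g := (measurable_fun (setT : set (RM * RM)) g).
Local Notation L2 G := (L2field mu2 half_plane G).
Local Notation "<< G , H >>" := (ip mu2 half_plane G H).
Local Notation sqI f := (sq_integrable mu (setT : set RM) f).
Implicit Types (z : R * R -> R) (p : R * R) (x y t K M l e k : R) (w : R -> R).
Implicit Types (G H V X Y : field (RM * RM)%type R).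

Let mH : measurable (half_plane : set (RM * RM)). Proof. exact: meas_half_plane. Qed.
Let mT1 : measurable (setT : set RM). Proof. exact: measurableT. Qed.
Let mT2 : measurable (setT : set (RM * RM)). Proof. exact: measurableT. Qed.
Let mPos : measurable (`]0, +oo[%classic : set RM). Proof. exact: measurable_itv. Qed.
Hint Resolve mH mT1 mT2 mPos : core.

Lemma exp_derive k x : is_derive x 1 (fun y => expR (- (k * y))) (- k * expR (- (k * x))).
Proof.
apply: is_derive_val (der_comp (derN (derZ k (der_id x))) (der_exp _)) _; ring.
Qed.

Lemma exp_cont k : continuous (fun y : R => expR (- (k * y))).
Proof. by apply: derive_cont; exact: exp_derive. Qed.

Lemma exp_half k : 0 < k ->
  mu.-integrable `]0, +oo[ (EFin \o (fun y => expR (- (k * y)))) /\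
  \int[mu]_(y in `]0, +oo[) expR (- (k * y)) = k^-1.
Proof.
move=> k0; have mE : meas (fun y : R => expR (- (k * y))) := continuous_measurable_fun (exp_cont (k := k)).
have E : (\int[mu]_(y in `]0%R, +oo[%classic) (expR (- (k * y)))%:E = (k^-1)%:E)%E.
  rewrite integral_itv_obnd_cbnd; last by apply/measurable_EFinP; apply: measurable_funS mE.
  have -> : k^-1 = 0 - (- (k^-1 * expR (- (k * 0)))).
    by rewrite mulr0 oppr0 expR0; ring.
  have dF x : is_derive x 1 (fun y => - (k^-1 * expR (- (k * y)))) (expR (- (k * x))).
    apply: is_derive_val (derN (derZ k^-1 (exp_derive k x))) _.
    by rewrite mulrA mulrN mulVf ?gt_eqF// mulN1r opprK.
  rewrite EFinB; apply: (ge0_continuous_FTC2y (F := fun y => - (k^-1 * expR (- (k * y))))).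
  - by move=> x _; exact: expR_ge0.
  - by apply: continuous_subspaceT; exact: exp_cont.
  - have -> : 0 = - (k^-1 * 0) :> R by ring.
    apply: cvgN; apply: cvgM; first exact: cvg_cst.
    have h : k * x @[x --> +oo] --> +oo by apply: (gt0_cvgMry (f := id) k0); exact: cvg_id.
    exact: (cvg_comp _ _ h (@cvgr_expR R)).
  - by move=> x _; case: (dF x).
  - by apply: cvg_at_right_filter; apply: der_cont (dF 0).
  - by move=> x _; rewrite derive1E; case: (dF x).
split; last by rewrite /Rintegral E.
apply: integ_ltyP => //; first exact: measurable_funS mE.
  by rewrite E ltry.
Qed.

Lemma cont_supp_sqI z M : continuous z -> (forall p, ~ in_box M p -> z p = 0) ->
  sq_integrable mu2 half_plane z.
Proof.
move=> cz z0; have mz := cont2_meas cz.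
have [K K0 zK] := cont_box_bounded M cz.
apply: (integ_sqI mH); first exact: measurable_funS mz.
apply: (integrableS mT2 mH) => //.
apply: (@box_integrable _ _ (K ^+ 2) M); first exact: measurable_funX.
  by move=> p pM; rewrite normrX lerXn2r ?nnegrE ?(ltW K0)// zK.
by move=> p /z0 ->; rewrite expr0n.
Qed.

Lemma test2_sqI z : test_function2 z -> sq_integrable mu2 half_plane z.
Proof.
move=> tz; have [M M0 hM] := test2_supp tz; have [sz _] := tz.
by apply: (@cont_supp_sqI _ M (smooth2_cont sz)) => p /hM [].
Qed.

(** The conjugate of the gradient of [w(x) e^{-ly}]: both components are
    rotated by a right angle. *)
Definition expfield l w w' : field (RM * RM)%type R :=
  (fun p => - l * w p.1 * expR (- (l * p.2)), fun p => - (w' p.1 * expR (- (l * p.2)))).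

Lemma sqI_exp k l w : 0 < l -> sqI w ->
  sq_integrable mu2 half_plane (fun p => k * w p.1 * expR (- (l * p.2))).
Proof.
move=> l0 sw; have [mw _] := sw.
have [i1 _] := prod_half (integZ mT1 (k ^+ 2) (sqI_integ sw)) (exp_half (k := 2 * l) ltac:(by rewrite mulr_gt0)).1.
apply: (integ_sqI mH).
  apply: (measurable_funS mT2) => //; apply: measurable_funM.
    by apply: measurable_funM => //; apply: (measurableT_comp mw).
  by apply: (measurableT_comp (continuous_measurable_fun (exp_cont (k := l)))).
apply: (eq_integ mH _ i1) => p _ /=; rewrite !exprMn -expRM_natl; congr (_ * expR _); ring.
Qed.

Lemma L2_expfield l w w' : 0 < l -> sqI w -> sqI w' -> L2 (expfield l w w').
Proof.
move=> l0 sw sw'; split; first exact: sqI_exp.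
have := sqI_exp (-1) l0 sw'; congr sq_integrable; apply/funext => p /=; ring.
Qed.

Lemma expfield_norm l w w' : 0 < l -> sqI w -> sqI w' ->
  << expfield l w w', expfield l w w' >> =
  (l ^+ 2 * (\int[mu]_x (w x ^+ 2)) + \int[mu]_x (w' x ^+ 2)) / (2 * l).
Proof.
move=> l0 sw sw'; have l20 : 0 < 2 * l by rewrite mulr_gt0.
have iw := integZ mT1 (l ^+ 2) (sqI_integ sw); have iw' := sqI_integ sw'.
have [e1 e2] := exp_half l20.
have [_ h] := prod_half (integD mT1 iw iw') e1.
rewrite e2 (RintegralD mT1 iw iw') (RintegralZl (l ^+ 2) mT1 (sqI_integ sw)) in h.
rewrite -h; apply: eq_Rintegral => p _; rewrite /dotp /expfield /=.
have -> : expR (- (2 * l * p.2)) = expR (- (l * p.2)) ^+ 2.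
  by rewrite -expRM_natl; congr expR; ring.
ring.
Qed.

(** The boundary functional of [w'] is represented by an explicit
    square-integrable field, for every rate [l]. *)
Lemma trace_pairing l w w' z : 0 < l -> prim w w' -> sqI w -> sqI w' -> test_function2 z ->
  \int[mu]_x (w' x * z (x, 0)) = << expfield l w w', grad z >>.
Proof.
move=> l0 pw sw sw' tz; have [lw' _] := pw.
have [sz _] := tz; have [M M0 hM] := test2_supp tz.
pose A p := - l * w p.1 * expR (- (l * p.2)).
pose B p := w' p.1 * expR (- (l * p.2)).
pose C p := - l * w' p.1 * expR (- (l * p.2)).
have sB : sq_integrable mu2 half_plane B.
  have := sqI_exp 1 l0 sw'; congr sq_integrable; apply/funext => p; rewrite /B /=; ring.
have := @boundary_pairing R A B C z tz.
have -> : \int[mu]_x (B (x, 0) * z (x, 0)) = \int[mu]_x (w' x * z (x, 0)).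
  by apply: eq_Rintegral => x _; rewrite /B /= mulr0 oppr0 expR0 mulr1.
move=> ->.
- apply: eq_Rintegral => p _; rewrite /dotp /expfield /grad /A /B /=; ring.
- move=> y _; apply: eq_prim (primZ (- l * expR (- (l * y))) pw) => x; rewrite /A /C /=; ring.
- move=> x; apply: eq_prim (primZ (w' x) (prim_C1 (exp_derive l) _)).
  + by move=> y.
  + by move=> y; rewrite /C /=; ring.
  + by move=> y; apply: cvgM; [exact: cvg_cst|exact: exp_cont].
- exact: (sqIM mH (sqI_exp (- l) l0 sw') (test2_sqI tz)).
- exact: (sqIM mH (sqI_exp (- l) l0 sw) (L2_grad tz).1).
- exact: (sqIM mH sB (L2_grad tz).2).
- apply: (@integ_supp _ _ M).
    apply: locM; last by apply: cont_slice1; exact: smooth2_cont.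
    by apply: eq_loc lw' => x; rewrite /B /= mulr0 oppr0 expR0 mulr1.
  by move=> x xM; have [|-> _ _] := hM (x, 0); [move=> [/=]; rewrite leNgt xM|rewrite mulr0].
Qed.

(** The gradient of the harmonic function on the half-plane with Neumann datum
    [- w'], in weak form. *)
Definition harmonic_gradient w' G := homogeneous_H1_gradient G /\
  forall z, test_function2 z -> << G, grad z >> = \int[mu]_x (w' x * z (x, 0)).

(** Project onto the gradients any field that represents the boundary
    functional. *)
Lemma harmonic_exists w w' : prim w w' -> sqI w -> sqI w' -> exists G, harmonic_gradient w' G.
Proof.
move=> pw sw sw'; have l0 : 0 < 1 :> R by [].
have [G [hG GV]] := gradient_projection (L2_expfield l0 sw sw').
exists G; split=> // z tz; rewrite (GV z tz); exact/esym/trace_pairing.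
Qed.

Lemma hom_L2 G : homogeneous_H1_gradient G -> L2 G.
Proof. by case. Qed.

(** The harmonic field is the projection of [expfield l w w'], so that its
    norm is at most the norm of the latter; the rate [l] is free to balance
    the two terms. *)
Lemma harmonic_norm_le l w w' G : 0 < l -> prim w w' -> sqI w -> sqI w' -> harmonic_gradient w' G ->
  << G, G >> <= (l ^+ 2 * (\int[mu]_x (w x ^+ 2)) + \int[mu]_x (w' x ^+ 2)) / (2 * l).
Proof.
move=> l0 pw sw sw' [hG eG]; have g := hom_L2 hG.
have v := L2_expfield l0 sw sw'.
have E : << G, G >> = << expfield l w w', G >>.
  by apply: (closure_ip hG g v) => z tz; rewrite eG// (trace_pairing l0 pw sw sw').
have := ip_ge0 mu2 half_plane (fieldB (expfield l w w') G).
rewrite -(expfield_norm l0 sw sw'); have := dist2E v g; rewrite /dist2 => ->.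
rewrite -E; lra.
Qed.

End Traces.

(** * Improper integrals *)

Section ImproperIntegrals.
Context {R : realType}.
Local Notation mu := (@lebesgue_measure R).
Local Notation mu2 := (@lebesgue_measure R \x @lebesgue_measure R)%E.
Local Notation RM := (measurableTypeR R).
Local Notation meas g := (measurable_fun (setT : set RM) g).
Local Notation integT g := (mu.-integrable (setT : set RM) (EFin \o g)).
Implicit Types (a f g F G k : R -> R) (x y s t u e M A B : R).

Let mT1 : measurable (setT : set RM). Proof. exact: measurableT. Qed.
Let mT2 : measurable (setT : set (RM * RM)). Proof. exact: measurableT. Qed.
Hint Resolve mT1 mT2 : core.

Lemma Rint_line F g A B : prim F g -> integT g ->
  (fun n : nat => F n%:R) @ \oo --> A -> (fun n : nat => F (- n%:R)) @ \oo --> B ->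
  \int[mu]_x g x = A - B.
Proof.
move=> [_ pF] gi cA cB; apply: (cvg_uniq (Rint_limn gi)).
apply: cvg_ext (cvg_sub cA cB) => n; rewrite -pF//.
by rewrite (@le_trans _ _ 0) ?oppr_le0.
Qed.

(** Monotone convergence along the intervals [[- n, n]]. *)
Lemma improper_line F g A B : prim F g -> (forall x, 0 <= g x) ->
  (fun n : nat => F n%:R) @ \oo --> A -> (fun n : nat => F (- n%:R)) @ \oo --> B ->
  integT g /\ \int[mu]_x g x = A - B.
Proof.
move=> pF g0 cA cB; have [lg hF] := pF; have mg := loc_meas lg.
suff gi : integT g by split=> //; exact: Rint_line pF gi cA cB.
apply: integ_ltyP => //.
pose h (n : nat) x := (g x * \1_(`[(- n%:R), n%:R]) x)%:E.
have hE n : (\int[mu]_x h n x = (F n%:R - F (- n%:R))%:E)%E.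
  rewrite hF; last by rewrite (@le_trans _ _ 0) ?oppr_le0.
  rewrite (EFin_Rint (mitv _ _) (lg _ _)) integral_mkcond; apply: eq_integral => x _.
  by rewrite /h patchE indicE; case: ifP => _; rewrite ?mulr1 ?mulr0.
have lim_h x : limn (h ^~ x) = (g x)%:E.
  apply/cvg_lim => //; apply: cvg_near_cst; near=> n.
  rewrite /h indicE mem_set ?mulr1//= in_itv /= -ler_norml.
  near: n; exact: nbhs_infty_ger.
have mono x : setT x -> {homo h ^~ x : n m / (n <= m)%N >-> (n <= m)%E}.
  move=> _ n m nm; rewrite lee_fin ler_wpM2l// !indicE ler_nat.
  case: (boolP (x \in `[(- n%:R), n%:R]%classic)) => // xn.
  rewrite mem_set// /=; move: xn; rewrite inE /= !in_itv /= -!ler_norml => /le_trans; apply.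
  by rewrite ler_nat.
have := @cvg_monotone_convergence _ RM R mu setT mT1 h.
under eq_integral => x _ do rewrite lim_h.
have -> : (fun n => (\int[mu]_x h n x)%E) = EFin \o (fun n => F n%:R - F (- n%:R)).
  by apply/funext => n; rewrite hE.
move=> hc; have : (EFin \o (fun n : nat => F n%:R - F (- n%:R))) @ \oo --> (A - B)%:E.
  by apply: cvg_EFin; [exact: nearW|exact: (cvg_sub cA cB)].
move=> hc2; rewrite -(cvg_lim _ (hc _ _ mono))//.
- by rewrite (cvg_lim _ hc2)// ltry.
- move=> n; apply/measurable_EFinP; apply: measurable_funM => //; exact: measurable_indic.
- by move=> n x _; rewrite lee_fin mulr_ge0.
Unshelve. all: by end_near. Qed.

(** * Convolution with a bounded kernel *)

Definition convol k a x := \int[mu]_s (a s * k (x - s)).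

Lemma cont_comp_sub k x : continuous k -> continuous (fun s => k (x - s)).
Proof.
move=> ck s; apply: (continuous_comp (f := fun s => x - s)); last exact: ck.
by apply: cvgB; [exact: cvg_cst|exact: cvg_id].
Qed.

Lemma cont_comp_subl k s : continuous k -> continuous (fun x => k (x - s)).
Proof.
move=> ck x; apply: (continuous_comp (f := fun x => x - s)); last exact: ck.
by apply: cvgB; [exact: cvg_id|exact: cvg_cst].
Qed.

Lemma conv_integ k a x M : continuous k -> (forall u, `|k u| <= M) -> integT a ->
  integT (fun s => a s * k (x - s)).
Proof.
move=> ck kM ai; apply: (@integM_bounded _ _ _ _ _ mT1 M) => //.
exact: (continuous_measurable_fun (cont_comp_sub (x := x) ck)).
Qed.

Lemma conv_bound k a x M : continuous k -> (forall u, `|k u| <= M) -> integT a ->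
  `|convol k a x| <= M * \int[mu]_s `|a s|.
Proof.
move=> ck kM ai; rewrite -RintegralZl//; last exact: integ_norm.
apply: (Rint_norm_le mT1 (conv_integ x ck kM ai) (integZ mT1 M (integ_norm ai))) => s _.
by rewrite normrM mulrC ler_wpM2r.
Qed.

Lemma cont_seq F : (forall x (u : nat -> R), u @ \oo --> x -> (F \o u) @ \oo --> F x) -> continuous F.
Proof.
move=> h x; apply/cvgrPdist_le => e e0; apply: contrapT => nF.
have /choice[u uP] : forall n : nat, exists y, `|x - y| <= n.+1%:R^-1 /\ ~ (`|F x - F y| <= e).
  move=> n; apply: contrapT => nu; apply: nF.
  have n0 : 0 < n.+1%:R^-1 :> R by rewrite invr_gt0.
  have hx : \forall t \near nbhs x, `|x - t| <= n.+1%:R^-1.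
    by apply: (@cvgr_dist_le _ _ _ (nbhs x) _ id x).
  by apply: filterS hx => y xy; apply: contrapT => nf; apply: nu; exists y.
have ux : u @ \oo --> x.
  have inv0 : (fun n : nat => n.+1%:R^-1 : R) @ \oo --> 0 by exact: cvg_harmonic.
  apply/cvgrPdist_le => d d0; have /cvgr0Pnorm_le/(_ d d0) := inv0.
  apply: filterS => n hn; apply: (le_trans (uP n).1); exact: le_trans (ler_norm _) hn.
have /cvgrPdist_le/(_ e e0) [N _ hN] := h x u ux.
by case: (uP N) => _; apply; exact: hN N (leqnn N).
Qed.

Lemma seq_cont F x (u : nat -> R) : continuous F -> u @ \oo --> x -> (fun n => F (u n)) @ \oo --> F x.
Proof. by move=> cF ux; exact: (cvg_comp _ _ ux (cF x)). Qed.

Lemma conv_cont k a M : continuous k -> (forall u, `|k u| <= M) -> integT a -> continuous (convol k a).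
Proof.
move=> ck kM ai; apply: cont_seq => x u ux.
have [] := @Rint_dominated _ _ R mu setT mT1 (fun n s => a s * k (u n - s)) (fun s => a s * k (x - s))
   (fun s => M * `|a s|).
- by move=> n; exact: (integ_meas (conv_integ (u n) ck kM ai)).
- exact: (integZ mT1 M (integ_norm ai)).
- by move=> n s _; rewrite normrM mulrC ler_wpM2r.
- move=> s _; apply: cvg_mul; first exact: cvg_const.
  exact: (seq_cont (cont_comp_subl (s := s) ck) ux).
by [].
Qed.

(** Fubini's theorem on [[b, c] x R]. *)
Lemma conv_prim k k' a M : (forall u, is_derive u 1 k (k' u)) -> continuous k' ->
  (forall u, `|k u| <= M) -> (forall u, `|k' u| <= M) -> integT a ->
  prim (convol k a) (convol k' a).
Proof.
move=> dk ck' kM k'M ai; have ck := derive_cont dk.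
split; first by apply: loc_cont; exact: (conv_cont ck' k'M ai).
move=> b c bc.
rewrite -(RintegralB mT1 (conv_integ c ck kM ai) (conv_integ b ck kM ai)).
pose f (p : R * R) := (a p.1 * \1_(`[b, c]) p.2) * k' (p.2 - p.1).
have i1 : integT (\1_(`[b, c]%classic) : R -> R).
  have := @integrable_indic_itv R b c true false. done.
have fi : mu2.-integrable setT (EFin \o f).
  apply: (@integM_bounded _ _ _ _ _ mT2 M); first exact: (prod_integrable ai i1); last by [].
  apply: cont2_meas => p; apply: (continuous_comp (f := fun p : R * R => p.2 - p.1)); last exact: ck'.
  by apply: cvgB; [exact: cvg_snd|exact: cvg_fst].
have := Fubini12 fi; rewrite (Fubini21 fi) => E.
have -> : \int[mu]_(x in `[b, c]) convol k' a x = \int[mu]_y \int[mu]_x f (x, y).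
  rewrite Rintegral_mkcond; apply: eq_Rintegral => y _; rewrite patchE /convol.
  case: ifPn => yb.
    by apply: eq_Rintegral => x _; rewrite /f indicE yb /= mulr1.
  by apply/esym/Rint_zero => x _; rewrite /f indicE (negbTE yb) mulr0 mul0r.
rewrite E; apply: eq_Rintegral => s _.
rewrite -mulrBr.
have pk : prim (fun x => k (x - s)) (fun x => k' (x - s)).
  apply: prim_C1; last exact: cont_comp_subl.
  move=> x; apply: is_derive_val (der_comp (derB (der_id x) (der_cst s x)) (dk _)) _; ring.
have [l1 h1] := pk; rewrite h1// -RintegralZl//.
rewrite Rintegral_mkcond; apply: eq_Rintegral => y _; rewrite patchE /f indicE /=.
by case: ifP => _; rewrite ?mulr1 ?mulr0 ?mul0r.
Qed.

Definition vanishes k := (forall x, (fun n : nat => k (x - n%:R)) @ \oo --> 0) /\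
  (forall x, (fun n : nat => k (x + n%:R)) @ \oo --> 0).

Lemma bounded_cvg0 (u v : nat -> R) M : (forall n, `|u n| <= M) -> v @ \oo --> 0 ->
  (fun n => u n * v n) @ \oo --> 0.
Proof.
move=> uM v0; apply/cvgr0Pnorm_le => e e0.
have M1 : 0 < M + 1 by have := uM 0%N; have := normr_ge0 (u 0%N); lra.
move/cvgr0Pnorm_le: v0 => /(_ _ (divr_gt0 e0 M1)).
apply: filterS => n h; rewrite normrM -[e](@divfK _ (M + 1)) ?gt_eqF// mulrC.
by apply: ler_pM => //; have := uM n; lra.
Qed.

Lemma prim_bounded F f : prim F f -> integT f -> exists M, forall x, `|F x| <= M.
Proof.
move=> [lf hF] fi; exists (`|F 0| + \int[mu]_x `|f x|) => x.
have sub c d : `|\int[mu]_(y in `[c, d]) f y| <= \int[mu]_x `|f x|.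
  apply: (le_trans (le_normr_Rintegral (mitv c d) (lf c d))).
  rewrite Rintegral_mkcond; apply: le_Rintegral => //; last 1 first.
  - by move=> y _; rewrite patchE; case: ifP => _ /=; [exact: lexx|exact: normr_ge0].
  - have := (@integrable_mkcond _ RM R mu _ (EFin \o (fun x => `|f x|)) (mitv c d)).1 (integ_norm (lf c d)).
    by rewrite restrict_EFin.
  - exact: integ_norm.
have [x0|x0] := leP 0 x.
  have -> : F x = F 0 + (F x - F 0) by ring.
  by apply: (le_trans (ler_normD _ _)); rewrite lerD2l hF.
have -> : F x = F 0 - (F 0 - F x) by ring.
by apply: (le_trans (ler_normB _ _)); rewrite lerD2l hF// ltW.
Qed.

(** Integration by parts over the line; the boundary terms vanish with the
    kernel. *)
Lemma conv_ibp k k' a a' M : (forall u, is_derive u 1 k (k' u)) -> continuous k' ->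
  (forall u, `|k u| <= M) -> (forall u, `|k' u| <= M) -> vanishes k ->
  prim a a' -> integT a -> integT a' -> forall x, convol k' a x = convol k a' x.
Proof.
move=> dk ck' kM k'M [v1 v2] pa ia ia' x; have ck := derive_cont dk.
have pk : prim (fun s => k (x - s)) (fun s => - k' (x - s)).
  apply: prim_C1; last by move=> s; apply: cvgN; exact: cont_comp_sub.
  move=> s; apply: is_derive_val (der_comp (derB (der_cst x s) (der_id s)) (dk _)) _; ring.
have [Ma aM] := prim_bounded pa ia'.
have i1 := conv_integ x ck' k'M ia.
have i2 : integT (fun s => a s * - k' (x - s)).
  by apply: (eq_integ mT1 _ (integN i1)) => s _; rewrite mulrN.
have E := @prim_ibpT _ _ _ _ _ pa pk (conv_integ x ck kM ia') i2 _ _.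
rewrite /convol E.
- rewrite -RintN//; apply: eq_Rintegral => s _; ring.
- by apply: (bounded_cvg0 (M := Ma)).
- by apply: (bounded_cvg0 (M := Ma)) => //; apply: cvg_ext (v2 x) => n; rewrite opprK.
Qed.

End ImproperIntegrals.

(** * The Poisson kernel and its conjugate *)

Section PoissonKernels.
Context {R : realType}.
Local Notation mu := (@lebesgue_measure R).
Local Notation mu2 := (@lebesgue_measure R \x @lebesgue_measure R)%E.
Local Notation RM := (measurableTypeR R).
Local Notation meas g := (measurable_fun (setT : set RM) g).
Local Notation integT g := (mu.-integrable (setT : set RM) (EFin \o g)).
Local Notation sqI f := (sq_integrable mu (setT : set RM) f).
Implicit Types (a f g F G k : R -> R) (x y s t u e M A B r : R).

Let mT1 : measurable (setT : set RM). Proof. exact: measurableT. Qed.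
Let mT2 : measurable (setT : set (RM * RM)). Proof. exact: measurableT. Qed.
Hint Resolve mT1 mT2 : core.

(** The Poisson kernel, its harmonic conjugate, and their derivatives. *)
Definition poi e u := e / (pi * (u ^+ 2 + e ^+ 2)).
Definition poi' e u := - (2 * e * u) / (pi * (u ^+ 2 + e ^+ 2) ^+ 2).
Definition cjg e u := u / (pi * (u ^+ 2 + e ^+ 2)).
Definition cjg' e u := (e ^+ 2 - u ^+ 2) / (pi * (u ^+ 2 + e ^+ 2) ^+ 2).

Lemma pi0 : pi != 0 :> R. Proof. by rewrite gt_eqF// pi_gt0. Qed.

Lemma den_gt0 e u : 0 < e -> 0 < u ^+ 2 + e ^+ 2.
Proof. by move=> e0; rewrite ltr_wpDl ?sqr_ge0 ?exprn_gt0. Qed.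

Lemma den_neq0 e u : 0 < e -> u ^+ 2 + e ^+ 2 != 0.
Proof. by move=> e0; rewrite gt_eqF ?den_gt0. Qed.

Local Ltac field_pi := let q := fresh "q" in let q0 := fresh "q0" in
  have := pi0; move: (@pi R) => q q0; field; rewrite ?q0 ?den_neq0 ?gt_eqF.

Lemma poiN e u : poi e (- u) = poi e u.
Proof. by rewrite /poi sqrrN. Qed.

Lemma poi_ge0 e u : 0 < e -> 0 <= poi e u.
Proof. by move=> e0; rewrite /poi divr_ge0 ?mulr_ge0 ?pi_ge0 ?(ltW e0) ?(ltW (den_gt0 u e0)). Qed.

Lemma der_den e u : 0 < e ->
  is_derive u 1 (fun u => (pi * (u ^+ 2 + e ^+ 2))^-1) (- (2 * u) / (pi * (u ^+ 2 + e ^+ 2) ^+ 2)).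
Proof.
move=> e0; have d0 : pi * (u ^+ 2 + e ^+ 2) != 0 by rewrite mulf_neq0 ?pi0 ?den_neq0.
have := @derV _ (fun u => pi * (u ^+ 2 + e ^+ 2)) u _ d0 (derZ pi (derD (derX 1 (der_id u)) (der_cst (e ^+ 2) u))).
by move=> /is_derive_val; apply; move: d0 => _; field_pi.
Qed.

Lemma poi_derive e u : 0 < e -> is_derive u 1 (poi e) (poi' e u).
Proof.
move=> e0; apply: is_derive_val (derZ e (der_den u e0)) _.
by rewrite /poi'; field_pi.
Qed.

Lemma cjg_derive e u : 0 < e -> is_derive u 1 (cjg e) (cjg' e u).
Proof.
move=> e0; apply: is_derive_val (derM (der_id u) (der_den u e0)) _.
by rewrite /cjg'; field_pi.
Qed.

Lemma der_den2 e u : 0 < e ->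
  is_derive u 1 (fun u => (pi * (u ^+ 2 + e ^+ 2) ^+ 2)^-1) (- (4 * u) / (pi * (u ^+ 2 + e ^+ 2) ^+ 3)).
Proof.
move=> e0; have d0 : pi * (u ^+ 2 + e ^+ 2) ^+ 2 != 0 by rewrite mulf_neq0 ?pi0// expf_neq0 ?den_neq0.
have := @derV _ (fun u => pi * (u ^+ 2 + e ^+ 2) ^+ 2) u _ d0 (derZ pi (derX 1 (derD (derX 1 (der_id u)) (der_cst (e ^+ 2) u)))).
by move=> /is_derive_val; apply; move: d0 => _; field_pi.
Qed.

Lemma poi'_cont e : 0 < e -> continuous (poi' e).
Proof.
move=> e0; have h u := derM (derZ (- (2 * e)) (der_id u)) (der_den2 u e0).
have E : poi' e = fun u => - (2 * e) * u * (pi * (u ^+ 2 + e ^+ 2) ^+ 2)^-1.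
  by apply/funext => v; rewrite /poi' !mulNr.
rewrite E; exact: (derive_cont h).
Qed.

Lemma cjg'_cont e : 0 < e -> continuous (cjg' e).
Proof.
move=> e0; have h u := derM (derB (der_cst (e ^+ 2) u) (derX 1 (der_id u))) (der_den2 u e0).
exact: (derive_cont h).
Qed.

Lemma poi_cont e : 0 < e -> continuous (poi e).
Proof. by move=> e0; apply: derive_cont => u; exact: poi_derive. Qed.
Lemma cjg_cont e : 0 < e -> continuous (cjg e).
Proof. by move=> e0; apply: derive_cont => u; exact: cjg_derive. Qed.

(** All four kernels are controlled by powers of [1 / (u^2 + e^2)]. *)
Definition rec e u := (u ^+ 2 + e ^+ 2)^-1.

Lemma rec_ge0 e u : 0 < e -> 0 <= rec e u.
Proof. by move=> e0; rewrite invr_ge0 ltW ?den_gt0. Qed.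

Lemma rec_poi e u : 0 < e -> rec e u = pi / e * poi e u.
Proof. by move=> e0; rewrite /rec /poi; field_pi. Qed.

Lemma rec_le e u : 0 < e -> rec e u <= e ^- 2.
Proof.
by move=> e0; rewrite /rec lef_pV2 ?posrE ?den_gt0 ?exprn_gt0// lerDr sqr_ge0.
Qed.

Lemma sqr_rec e u : 0 < e -> u ^+ 2 * rec e u <= 1.
Proof. by move=> e0; rewrite /rec ler_pdivrMr ?den_gt0// mul1r lerDl sqr_ge0. Qed.

Lemma sqe_rec e u : 0 < e -> e ^+ 2 * rec e u <= 1.
Proof. by move=> e0; rewrite /rec ler_pdivrMr ?den_gt0// mul1r lerDr sqr_ge0. Qed.

Lemma mix_rec e u : 0 < e -> e * `|u| * rec e u <= 2^-1.
Proof.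
move=> e0; rewrite /rec ler_pdivrMr ?den_gt0// -(real_normK (num_real u)).
have := sqr_ge0 (`|u| - e); move: `|u| => v; nra.
Qed.

Lemma pi_ge1 : 1 <= pi :> R.
Proof. by apply: le_trans (pi_ge2 _); rewrite ler1n. Qed.

Lemma cjg_bound e u : 0 < e -> `|cjg e u| <= e^-1.
Proof.
move=> e0; have -> : cjg e u = pi^-1 * (u * rec e u).
  by rewrite /cjg /rec; field_pi.
rewrite normrM ger0_norm ?invr_ge0 ?pi_ge0// normrM (ger0_norm (rec_ge0 u e0)).
rewrite -[e^-1]mul1r; apply: ler_pM; rewrite ?invr_ge0 ?pi_ge0 ?mulr_ge0 ?rec_ge0//.
  by rewrite invf_le1 ?pi_gt0 ?pi_ge1.
by rewrite -(ler_pM2l e0) divff ?gt_eqF// mulrA; have := mix_rec u e0; lra.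
Qed.

Lemma poi_bound e u : 0 < e -> `|poi e u| <= e^-1.
Proof.
move=> e0; rewrite ger0_norm ?poi_ge0//.
have -> : poi e u = pi^-1 * (e * rec e u).
  by rewrite /poi /rec; field_pi.
rewrite -[e^-1]mul1r; apply: ler_pM; rewrite ?invr_ge0 ?pi_ge0 ?mulr_ge0 ?rec_ge0 ?(ltW e0)//.
  by rewrite invf_le1 ?pi_gt0 ?pi_ge1.
by rewrite -(ler_pM2l e0) divff ?gt_eqF// mulrA; have := sqe_rec u e0; lra.
Qed.

Lemma cjg'_rec e u : 0 < e -> `|cjg' e u| <= rec e u.
Proof.
move=> e0; have -> : cjg' e u = pi^-1 * ((e ^+ 2 * rec e u - u ^+ 2 * rec e u) * rec e u).
  by rewrite /cjg' /rec; field_pi.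
rewrite normrM (ger0_norm (_ : 0 <= pi^-1)) ?invr_ge0 ?pi_ge0// normrM (ger0_norm (rec_ge0 u e0)).
rewrite -[leRHS]mul1r; apply: ler_pM; rewrite ?invr_ge0 ?pi_ge0 ?mulr_ge0 ?rec_ge0//.
  by rewrite invf_le1 ?pi_gt0 ?pi_ge1.
rewrite ler_piMl ?rec_ge0// ler_norml.
have := sqe_rec u e0; have := sqr_rec u e0.
have := mulr_ge0 (sqr_ge0 e) (rec_ge0 u e0); have := mulr_ge0 (sqr_ge0 u) (rec_ge0 u e0).
move: (_ * rec e u) (_ * rec e u) => v w; lra.
Qed.

Lemma poi'_rec e u : 0 < e -> `|poi' e u| <= rec e u.
Proof.
move=> e0; have -> : poi' e u = pi^-1 * (- (2 * (e * u * rec e u)) * rec e u).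
  by rewrite /poi' /rec; field_pi.
rewrite normrM (ger0_norm (_ : 0 <= pi^-1)) ?invr_ge0 ?pi_ge0// normrM (ger0_norm (rec_ge0 u e0)).
rewrite -[leRHS]mul1r; apply: ler_pM; rewrite ?invr_ge0 ?pi_ge0 ?mulr_ge0 ?rec_ge0//.
  by rewrite invf_le1 ?pi_gt0 ?pi_ge1.
rewrite ler_piMl ?rec_ge0// normrN !normrM (ger0_norm (ltW e0)) (ger0_norm (rec_ge0 u e0)) ger0_norm//.
by have := mix_rec u e0; lra.
Qed.

Lemma cjg'_bound e u : 0 < e -> `|cjg' e u| <= e ^- 2.
Proof. by move=> e0; apply: le_trans (cjg'_rec u e0) (rec_le u e0). Qed.
Lemma poi'_bound e u : 0 < e -> `|poi' e u| <= e ^- 2.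
Proof. by move=> e0; apply: le_trans (poi'_rec u e0) (rec_le u e0). Qed.

(** * Decay at infinity *)

Lemma nat_inv0 (c : R) : (fun n : nat => c / n.+1%:R) @ \oo --> 0.
Proof.
have inv0 : (fun n : nat => n.+1%:R^-1 : R) @ \oo --> 0 by exact: cvg_harmonic.
by have := cvg_mul (@cvg_const R c) inv0; rewrite mulr0.
Qed.

Lemma decay_seq k A x (u : nat -> R) : (forall u, `|k u| * (1 + `|u|) <= A) ->
  (forall n, n%:R - `|x| <= `|u n|) -> (fun n => k (u n)) @ \oo --> 0.
Proof.
move=> kA hu.
have v0 := nat_inv0 (A * (1 + `|x|)).
apply/cvgr0Pnorm_le => e e0; move/cvgr0Pnorm_le: v0 => /(_ e e0); apply: filterS => n.
apply: le_trans; apply: le_trans (ler_norm _).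
rewrite ler_pdivlMr//.
have A0 : 0 <= A by apply: le_trans (kA 0); rewrite mulr_ge0// addr_ge0.
have h := kA (u n).
have h1 : n.+1%:R <= (1 + `|x|) * (1 + `|u n|).
  have := hu n; have := normr_ge0 x; have := normr_ge0 (u n).
  rewrite -(natr1 n); move: `|x| `|u n| (n%:R : R) => a b c; nra.
apply: (@le_trans _ _ (`|k (u n)| * ((1 + `|x|) * (1 + `|u n|)))); first by rewrite ler_wpM2l.
have := normr_ge0 x; move: h; move: `|x| `|u n| `|k (u n)| => a b c; nra.
Qed.

Lemma decay_vanishes k A : (forall u, `|k u| * (1 + `|u|) <= A) -> vanishes k.
Proof.
move=> kA; split=> x; apply: (decay_seq (x := x) kA) => n.
- by rewrite distrC; have := lerB_dist (n%:R : R) x; rewrite (ger0_norm (ler0n _ n)).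
- by have := lerB_dist (n%:R : R) (- x); rewrite opprK normrN (ger0_norm (ler0n _ n)) [x + _]addrC.
Qed.

Lemma rec_decay e u : 0 < e -> rec e u * (1 + `|u|) <= 2 + e ^- 2 * 2.
Proof.
move=> e0; have h1 := sqr_rec u e0; have h2 := rec_le u e0; have h0 := rec_ge0 u e0.
rewrite -(real_normK (num_real u)) in h1.
have := normr_ge0 u; move: `|u| (rec e u) (e ^- 2) h1 h2 h0 => v w z; nra.
Qed.

Lemma cjg_decay e u : 0 < e -> `|cjg e u| * (1 + `|u|) <= e^-1 + 1.
Proof.
move=> e0; rewrite mulrDr mulr1 lerD ?cjg_bound//.
have -> : cjg e u = pi^-1 * (u * rec e u).
  by rewrite /cjg /rec; field_pi.
rewrite normrM ger0_norm ?invr_ge0 ?pi_ge0// normrM (ger0_norm (rec_ge0 u e0)).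
have := sqr_rec u e0; rewrite -(real_normK (num_real u)) => h.
rewrite -mulrA -[leRHS]mul1r; apply: ler_pM; rewrite ?invr_ge0 ?pi_ge0 ?mulr_ge0 ?rec_ge0//.
  by rewrite invf_le1 ?pi_gt0 ?pi_ge1.
by apply: le_trans h; rewrite expr2 mulrAC.
Qed.

Lemma cjg_vanishes e : 0 < e -> vanishes (cjg e).
Proof. by move=> e0; apply: (@decay_vanishes _ (e^-1 + 1)) => u; exact: cjg_decay. Qed.

Lemma rec_vanishes e : 0 < e -> vanishes (rec e).
Proof.
move=> e0; apply: (@decay_vanishes _ (2 + e ^- 2 * 2)) => u.
by rewrite ger0_norm ?rec_ge0 ?rec_decay.
Qed.

Lemma le_vanishes k l : (forall u, `|k u| <= l u) -> vanishes l -> vanishes k.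
Proof.
have key (u : nat -> R) : (forall v, `|k v| <= l v) -> (fun n => l (u n)) @ \oo --> 0 ->
    (fun n => k (u n)) @ \oo --> 0.
  move=> kl l0; apply/cvgr0Pnorm_le => e e0; move/cvgr0Pnorm_le: l0 => /(_ e e0).
  by apply: filterS => n; apply: le_trans; apply: (le_trans (kl _)); exact: ler_norm.
by move=> kl [h1 h2]; split => x; apply: key.
Qed.

(** * The Poisson kernel is a probability density *)

Lemma atan_cvg (x e : R) : 0 < e ->
  (fun n : nat => atan ((n%:R - x) / e)) @ \oo --> (pi / 2 : R) /\
  (fun n : nat => atan ((- n%:R - x) / e)) @ \oo --> (- (pi / 2) : R).
Proof.
move=> e0.
have h y : (fun n : nat => (n%:R + y) / e) @ \oo --> +oo.
  apply/cvgryPge => M; near=> n.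
  rewrite ler_pdivlMr// -lerBlDr; near: n; exact: nbhs_infty_ger.
split; first exact: (cvg_comp _ _ (h (- x)) (@cvgy_atan R)).
have := cvg_opp (cvg_comp _ _ (h x) (@cvgy_atan R)); apply: cvg_ext => n /=.
by rewrite -atanN; congr atan; ring.
Unshelve. all: by end_near. Qed.

Lemma poi_total e x : 0 < e -> integT (fun s => poi e (x - s)) /\ \int[mu]_s poi e (x - s) = 1.
Proof.
move=> e0.
pose F s := pi^-1 * atan ((s - x) / e).
have pF : prim F (fun s => poi e (x - s)).
  apply: prim_C1; last by apply: cont_comp_sub; exact: poi_cont.
  move=> s; have d1 : is_derive s 1 (fun s => (s - x) / e) e^-1.
    apply: is_derive_ext (is_derive_val (derZ e^-1 (derB (der_id s) (der_cst x s))) _).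
      by move=> y; rewrite mulrC.
    by rewrite subr0 mulr1.
  apply: is_derive_val (derZ pi^-1 (der_comp d1 (is_derive1_atan _))) _.
  have h := den_neq0 (s - x) e0.
  rewrite -(poiN e (x - s)) opprB /poi; move: (s - x) h => u h.
  have h' : e * e + u * u != 0 by move: h; congr (~~ (_ == _)); ring.
  field_pi => //=.
have [c1 c2] := atan_cvg x e0.
have [i1 ->] := improper_line pF (fun s => poi_ge0 (x - s) e0)
  (cvg_mul (@cvg_const R pi^-1) c1) (cvg_mul (@cvg_const R pi^-1) c2).
by split=> //; field_pi.
Qed.

Lemma poi_total' e s : 0 < e -> integT (fun x => poi e (x - s)) /\ \int[mu]_x poi e (x - s) = 1.
Proof.
move=> e0; have [h1 h2] := poi_total s e0.
have E x : poi e (x - s) = poi e (s - x) by rewrite -poiN opprB.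
by split; [apply: (eq_integ mT1 _ h1) => x _; rewrite E|under eq_Rintegral do rewrite E].
Qed.

Lemma rec_integ e x : 0 < e -> integT (fun s => rec e (x - s)) /\ \int[mu]_s rec e (x - s) = pi / e.
Proof.
move=> e0; have [i1 h1] := poi_total x e0; split.
  by apply: (eq_integ mT1 _ (integZ mT1 (pi / e) i1)) => s _; rewrite rec_poi.
under eq_Rintegral do rewrite (rec_poi _ e0).
by rewrite RintegralZl// h1 mulr1.
Qed.

End PoissonKernels.

Section HilbertTransform.
Context {R : realType}.
Local Notation mu := (@lebesgue_measure R).
Local Notation RM := (measurableTypeR R).
Local Notation meas g := (measurable_fun (setT : set RM) g).
Local Notation integT g := (mu.-integrable (setT : set RM) (EFin \o g)).
Local Notation sqI f := (sq_integrable mu (setT : set RM) f).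
Implicit Types (a f g F G k : R -> R) (x y s t u e b c M A B C r : R).

Let mT1 : measurable (setT : set RM). Proof. exact: measurableT. Qed.
Hint Resolve mT1 : core.

(** * Increments of the conjugate kernel between the scales [r^2] and [r^2 / 4] *)

Definition step_cjg r u := cjg (r ^+ 2 / 4) u - cjg (r ^+ 2) u.
Definition step_cjg' r u := cjg' (r ^+ 2 / 4) u - cjg' (r ^+ 2) u.

Lemma rec_le_rec b e u : 0 < b -> b <= e -> rec e u <= rec b u.
Proof.
move=> b0 be; have e0 := lt_le_trans b0 be.
by rewrite /rec lef_pV2 ?posrE ?den_gt0// lerD2l lerXn2r ?nnegrE ?(ltW b0) ?(ltW e0).
Qed.

Lemma cjg_rec e u : 0 < e -> cjg e u = pi^-1 * (u * rec e u).
Proof.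
move=> e0; rewrite /cjg /rec; have := @pi0 R; move: (@pi R) => q q0; field.
by rewrite q0 den_neq0.
Qed.

Lemma cjg'_rec2 e u : 0 < e -> cjg' e u = pi^-1 * (2 * (e ^+ 2 * rec e u) * rec e u - rec e u).
Proof.
move=> e0; rewrite /cjg' /rec; have := @pi0 R; move: (@pi R) => q q0; field.
by rewrite q0 den_neq0.
Qed.

Lemma poi_rec e u : 0 < e -> poi e u = pi^-1 * (e * rec e u).
Proof.
move=> e0; rewrite /poi /rec; have := @pi0 R; move: (@pi R) => q q0; field.
by rewrite q0 den_neq0.
Qed.

Lemma rec_diff b u : 0 < b -> rec b u - rec (4 * b) u = 15 * b ^+ 2 * rec b u * rec (4 * b) u.
Proof.
move=> b0; have b4 : 0 < 4 * b by rewrite mulr_gt0.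
have := den_neq0 u b0; have := den_neq0 u b4; rewrite /rec => h1 h2.
have h3 : u * u + 4 * b * (4 * b) != 0 by move: h1; congr (~~ (_ == _)); ring.
have h4 : u * u + b * b != 0 by move: h2; congr (~~ (_ == _)); ring.
by field; rewrite ?h1 ?h2 ?h3 ?h4.
Qed.

(** The weight [r + |u| / r] is the modulus of continuity at scale [r].  The
    difference of two conjugate kernels decays like [|u|^-3], two powers
    faster than each of them, so that the weighted difference is still
    dominated by a Poisson kernel. *)
Lemma step_cjg_bound r u : 0 < r ->
  (r + `|u| / r) * `|step_cjg r u| <= 3 * r * poi (r ^+ 2) u.
Proof.
move=> r0; rewrite /step_cjg; pose b := r ^+ 2 / 4.
have b0 : 0 < b by rewrite divr_gt0// exprn_gt0.
have b4 : 0 < 4 * b by rewrite mulr_gt0.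
have eb : r ^+ 2 = 4 * b by rewrite /b; field.
rewrite -/b eb cjg_rec// cjg_rec// poi_rec// -mulrBr -mulrBr rec_diff//.
rewrite normrM (ger0_norm (_ : 0 <= pi^-1)) ?invr_ge0 ?pi_ge0//.
rewrite mulrCA [leRHS]mulrCA ler_wpM2l ?invr_ge0 ?pi_ge0//.
have h1 := mix_rec u b0; have h2 := sqr_rec u b0.
rewrite -(real_normK (num_real u)) in h2.
have D0 := rec_ge0 u b0; have A0 := rec_ge0 u b4.
rewrite normrM (ger0_norm (_ : 0 <= 15 * b ^+ 2 * rec b u * rec (4 * b) u)); last first.
  by rewrite !mulr_ge0// ltW.
have br : `|u| / r = `|u| * r / (4 * b) by rewrite -eb; field; rewrite gt_eqF.
rewrite br.
have -> : (r + `|u| * r / (4 * b)) * (`|u| * (15 * b ^+ 2 * rec b u * rec (4 * b) u)) =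
   15 * r * b * rec (4 * b) u * (b * `|u| * rec b u + `|u| ^+ 2 * rec b u / 4).
  by field; rewrite gt_eqF.
have -> : 3 * r * (4 * b * rec (4 * b) u) = 15 * r * b * rec (4 * b) u * (4 / 5) by field.
apply: ler_wpM2l; last lra.
by rewrite !mulr_ge0// ltW.
Qed.

(** As for [step_cjg_bound], at the cost of a factor of order [r^-2]. *)
Lemma step_cjg'_bound r u : 0 < r ->
  (r + `|u| / r) * `|step_cjg' r u| <= 90 / r * poi (r ^+ 2 / 4) u.
Proof.
move=> r0; rewrite /step_cjg'; pose b := r ^+ 2 / 4.
have b0 : 0 < b by rewrite divr_gt0// exprn_gt0.
have b4 : 0 < 4 * b by rewrite mulr_gt0.
have eb : r ^+ 2 = 4 * b by rewrite /b; field.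
rewrite -/b eb (cjg'_rec2 u b0) (cjg'_rec2 u b4) poi_rec//.
have bb4 : b <= 4 * b by lra.
have AD := rec_le_rec u b0 bb4; have D0 := rec_ge0 u b0; have A0 := rec_ge0 u b4.
have h1 := mix_rec u b0; have h2 := sqe_rec u b0.
have h3 := mix_rec u b4; have h4 := sqe_rec u b4.
rewrite -mulrBr normrM (ger0_norm (_ : 0 <= pi^-1)) ?invr_ge0 ?pi_ge0//.
rewrite mulrCA [leRHS]mulrCA ler_wpM2l ?invr_ge0 ?pi_ge0//.
have -> : 2 * (b ^+ 2 * rec b u) * rec b u - rec b u -
    (2 * ((4 * b) ^+ 2 * rec (4 * b) u) * rec (4 * b) u - rec (4 * b) u) =
    2 * (b ^+ 2 * rec b u) * rec b u - 2 * ((4 * b) ^+ 2 * rec (4 * b) u) * rec (4 * b) u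
    - 15 * b ^+ 2 * rec b u * rec (4 * b) u by rewrite -rec_diff//; ring.
have br : `|u| / r = `|u| * r / (4 * b) by rewrite -eb; field; rewrite gt_eqF.
have rb : 90 / r * (b * rec b u) = 90 / 4 * r * rec b u.
  by rewrite /b; field; rewrite gt_eqF.
rewrite br rb.
move: (rec b u) (rec (4 * b) u) AD D0 A0 h1 h2 h3 h4 => D A AD D0 A0 h1 h2 h3 h4.
have u0 := normr_ge0 u; move: `|u| u0 h1 h3 => v v0 h1 h3.
have W0 : 0 <= r + v * r / (4 * b).
  by rewrite addr_ge0 ?(ltW r0)// divr_ge0 ?mulr_ge0// ltW.
(* each squared kernel against the weight costs at most one more factor of [1 / (u^2 + b^2)] *)
have k1 : (r + v * r / (4 * b)) * (b ^+ 2 * D) <= 9 / 8 * r.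
  have -> : (r + v * r / (4 * b)) * (b ^+ 2 * D) = r * (b ^+ 2 * D + b * v * D / 4) by field; rewrite gt_eqF.
  have -> : 9 / 8 * r = r * (9 / 8) by ring.
  by rewrite ler_wpM2l ?(ltW r0)//; lra.
have k2 : (r + v * r / (4 * b)) * ((4 * b) ^+ 2 * A) <= 3 / 2 * r.
  have -> : (r + v * r / (4 * b)) * ((4 * b) ^+ 2 * A) = r * ((4 * b) ^+ 2 * A + 4 * b * v * A) by field; rewrite gt_eqF.
  have -> : 3 / 2 * r = r * (3 / 2) by ring.
  by rewrite ler_wpM2l ?(ltW r0)//; lra.
have X0 : 0 <= b ^+ 2 * D by rewrite mulr_ge0 ?sqr_ge0.
have Y0 : 0 <= (4 * b) ^+ 2 * A by rewrite mulr_ge0 ?sqr_ge0.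
apply: (@le_trans _ _ ((r + v * r / (4 * b)) * (17 * (b ^+ 2 * D) * D + 2 * ((4 * b) ^+ 2 * A) * D))).
  apply: ler_wpM2l => //.
  have -> : 15 * b ^+ 2 * D * A = 15 * ((b ^+ 2 * D) * A) by ring.
  move: (b ^+ 2 * D) ((4 * b) ^+ 2 * A) X0 Y0 => X Y X0 Y0.
  have n1 : 0 <= X * D by rewrite mulr_ge0.
  have n2 : 0 <= Y * A by rewrite mulr_ge0.
  have n3 : X * A <= X * D by rewrite ler_wpM2l.
  have n4 : Y * A <= Y * D by rewrite ler_wpM2l.
  have n5 : 0 <= X * A by rewrite mulr_ge0.
  have -> : 2 * X * D = 2 * (X * D) by ring.
  have -> : 2 * Y * A = 2 * (Y * A) by ring.
  have -> : 17 * X * D = 17 * (X * D) by ring.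
  have -> : 2 * Y * D = 2 * (Y * D) by ring.
  by rewrite ler_norml; apply/andP; split; lra.
have -> : (r + v * r / (4 * b)) * (17 * (b ^+ 2 * D) * D + 2 * ((4 * b) ^+ 2 * A) * D) =
   (17 * ((r + v * r / (4 * b)) * (b ^+ 2 * D)) + 2 * ((r + v * r / (4 * b)) * ((4 * b) ^+ 2 * A))) * D by ring.
by rewrite ler_wpM2r//; move: k1 k2; move: (_ * (_ ^+ 2 * D)) (_ * (_ ^+ 2 * A)) => Z1 Z2; lra.
Qed.

Lemma weight_drop r c (h v : R) (w : R) : 0 < r -> 0 <= w -> (r + v / r) * w <= c -> 0 <= v -> w <= c / r.
Proof.
move=> r0 w0 hw v0; rewrite ler_pdivlMr// mulrC; apply: le_trans hw.
by rewrite ler_wpM2r// lerDl divr_ge0// ltW.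
Qed.

Section Step.
Variable r : R.
Hypothesis r0 : 0 < r.
Let b0 : 0 < r ^+ 2 / 4. Proof. by rewrite divr_gt0// exprn_gt0. Qed.
Let e0 : 0 < r ^+ 2. Proof. by rewrite exprn_gt0. Qed.

Lemma step_cont : continuous (step_cjg r).
Proof. by move=> u; apply: cvgB; exact: cjg_cont. Qed.
Lemma step'_cont : continuous (step_cjg' r).
Proof. by move=> u; apply: cvgB; exact: cjg'_cont. Qed.

Lemma step_derive u : is_derive u 1 (step_cjg r) (step_cjg' r u).
Proof. exact: (derB (cjg_derive u b0) (cjg_derive u e0)). Qed.

Lemma step_le u : `|step_cjg r u| <= 3 * poi (r ^+ 2) u.
Proof.
have h := weight_drop 0 r0 (normr_ge0 _) (step_cjg_bound u r0) (normr_ge0 u).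
apply: le_trans h _; rewrite le_eqVlt; apply/orP; left; apply/eqP; field; by rewrite gt_eqF.
Qed.

Lemma step'_le u : `|step_cjg' r u| <= 90 / r ^+ 2 * poi (r ^+ 2 / 4) u.
Proof.
have h := weight_drop 0 r0 (normr_ge0 _) (step_cjg'_bound u r0) (normr_ge0 u).
apply: le_trans h _; rewrite le_eqVlt; apply/orP; left; apply/eqP.
move: (poi _ u) => q; field; by rewrite gt_eqF.
Qed.

Lemma step_vanishes : vanishes (step_cjg r).
Proof.
apply: (@decay_vanishes _ _ (((r ^+ 2 / 4)^-1 + 1) + ((r ^+ 2)^-1 + 1))) => u.
apply: (@le_trans _ _ ((`|cjg (r ^+ 2 / 4) u| + `|cjg (r ^+ 2) u|) * (1 + `|u|))).
  by rewrite ler_wpM2r ?addr_ge0 ?ler_normB.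
by rewrite mulrDl lerD// cjg_decay.
Qed.

Lemma step_integ x : integT (fun s => step_cjg r (x - s)).
Proof.
have [i1 _] := poi_total x e0.
apply: (integ_le mT1 _ (integZ mT1 3 i1)); last by move=> s _; exact: step_le.
exact: (continuous_measurable_fun (cont_comp_sub (x := x) step_cont)).
Qed.

Lemma step'_integ x : integT (fun s => step_cjg' r (x - s)).
Proof.
have [i1 _] := poi_total x b0.
apply: (integ_le mT1 _ (integZ mT1 (90 / r ^+ 2) i1)); last by move=> s _; exact: step'_le.
exact: (continuous_measurable_fun (cont_comp_sub (x := x) step'_cont)).
Qed.

(** The logarithms in the primitives of the two kernels cancel at infinity. *)
Let L u := - (2 * pi)^-1 * ln (1 + 15 * (r ^+ 2 / 4) ^+ 2 * rec (r ^+ 2 / 4) u).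

Let w_ge0 u : 0 <= 15 * (r ^+ 2 / 4) ^+ 2 * rec (r ^+ 2 / 4) u.
Proof. by apply: mulr_ge0; [apply: mulr_ge0; [exact: ler0n|exact: sqr_ge0]|exact: rec_ge0]. Qed.

Let L_derive u : is_derive u 1 L (step_cjg r u).
Proof.
rewrite /L; pose b := r ^+ 2 / 4; rewrite -/b.
have p0 : 0 < 1 + 15 * b ^+ 2 * rec b u by apply: ltr_pwDl => //; exact: w_ge0.
have d0 := den_neq0 u b0.
have dr : is_derive u 1 (rec b) (- (u ^+ 2 + b ^+ 2)^-2 * (2 * u ^+ 1 * 1 + 0)).
  exact: (@derV _ (fun u => u ^+ 2 + b ^+ 2) u _ d0 (derD (derX 1 (der_id u)) (der_cst (b ^+ 2) u))).
have d1 := derD (der_cst 1 u) (derZ (15 * b ^+ 2) dr).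
apply: is_derive_val (derZ (- (2 * pi)^-1) (der_comp d1 (is_derive1_ln p0))) _.
rewrite /step_cjg -/b; have -> : r ^+ 2 = 4 * b by rewrite /b; field.
have b4 : 0 < 4 * b by rewrite mulr_gt0.
rewrite !cjg_rec// -mulrBr -mulrBr rec_diff//.
have h4 := den_neq0 u b4.
have E : 1 + 15 * b ^+ 2 * rec b u = (u ^+ 2 + (4 * b) ^+ 2) / (u ^+ 2 + b ^+ 2).
  by rewrite /rec; field.
rewrite E /rec invf_div; move: d0 h4; have := @pi0 R; move: (@pi R) => q q0.
move: (u ^+ 2 + b ^+ 2) (u ^+ 2 + (4 * b) ^+ 2) => X Y X0 Y0.
by field; rewrite X0 Y0 q0.
Qed.

Let L_vanishes : vanishes L.
Proof.
apply: (@le_vanishes _ _ (fun u => 15 * (r ^+ 2 / 4) ^+ 2 * rec (r ^+ 2 / 4) u)).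
  move=> u; pose w := 15 * (r ^+ 2 / 4) ^+ 2 * rec (r ^+ 2 / 4) u.
  have w0 : 0 <= w := w_ge0 u.
  have p2 : 0 < 2 * pi :> R by rewrite mulr_gt0 ?pi_gt0.
  rewrite /L -/w mulNr normrN normrM (ger0_norm (_ : 0 <= (2 * pi)^-1)) ?invr_ge0 ?(ltW p2)//.
  have l0 : 0 <= ln (1 + w) by rewrite ln_ge0// lerDl.
  have lw : ln (1 + w) <= w.
    by rewrite -ler_expR lnK ?posrE ?ltr_pwDl//; exact: expR_ge1Dx.
  rewrite ger0_norm//; apply: le_trans lw; rewrite ler_piMl//.
  by rewrite invf_le1//; have := @pi_ge1 R; lra.
have [h1 h2] := rec_vanishes b0.
by split => x; [have := cvg_mul (@cvg_const R (15 * (r ^+ 2 / 4) ^+ 2)) (h1 x)|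
  have := cvg_mul (@cvg_const R (15 * (r ^+ 2 / 4) ^+ 2)) (h2 x)]; rewrite mulr0.
Qed.

Let mean_zero k k' x : (forall u, is_derive u 1 k (k' u)) -> continuous k' -> vanishes k ->
  integT (fun s => k' (x - s)) -> \int[mu]_s k' (x - s) = 0.
Proof.
move=> dk ck' [v1 v2] ik.
have pk : prim (fun s => - k (x - s)) (fun s => k' (x - s)).
  apply: prim_C1; last exact: cont_comp_sub.
  move=> s; apply: is_derive_val (derN (der_comp (derB (der_cst x s) (der_id s)) (dk _))) _; ring.
have c1 := cvg_opp (v1 x); have c2 := cvg_opp (v2 x).
rewrite (Rint_line pk ik c1 (B := - 0)) ?subrr//.
by apply: cvg_ext c2 => n; rewrite opprK.
Qed.

Lemma step_mean x : \int[mu]_s step_cjg r (x - s) = 0.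
Proof. exact: (mean_zero L_derive step_cont L_vanishes (step_integ x)). Qed.

Lemma step'_mean x : \int[mu]_s step_cjg' r (x - s) = 0.
Proof. exact: (mean_zero step_derive step'_cont step_vanishes (step'_integ x)). Qed.

End Step.

(** A kernel of mean zero only sees the increments of [f]. *)
Lemma conv_mean_bound k f e c C r x M : 0 < e -> 0 < r -> 0 <= C -> continuous k -> (forall u, `|k u| <= M) ->
  integT (fun s => k (x - s)) -> \int[mu]_s k (x - s) = 0 ->
  (forall u, (r + `|u| / r) * `|k u| <= c * poi e u) ->
  integT f -> (forall s, `|f s - f x| <= C * (r + `|x - s| / r)) ->
  `|convol k f x| <= C * c.
Proof.
move=> e0 r0 C0 ck kM ik k0 kb fi fx.
have i1 := conv_integ x ck kM fi; have i2 := integZ mT1 (f x) ik.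
have -> : convol k f x = \int[mu]_s (f s * k (x - s) - f x * k (x - s)).
  by rewrite (RintegralB mT1 i1 i2) (RintegralZl (f x) mT1 ik) k0 mulr0 subr0.
have [p1 p2] := poi_total x e0.
have -> : C * c = \int[mu]_s (C * c * poi e (x - s)) by rewrite RintegralZl// p2 mulr1.
apply: (Rint_norm_le mT1 (integB mT1 i1 i2) (integZ mT1 (C * c) p1)) => s _.
rewrite -mulrBl normrM -mulrA.
apply: (@le_trans _ _ (C * (r + `|x - s| / r) * `|k (x - s)|)); first by rewrite ler_wpM2r.
by rewrite -mulrA ler_wpM2l.
Qed.

(** * Dyadic scales *)

Definition dy (n : nat) : R := 2^-1 ^+ n.
Definition ee n := dy n ^+ 2.

Lemma dy_gt0 n : 0 < dy n. Proof. by rewrite exprn_gt0// invr_gt0. Qed.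
Lemma ee_gt0 n : 0 < ee n. Proof. by rewrite exprn_gt0// dy_gt0. Qed.
Lemma dy0 : dy 0 = 1. Proof. by rewrite /dy expr0. Qed.
Lemma ee0 : ee 0 = 1. Proof. by rewrite /ee dy0 expr1n. Qed.
Lemma dyS n : dy n.+1 = dy n / 2. Proof. by rewrite /dy exprSr. Qed.
Lemma eeS n : ee n.+1 = dy n ^+ 2 / 4. Proof. by rewrite /ee dyS expr_div_n; congr (_ / _); ring. Qed.
Lemma dy_le1 n : dy n <= 1. Proof. by rewrite /dy exprn_ile1// ?invr_ge0// invf_le1// ler1n. Qed.

Lemma dy_cvg : dy @ \oo --> 0.
Proof. by apply: cvg_expr; rewrite ger0_norm ?invr_ge0// invf_lt1// ltr1n. Qed.

Lemma dyV_ge1 n : 1 <= (dy n)^-1.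
Proof. by rewrite invf_ge1 ?dy_gt0// dy_le1. Qed.

Lemma dyVS n : (dy n.+1)^-1 = 2 * (dy n)^-1.
Proof. by rewrite dyS invf_div mulrC. Qed.

(** [u n + 2 * c * dy n] is nonincreasing and bounded below. *)
Lemma geom_cauchy (u : nat -> R) c : (forall n, `|u n.+1 - u n| <= c * dy n) ->
  exists l, u @ \oo --> l /\ forall n, `|l - u n| <= 2 * c * dy n.
Proof.
move=> h; have c0 : 0 <= c.
  by have := le_trans (normr_ge0 _) (h 0%N); rewrite /dy expr0 mulr1.
have tail n (k : nat) : `|u (n + k)%N - u n| <= 2 * c * (dy n - dy (n + k)%N).
  elim: k => [|k IH]; first by rewrite addn0 !subrr mulr0 normr0.
  have -> : u (n + k.+1)%N - u n = (u (n + k).+1 - u (n + k)%N) + (u (n + k)%N - u n) by rewrite addnS; ring.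
  apply: (le_trans (ler_normD _ _)); have := h (n + k)%N; move: IH; rewrite addnS dyS; lra.
have tail' n m : (n <= m)%N -> `|u m - u n| <= 2 * c * dy n.
  move=> nm; have := tail n (m - n)%N; rewrite subnKC// => /le_trans; apply.
  by apply: ler_wpM2l; [lra|rewrite gerBl ltW// dy_gt0].
pose v n := u n + 2 * c * dy n.
have cv : cvgn v.
  apply: nonincreasing_is_cvgn.
    move=> n m nm; rewrite /v; have := tail n (m - n)%N; rewrite subnKC// ler_norml => /andP[_]; lra.
  exists (u 0%N - 2 * c) => _ [n _ <-]; rewrite /v.
  have := tail' 0%N n (leq0n n); rewrite dy0 mulr1 ler_norml => /andP[h1 _].
  have := mulr_ge0 c0 (ltW (dy_gt0 n)); lra.
exists (limn v).
have cu : u @ \oo --> limn v.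
  have := cvg_sub cv (cvg_mul (@cvg_const R (2 * c)) dy_cvg); rewrite mulr0 subr0.
  by apply: cvg_ext => n; rewrite /v; ring.
split=> // n.
have c2 : (fun m => `|u m - u n|) @ \oo --> `|limn v - u n|.
  by apply: cvg_norm; apply: (cvg_sub cu (@cvg_const R (u n))).
apply: (cvgr_to_le c2); exists n => // m /= nm; exact: tail'.
Qed.

(** * Holder continuity of exponent 1/2 *)

(** Holder continuity of exponent 1/2: for [|x - y| <= 1] the infimum over [n]
    of [dy n + |x - y| / dy n] is comparable to the square root of [|x - y|],
    and each scale can be used on its own. *)
Definition hold f C := forall n x y, `|f x - f y| <= C * (dy n + `|x - y| / dy n).

Lemma hold_ge0 f C : hold f C -> 0 <= C.
Proof.
move=> /(_ 0%N 0 0); rewrite !subrr !normr0 mul0r addr0 /dy expr0 mulr1; exact.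
Qed.

Lemma hold_cont f C : hold f C -> continuous f.
Proof.
move=> hf; have C0 := hold_ge0 hf; move=> x; apply/cvgrPdist_le => e e0.
have := dy_cvg; move=> /cvgr0Pnorm_le/(_ (e / (2 * (C + 1)))) [].
  by rewrite divr_gt0// mulr_gt0//; lra.
move=> n _ /(_ n (leqnn n)) /=; rewrite (ger0_norm (ltW (dy_gt0 n))) ler_pdivlMr; last by rewrite mulr_gt0//; lra.
move=> hn; near=> y; apply: (le_trans (hf n x y)).
have xy : `|x - y| <= dy n ^+ 2.
  near: y; apply: (@cvgr_dist_le _ _ _ (nbhs x) _ id x) => //; exact: ee_gt0.
have h : `|x - y| / dy n <= dy n by rewrite ler_pdivrMr ?dy_gt0// -expr2.
apply: le_trans hn; apply: (@le_trans _ _ (C * (2 * dy n))).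
  by apply: ler_wpM2l => //; lra.
by have := dy_gt0 n; nra.
Unshelve. all: by end_near. Qed.

Lemma holdD f g A B : hold f A -> hold g B -> hold (fun x => f x + g x) (A + B).
Proof.
move=> hf hg n x y; have -> : f x + g x - (f y + g y) = (f x - f y) + (g x - g y) by ring.
by rewrite mulrDl; apply: le_trans (ler_normD _ _) (lerD (hf n x y) (hg n x y)).
Qed.

Lemma holdN f A : hold f A -> hold (fun x => - f x) A.
Proof. by move=> hf n x y; rewrite -opprD normrN. Qed.

Lemma holdM f g A B Mf Mg : hold f A -> hold g B -> (forall x, `|f x| <= Mf) ->
  (forall x, `|g x| <= Mg) -> hold (fun x => f x * g x) (A * Mg + B * Mf).
Proof.
move=> hf hg fM gM n x y.
have -> : f x * g x - f y * g y = (f x - f y) * g x + (g x - g y) * f y by ring.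
apply: (le_trans (ler_normD _ _)); rewrite !normrM.
have hx := hf n x y; have gx := hg n x y.
rewrite mulrDl; apply: lerD; rewrite mulrAC; apply: ler_pM => //.
Qed.

Lemma hold_lip f A M (P : R -> R) : (forall x y, `|P x - P y| <= M * `|x - y|) -> 0 <= M ->
  hold f A -> hold (fun x => P (f x)) (M * A).
Proof.
by move=> lP M0 hf n x y; apply: (le_trans (lP _ _)); rewrite -mulrA ler_wpM2l.
Qed.

(** Integrating [|f| <= dy n * f^2 + (dy n)^-1] produces the two terms of the
    modulus. *)
Lemma prim_hold F f : prim F f -> sqI f -> exists C, hold F C.
Proof.
move=> pF sf; have [lf hF] := pF; have i2 := sqI_integ sf.
pose S := \int[mu]_x (f x ^+ 2).
have S0 : 0 <= S by apply: Rint_ge0 => x _; exact: sqr_ge0.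
exists (1 + S) => n.
have key x y : x <= y -> `|F x - F y| <= (1 + S) * (dy n + `|x - y| / dy n).
  move=> xy; rewrite distrC hF//.
  have lq : loc (fun t => dy n * f t ^+ 2 + (dy n)^-1).
    apply: locD; last by apply: loc_cont => t; exact: cvg_cst.
    by apply: locZ; apply: loc_integ.
  have h t : x <= t <= y -> `|f t| <= dy n * f t ^+ 2 + (dy n)^-1.
    move=> _; rewrite -(real_normK (num_real (f t))).
    have d0 := dy_gt0 n; rewrite -(ler_pM2l d0) mulrDr divff ?gt_eqF//.
    have := normr_ge0 (f t); move: `|f t| => v v0.
    have := sqr_ge0 (dy n * v - 1); nra.
  apply: (le_trans (Int_norm_le lf lq h)).
  have l1 : loc (fun t => dy n * f t ^+ 2) by apply: locZ; apply: loc_integ.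
  have l2 : loc (fun _ => (dy n)^-1) by apply: loc_cont => t; exact: cvg_cst.
  rewrite (RintegralD (mitv x y) (l1 x y) (l2 x y)).
  rewrite (Int_cst (dy n)^-1 xy) (RintegralZl (dy n) (mitv x y) (loc_integ i2 x y)).
  have h1 : \int[mu]_(t in `[x, y]) (f t ^+ 2) <= S.
    rewrite Rintegral_mkcond; apply: le_Rintegral => //.
      have := (@integrable_mkcond _ RM R mu _ (EFin \o (fun x => f x ^+ 2)) (mitv x y)).1 (loc_integ i2 _ _).
      by rewrite restrict_EFin.
    by move=> t _; rewrite patchE; case: ifP => _ /=; [exact: lexx|exact: sqr_ge0].
  have d0 := dy_gt0 n; have dv : 0 < (dy n)^-1 by rewrite invr_gt0.
  have yx : 0 <= y - x by rewrite subr_ge0.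
  rewrite distrC (ger0_norm yx).
  apply: (le_trans (lerD (ler_wpM2l (ltW d0) h1) (lexx _))).
  rewrite (mulrC (dy n)^-1); have w0 := mulr_ge0 yx (ltW dv).
  have := mulr_ge0 S0 w0; move: ((y - x) / dy n) w0 => w w0 h3; lra.
move=> x y; have [xy|yx] := leP x y; first exact: key.
by rewrite distrC (distrC x); apply: key; exact: ltW.
Qed.

(** * The Hilbert transform *)

Definition H_ n f := convol (cjg (ee n)) f.
Definition H_' n f := convol (cjg' (ee n)) f.

Lemma H_prim n f : integT f -> prim (H_ n f) (H_' n f).
Proof.
move=> fi; have e0 := ee_gt0 n.
apply: (@conv_prim _ _ _ _ ((ee n)^-1 + (ee n) ^- 2)) => //.
- by move=> u; exact: cjg_derive.
- exact: cjg'_cont.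
- by move=> u; apply: le_trans (cjg_bound u e0) _; rewrite lerDl invr_ge0 ltW// exprn_gt0.
- by move=> u; apply: le_trans (cjg'_bound u e0) _; rewrite lerDr invr_ge0 ltW.
Qed.

Lemma H_ibp n f f' : prim f f' -> integT f -> integT f' -> forall x, H_' n f x = H_ n f' x.
Proof.
move=> pf fi fi' x; have e0 := ee_gt0 n.
apply: (@conv_ibp _ _ _ _ _ ((ee n)^-1 + (ee n) ^- 2)) => //.
- by move=> u; exact: cjg_derive.
- exact: cjg'_cont.
- by move=> u; apply: le_trans (cjg_bound u e0) _; rewrite lerDl invr_ge0 ltW// exprn_gt0.
- by move=> u; apply: le_trans (cjg'_bound u e0) _; rewrite lerDr invr_ge0 ltW.
- exact: cjg_vanishes.
Qed.

Section Fixed.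
Variables (f : R -> R) (C : R).
Hypothesis (fi : integT f) (hf : hold f C).
Let C0 : 0 <= C := hold_ge0 hf.
Let N1 := \int[mu]_s `|f s|.

Let incr n x s : `|f s - f x| <= C * (dy n + `|x - s| / dy n).
Proof. by rewrite distrC; exact: hf. Qed.

Lemma H_step n x : `|H_ n.+1 f x - H_ n f x| <= 3 * C * dy n.
Proof.
have e0 := ee_gt0 n; have e1 := ee_gt0 n.+1.
have i1 := conv_integ x (cjg_cont e1) (fun u => cjg_bound u e1) fi.
have i0 := conv_integ x (cjg_cont e0) (fun u => cjg_bound u e0) fi.
have -> : H_ n.+1 f x - H_ n f x = convol (step_cjg (dy n)) f x.
  rewrite /H_ /convol -(RintegralB mT1 i1 i0); apply: eq_Rintegral => s _.
  by rewrite /step_cjg -eeS -/(ee n); ring.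
have -> : 3 * C * dy n = C * (3 * dy n) by ring.
have b u : `|step_cjg (dy n) u| <= (ee n.+1)^-1 + (ee n)^-1.
  by rewrite /step_cjg -eeS; apply: le_trans (ler_normB _ _) (lerD (cjg_bound _ _) (cjg_bound _ _)).
exact: (conv_mean_bound e0 (dy_gt0 n) C0 (step_cont (dy_gt0 n)) b (step_integ (dy_gt0 n) x)
   (step_mean (dy_gt0 n) x) (fun u => step_cjg_bound u (dy_gt0 n)) fi (incr n x)).
Qed.

Lemma H_step' n x : `|H_' n.+1 f x - H_' n f x| <= 90 * C / dy n.
Proof.
have e0 := ee_gt0 n; have e1 := ee_gt0 n.+1.
have i1 := conv_integ x (cjg'_cont e1) (fun u => cjg'_bound u e1) fi.
have i0 := conv_integ x (cjg'_cont e0) (fun u => cjg'_bound u e0) fi.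
have -> : H_' n.+1 f x - H_' n f x = convol (step_cjg' (dy n)) f x.
  rewrite /H_' /convol -(RintegralB mT1 i1 i0); apply: eq_Rintegral => s _.
  by rewrite /step_cjg' -eeS -/(ee n); ring.
have -> : 90 * C / dy n = C * (90 / dy n) by ring.
have b u : `|step_cjg' (dy n) u| <= (ee n.+1) ^- 2 + (ee n) ^- 2.
  by rewrite /step_cjg' -eeS; apply: le_trans (ler_normB _ _) (lerD (cjg'_bound _ _) (cjg'_bound _ _)).
have e1' : 0 < dy n ^+ 2 / 4 by rewrite -eeS.
exact: (conv_mean_bound e1' (dy_gt0 n) C0 (step'_cont (dy_gt0 n)) b (step'_integ (dy_gt0 n) x)
   (step'_mean (dy_gt0 n) x) (fun u => step_cjg'_bound u (dy_gt0 n)) fi (incr n x)).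
Qed.

Lemma H_'_bound n x : `|H_' n f x| <= (N1 + 90 * C) / dy n.
Proof.
have C9 : 0 <= 90 * C by rewrite mulr_ge0.
have N0 : 0 <= N1 by apply: Rint_ge0.
elim: n => [|n IH].
  have := conv_bound x (cjg'_cont (ee_gt0 0)) (fun u => cjg'_bound u (ee_gt0 0)) fi.
  rewrite -/N1 -/(H_' 0 f x) ee0 dy0 !expr1n !invr1 mul1r mulr1 => h; lra.
have -> : H_' n.+1 f x = (H_' n.+1 f x - H_' n f x) + H_' n f x by ring.
apply: (le_trans (ler_normD _ _)); apply: (le_trans (lerD (H_step' n x) IH)).
rewrite dyVS; have := dyV_ge1 n; move: (dy n)^-1 => w w1; nra.
Qed.

(** The Hilbert transform as a limit of conjugate Poisson integrals; at the
    heights [ee n] their increments are geometrically small. *)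
Definition Hilb x := limn (fun n => H_ n f x).

Lemma Hilb_cvg x : (fun n => H_ n f x) @ \oo --> Hilb x.
Proof. by have [l [hl _]] := geom_cauchy (fun n => H_step n x); rewrite /Hilb (cvg_lim _ hl). Qed.

Lemma Hilb_dist n x : `|Hilb x - H_ n f x| <= 6 * C * dy n.
Proof.
have [l [hl hd]] := geom_cauchy (fun n => H_step n x).
by rewrite (cvg_uniq (@Hilb_cvg x) hl); apply: le_trans (hd n) _; rewrite le_eqVlt; apply/orP; left; apply/eqP; ring.
Qed.

Lemma Hilb_bounded x : `|Hilb x| <= N1 + 6 * C.
Proof.
have -> : Hilb x = H_ 0 f x + (Hilb x - H_ 0 f x) by ring.
apply: (le_trans (ler_normD _ _)); apply: lerD.
  have := conv_bound x (cjg_cont (ee_gt0 0)) (fun u => cjg_bound u (ee_gt0 0)) fi.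
  by rewrite -/N1 -/(H_ 0 f x) ee0 invr1 mul1r.
by have := Hilb_dist 0 x; rewrite /dy expr0 mulr1.
Qed.

(** At scale [n], compare with [H_ n f]: the distance to it gives the first
    term of the modulus, its Lipschitz constant the second. *)
Lemma Hilb_hold : hold Hilb (12 * C + (N1 + 90 * C)).
Proof.
move=> n x y.
have lip : `|H_ n f x - H_ n f y| <= (N1 + 90 * C) / dy n * `|x - y|.
  have key (a b : R) : a <= b -> `|H_ n f b - H_ n f a| <= (N1 + 90 * C) / dy n * `|b - a|.
    move=> ab; have [l h] := H_prim n fi; rewrite h// (ger0_norm (_ : 0 <= b - a)) ?subr_ge0//.
    by apply: Int_bound => // t _; exact: H_'_bound.
  have [xy|yx] := leP x y; first by rewrite distrC (distrC x); exact: key.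
  by apply: key; exact: ltW.
have -> : Hilb x - Hilb y = (Hilb x - H_ n f x) + (H_ n f x - H_ n f y) - (Hilb y - H_ n f y) by ring.
apply: (le_trans (ler_normB _ _)); have h2 := Hilb_dist n y; have h1 := Hilb_dist n x.
have h3 := ler_normD (Hilb x - H_ n f x) (H_ n f x - H_ n f y).
have N0 : 0 <= N1 by apply: Rint_ge0.
have w0 : 0 <= `|x - y| / dy n by rewrite divr_ge0// ltW// dy_gt0.
have lip2 : `|H_ n f x - H_ n f y| <= (N1 + 90 * C) * (`|x - y| / dy n).
  by apply: le_trans lip _; rewrite le_eqVlt; apply/orP; left; apply/eqP; ring.
have d0 := dy_gt0 n; move: (_ / dy n) w0 lip2 => w w0 lip2.
have := mulr_ge0 C0 w0; have := mulr_ge0 N0 (ltW d0); have := mulr_ge0 C0 (ltW d0); lra.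
Qed.

(** [H_ n f] approximates uniformly and vanishes at infinity by dominated
    convergence. *)
Lemma Hilb_vanish e : 0 < e -> exists M, forall x, M <= x -> `|Hilb x| <= e.
Proof.
move=> e0.
have [n hn] : exists n, 6 * C * dy n <= e / 2.
  have := cvg_mul (@cvg_const R (6 * C)) dy_cvg; rewrite mulr0.
  move=> /cvgr0Pnorm_le/(_ (e / 2) (divr_gt0 e0 _)) []// n _ /(_ n (leqnn n)) /=.
  by move=> h; exists n; apply: le_trans h; exact: ler_norm.
apply: contrapT => nM.
have /choice[u uP] : forall k : nat, exists x : R, k%:R <= x /\ e < `|Hilb x|.
  move=> k; apply: contrapT => nx; apply: nM; exists k%:R => x kx.
  by rewrite leNgt; apply/negP => ex; apply: nx; exists x.
have dec t : `|cjg (ee n) t| * (1 + `|t|) <= (ee n)^-1 + 1 by exact/cjg_decay/ee_gt0.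
have cu : (fun k : nat => H_ n f (u k)) @ \oo --> 0.
  have e0' := ee_gt0 n; have cb t := cjg_bound t e0'.
  have [] := @Rint_dominated _ _ R mu setT mT1 (fun i s => f s * cjg (ee n) (u i - s)) (fun=> 0)
     (fun s => (ee n)^-1 * `|f s|).
  - by move=> i; exact: (integ_meas (conv_integ (u i) (cjg_cont e0') cb fi)).
  - exact: (integZ mT1 _ (integ_norm fi)).
  - by move=> i s _; rewrite normrM mulrC ler_wpM2r.
  - move=> s _; rewrite -(mulr0 (f s)); apply: cvg_mul; first exact: cvg_const.
    apply: (decay_seq (x := s) dec) => i; have [h _] := uP i.
    have h2 := ler_norm s; have h3 := ler_norm (u i - s); lra.
  by move=> _; rewrite Rint_zero.
move/cvgr0Pnorm_le: cu => /(_ (e / 2)) []; first by rewrite divr_gt0.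
move=> k _ /(_ k (leqnn k)) /= hk; have [_] := uP k; apply/negP; rewrite -leNgt.
have -> : Hilb (u k) = (Hilb (u k) - H_ n f (u k)) + H_ n f (u k) by ring.
apply: (le_trans (ler_normD _ _)); have := Hilb_dist n (u k); lra.
Qed.

End Fixed.

(** The regularised transforms commute with differentiation, and both sides
    converge uniformly. *)
Lemma Hilb_prim f f' C C' : prim f f' -> integT f -> integT f' -> hold f C -> hold f' C' ->
  prim (Hilb f) (Hilb f').
Proof.
move=> pf fi fi' hf hf'.
have lH : loc (Hilb f') := loc_cont (hold_cont (Hilb_hold fi' hf')).
have lHn n : loc (H_ n f') := loc_cont (prim_cont (H_prim n fi')).
split=> // a b ab.
have c1 := cvg_sub (Hilb_cvg fi hf (x := b)) (Hilb_cvg fi hf (x := a)).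
apply: (cvg_uniq c1).
apply/cvgrPdist_le => e e0.
have := cvg_mul (@cvg_const R (6 * C' * (b - a))) dy_cvg; rewrite mulr0.
move=> /cvgr0Pnorm_le/(_ e e0); apply: filterS => n hn.
have [_ h] := H_prim n fi.
have E : H_' n f = H_ n f' by apply/funext => x; exact: (H_ibp n pf fi fi').
rewrite h// E.
rewrite -(RintegralB (mitv a b) (lH a b) (lHn n a b)).
apply: le_trans hn; apply: le_trans (ler_norm _).
have -> : 6 * C' * (b - a) * dy n = 6 * C' * dy n * (b - a) by ring.
by apply: Int_bound => //; [exact: locB|move=> x _; exact: Hilb_dist].
Qed.

End HilbertTransform.

(** * Conjugate Poisson kernels in the half-plane *)

Section PlaneKernel.
Context {R : realType}.
Local Notation mu := (@lebesgue_measure R).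
Local Notation mu2 := (@lebesgue_measure R \x @lebesgue_measure R)%E.
Local Notation RM := (measurableTypeR R).
Local Notation meas g := (measurable_fun (setT : set RM) g).
Local Notation meas2 g := (measurable_fun (setT : set (RM * RM)) g).
Local Notation integT g := (mu.-integrable (setT : set RM) (EFin \o g)).
Local Notation sqI f := (sq_integrable mu (setT : set RM) f).
Local Notation L2 G := (L2field mu2 half_plane G).
Local Notation "<< G , H >>" := (ip mu2 half_plane G H).
Implicit Types (z : R * R -> R) (p : R * R) (x y t u : R) (f : R -> R) (n : nat).
Implicit Types (G H V : field (RM * RM)%type R).

Let mH : measurable (half_plane : set (RM * RM)). Proof. exact: meas_half_plane. Qed.
Let mT1 : measurable (setT : set RM). Proof. exact: measurableT. Qed.
Let mT2 : measurable (setT : set (RM * RM)). Proof. exact: measurableT. Qed.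
Let mPos : measurable (`]0, +oo[%classic : set RM). Proof. exact: measurable_itv. Qed.
Hint Resolve mH mT1 mT2 mPos : core.

Lemma smooth_affine (a b : R) : smooth (fun x : R => a * x + b).
Proof.
apply: (@smooth_class _ (fun g => exists a b : R, g = fun x => a * x + b)); last by exists a, b.
move=> _ [c [d ->]]; exists (fun x => 0 * x + c); first by exists 0, c.
move=> x; apply: is_derive_val (derD (derZ c (der_id x)) (der_cst d x)) _; ring.
Qed.

(** A plateau equal to [1] on [[-1, 1]] and supported in [[-2, 2]]. *)
Definition bump x : R := step (-1 * x + 2) * step (1 * x + 2).

Lemma smooth_bump : smooth bump.
Proof.
by apply: smooth_exprP; apply: SEmul; apply: SEaff; apply: SEbase; exact: smooth_step.
Qed.

Lemma bump1 x : `|x| <= 1 -> bump x = 1.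
Proof. by rewrite ler_norml => /andP[h1 h2]; rewrite /bump !step1 ?mulr1//; lra. Qed.

Lemma bump0 x : 2 < `|x| -> bump x = 0.
Proof.
rewrite ltr_normr => /orP[h|h]; rewrite /bump.
  by rewrite step0 ?mul0r//; lra.
by rewrite [X in _ * X]step0 ?mulr0//; lra.
Qed.

Lemma bump_bound x : `|bump x| <= 1.
Proof.
rewrite /bump normrM; have /andP[a0 a1] := step_bound (-1 * x + 2); have /andP[b0 b1] := step_bound (1 * x + 2).
by rewrite !ger0_norm// mulr_ile1.
Qed.

Lemma bump_derive_bound : exists2 A : R, 0 < A & forall x, `|(bump^`())%classic x| <= A.
Proof.
have tb : test_function bump.
  split; first exact: smooth_bump.
  by apply: (@supp_compact _ _ 2) => x; exact: bump0.
have [M M0 [_ h0]] := test_supp tb.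
have [A hA] := cont_bounded (- M) M (smooth_cont (smooth_deriv1 smooth_bump)).
exists (`|A| + 1); first by rewrite ltr_wpDl.
move=> x; have [xM|Mx] := leP `|x| M; last by rewrite h0// normr0 addr_ge0.
apply: (le_trans (hA x _)); first by rewrite -ler_norml.
by have := ler_norm A; lra.
Qed.

Variables e s : R.
Hypothesis e0 : 0 < e.

(** The height above the pole, made positive in the lower half-plane so that
    the kernel is smooth on the whole plane. *)
Definition height y := e + y * step (2 / e * y + 1).

Lemma smooth_height : smooth height.
Proof.
apply: smooth_exprP; apply: SEadd; first exact: SEcst.
apply: SEmul; last by apply: SEaff; apply: SEbase; exact: smooth_step.
have := SEbase (@smooth_affine 1 0); congr smooth_expr; apply/funext => x; ring.
Qed.

Lemma height_pos y : 0 <= y -> height y = e + y.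
Proof. by move=> y0; rewrite /height step1 ?mulr1// lerDr mulr_ge0// divr_ge0// ltW. Qed.

Lemma height_gt0 y : 0 < height y.
Proof.
rewrite /height; have /andP[s0 s1] := step_bound (2 / e * y + 1).
have [y0|y0] := leP 0 y; first by rewrite ltr_pwDl// mulr_ge0.
have [h|h] := leP (2 / e * y + 1) 0; first by rewrite step0// mulr0 addr0.
have h2 : - e / 2 < y.
  have : - 1 < 2 / e * y by lra.
  by rewrite -mulrA (mulrC e^-1) mulrA ltr_pdivlMr// => h3; lra.
move: (step _) s0 s1 => w w0 w1; have : 0 <= (- y) * (1 - w) by rewrite mulr_ge0; lra.
lra.
Qed.

Lemma height_derive y : 0 < y -> (height^`())%classic y = 1.
Proof.
move=> y0; have h : is_derive y 1 height 1.
  apply: (@der_local _ (fun y => e + y)).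
    near=> t; rewrite height_pos//; apply: ltW; near: t; exact: lt_nbhsr.
  by apply: is_derive_val (derD (der_cst e y) (der_id y)) _; rewrite add0r.
by rewrite derive1E; case: h.
Unshelve. all: by end_near. Qed.

Lemma height_der y : is_derive y 1 height ((height^`())%classic y).
Proof. exact: smooth_derive smooth_height y. Qed.

(** Minus the conjugate Poisson kernel with pole at [(s, - e)]: it is harmonic
    in the upper half-plane, where its derivative in the second variable is
    [- poi']. *)
Definition nk p := - cjg (height p.2) (p.1 - s).
Definition rk p := rec (height p.2) (p.1 - s).

Let den2 p := (1 * p.1 + - s) * (1 * p.1 + - s) + height p.2 * height p.2.

Let den2E p : den2 p = (p.1 - s) ^+ 2 + height p.2 ^+ 2.
Proof. by rewrite /den2; ring. Qed.

Let den2_neq0 p : den2 p != 0.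
Proof. by rewrite den2E; apply: den_neq0; exact: height_gt0. Qed.

Let smooth2_rk : smooth2_expr rk.
Proof.
have := S2inv (S2add (S2mul (S2fst (@smooth_affine 1 (- s))) (S2fst (@smooth_affine 1 (- s))))
   (S2mul (S2snd smooth_height) (S2snd smooth_height))) den2_neq0.
by congr smooth2_expr; apply/funext => p; rewrite /rk /rec -den2E.
Qed.

Lemma smooth2_nk : smooth2 nk.
Proof.
apply: smooth2_exprP.
have := S2mul (S2fst (@smooth_affine (- pi^-1) (pi^-1 * s))) smooth2_rk.
congr smooth2_expr; apply/funext => p; rewrite /nk cjg_rec ?height_gt0// /rk; ring.
Qed.

Lemma rk_cont : continuous rk.
Proof. exact/smooth2_cont/smooth2_exprP. Qed.

Lemma nk_p1 p : partial1 nk p = - cjg' (height p.2) (p.1 - s).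
Proof.
case: p => x y; apply: partial1_eq; apply/slice_derive1; rewrite /nk /=.
have := derN (der_comp (derB (der_id x) (der_cst s x)) (cjg_derive (x - s) (height_gt0 y))).
by move=> /is_derive_val; apply; ring.
Qed.

Lemma nk_p2 p : partial2 nk p = - (poi' (height p.2) (p.1 - s) * (height^`())%classic p.2).
Proof.
case: p => x y; apply: partial2_eq; apply/slice_derive2; rewrite /nk /=.
have d0 : pi * ((x - s) ^+ 2 + height y ^+ 2) != 0 by rewrite mulf_neq0 ?pi0 ?den_neq0 ?height_gt0.
have := derN (derZ (x - s) (@derV _ (fun y => pi * ((x - s) ^+ 2 + height y ^+ 2)) y _ d0
  (derZ pi (derD (der_cst ((x - s) ^+ 2) y) (derX 1 (height_der y)))))).
move=> /is_derive_val; apply; rewrite /poi'.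
have := den_neq0 (x - s) (height_gt0 y); have := @pi0 R; move: (@pi R) (height y) (x - s) (derive1 _ _) => q h X h' q0.
by move=> n0; field; rewrite n0 q0.
Qed.

Definition mix h u := 2 * u * (3 * h ^+ 2 - u ^+ 2) / (pi * (u ^+ 2 + h ^+ 2) ^+ 3) : R.

Lemma nk_p11 p : partial1 (partial1 nk) p = mix (height p.2) (p.1 - s).
Proof.
have -> : partial1 nk = fun p => - cjg' (height p.2) (p.1 - s) by apply/funext => q; exact: nk_p1.
case: p => x y; apply: partial1_eq; apply/slice_derive1; rewrite /cjg' /=.
have d1 := derB (der_id x) (der_cst s x).
have d2 := der_comp d1 (der_den2 (x - s) (height_gt0 y)).
have := derN (derM (derB (der_cst (height y ^+ 2) x) (derX 1 d1)) d2).
move=> /is_derive_val; apply; rewrite /mix.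
have := den_neq0 (x - s) (height_gt0 y); have := @pi0 R; move: (@pi R) (height y) (x - s) => q h X q0.
by move=> n0; field; rewrite n0 q0.
Qed.

Lemma poi'_height x y : is_derive y 1 (fun y => poi' (height y) (x - s))
  (mix (height y) (x - s) * (height^`())%classic y).
Proof.
rewrite /poi'; have n0 := den_neq0 (x - s) (height_gt0 y).
have d0 : pi * ((x - s) ^+ 2 + height y ^+ 2) ^+ 2 != 0 by rewrite mulf_neq0 ?pi0 ?expf_neq0.
have d1 := @derV _ (fun y => pi * ((x - s) ^+ 2 + height y ^+ 2) ^+ 2) y _ d0
  (derZ pi (derX 1 (derD (der_cst ((x - s) ^+ 2) y) (derX 1 (height_der y))))).
have := derM (derZ (- (2 * (x - s))) (height_der y)) d1.
have E y' : - (2 * (x - s)) * height y' / (pi * ((x - s) ^+ 2 + height y' ^+ 2) ^+ 2) =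
   - (2 * height y' * (x - s)) / (pi * ((x - s) ^+ 2 + height y' ^+ 2) ^+ 2).
  by congr (_ / _); ring.
move=> h; apply: is_derive_ext (fun y' => E y') (is_derive_val h _).
move: n0; rewrite /mix; have := @pi0 R; move: (@pi R) (height y) (x - s) (derive1 _ _) => q k X h' q0 n0.
by field; rewrite n0 q0.
Qed.

(** * Size of the gradient *)

Lemma half_pos p : half_plane p -> 0 < p.2. Proof. by []. Qed.

Lemma rk_sq p : half_plane p -> rk p ^+ 2 <= rec e (p.1 - s) * rec e p.2.
Proof.
move=> /half_pos y0; rewrite /rk height_pos ?(ltW y0)// /rec exprVn -invfM lef_pV2.
- move: p.2 (p.1 - s) y0 => y u y0; apply: ler_pM; [exact: ltW (den_gt0 _ e0)|exact: ltW (den_gt0 _ e0)| |].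
    by have := mulr_ge0 (ltW e0) (ltW y0); have := sqr_ge0 y; nra.
  by have := mulr_ge0 (ltW e0) (ltW y0); have := sqr_ge0 u; nra.
- by rewrite posrE mulr_gt0// den_gt0// addr_gt0.
- by rewrite posrE mulr_gt0// den_gt0.
Qed.

Lemma rec_half : integT (rec e) /\ \int[mu]_(y in `]0, +oo[) rec e y <= pi / e.
Proof.
have [i1 h1] := rec_integ 0 e0.
have E t : rec e (0 - t) = rec e t by rewrite /rec sub0r sqrrN.
have i2 : integT (rec e) by apply: (eq_integ mT1 _ i1) => t _; rewrite E.
split=> //; rewrite -h1 Rintegral_mkcond; apply: le_Rintegral => //.
  by have := (@integrable_mkcond _ RM R mu _ (EFin \o rec e) mPos).1 (integrableS mT1 mPos (@subsetT _ _) i2);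
     rewrite restrict_EFin.
by move=> t _; rewrite E patchE; case: ifP => _ /=; [exact: lexx|exact: rec_ge0].
Qed.

Lemma rec_shift : integT (fun x => rec e (x - s)) /\ \int[mu]_x rec e (x - s) = pi / e.
Proof.
have [i1 h1] := rec_integ s e0.
have E t : rec e (s - t) = rec e (t - s) by rewrite /rec -sqrrN opprB.
split; first by apply: (eq_integ mT1 _ i1) => t _; rewrite E.
by rewrite -h1; apply: eq_Rintegral => t _; rewrite E.
Qed.

Lemma rk_prod : mu2.-integrable half_plane (EFin \o (fun p => rec e (p.1 - s) * rec e p.2)) /\
  \int[mu2]_(p in half_plane) (rec e (p.1 - s) * rec e p.2) <= (pi / e) ^+ 2.
Proof.
have [i1 h1] := rec_shift; have [i2 h2] := rec_half.
have [i3 ->] := prod_half i1 (integrableS mT1 mPos (@subsetT _ _) i2).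
by split=> //; rewrite h1 expr2 ler_wpM2l// divr_ge0 ?pi_ge0// ltW.
Qed.

Lemma rk_sqI : sq_integrable mu2 half_plane rk.
Proof.
have mr : meas2 rk := cont2_meas rk_cont.
apply: (integ_sqI mH); first exact: measurable_funS mr.
have [i1 _] := rk_prod; apply: (integ_le mH _ i1).
  by apply: measurable_funX; exact: measurable_funS mr.
by move=> p hp; rewrite ger0_norm ?sqr_ge0// rk_sq.
Qed.

Lemma rk_ge0 p : 0 <= rk p. Proof. exact/rec_ge0/height_gt0. Qed.

Lemma nk_p1_le p : `|partial1 nk p| <= rk p.
Proof. by rewrite nk_p1 normrN; exact/cjg'_rec/height_gt0. Qed.

Lemma nk_p2_le p : half_plane p -> `|partial2 nk p| <= rk p.
Proof.
by move=> /half_pos y0; rewrite nk_p2 normrN height_derive// mulr1; exact/poi'_rec/height_gt0.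
Qed.

Lemma nk_p1_cont : continuous (partial1 nk). Proof. exact/smooth2_cont/smooth2_p1/smooth2_nk. Qed.
Lemma nk_p2_cont : continuous (partial2 nk). Proof. exact/smooth2_cont/smooth2_p2/smooth2_nk. Qed.

Lemma L2_nk : L2 (grad nk).
Proof.
split; apply: (sqI_le mH _ rk_sqI) => [|p hp].
- exact: measurable_funS (cont2_meas nk_p1_cont).
- by rewrite (ger0_norm (rk_ge0 p)) nk_p1_le.
- exact: measurable_funS (cont2_meas nk_p2_cont).
- by rewrite (ger0_norm (rk_ge0 p)) nk_p2_le.
Qed.

Lemma sqr_le_of_norm (a b : R) : `|a| <= b -> a * a <= b ^+ 2.
Proof. by rewrite ler_norml => /andP[h1 h2]; nra. Qed.

Lemma sum_le2 (a b c d : R) : a <= c -> b <= c -> c <= d -> a + b <= 2 * d.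
Proof. lra. Qed.

Lemma nk_sq_le p : half_plane p ->
  partial1 nk p * partial1 nk p + partial2 nk p * partial2 nk p <= 2 * (rec e (p.1 - s) * rec e p.2).
Proof.
move=> hp; have h := rk_sq hp.
have h2 := sqr_le_of_norm (nk_p1_le p); have h3 := sqr_le_of_norm (nk_p2_le hp).
exact: sum_le2 h2 h3 h.
Qed.

Lemma nk_norm : << grad nk, grad nk >> <= 2 * (pi / e) ^+ 2.
Proof.
have [i1 h1] := rk_prod.
apply: (@le_trans _ _ (\int[mu2]_(p in half_plane) (2 * (rec e (p.1 - s) * rec e p.2)))).
  apply: le_Rintegral => //; [exact: (L2_dotp mH L2_nk L2_nk)|exact: (integZ mH 2 i1)|].
  exact: nk_sq_le.
by rewrite (RintegralZl 2 mH i1) ler_wpM2l.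
Qed.

Lemma cont_supp_integ (g z : R * R -> R) : continuous g -> continuous z -> (exists M : R, forall p, ~ in_box M p -> z p = 0) ->
  mu2.-integrable half_plane (EFin \o (fun p => g p * z p)).
Proof.
move=> cg cz [M zM].
have cgz : continuous (fun p => g p * z p) by move=> p; apply: cvgM; [exact: cg|exact: cz].
have [K K0 hK] := cont_box_bounded M cgz.
apply: (integrableS mT2 mH) => //; apply: (@box_integrable _ _ K M) => //; first exact: cont2_meas.
by move=> p /zM ->; rewrite mulr0.
Qed.

(** Green's identity for the harmonic function [nk], whose normal derivative
    on the boundary is a derivative of the Poisson kernel. *)
Lemma nk_pairing z : test_function2 z ->
  << grad z, grad nk >> = \int[mu]_x (poi' e (x - s) * z (x, 0)).
Proof.
move=> tz; have [M M0 hM] := test2_supp tz; have [sz _] := tz.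
pose A p := partial1 nk p.
pose B p := poi' (height p.2) (p.1 - s).
pose C p := mix (height p.2) (p.1 - s) * (height^`())%classic p.2.
have HB p : half_plane p -> - partial2 nk p = B p.
  by move=> /half_pos y0; rewrite nk_p2 opprK height_derive// mulr1.
have HC p : half_plane p -> partial1 (partial1 nk) p = C p.
  by move=> /half_pos y0; rewrite nk_p11 /C height_derive// mulr1.
have z0 : exists M : R, forall p, ~ in_box M p -> z p = 0 by exists M => p /hM [].
have z1 : exists M : R, forall p, ~ in_box M p -> partial1 z p = 0 by exists M => p /hM [].
have z2 : exists M : R, forall p, ~ in_box M p -> partial2 z p = 0 by exists M => p /hM [].
have cz1 := test2_p1 tz; have cz2 := test2_p2 tz; have cz := smooth2_cont sz.
have h0 : height 0 = e by rewrite height_pos// addr0.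
have := @boundary_pairing R A B C z tz.
have -> : \int[mu]_x (B (x, 0) * z (x, 0)) = \int[mu]_x (poi' e (x - s) * z (x, 0)).
  by apply: eq_Rintegral => x _; rewrite /B /= h0.
move=> ->.
- apply: eq_Rintegral => p; rewrite inE => hp; rewrite /dotp /grad /= -(HB p hp) /A; ring.
- move=> y y0; apply: prim_C1.
    move=> x; have := smooth2_slice1 x y (smooth2_p1 smooth2_nk).
    by rewrite (HC (x, y)).
  have : continuous (fun x => partial1 (partial1 nk) (x, y)).
    by apply: cont_slice1; apply: smooth2_cont; apply: smooth2_p1; exact: (smooth2_p1 smooth2_nk).
  have -> : (fun x => partial1 (partial1 nk) (x, y)) = (fun x => C (x, y)).
    by apply/funext => x; rewrite HC.
  exact.
- move=> x; apply: prim_C1; first by move=> y; exact: poi'_height.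
  move=> y; apply: cvgM; last exact: (smooth_cont (smooth_deriv1 smooth_height)).
  have : continuous (fun y => partial1 (partial1 nk) (x, y)).
    by apply: cont_slice2; apply: smooth2_cont; apply: smooth2_p1; exact: (smooth2_p1 smooth2_nk).
  have -> : (fun y => partial1 (partial1 nk) (x, y)) = (fun y => mix (height y) (x - s)).
    by apply/funext => y'; rewrite nk_p11.
  exact.
- apply: (eq_integ mH _ (cont_supp_integ (g := partial1 (partial1 nk)) _ cz z0)).
    by move=> p hp; rewrite HC.
  by apply: smooth2_cont; apply: smooth2_p1; exact: (smooth2_p1 smooth2_nk).
- exact: (cont_supp_integ nk_p1_cont cz1 z1).
- apply: (eq_integ mH _ (integN (cont_supp_integ nk_p2_cont cz2 z2))).
  by move=> p hp; rewrite -(HB p hp) mulNr.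
- apply: (@integ_supp _ _ M).
    have cB : continuous (fun x => B (x, 0)).
      have -> : (fun x => B (x, 0)) = (fun x => poi' e (x - s)) by apply/funext => x; rewrite /B /= h0.
      by apply: cont_comp_subl; exact: poi'_cont.
    by apply: loc_cont => x; apply: cvgM; [exact: cB|exact: cont_slice1].
  by move=> x xM; have [|-> _ _] := hM (x, 0); [move=> [/=]; rewrite leNgt xM|rewrite mulr0].
Qed.

(** * Cut-offs: the kernel is a limit of test functions *)

Definition cut n p := bump (n.+1%:R^-1 * p.1 + - (n.+1%:R^-1 * s)) * bump (n.+1%:R^-1 * p.2 + 0).
Definition nkc n p := cut n p * nk p.

Let q n : R := n.+1%:R^-1.
Let q_gt0 n : 0 < q n. Proof. by rewrite invr_gt0. Qed.
Let cutE n p : cut n p = bump (q n * (p.1 - s)) * bump (q n * p.2).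
Proof. by rewrite /cut addr0 mulrBr. Qed.

Lemma nkc_test n : test_function2 (nkc n).
Proof.
apply: (@box_test2 _ _ (2 * n.+1%:R + `|s|)).
  apply: smooth2_exprP; apply: S2mul; last exact: (S2base smooth2_nk).
  have sb := SEbase smooth_bump.
  exact: (S2mul (S2fst (smooth_exprP (SEaff (q n) (- (q n * s)) sb)))
     (S2snd (smooth_exprP (SEaff (q n) 0 sb)))).
move=> -[x y] nb; rewrite /nkc cutE /=.
have n0 : 0 < n.+1%:R :> R by [].
have [h|h] := ltP 2 `|q n * (x - s)|; first by rewrite bump0// !mul0r.
have [h'|h'] := ltP 2 `|q n * y|; first by rewrite [X in _ * X * _]bump0// mulr0 mul0r.
exfalso; apply: nb; move: h h'; rewrite !normrM (ger0_norm (ltW (q_gt0 n))) /q.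
rewrite ![n.+1%:R^-1 * _]mulrC !ler_pdivrMr// => h h'; split => /=.
  have -> : x = (x - s) + s by ring.
  by apply: (le_trans (ler_normD _ _)); rewrite lerD2r.
by apply: (le_trans h'); rewrite lerDl.
Qed.

Let b' := (bump^`())%classic.

Lemma nkc_p1 n p : partial1 (nkc n) p =
  q n * (b' (q n * (p.1 - s)) * bump (q n * p.2) * nk p) + cut n p * partial1 nk p.
Proof.
case: p => x y; apply: partial1_eq; apply/slice_derive1; rewrite /nkc.
have d1 : is_derive x 1 (fun x => q n * (x - s)) (q n).
  by apply: is_derive_val (derZ (q n) (derB (der_id x) (der_cst s x))) _; ring.
have d2 := derM (derM (der_comp d1 (smooth_derive smooth_bump (q n * (x - s)))) (der_cst (bump (q n * y)) x))
  (smooth2_slice1 x y smooth2_nk).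
have E x' : bump (q n * (x' - s)) * bump (q n * y) * nk (x', y) = cut n (x', y) * nk (x', y).
  by rewrite cutE.
apply: is_derive_ext E (is_derive_val d2 _); rewrite cutE /b' /=; ring.
Qed.

Lemma nkc_p2 n p : partial2 (nkc n) p =
  q n * (bump (q n * (p.1 - s)) * b' (q n * p.2) * nk p) + cut n p * partial2 nk p.
Proof.
case: p => x y; apply: partial2_eq; apply/slice_derive2; rewrite /nkc.
have d1 : is_derive y 1 (fun y => q n * y) (q n).
  by apply: is_derive_val (derZ (q n) (der_id y)) _; ring.
have d2 := derM (derM (der_cst (bump (q n * (x - s))) y) (der_comp d1 (smooth_derive smooth_bump (q n * y))))
  (smooth2_slice2 x y smooth2_nk).
have E y' : bump (q n * (x - s)) * bump (q n * y') * nk (x, y') = cut n (x, y') * nk (x, y').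
  by rewrite cutE.
apply: is_derive_ext E (is_derive_val d2 _); rewrite cutE /b' /=; ring.
Qed.

Lemma cut_bound n p : `|cut n p| <= 1.
Proof. by rewrite cutE normrM mulr_ile1 ?bump_bound. Qed.

Lemma nk_abs p : `|nk p| <= `|p.1 - s| * rk p.
Proof.
rewrite /nk normrN cjg_rec ?height_gt0// normrM (ger0_norm (_ : 0 <= pi^-1)) ?invr_ge0 ?pi_ge0//.
rewrite normrM (ger0_norm (rk_ge0 p)) ler_piMl//; first by rewrite mulr_ge0 ?rk_ge0.
by rewrite invf_le1 ?pi_gt0 ?pi_ge1.
Qed.

(** Where the cut-off varies, its slope [1/n] is compensated by [|x - s| <= 2n]. *)
Lemma cut_slope (c d : R) n p : `|c| * `|d| <= `|d| -> (2 < `|q n * (p.1 - s)| -> c = 0) ->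
  `|q n * (c * d * nk p)| <= 2 * `|d| * rk p.
Proof.
move=> cd c0; have r0 := rk_ge0 p.
have [h|h] := ltP 2 `|q n * (p.1 - s)|.
  by rewrite c0// !mul0r mulr0 normr0 !mulr_ge0.
rewrite !normrM (ger0_norm (ltW (q_gt0 n))).
apply: (@le_trans _ _ (q n * (`|d| * (`|p.1 - s| * rk p)))).
  by rewrite ler_wpM2l ?(ltW (q_gt0 n))//; apply: ler_pM; rewrite ?mulr_ge0 ?nk_abs.
have -> : q n * (`|d| * (`|p.1 - s| * rk p)) = (q n * `|p.1 - s|) * (`|d| * rk p) by ring.
have -> : 2 * `|d| * rk p = 2 * (`|d| * rk p) by ring.
apply: ler_wpM2r; first by rewrite mulr_ge0.
by move: h; rewrite normrM (ger0_norm (ltW (q_gt0 n))).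
Qed.

Lemma nkc_bound : exists2 A : R, 0 < A & forall n p, half_plane p ->
  `|partial1 (nkc n) p| <= A * rk p /\ `|partial2 (nkc n) p| <= A * rk p.
Proof.
have [A A0 hA] := bump_derive_bound.
have b'0 x : 2 < `|x| -> b' x = 0.
  move=> x2; have d0 : is_derive x 1 bump 0.
    apply: (@der_local _ (fun _ => 0) _ _ _ _ (der_cst 0 x)).
    near=> t; rewrite bump0//.
    have h : `|x - t| < `|x| - 2.
      by near: t; apply: (@cvgr_dist_lt _ _ _ (nbhs x) _ id x) => //; rewrite subr_gt0.
    by have := lerB_dist x t; lra.
  by rewrite /b' derive1E; case: d0.
exists (2 * A + 1); first by rewrite addr_gt0// mulr_gt0.
move=> n p hp; have r0 := rk_ge0 p.
have k (w : R) : `|w| <= A -> 2 * `|w| * rk p <= 2 * A * rk p.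
  by move=> wA; rewrite ler_wpM2r// ler_wpM2l.
split.
- rewrite nkc_p1 mulrDl mul1r; apply: (le_trans (ler_normD _ _)); apply: lerD; last first.
    rewrite normrM; apply: le_trans (nk_p1_le p); rewrite ler_piMl//; exact: cut_bound.
  rewrite (mulrC (b' _)).
  have [h|h] := ltP 2 `|q n * (p.1 - s)|.
    by rewrite b'0// mulr0 mul0r mulr0 normr0 !mulr_ge0// ltW.
  apply: (le_trans _ (k _ (hA (q n * (p.1 - s))))); apply: cut_slope.
    by rewrite ler_piMl// bump_bound.
  by move=> h2; move: (lt_le_trans h2 h); rewrite ltxx.
- rewrite nkc_p2 mulrDl mul1r; apply: (le_trans (ler_normD _ _)); apply: lerD; last first.
    rewrite normrM; apply: le_trans (nk_p2_le hp); rewrite ler_piMl//; exact: cut_bound.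
  apply: (le_trans _ (k _ (hA (q n * p.2)))); apply: cut_slope.
    by rewrite ler_piMl// bump_bound.
  by move=> h2; rewrite bump0.
Unshelve. all: by end_near. Qed.

Let qx_cvg (c : R) : (fun n => q n * c) @ \oo --> 0.
Proof. by have := nat_inv0 c; apply: cvg_ext => n; rewrite mulrC. Qed.

Let bump_cvg (c : R) : (fun n => bump (q n * c)) @ \oo --> (1 : R).
Proof.
have := seq_cont (smooth_cont smooth_bump) (qx_cvg c).
by rewrite (@bump1 0) ?normr0.
Qed.

Lemma cut_cvg p : (fun n => cut n p) @ \oo --> (1 : R).
Proof.
have := cvg_mul (bump_cvg (p.1 - s)) (bump_cvg p.2); rewrite mulr1.
by apply: cvg_ext => n; rewrite cutE.
Qed.

Lemma nkc_cvg p : (fun n => partial1 (nkc n) p) @ \oo --> partial1 nk p /\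
  (fun n => partial2 (nkc n) p) @ \oo --> partial2 nk p.
Proof.
have [A A0 hA] := bump_derive_bound.
have key (u v : nat -> R) : (forall n, `|u n| <= A) -> (forall n, `|v n| <= 1) ->
    (fun n => q n * (u n * v n * nk p)) @ \oo --> 0.
  move=> uA v1; have h : forall n, `|u n * v n * nk p| <= A * `|nk p|.
    move=> n; rewrite normrM ler_wpM2r// normrM -[A]mulr1; exact: ler_pM.
  by have := bounded_cvg0 h (qx_cvg 1); apply: cvg_ext => n; rewrite mulr1 mulrC.
split.
- have h1 := key _ _ (fun n => hA (q n * (p.1 - s))) (fun n => bump_bound (q n * p.2)).
  have := cvg_add h1 (cvg_mul (cut_cvg p) (@cvg_const R (partial1 nk p))); rewrite add0r mul1r.
  by apply: cvg_ext => n; rewrite nkc_p1.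
- have h1 := key _ _ (fun n => hA (q n * p.2)) (fun n => bump_bound (q n * (p.1 - s))).
  have := cvg_add h1 (cvg_mul (cut_cvg p) (@cvg_const R (partial2 nk p))); rewrite add0r mul1r.
  by apply: cvg_ext => n; rewrite nkc_p2 (mulrC (bump _)).
Qed.

Lemma dot_bound (g1 g2 a b A r : R) : `|a| <= A * r -> `|b| <= A * r ->
  `|g1 * a + g2 * b| <= A * (`|g1| * r) + A * (`|g2| * r).
Proof.
move=> ha hb; apply: (le_trans (ler_normD _ _)).
by apply: lerD; rewrite normrM mulrCA; exact: ler_wpM2l.
Qed.

(** The kernel is a limit of the test functions [nkc n], with gradients
    dominated by a square-integrable function, so that it may be used as a
    test function. *)
Lemma harmonic_nk f G : integT f -> harmonic_gradient f G ->
  << G, grad nk >> = convol (cjg e) f s.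
Proof.
move=> fi [hG eG]; have g := hom_L2 hG; have [g1 g2] := g; have [A A0 hA] := nkc_bound.
have h0 : height 0 = e by rewrite height_pos// addr0.
have c1 : (fun n => << G, grad (nkc n) >>) @ \oo --> << G, grad nk >>.
  have [] := @Rint_dominated _ _ R mu2 half_plane mH (fun n => dotp G (grad (nkc n))) (dotp G (grad nk))
     (fun p => A * (`|G.1 p| * rk p) + A * (`|G.2 p| * rk p)).
  - by move=> n; exact: (integ_meas (L2_dotp mH g (L2_grad (nkc_test n)))).
  - have i1 := integ_norm (sqIM mH g1 rk_sqI); have i2 := integ_norm (sqIM mH g2 rk_sqI).
    apply: (eq_integ mH _ (integD mH (integZ mH A i1) (integZ mH A i2))) => p _.
    by rewrite !normrM (ger0_norm (rk_ge0 p)).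
  - move=> n p hp; have [a1 a2] := hA n p hp.
    exact: dot_bound a1 a2.
  - move=> p _; have [a1 a2] := nkc_cvg p.
    exact: (cvg_add (cvg_mul (@cvg_const R (G.1 p)) a1) (cvg_mul (@cvg_const R (G.2 p)) a2)).
  by [].
have c2 : (fun n => \int[mu]_x (f x * nkc n (x, 0))) @ \oo --> \int[mu]_x (f x * nk (x, 0)).
  have nkb x : `|nk (x, 0)| <= e^-1 by rewrite /nk normrN h0 /=; exact: cjg_bound.
  have [] := @Rint_dominated _ _ R mu setT mT1 (fun n x => f x * nkc n (x, 0)) (fun x => f x * nk (x, 0))
     (fun x => e^-1 * `|f x|).
  - move=> n; apply: measurable_funM; first exact: (integ_meas fi).
    apply: continuous_measurable_fun; apply: cont_slice1.
    by have [sz _] := nkc_test n; exact: smooth2_cont.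
  - exact: (integZ mT1 _ (integ_norm fi)).
  - move=> n x _; rewrite normrM mulrC ler_wpM2r// /nkc normrM.
    by apply: le_trans (nkb x); rewrite ler_piMl// cut_bound.
  - move=> x _; apply: cvg_mul; first exact: cvg_const.
    have := cvg_mul (cut_cvg (x, 0)) (@cvg_const R (nk (x, 0))); rewrite mul1r.
    by apply: cvg_ext => n.
  by [].
rewrite (cvg_uniq c1 (cvg_ext (fun n => esym (eG _ (nkc_test n))) c2)).
by apply: eq_Rintegral => x _; rewrite /nk h0 /cjg /= -(opprB s x) sqrrN mulNr opprK.
Qed.

(** Cauchy-Schwarz against the gradient of the kernel: the Poisson averages of
    the trace of [z] are close to the conjugate Poisson integrals of [f], with
    an error that does not depend on the pole [s]. *)
Lemma trace_average f G z : integT f -> harmonic_gradient f G -> test_function2 z ->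
  (\int[mu]_x (poi' e (x - s) * z (x, 0)) - convol (cjg e) f s) ^+ 2 <=
  dist2 G (grad z) * (2 * (pi / e) ^+ 2).
Proof.
move=> fi hG tz; have [hG1 _] := hG; have g := hom_L2 hG1; have gz := L2_grad tz.
rewrite -(nk_pairing tz) -(harmonic_nk fi hG).
have k2 := L2_nk; have d2 := L2_diff g gz.
have -> : << grad z, grad nk >> - << G, grad nk >> = - << fieldB G (grad z), grad nk >>.
  by rewrite (ip_diffl g gz k2) opprB.
rewrite sqrrN; apply: (le_trans (ip_CS mH d2 k2)).
by apply: ler_wpM2l; [exact: ip_ge0|exact: nk_norm].
Qed.

End PlaneKernel.

Section TraceFunctional.
Context {R : realType}.
Local Notation mu := (@lebesgue_measure R).
Local Notation mu2 := (@lebesgue_measure R \x @lebesgue_measure R)%E.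
Local Notation RM := (measurableTypeR R).
Local Notation meas g := (measurable_fun (setT : set RM) g).
Local Notation meas2 g := (measurable_fun (setT : set (RM * RM)) g).
Local Notation integT g := (mu.-integrable (setT : set RM) (EFin \o g)).
Local Notation sqI f := (sq_integrable mu (setT : set RM) f).
Local Notation L2 G := (L2field mu2 half_plane G).
Local Notation "<< G , H >>" := (ip mu2 half_plane G H).
Implicit Types (z : R * R -> R) (p : R * R) (x y t u s e C M B l : R) (a f g : R -> R) (n k : nat).
Implicit Types (G D H V : field (RM * RM)%type R).

Let mH : measurable (half_plane : set (RM * RM)). Proof. exact: meas_half_plane. Qed.
Let mT1 : measurable (setT : set RM). Proof. exact: measurableT. Qed.
Let mT2 : measurable (setT : set (RM * RM)). Proof. exact: measurableT. Qed.
Hint Resolve mH mT1 mT2 : core.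

(** * The Poisson semigroup contracts [L^1] and [L^2] *)

Lemma poi_prod e a : 0 < e -> integT a ->
  mu2.-integrable setT (EFin \o (fun p => a p.1 * poi e (p.2 - p.1))).
Proof.
move=> e0 ia; have ma := integ_meas ia.
have mp : meas2 (fun p => poi e (p.2 - p.1)).
  apply: cont2_meas => p; apply: (continuous_comp (f := fun p : R * R => p.2 - p.1)); last exact: poi_cont.
  by apply: cvgB; [exact: cvg_snd|exact: cvg_fst].
have mf : meas2 (fun p => a p.1 * poi e (p.2 - p.1)).
  by apply: measurable_funM => //; apply: (measurableT_comp ma).
apply/(integrable12ltyP _ _ _).2; first exact/measurable_EFinP.
rewrite /=.
under eq_integral => x _.
  have [i1 h1] := poi_total' x e0.
  under eq_integral => y _ do rewrite normrM EFinM.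
  rewrite ge0_integralZl//; last first.
    by apply/measurable_EFinP; apply: measurableT_comp => //; exact: (integ_meas i1).
  under eq_integral => y _ do rewrite (ger0_norm (poi_ge0 _ e0)).
  rewrite -(EFin_Rint mT1 i1) h1 mule1.
  over.
exact: (integ_lty mT1 (integ_norm ia)).
Qed.

Lemma convol_poi_integrand e a x : 0 < e -> integT a -> integT (fun s => a s * poi e (x - s)).
Proof. by move=> e0 ia; exact: (conv_integ x (poi_cont e0) (fun u => poi_bound u e0) ia). Qed.

Lemma poi_L1 e a : 0 < e -> integT a ->
  integT (convol (poi e) a) /\ \int[mu]_x convol (poi e) a x = \int[mu]_x a x.
Proof.
move=> e0 ia; have fi := poi_prod e0 ia; split.
  have := fubini_G_integrable fi; congr (_.-integrable _ _); apply/funext => y.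
  by rewrite /fubini_G /convol /= (EFin_Rint mT1 (convol_poi_integrand y e0 ia)).
have := Fubini21 fi; rewrite (Fubini12 fi) => /esym.
have -> : \int[mu]_x \int[mu]_y (a x * poi e (y - x)) = \int[mu]_x a x; last exact.
apply: eq_Rintegral => x _; have [i1 h1] := poi_total' x e0.
by rewrite (RintegralZl (a x) mT1 i1) h1 mulr1.
Qed.

(** The variance of [a] for the Poisson density is nonnegative. *)
Lemma poi_jensen e a x : 0 < e -> integT a -> sqI a ->
  convol (poi e) a x ^+ 2 <= convol (poi e) (fun s => a s ^+ 2) x.
Proof.
move=> e0 ia sa; have i2 := sqI_integ sa.
have [i0 h0] := poi_total x e0.
have j1 := convol_poi_integrand x e0 ia; have j2 := convol_poi_integrand x e0 i2.
set c := convol (poi e) a x.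
have : 0 <= \int[mu]_s ((a s - c) ^+ 2 * poi e (x - s)).
  by apply: Rint_ge0 => s _; rewrite mulr_ge0 ?sqr_ge0 ?poi_ge0.
have -> : \int[mu]_s ((a s - c) ^+ 2 * poi e (x - s)) =
  \int[mu]_s ((a s ^+ 2 * poi e (x - s) - 2 * c * (a s * poi e (x - s))) + c ^+ 2 * poi e (x - s)).
  by apply: eq_Rintegral => s _; ring.
have k1 := integZ mT1 (2 * c) j1; have k0 := integZ mT1 (c ^+ 2) i0.
rewrite (RintegralD mT1 (integB mT1 j2 k1) k0) (RintegralB mT1 j2 k1).
rewrite (RintegralZl (2 * c) mT1 j1) (RintegralZl (c ^+ 2) mT1 i0) h0.
rewrite -/(convol (poi e) a x) -/c -/(convol (poi e) (fun s => a s ^+ 2) x).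
move: (convol _ _ _) => v; nra.
Qed.

Lemma poi_L2 e a : 0 < e -> integT a -> sqI a ->
  sqI (convol (poi e) a) /\ \int[mu]_x (convol (poi e) a x ^+ 2) <= \int[mu]_x (a x ^+ 2).
Proof.
move=> e0 ia sa; have i2 := sqI_integ sa.
have [j1 h1] := poi_L1 e0 i2.
have mc : meas (convol (poi e) a) :=
  continuous_measurable_fun (conv_cont (poi_cont e0) (fun u => poi_bound u e0) ia).
have s1 : sqI (convol (poi e) a).
  apply: (integ_sqI mT1) => //; apply: (integ_le mT1 _ j1); first exact: measurable_funX.
  by move=> x _; rewrite ger0_norm ?sqr_ge0 ?poi_jensen.
split=> //; rewrite -h1; apply: le_Rintegral => //; first exact: (sqI_integ s1).
by move=> x _; exact: poi_jensen.
Qed.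

Lemma convol_poi_prim e a : 0 < e -> integT a -> prim (convol (poi e) a) (convol (poi' e) a).
Proof.
move=> e0 ia; apply: (@conv_prim _ _ _ _ (e^-1 + e ^- 2)) => //.
- by move=> u; exact: poi_derive.
- exact: poi'_cont.
- by move=> u; apply: le_trans (poi_bound u e0) _; rewrite lerDl invr_ge0 ltW// exprn_gt0.
- by move=> u; apply: le_trans (poi'_bound u e0) _; rewrite lerDr invr_ge0 ltW.
Qed.

Lemma poi_decay e u : 0 < e -> `|poi e u| * (1 + `|u|) <= e * (2 + e ^- 2 * 2).
Proof.
move=> e0; apply: le_trans (ler_wpM2l (ltW e0) (rec_decay u e0)); rewrite mulrA ler_wpM2r ?addr_ge0//.
rewrite poi_rec// normrM ger0_norm ?invr_ge0 ?pi_ge0// ger0_norm ?mulr_ge0 ?(ltW e0) ?rec_ge0//.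
rewrite ler_piMl ?mulr_ge0 ?(ltW e0) ?rec_ge0//.
by rewrite invf_le1 ?pi_gt0 ?pi_ge1.
Qed.

Lemma convol_poi_ibp e a a' x : 0 < e -> prim a a' -> integT a -> integT a' ->
  convol (poi' e) a x = convol (poi e) a' x.
Proof.
move=> e0 pa ia ia'; apply: (@conv_ibp _ _ _ _ _ (e^-1 + e ^- 2)) => //.
- by move=> u; exact: poi_derive.
- exact: poi'_cont.
- by move=> u; apply: le_trans (poi_bound u e0) _; rewrite lerDl invr_ge0 ltW// exprn_gt0.
- by move=> u; apply: le_trans (poi'_bound u e0) _; rewrite lerDr invr_ge0 ltW.
- by apply: decay_vanishes => u; exact: poi_decay.
Qed.

(** * Approximation of the identity, uniformly *)

(** Within distance [ee k] the modulus of continuity gives [dy k]; beyond it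
    the Poisson kernel at the much smaller height [ee (k + k) = ee k ^+ 2] has
    little mass, estimated by the weight [u^2 / (u^2 + (ee k)^2)], which is at
    least [1/2] there. *)
Lemma poi_approx k g C B x : hold g C -> (forall y, `|g y| <= B) -> integT g ->
  `|g x - convol (poi (ee (k + k))) g x| <= (2 * C + 16 * B) * dy k.
Proof.
move=> hg gB ig; have C0 := hold_ge0 hg; have d0 : 0 < dy k :> R := dy_gt0 k; have d20 : 0 < ee k :> R := ee_gt0 k.
set e := ee (k + k); have e0 : 0 < e by exact: ee_gt0.
have B0 : 0 <= B := le_trans (normr_ge0 _) (gB 0).
have eE : e = ee k ^+ 2 by rewrite /e /ee /dy exprD; ring.
have [i0 h0] := poi_total x e0; have i1 := convol_poi_integrand x e0 ig.
have [r0 r1] := rec_integ x d20.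
have -> : g x - convol (poi e) g x = \int[mu]_s ((g x - g s) * poi e (x - s)).
  have -> : \int[mu]_s ((g x - g s) * poi e (x - s)) = \int[mu]_s (g x * poi e (x - s) - g s * poi e (x - s)).
    by apply: eq_Rintegral => s _; rewrite mulrBl.
  by rewrite (RintegralB mT1 (integZ mT1 (g x) i0) i1) (RintegralZl (g x) mT1 i0) h0 mulr1.
have inc s : `|g x - g s| <= 2 * C * dy k + 4 * B * ((x - s) ^+ 2 * rec (ee k) (x - s)).
  have q0 : 0 <= (x - s) ^+ 2 * rec (ee k) (x - s) by rewrite mulr_ge0 ?sqr_ge0 ?rec_ge0.
  have [h|h] := leP `|x - s| (ee k).
    apply: (@le_trans _ _ (2 * C * dy k)); last by rewrite lerDl mulr_ge0// mulr_ge0.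
    apply: (le_trans (hg k x s)); rewrite -mulrA mulrCA ler_wpM2l//.
    have : `|x - s| / dy k <= dy k by rewrite ler_pdivrMr// -expr2.
    lra.
  apply: (@le_trans _ _ (4 * B * ((x - s) ^+ 2 * rec (ee k) (x - s)))); last first.
    by rewrite lerDr !mulr_ge0 // ltW.
  have h2 : 2^-1 <= (x - s) ^+ 2 * rec (ee k) (x - s).
    rewrite /rec ler_pdivlMr ?den_gt0// -(real_normK (num_real (x - s))).
    have : ee k ^+ 2 <= `|x - s| ^+ 2 by rewrite lerXn2r ?nnegrE ?(ltW d20) ?(ltW h).
    lra.
  have := ler_normB (g x) (g s); have := gB x; have := gB s.
  move: (_ * rec _ _) h2 q0 => q h2 q0; nra.
have dom : integT (fun s => 2 * C * dy k * poi e (x - s) + 4 * B * (e * rec (ee k) (x - s))).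
  apply: (integD mT1 (integZ mT1 _ i0)).
  by apply: (eq_integ mT1 _ (integZ mT1 (4 * B * e) r0)) => s _; rewrite mulrA.
apply: (@le_trans _ _ (\int[mu]_s (2 * C * dy k * poi e (x - s) + 4 * B * (e * rec (ee k) (x - s))))).
  apply: (Rint_norm_le mT1 _ dom).
    by apply: (eq_integ mT1 _ (integB mT1 (integZ mT1 (g x) i0) i1)) => s _; rewrite mulrBl.
  move=> s _; rewrite normrM (ger0_norm (poi_ge0 _ e0)).
  apply: (le_trans (ler_wpM2r (poi_ge0 _ e0) (inc s))).
  rewrite mulrDl lerD2l; have B4 : 0 <= 4 * B by rewrite mulr_ge0.
  rewrite -[X in X <= _]mulrA; apply: ler_wpM2l => //.
  have -> : (x - s) ^+ 2 * rec (ee k) (x - s) * poi e (x - s) =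
     (x - s) ^+ 2 * poi e (x - s) * rec (ee k) (x - s) by ring.
  apply: ler_wpM2r; first exact: rec_ge0.
  rewrite poi_rec//; have h := sqr_rec (x - s) e0.
  have hp : pi^-1 <= 1 :> R by rewrite invf_le1 ?pi_gt0 ?pi_ge1.
  have hp0 : 0 <= pi^-1 :> R by rewrite invr_ge0 pi_ge0.
  have -> : (x - s) ^+ 2 * (pi^-1 * (e * rec e (x - s))) = pi^-1 * (e * ((x - s) ^+ 2 * rec e (x - s))) by ring.
  apply: (@le_trans _ _ (1 * (e * 1))); last by rewrite mul1r mulr1.
  have h1 : 0 <= (x - s) ^+ 2 * rec e (x - s) by rewrite mulr_ge0 ?sqr_ge0 ?rec_ge0.
  apply: ler_pM => //; first by rewrite mulr_ge0// ltW.
  by rewrite ler_wpM2l// ltW.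
rewrite (RintegralD mT1 (integZ mT1 _ i0)); last first.
  by apply: (eq_integ mT1 _ (integZ mT1 (4 * B * e) r0)) => s _; rewrite mulrA.
rewrite (RintegralZl _ mT1 i0) h0 mulr1.
have -> : \int[mu]_s (4 * B * (e * rec (ee k) (x - s))) = 4 * B * e * (pi / ee k).
  by rewrite -r1 -RintegralZl//; apply: eq_Rintegral => s _; rewrite mulrA.
have -> : 4 * B * e * (pi / ee k) = 4 * B * (pi * ee k).
  by rewrite eE; move: (@pi R) => q; field; rewrite gt_eqF.
have hp : pi * ee k <= 4 * dy k :> R.
  have pi4 : pi <= 4 :> R by have := pihalf_lt2 R; lra.
  apply: ler_pM; rewrite ?pi_ge0 ?pi4 ?(ltW d20)//.
  by rewrite /ee expr2 ler_piMl ?dy_le1 ?ltW.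
have := ler_wpM2l (mulr_ge0 (ler0n _ 4) B0) hp; lra.
Qed.

(** * The trace of the harmonic extension is minus the Hilbert transform *)

Lemma expfield_trace_lim l w w' G zn : 0 < l -> prim w w' -> sqI w -> sqI w' ->
  L2 G -> grad_approx zn G ->
  (fun n => \int[mu]_x (w' x * zn n (x, 0))) @ \oo --> << expfield l w w', G >>.
Proof.
move=> l0 pw sw sw' g az; have [tz _] := az.
apply: cvg_ext (approx_ip g (L2_expfield l0 sw sw') az) => n.
by rewrite (trace_pairing l0 pw sw sw' (tz n)).
Qed.

Lemma prim_supp_integ g g' M : prim g g' -> (forall x, M < `|x| -> g x = 0) ->
  (forall x, M < `|x| -> g' x = 0) -> [/\ integT g, integT g' & sqI g].
Proof.
move=> pg g0 g'0; have cg := prim_cont pg; have [lg' _] := pg.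
split; [exact: (integ_supp (loc_cont cg) g0)|exact: (integ_supp lg' g'0)|].
apply: (integ_sqI mT1); first exact: continuous_measurable_fun.
apply: (@integ_supp _ _ M); last by move=> x /g0 ->; rewrite expr0n.
by apply: loc_cont => x; apply: cvgM; exact: cg.
Qed.

Section Pairing.
Variables (f f' g g' : R -> R) (C M l : R) (G : field (RM * RM)%type R).
Hypotheses (l0 : 0 < l) (pf : prim f f') (fi : integT f) (fi' : integT f') (hf : hold f C).
Hypotheses (hG : harmonic_gradient f' G).
Hypotheses (pg : prim g g') (sg' : sqI g').
Hypotheses (g0 : forall x, M < `|x| -> g x = 0) (g'0 : forall x, M < `|x| -> g' x = 0).

Let hG1 : homogeneous_H1_gradient G. Proof. by case: hG. Qed.
Let LG : L2 G := hom_L2 hG1.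
Let ig : integT g. Proof. by have [] := prim_supp_integ pg g0 g'0. Qed.
Let ig' : integT g'. Proof. by have [] := prim_supp_integ pg g0 g'0. Qed.
Let sg : sqI g. Proof. by have [] := prim_supp_integ pg g0 g'0. Qed.

Let mg n := convol (poi (ee n)) g.
Let mg' n := convol (poi' (ee n)) g.
Let e0 n : 0 < ee n :> R. Proof. exact: ee_gt0. Qed.

Let pmg n : prim (mg n) (mg' n). Proof. exact: convol_poi_prim. Qed.
Let smg n : sqI (mg n). Proof. exact: (poi_L2 (e0 n) ig sg).1. Qed.
Let mgE n : mg' n = convol (poi (ee n)) g'.
Proof. by apply/funext => x; exact: (convol_poi_ibp x (e0 n) pg ig ig'). Qed.
Let smg' n : sqI (mg' n). Proof. by rewrite mgE; exact: (poi_L2 (e0 n) ig' sg').1. Qed.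

(** Fubini's theorem moves the mollifier from [g] to the trace, where
    [trace_average] identifies the limit. *)
Let pairing_mollified n : << expfield l (mg n) (mg' n), G >> = - \int[mu]_x (g' x * H_ n f x).
Proof.
have [g1 [zn az]] := (hom_approx G).1 hG1; have [tz cz] := az.
have c1 := expfield_trace_lim l0 (pmg n) (smg n) (smg' n) LG az.
apply: (cvg_uniq c1).
have -> : - (\int[mu]_x (g' x * H_ n f x)) = \int[mu]_s (g s * convol (cjg (ee n)) f' s).
  have E : \int[mu]_s (H_' n f s * g s) = - \int[mu]_s (H_ n f s * g' s).
    exact: (prim_ibp_supp (H_prim n fi) pg g0 g'0).
  have -> : \int[mu]_x (g' x * H_ n f x) = \int[mu]_s (H_ n f s * g' s).
    by apply: eq_Rintegral => s _; rewrite mulrC.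
  by rewrite -E; apply: eq_Rintegral => s _; rewrite mulrC (H_ibp n pf fi fi').
have av k s := trace_average s (e0 n) fi' hG (tz k).
set Kn : R := 2 * (pi / ee n) ^+ 2 in av.
have K0 : 0 <= Kn by rewrite mulr_ge0 ?sqr_ge0.
pose tr k s := \int[mu]_x (poi' (ee n) (x - s) * zn k (x, 0)).
(* Fubini: both densities have compact support *)
have fub k : \int[mu]_x (mg' n x * zn k (x, 0)) = \int[mu]_s (g s * tr k s).
  have [sz _] := tz k; have [M' M'0 hM] := test2_supp (tz k).
  have cz0 : continuous (fun x => zn k (x, 0)) by apply: cont_slice1; exact: smooth2_cont.
  have iz : integT (fun x => zn k (x, 0)).
    apply: (integ_supp (M := M') (loc_cont cz0)) => x xM.
    by have [|-> _ _] := hM (x, 0); [move=> [/=]; rewrite leNgt xM|].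
  pose F p := g p.1 * zn k (p.2, 0) * poi' (ee n) (p.2 - p.1).
  have iF : mu2.-integrable setT (EFin \o F).
    apply: (@integM_bounded _ _ _ _ _ mT2 (ee n ^- 2)); first exact: (prod_integrable ig iz).
      apply: cont2_meas => p; apply: (continuous_comp (f := fun p : R * R => p.2 - p.1)).
        by apply: cvgB; [exact: cvg_snd|exact: cvg_fst].
      exact: poi'_cont.
    by move=> p _; exact: poi'_bound.
  have := Fubini12 iF; rewrite (Fubini21 iF) => EF.
  have -> : \int[mu]_x (mg' n x * zn k (x, 0)) = \int[mu]_y \int[mu]_x F (x, y).
    apply: eq_Rintegral => y _; rewrite /mg' /convol.
    have iy := conv_integ y (poi'_cont (e0 n)) (fun u => poi'_bound u (e0 n)) ig.
    rewrite mulrC -(RintegralZl _ mT1 iy); apply: eq_Rintegral => x _; rewrite /F /=; ring.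
  rewrite EF; apply: eq_Rintegral => s _.
  have is' : integT (fun x => poi' (ee n) (x - s) * zn k (x, 0)).
    have := @integM_bounded _ _ _ _ _ mT1 (ee n ^- 2) _ (fun x => poi' (ee n) (x - s)) iz.
    move=> h; apply: (eq_integ mT1 _ (h _ _)).
    - by move=> x _; rewrite mulrC.
    - apply: continuous_measurable_fun; apply: cont_comp_subl; exact: poi'_cont.
    - by move=> x _; exact: poi'_bound.
  by rewrite /tr -(RintegralZl _ mT1 is'); apply: eq_Rintegral => x _; rewrite /F /=; ring.
have trc k : continuous (tr k).
  have [sz _] := tz k; have [M' M'0 hM] := test2_supp (tz k).
  have cz0 : continuous (fun x => zn k (x, 0)) by apply: cont_slice1; exact: smooth2_cont.
  have iz : integT (fun x => zn k (x, 0)).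
    apply: (integ_supp (M := M') (loc_cont cz0)) => x xM.
    by have [|-> _ _] := hM (x, 0); [move=> [/=]; rewrite leNgt xM|].
  have := conv_cont (k := fun u => poi' (ee n) (- u)) (M := ee n ^- 2) _ _ iz.
  have -> : convol (fun u => poi' (ee n) (- u)) (fun x => zn k (x, 0)) = tr k.
    by apply/funext => s; apply: eq_Rintegral => x _; rewrite opprB mulrC.
  apply; last by move=> u; exact: poi'_bound.
  have -> : (fun u => poi' (ee n) (- u)) = (fun u => poi' (ee n) (0 - u)).
    by apply/funext => u; rewrite sub0r.
  exact: (cont_comp_sub (x := 0) (poi'_cont (e0 n))).
apply: (cvg_ext (fun k => esym (fub k))).
(* the averages converge uniformly in the pole [s] *)
pose N1 := \int[mu]_s `|g s|.
pose hn s := convol (cjg (ee n)) f' s.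
have hnc : continuous hn := conv_cont (cjg_cont (e0 n)) (fun u => cjg_bound u (e0 n)) fi'.
have lgt k : loc (fun s => g s * tr k s).
  by apply: loc_cont => s; apply: cvgM; [exact: (prim_cont pg)|exact: trc].
have igt k : integT (fun s => g s * tr k s).
  by apply: (integ_supp (M := M) (lgt k)) => s /g0 ->; rewrite mul0r.
have igh : integT (fun s => g s * hn s).
  apply: (@integ_supp _ _ M); last by move=> s /g0 ->; rewrite mul0r.
  by apply: loc_cont => s; apply: cvgM; [exact: (prim_cont pg)|exact: hnc].
have lim0 : (fun k => \int[mu]_s (g s * hn s) - \int[mu]_s (g s * tr k s)) @ \oo --> 0.
  have N10 : 0 <= N1 by apply: Rint_ge0.
  apply: (sqr_cvg0 (K := N1 ^+ 2 * Kn) cz) => k.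
  pose d := Num.sqrt (dist2 G (grad (zn k)) * Kn).
  have d2 : d ^+ 2 = dist2 G (grad (zn k)) * Kn by rewrite sqr_sqrtr// mulr_ge0// ip_ge0.
  have d0 : 0 <= d by exact: sqrtr_ge0.
  have -> : N1 ^+ 2 * Kn * dist2 G (grad (zn k)) = (N1 * d) ^+ 2 by rewrite exprMn d2; ring.
  rewrite -(real_normK (num_real (_ - _))) lerXn2r ?nnegrE ?mulr_ge0//.
  rewrite -(RintegralB mT1 igh (igt k)) mulrC /N1 -(RintegralZl _ mT1 (integ_norm ig)).
  apply: (Rint_norm_le mT1 (integB mT1 igh (igt k)) (integZ mT1 d (integ_norm ig))) => s _.
  rewrite -mulrBr normrM mulrC ler_wpM2r//.
  rewrite -(ler_pXn2r (n := 2)) ?nnegrE// real_normK ?num_real// d2 -sqrrN opprB.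
  exact: av.
have := cvg_sub (@cvg_const R (\int[mu]_s (g s * hn s))) lim0; rewrite subr0.
by apply: cvg_ext => k; rewrite subKr.
Qed.

Let bounded_g : exists B, forall x, `|g x| <= B.
Proof. exact: (prim_bounded pg ig'). Qed.

(** With rate [(dy k)^-1] both terms in the norm of the exponential field of
    the mollification error are of order [dy k]. *)
Let error_small : exists K, forall k,
  (<< expfield l g g', G >> - << expfield l (mg (k + k + (k + k))) (mg' (k + k + (k + k))), G >>) ^+ 2
  <= K * dy k.
Proof.
have [B gB] := bounded_g; have [Cg hg] := prim_hold pg sg'.
have Cg0 := hold_ge0 hg; have B0 : 0 <= B := le_trans (normr_ge0 _) (gB 0).
pose N1 := \int[mu]_s `|g s|; have N10 : 0 <= N1 by apply: Rint_ge0.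
pose S := \int[mu]_s (g' s ^+ 2); have S0 : 0 <= S by apply: Rint_ge0 => s _; exact: sqr_ge0.
pose A := (2 * Cg + 16 * B) * (2 * N1); have A0 : 0 <= A by rewrite !mulr_ge0// addr_ge0// mulr_ge0.
pose E := << G, G >>; have E0 : 0 <= E by exact: ip_ge0.
exists ((A + 4 * S) / 2 * E) => k.
set n := (k + k + (k + k))%N.
pose w x := g x - mg n x; pose w' x := g' x - mg' n x.
have pw : prim w w' by exact: (primB pg (pmg n)).
have sw : sqI w by exact: (sqIB mT1 sg (smg n)).
have sw' : sqI w' by exact: (sqIB mT1 sg' (smg' n)).
have wb x : `|w x| <= (2 * Cg + 16 * B) * dy (k + k) by exact: (poi_approx (k + k) x hg gB ig).
have [jn jE] := poi_L1 (e0 n) (integ_norm ig).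
have im : integT (mg n) := (poi_L1 (e0 n) ig).1.
have nm : \int[mu]_x `|mg n x| <= N1.
  rewrite /N1 -jE; apply: le_Rintegral => //; first exact: (integ_norm im).
  move=> x _; apply: (le_trans (le_normr_Rintegral mT1 (convol_poi_integrand x (e0 n) ig))).
  apply: le_Rintegral => //.
  - exact: (integ_norm (convol_poi_integrand x (e0 n) ig)).
  - exact: (convol_poi_integrand x (e0 n) (integ_norm ig)).
  - by move=> s _; rewrite normrM (ger0_norm (poi_ge0 _ (e0 n))).
have dw : 0 <= (2 * Cg + 16 * B) * dy (k + k) by apply: le_trans (wb 0).
have w2 : \int[mu]_x (w x ^+ 2) <= A * dy (k + k).
  apply: (@le_trans _ _ (\int[mu]_x ((2 * Cg + 16 * B) * dy (k + k) * (`|g x| + `|mg n x|)))).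
    apply: le_Rintegral => //; first exact: (sqI_integ sw).
      exact: (integZ mT1 _ (integD mT1 (integ_norm ig) (integ_norm im))).
    move=> x _; rewrite -(real_normK (num_real (w x))) expr2.
    by apply: ler_pM => //; exact: ler_normB.
  rewrite (RintegralZl _ mT1 (integD mT1 (integ_norm ig) (integ_norm im))).
  rewrite (RintegralD mT1 (integ_norm ig) (integ_norm im)).
  have -> : A * dy (k + k) = (2 * Cg + 16 * B) * dy (k + k) * (2 * N1) by rewrite /A; ring.
  by apply: ler_wpM2l => //; rewrite -/N1; lra.
have w'2 : \int[mu]_x (w' x ^+ 2) <= 4 * S.
  have [s1 s2] := poi_L2 (e0 n) ig' sg'.
  apply: (@le_trans _ _ (\int[mu]_x (2 * (g' x ^+ 2) + 2 * (mg' n x ^+ 2)))).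
    apply: le_Rintegral => //; first exact: (sqI_integ sw').
      exact: (integD mT1 (integZ mT1 2 (sqI_integ sg')) (integZ mT1 2 (sqI_integ (smg' n)))).
    by move=> x _; rewrite /w'; have := sqr_ge0 (g' x + mg' n x); nra.
  rewrite (RintegralD mT1 (integZ mT1 2 (sqI_integ sg')) (integZ mT1 2 (sqI_integ (smg' n)))).
  rewrite (RintegralZl 2 mT1 (sqI_integ sg')) (RintegralZl 2 mT1 (sqI_integ (smg' n))).
  by rewrite -/S; move: s2; rewrite -mgE -/S; lra.
(* the boundary functional does not involve the rate, and [G] is a limit of gradients *)
have rate v v' l1 l2 : 0 < l1 -> 0 < l2 -> prim v v' -> sqI v -> sqI v' ->
    << expfield l1 v v', G >> = << expfield l2 v v', G >>.
  move=> l10 l20 pv sv sv'; have V1 := L2_expfield l10 sv sv'; have V2 := L2_expfield l20 sv sv'.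
  apply: (closure_ip hG1 V1 V2) => z tz.
  by rewrite -(trace_pairing l10 pv sv sv' tz) -(trace_pairing l20 pv sv sv' tz).
have k0 : 0 < (dy k)^-1 :> R by rewrite invr_gt0 dy_gt0.
have -> : << expfield l g g', G >> - << expfield l (mg n) (mg' n), G >> = << expfield (dy k)^-1 w w', G >>.
  rewrite (rate _ _ _ _ l0 k0 pg sg sg') (rate _ _ _ _ l0 k0 (pmg n) (smg n) (smg' n)).
  have V1 := L2_expfield k0 sg sg'; have V2 := L2_expfield k0 (smg n) (smg' n).
  rewrite -(ip_diffl V1 V2 LG); congr (ip _ _ _ _); congr pair; apply/funext => p;
    rewrite /w /w' /=; ring.
have V := L2_expfield k0 sw sw'.
apply: (le_trans (ip_CS mH V LG)); rewrite -/E (expfield_norm k0 sw sw').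
have -> : (A + 4 * S) / 2 * E * dy k = (A + 4 * S) / 2 * dy k * E by ring.
apply: ler_wpM2r => //; have d0 : 0 < dy k :> R := dy_gt0 k.
rewrite ler_pdivrMr; last by rewrite mulr_gt0.
have -> : (A + 4 * S) / 2 * dy k * (2 * (dy k)^-1) = A + 4 * S by field; rewrite gt_eqF.
apply: lerD => //; apply: (@le_trans _ _ ((dy k)^-1 ^+ 2 * (A * dy (k + k)))).
  by rewrite ler_wpM2l ?sqr_ge0.
by rewrite /dy exprD -/(dy k) le_eqVlt; apply/orP; left; apply/eqP; field; rewrite gt_eqF.
Qed.

(** The mollification is removed by letting [n] tend to infinity on both sides
    of [pairing_mollified]. *)
Lemma trace_hilbert : << expfield l g g', G >> = - \int[mu]_x (g' x * Hilb f x).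
Proof.
have [K hK] := error_small.
have c1 := sqr_cvg0 (@dy_cvg R) hK.
have Hc : continuous (Hilb f) := hold_cont (Hilb_hold fi hf).
have [B HB] : exists B, forall x, `|Hilb f x| <= B.
  by exists (\int[mu]_s `|f s| + 6 * C) => x; exact: (Hilb_bounded fi hf).
have iH : integT (fun x => g' x * Hilb f x).
  by apply: (@integM_bounded _ _ _ _ _ mT1 B) => //; exact: continuous_measurable_fun.
have c2 : (fun n => \int[mu]_x (g' x * H_ n f x)) @ \oo --> \int[mu]_x (g' x * Hilb f x).
  apply/cvgrPdist_le => d d0.
  pose N1 := \int[mu]_s `|g' s|.
  have := cvg_mul (@cvg_const R (6 * C * N1)) (@dy_cvg R); rewrite mulr0.
  move=> /cvgr0Pnorm_le/(_ d d0); apply: filterS => n hn.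
  apply: le_trans hn; apply: le_trans (ler_norm _).
  have ein : 0 < ee n :> R := ee_gt0 n.
  have iHn : integT (fun x => g' x * H_ n f x).
    apply: (@integM_bounded _ _ _ _ _ mT1 ((ee n)^-1 * \int[mu]_s `|f s|)) => //.
      exact: (continuous_measurable_fun (prim_cont (H_prim n fi))).
    by move=> x _; exact: (conv_bound x (cjg_cont ein) (fun u => cjg_bound u ein) fi).
  rewrite -(RintegralB mT1 iH iHn).
  have -> : 6 * C * N1 * dy n = 6 * C * dy n * N1 by ring.
  rewrite /N1 -(RintegralZl _ mT1 (integ_norm ig')).
  apply: (Rint_norm_le mT1 (integB mT1 iH iHn) (integZ mT1 _ (integ_norm ig'))) => x _.
  by rewrite -mulrBr normrM mulrC ler_wpM2r//; exact: (Hilb_dist fi hf).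
have c3 := cvg_opp c2.
have c4 : (fun k => << expfield l (mg (k + k + (k + k))) (mg' (k + k + (k + k))), G >>) @ \oo -->
    - \int[mu]_x (g' x * Hilb f x).
  apply: (@cvg_ext _ (fun k => - \int[mu]_x (g' x * H_ (k + k + (k + k)) f x))).
    by move=> k; rewrite pairing_mollified.
  apply: (cvg_comp (fun k => (k + k + (k + k))%N) _ _ c3).
  by apply/cvgnyPge => N; exists N => // m /= Nm; rewrite -!addnA (leq_trans Nm)// leq_addr.
have := cvg_add c1 c4; rewrite add0r => c5.
apply: (cvg_uniq _ c5).
have := @cvg_const R (<< expfield l g g', G >>); apply: cvg_ext => k; ring.
Qed.

(** The mixed stray-field energy of two boundary data as an integral over the
    support of one of them; this is what makes the first variation computable. *)
Lemma harmonic_pairing D : harmonic_gradient g' D -> << D, G >> = - \int[mu]_x (g' x * Hilb f x).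
Proof.
move=> [hD eD]; rewrite -trace_hilbert.
apply: (closure_ip hG1 (hom_L2 hD) (L2_expfield l0 sg sg')) => z tz.
by rewrite (eD z tz) (trace_pairing l0 pg sg sg' tz).
Qed.

End Pairing.

End TraceFunctional.

Section Liftings.
Context {R : realType}.
Local Notation mu := (@lebesgue_measure R).
Local Notation mu2 := (@lebesgue_measure R \x @lebesgue_measure R)%E.
Local Notation RM := (measurableTypeR R).
Local Notation meas g := (measurable_fun (setT : set RM) g).
Local Notation integT g := (mu.-integrable (setT : set RM) (EFin \o g)).
Local Notation sqI f := (sq_integrable mu (setT : set RM) f).
Local Notation "<< G , H >>" := (ip mu2 half_plane G H).
Implicit Types (x y t u v r e M : R) (phi psi p q a F f g : R -> R) (m : R -> R * R).
Implicit Types (G D : field (RM * RM)%type R).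

Let mT1 : measurable (setT : set RM). Proof. exact: measurableT. Qed.
Hint Resolve mT1 : core.

(** * Trigonometric estimates *)

Lemma lipschitz1 f f' : (forall x, is_derive x 1 f (f' x)) -> (forall x, `|f' x| <= 1) ->
  forall x y, `|f x - f y| <= `|x - y|.
Proof.
move=> df f1; have cf := derive_cont df.
have key x y : x < y -> `|f y - f x| <= `|y - x|.
  move=> xy; have [|c _ ->] := MVT xy (fun z _ => df z); first exact: continuous_subspaceT.
  by rewrite normrM ler_piMl.
move=> x y; have [xy|xy|->] := ltgtP x y; last by rewrite !subrr normr0.
- by rewrite distrC (distrC x); exact: key.
- exact: key.
Qed.

Lemma sin_norm_le1 x : `|sin x| <= 1 :> R.
Proof. by rewrite ler_norml sin_geN1 sin_le1. Qed.

Lemma cos_lip x y : `|cos x - cos y| <= `|x - y| :> R.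
Proof.
apply: (lipschitz1 (f' := fun x => - sin x)) => z.
by rewrite normrN sin_norm_le1.
Qed.

Lemma sin_lip x y : `|sin x - sin y| <= `|x - y| :> R.
Proof. by apply: (lipschitz1 (f' := cos)) => z; exact: cos_max. Qed.

Lemma sin_near0 e : 0 < e -> exists2 r : R, 0 < r & forall t, `|t| < r -> `|t - sin t| <= e * `|sin t|.
Proof.
move=> e0; have c0 := @continuous_cos R 0.
have d0 : 0 < e / (1 + e) by rewrite divr_gt0// addr_gt0.
have /cvgrPdist_lt/(_ _ d0) := c0; rewrite cos0 => /nbhs_ballP[r /= r0 hr].
have hc t : `|t| < r -> (1 + e)^-1 <= cos t.
  move=> tr; have := hr t; rewrite /ball /= sub0r normrN => /(_ tr).
  rewrite ltr_norml => /andP[_ h]; apply: ltW; apply: le_lt_trans (_ : 1 - e / (1 + e) < _); last by lra.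
  by rewrite le_eqVlt; apply/orP; left; apply/eqP; field; rewrite gt_eqF// addr_gt0.
exists r => // t tr.
have key s : 0 < s -> s < r -> `|s - sin s| <= e * `|sin s|.
  move=> s0 sr; have [|c] := MVT s0 (fun z _ => is_derive_sin z).
    exact/continuous_subspaceT/continuous_sin.
  rewrite in_itv /= sin0 !subr0 => /andP[c1 c2 E].
  have hc' := hc c ltac:(rewrite ger0_norm ?ltW//; lra).
  have e1 : 0 < 1 + e by rewrite addr_gt0.
  have cl := cos_le1 c; have h2 : 1 <= (1 + e) * cos c by rewrite -ler_pdivrMl// mulr1.
  have cp : 0 <= cos c by apply: le_trans hc'; rewrite invr_ge0 ltW.
  rewrite E (ger0_norm (mulr_ge0 cp (ltW s0))) ger0_norm; nra.
have [t0|t0|->] := ltgtP t 0.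
- have := key (- t) ltac:(lra) ltac:(by rewrite -(ltr0_norm t0)).
  by rewrite sinN -opprD !normrN.
- by apply: key => //; rewrite -(gtr0_norm t0).
- by rewrite sin0 subrr normr0 mulr0.
Qed.

(** The lifting is absolutely continuous because its increments are, to first
    order, the increments of the sine of the difference. *)
Lemma lift_prim phi a1 a2 : continuous phi -> prim (fun x => cos (phi x)) a1 ->
  prim (fun x => sin (phi x)) a2 -> prim phi (fun x => cos (phi x) * a2 x - sin (phi x) * a1 x).
Proof.
move=> cphi [l1 h1] [l2 h2].
have cc : continuous (fun x => cos (phi x)).
  by move=> x; apply: continuous_comp; [exact: cphi|exact: continuous_cos].
have cs : continuous (fun x => sin (phi x)).
  by move=> x; apply: continuous_comp; [exact: cphi|exact: continuous_sin].
have lp : loc (fun x => cos (phi x) * a2 x - sin (phi x) * a1 x).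
  by apply: locB; [apply: eq_loc (locM l2 cc)|apply: eq_loc (locM l1 cs)] => x; rewrite mulrC.
set p := (fun x => _) in lp *.
split => // a b ab; apply/eqP; rewrite -subr_eq0; apply/eqP.
have lG : loc (fun x => `|a1 x| + `|a2 x|) by apply: locD; exact: loc_norm.
apply: (@additive_vanish R (fun u v => phi v - phi u - \int[mu]_(x in `[u, v]) p x)
  (fun u v => \int[mu]_(x in `[u, v]) (`|a1 x| + `|a2 x|))) ab.
- by move=> x y z xy yz; rewrite (IntS lp xy yz); ring.
- by move=> x y z xy yz; rewrite (IntS lG xy yz).
move=> e x e0; have e2 : 0 < e / 2 by rewrite divr_gt0.
have [r0 r00 hr0] := sin_near0 e2.
pose d := Num.min r0 (e / 2) / 2.
have d0 : 0 < d by rewrite divr_gt0// lt_min r00 e2.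
have /cvgrPdist_lt/(_ _ d0)/nbhs_ballP[r /= rpos hr] := cphi x.
exists r => // u v ux xv ur vr.
have near t : u <= t <= v -> `|phi x - phi t| < d.
  move=> /andP[ut tv]; apply: hr; rewrite /ball /= ltr_norml; apply/andP; split; lra.
have uv := le_trans ux xv.
have osc t : u <= t <= v -> `|phi u - phi t| < Num.min r0 (e / 2).
  move=> h; have h1' := near t h; have h2' := near u ltac:(by rewrite lexx uv).
  have -> : phi u - phi t = (phi x - phi t) - (phi x - phi u) by ring.
  apply: (le_lt_trans (ler_normB _ _)); have -> : Num.min r0 (e / 2) = d + d by rewrite /d; field.
  exact: ltrD.
set th := phi v - phi u.
have lsu : loc (fun t => cos (phi u) * a2 t - sin (phi u) * a1 t).
  by apply: locB; exact: locZ.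
have sE : sin th = \int[mu]_(t in `[u, v]) (cos (phi u) * a2 t - sin (phi u) * a1 t).
  rewrite (RintegralB (mitv u v)); [|exact: locZ|exact: locZ].
  rewrite (RintegralZl (cos (phi u)) (mitv u v) (l2 u v)) (RintegralZl (sin (phi u)) (mitv u v) (l1 u v)).
  by rewrite -h1// -h2// /th sinB; ring.
have cu1 := cos_max (phi u); have su1 := sin_norm_le1 (phi u).
have sle : `|sin th| <= \int[mu]_(x in `[u, v]) (`|a1 x| + `|a2 x|).
  rewrite sE; apply: Int_norm_le => // t _.
  apply: (le_trans (ler_normB _ _)); rewrite addrC !normrM.
  by apply: lerD; rewrite ler_piMl.
have th_small : `|th| < r0.
  have := osc v ltac:(by rewrite lexx uv); rewrite distrC lt_min => /andP[] //.
have E1 := hr0 th th_small.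
have E2 : `|sin th - \int[mu]_(x in `[u, v]) p x| <= e / 2 * \int[mu]_(x in `[u, v]) (`|a1 x| + `|a2 x|).
  rewrite sE -(RintegralB (mitv u v) (lsu u v) (lp u v)) -(RintegralZl (e / 2) (mitv u v) (lG u v)).
  apply: Int_norm_le; [exact: locB|exact: locZ|].
  move=> t tuv; have := osc t tuv; rewrite lt_min => /andP[_ /ltW ho].
  have oc := le_trans (cos_lip (phi u) (phi t)) ho; have os := le_trans (sin_lip (phi u) (phi t)) ho.
  have -> : cos (phi u) * a2 t - sin (phi u) * a1 t - p t =
     (cos (phi u) - cos (phi t)) * a2 t - (sin (phi u) - sin (phi t)) * a1 t by rewrite /p; ring.
  apply: (le_trans (ler_normB _ _)); rewrite !normrM mulrDr addrC.
  by apply: lerD; rewrite ler_wpM2r.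
have -> : th - \int[mu]_(x in `[u, v]) p x = (th - sin th) + (sin th - \int[mu]_(x in `[u, v]) p x) by ring.
apply: (le_trans (ler_normD _ _)).
have := le_trans E1 (ler_wpM2l (ltW e2) sle); move: E2; lra.
Qed.

(** * Representatives of the weak derivative *)

(** Whatever weak derivative [weak_derivative] selects, it is a density by
    [weak_prim]. *)
Lemma weak_derivative_prim F g : prim F g -> prim F (weak_derivative F).
Proof.
move=> pF; apply: weak_prim; first exact: prim_cont pF.
by apply: (@xgetPex _ (cst 0) [set g | is_weak_derivative F g]); exists g; exact: prim_weak.
Qed.

Lemma prim_ae_sqr F g g' : prim F g -> prim F g' -> sqI g -> sqI g'.
Proof.
move=> pg pg' [mg hg]; have [lg' _] := pg'; have mg' := loc_meas lg'.
split=> //; rewrite (_ : \int[mu]_x _ = \int[mu]_x ((g x) ^+ 2)%:E)%E//.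
apply: ae_eq_integral => //; [by apply/measurable_EFinP; exact: measurable_funX..|].
have := prim_unique pg pg'; apply: filterS; first exact: (ae_filter_ringOfSetsType mu).
by move=> x E _; rewrite E.
Qed.

Lemma prim_ae_Rint F g g' f : prim F g -> prim F g' -> meas f ->
  \int[mu]_x (g x * f x) = \int[mu]_x (g' x * f x).
Proof.
move=> pg pg' mf; have [/loc_meas mg _] := pg; have [/loc_meas mg' _] := pg'.
apply: (ae_eq_Rint mT1); [exact: measurable_funM..|].
have := prim_unique pg pg'; apply: filterS; first exact: (ae_filter_ringOfSetsType mu).
by move=> x E _; rewrite E.
Qed.

Lemma loc_sq_compact f (K : set R) : meas f -> loc (fun x => f x ^+ 2) -> compact K -> sq_integrable mu K f.
Proof.
move=> mf lf cK; have mK : measurable (K : set RM) := compact_measurable cK.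
have [M _ KM] := compact_bdd cK.
split; first exact: measurable_funS mf.
have iK : mu.-integrable (K : set RM) (EFin \o (fun x => f x ^+ 2)).
  apply: (integrableS (mitv (- M) M) mK _ (lf _ _)) => x Kx /=.
  by rewrite in_itv /= -ler_norml ltW// KM.
exact: (integ_lty mK iK).
Qed.

(** * Profiles: absolutely continuous liftings of finite energy *)

Definition circ phi : R -> R * R := fun x => (cos (phi x), sin (phi x)).

Definition profile phi p := [/\ prim phi p, sqI p & integT (fun x => cos (phi x) - 1)].

Lemma cos_comp_prim phi p : prim phi p -> prim (fun x => cos (phi x)) (fun x => - sin (phi x) * p x).
Proof.
move=> pp; apply: (@prim_comp _ cos (fun x => - sin x) _ _ _ _ pp).
by move=> x; apply: cvgN; exact: continuous_sin.
Qed.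

Lemma sin_comp_prim phi p : prim phi p -> prim (fun x => sin (phi x)) (fun x => cos (phi x) * p x).
Proof.
move=> pp; apply: (@prim_comp _ sin cos _ _ _ _ pp).
exact: continuous_cos.
Qed.

Lemma cont_sin phi : continuous phi -> continuous (fun x => sin (phi x)).
Proof. by move=> c x; apply: continuous_comp; [exact: c|exact: continuous_sin]. Qed.
Lemma cont_cos phi : continuous phi -> continuous (fun x => cos (phi x)).
Proof. by move=> c x; apply: continuous_comp; [exact: c|exact: continuous_cos]. Qed.

Section Profile.
Variables (phi p : R -> R).
Hypothesis pr : profile phi p.

Let f x := cos (phi x) - 1.
Let f' x := - sin (phi x) * p x.
Let pphi : prim phi p. Proof. by case: pr. Qed.
Let sp : sqI p. Proof. by case: pr. Qed.
Let fi : integT f. Proof. by case: pr. Qed.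
Let cphi : continuous phi := prim_cont pphi.
Let mc : meas (fun x => cos (phi x)) := continuous_measurable_fun (cont_cos cphi).
Let ms : meas (fun x => sin (phi x)) := continuous_measurable_fun (cont_sin cphi).

Lemma profile_prim : prim f f'.
Proof.
by apply: eq_prim (primB (cos_comp_prim pphi) (prim_cst 1)) => x; rewrite /f' /= ?subr0.
Qed.

(** [sin^2 = (1 - cos) (1 + cos) <= 2 (1 - cos)]. *)
Lemma profile_sqI_sin : sqI (fun x => sin (phi x)).
Proof.
apply: (integ_sqI mT1) => //; apply: (integ_le mT1 _ (integZ mT1 2 (integ_norm fi))).
  exact: measurable_funX.
move=> x _; rewrite ger0_norm ?sqr_ge0// /f sin2cos2 distrC ger0_norm ?subr_ge0 ?cos_le1//.
by have := cos_le1 (phi x); have := cos_geN1 (phi x); nra.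
Qed.

Lemma profile_sqI_f : sqI f.
Proof.
apply: (integ_sqI mT1); first exact: measurable_funB.
apply: (integ_le mT1 _ (integZ mT1 2 (integ_norm fi))).
  by apply: measurable_funX; exact: measurable_funB.
move=> x _; rewrite ger0_norm ?sqr_ge0// /f distrC ger0_norm ?subr_ge0 ?cos_le1//.
by have := cos_le1 (phi x); have := cos_geN1 (phi x); nra.
Qed.

Lemma sqI_bounded g q M : sqI q -> meas g -> (forall x, `|g x| <= M) -> sqI (fun x => g x * q x).
Proof.
move=> [mq hq] mg gM; apply: (sqI_le mT1 _ (sqIZ mT1 M (conj mq hq))); first exact: measurable_funM.
move=> x _; rewrite !normrM ler_wpM2r//; apply: le_trans (gM x) _; exact: ler_norm.
Qed.

Lemma profile_sqI_f' : sqI f'.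
Proof.
apply: (sqI_bounded (M := 1) sp); first exact: measurableT_comp.
by move=> x; rewrite normrN sin_norm_le1.
Qed.

Lemma profile_integ_f' : integT f'.
Proof.
by apply: (eq_integ mT1 _ (integN (sqIM mT1 profile_sqI_sin sp))) => x _; rewrite /f' mulNr.
Qed.

Lemma profile_sqI_cosp : sqI (fun x => cos (phi x) * p x).
Proof. by apply: (sqI_bounded (M := 1) sp) => // x; exact: cos_max. Qed.

Lemma profile_H1loc : H1loc_circle (circ phi).
Proof.
have bl g : continuous g -> loc (fun x => g x ^+ 2).
  by move=> cg; apply: loc_cont => x; apply: cvgM; exact: cg.
split.
- exists f'; split; first exact: (prim_weak (cos_comp_prim pphi)).
  move=> K cK; split; apply: loc_sq_compact => //.
  + by apply: bl; exact: cont_cos.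
  + by have [] := profile_sqI_f'.
  + exact: (loc_integ (sqI_integ profile_sqI_f')).
- exists (fun x => cos (phi x) * p x); split; first exact: (prim_weak (sin_comp_prim pphi)).
  move=> K cK; split; apply: loc_sq_compact => //.
  + by apply: bl; exact: cont_sin.
  + by have [] := profile_sqI_cosp.
  + exact: (loc_integ (sqI_integ profile_sqI_cosp)).
- by move=> x; exact: cos2Dsin2.
Qed.

Lemma profile_finite : finite_energy (circ phi).
Proof.
split=> //.
- exists f'; split; first exact: (prim_weak profile_prim).
  by split; [exact: profile_sqI_f|exact: profile_sqI_f'].
- exact: (prim_ae_sqr (sin_comp_prim pphi) (weak_derivative_prim (sin_comp_prim pphi)) profile_sqI_cosp).
Qed.

Lemma profile_lifting : is_lifting (circ phi) phi.
Proof. by split. Qed.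

Lemma profile_admissible (d k l : int) : phi x @[x --> -oo] --> 2 * pi * k%:~R ->
  phi x @[x --> +oo] --> 2 * pi * l%:~R -> d = l - k -> admissible d (circ phi).
Proof.
move=> hk hl dE; split; [exact: profile_H1loc|exact: profile_finite|].
by exists phi, k, l; split => //; exact: profile_lifting.
Qed.

(** Twice the anisotropy, as a function of the lifting. *)
Definition W2 (h : R) x := cos x ^+ 2 - 2 * h * cos x + 2 * h - 1.

Lemma W2_integ h : integT (fun x => W2 h (phi x)).
Proof.
apply: (integ_le mT1 _ (integZ mT1 (2 + 2 * `|h|) (integ_norm fi))).
  have := measurable_funB (measurable_funB (measurable_funX 2 mc) (measurable_funM (measurable_cst (2 * h)) mc))
     (measurable_cst (1 - 2 * h)).
  by apply: eq_measurable_fun => x _ /=; rewrite /W2; ring.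
move=> x _; have -> : W2 h (phi x) = f x * (1 + cos (phi x) - 2 * h) by rewrite /W2 /f; ring.
rewrite normrM mulrC ler_wpM2r//; apply: (le_trans (ler_normB _ _)); apply: lerD.
  by apply: (le_trans (ler_normD _ _)); rewrite normr1; have := cos_max (phi x); lra.
by rewrite normrM ger0_norm.
Qed.

Lemma profile_stray G : harmonic_gradient f' G <-> is_stray_field (circ phi) G.
Proof.
have pw := weak_derivative_prim (cos_comp_prim pphi).
have E z : test_function2 z -> \int[mu]_x (f' x * z (x, 0)) = \int[mu]_x (weak_derivative (comp1 (circ phi)) x * z (x, 0)).
  move=> tz; apply: (prim_ae_Rint (cos_comp_prim pphi) pw).
  by apply: continuous_measurable_fun; apply: cont_slice1; have [sz _] := tz; exact: smooth2_cont.
split=> -[hG eG]; split=> // z tz; first by rewrite -(E z tz) -(eG z tz).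
by rewrite (E z tz) -(eG z tz).
Qed.

(** The representatives selected in [energy] agree almost everywhere with the
    densities of the profile, and [cos^2 + sin^2 = 1] reduces the exchange
    energy to [p^2]. *)
Lemma profile_energy h : exists2 G, harmonic_gradient f' G &
  energy h (circ phi) = (2^-1 * (\int[mu]_x (p x ^+ 2 + W2 h (phi x))) + 2^-1 * << G, G >>)%:E.
Proof.
have [G0 hG0] := harmonic_exists profile_prim profile_sqI_f profile_sqI_f'.
exists (stray_field (circ phi)).
  apply/profile_stray; apply: (@xgetPex _ (cst 0, cst 0) [set G | is_stray_field (circ phi) G]).
  by exists G0; exact/profile_stray.
have hS : is_stray_field (circ phi) (stray_field (circ phi)).
  apply: (@xgetPex _ (cst 0, cst 0) [set G | is_stray_field (circ phi) G]).
  by exists G0; exact/profile_stray.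
have LS := hom_L2 hS.1.
rewrite /energy EFinD !EFinM; congr (_ + _)%E; congr (_ * _)%E.
- rewrite (EFin_Rint mT1 (integD mT1 (sqI_integ sp) (W2_integ h))).
  have pw1 := weak_derivative_prim (cos_comp_prim pphi).
  have pw2 := weak_derivative_prim (sin_comp_prim pphi).
  have [/loc_meas m1 _] := pw1; have [/loc_meas m2 _] := pw2.
  have mW := integ_meas (W2_integ h).
  apply: ae_eq_integral => //.
  + apply/measurable_EFinP; apply: measurable_funD; first by apply: measurable_funD; exact: measurable_funX.
    by apply: eq_measurable_fun mW => x _; rewrite /anisotropy /W2 /circ /=; field.
  + by apply/measurable_EFinP; apply: measurable_funD => //; apply: measurable_funX; case: sp.
  + have h1 := prim_unique pw1 (cos_comp_prim pphi); have h2 := prim_unique pw2 (sin_comp_prim pphi).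
    move: h1 h2; apply: filterS2; first exact: (ae_filter_ringOfSetsType mu).
    move=> x E1 E2 _.
    rewrite /comp1 /comp2 /circ /= E1 E2; congr EFin; rewrite /anisotropy /W2 /=.
    have := cos2Dsin2 (phi x); move: (cos (phi x)) (sin (phi x)) => c s cs.
    have -> : (- s * p x) ^+ 2 + (c * p x) ^+ 2 = (c ^+ 2 + s ^+ 2) * p x ^+ 2 by ring.
    by rewrite cs; field.
- rewrite (EFin_Rint (meas_half_plane (R := R)) (L2_dotp (meas_half_plane (R := R)) LS LS)).
  by apply: eq_integral => z _; rewrite /dotp -!expr2.
Qed.

End Profile.

Lemma lifting_profile m phi : H1loc_circle m -> finite_energy m -> is_lifting m phi ->
  m = circ phi /\ exists p, profile phi p.
Proof.
move=> [h1 h2 _] [[g [wg [sf sg]]] fi s2] [cphi mE].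
have E : m = circ phi by apply/funext.
split=> //; subst m.
have [g1 [w1 _]] := h1; have [g2 [w2 _]] := h2.
have p1 : prim (fun x => cos (phi x)) g1 := weak_prim (cont_cos cphi) w1.
have p2 : prim (fun x => sin (phi x)) g2 := weak_prim (cont_sin cphi) w2.
have pw2 : prim (fun x => sin (phi x)) (weak_derivative (comp2 (circ phi))) := weak_derivative_prim p2.
have pg : prim (fun x => cos (phi x)) g.
  have cf : continuous (fun x => cos (phi x) - 1).
    by move=> x; apply: cvgB; [exact: cont_cos|exact: cvg_cst].
  apply: eq_prim (primD (weak_prim cf wg) (prim_cst 1)) => x /=; first by rewrite subrK.
  by rewrite addr0.
exists (fun x => cos (phi x) * weak_derivative (comp2 (circ phi)) x - sin (phi x) * g x); split => //.
- exact: lift_prim.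
- apply: (sqIB mT1).
    apply: (sqI_bounded (M := 1) s2) => [|x]; last exact: cos_max.
    exact: (continuous_measurable_fun (cont_cos cphi)).
  apply: (sqI_bounded (M := 1) sg) => [|x]; last exact: sin_norm_le1.
  exact: (continuous_measurable_fun (cont_sin cphi)).
Qed.

End Liftings.

(** * First variation of the energy *)

Section EulerLagrange.
Context {R : realType}.
Local Notation mu := (@lebesgue_measure R).
Local Notation mu2 := (@lebesgue_measure R \x @lebesgue_measure R)%E.
Local Notation RM := (measurableTypeR R).
Local Notation meas g := (measurable_fun (setT : set RM) g).
Local Notation integT g := (mu.-integrable (setT : set RM) (EFin \o g)).
Local Notation sqI f := (sq_integrable mu (setT : set RM) f).
Local Notation "<< G , H >>" := (ip mu2 half_plane G H).
Implicit Types (x y t u v r e : R) (psi q F g : R -> R) (z : R * R -> R).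
Implicit Types (G D : field (RM * RM)%type R).

Let mT1 : measurable (setT : set RM). Proof. exact: measurableT. Qed.
Let mH : measurable (half_plane : set (RM * RM)). Proof. exact: meas_half_plane. Qed.
Hint Resolve mT1 mH : core.

Lemma taylor1 F F' L : (forall x, is_derive x 1 F (F' x)) ->
  (forall x y, `|F' x - F' y| <= L * `|x - y|) -> forall x y, `|F (x + y) - F x - F' x * y| <= L * y ^+ 2.
Proof.
move=> dF LF x y.
have L0 : 0 <= L by have := LF 1 0; rewrite subr0 normr1 mulr1; apply: le_trans.
have cF := derive_cont dF.
have key a b : a < b -> exists2 c, a <= c <= b & F b - F a = F' c * (b - a).
  move=> ab; have [|c] := MVT ab (fun w _ => dF w); first exact: continuous_subspaceT.
  by rewrite in_itv /= => /andP[/ltW h1 /ltW h2] ->; exists c => //; rewrite h1 h2.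
have [c cxy ->] : exists2 c, `|c - x| <= `|y| & F (x + y) - F x = F' c * y.
  have [y0|y0|->] := ltgtP y 0.
  - have [|c /andP[c1 c2] E] := key (x + y) x; first lra.
    exists c; first by rewrite (ltr0_norm y0) ler_norml; apply/andP; split; lra.
    by rewrite -[LHS]opprK opprB E; ring.
  - have [|c /andP[c1 c2] E] := key x (x + y); first lra.
    exists c; first by rewrite (gtr0_norm y0) ler_norml; apply/andP; split; lra.
    by rewrite E; ring.
  - by exists x; rewrite ?subrr ?addr0 ?subrr ?mulr0.
rewrite -mulrBl normrM -(real_normK (num_real y)) expr2 mulrA ler_wpM2r//.
by apply: (le_trans (LF _ _)); rewrite ler_wpM2l.
Qed.

Lemma sin_taylor x y : `|sin (x + y) - sin x - cos x * y| <= y ^+ 2 :> R.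
Proof.
have h a b : `|cos a - cos b| <= 1 * `|a - b| :> R by rewrite mul1r cos_lip.
by have := taylor1 (F := sin) (fun x => is_derive_sin x) h x y; rewrite mul1r.
Qed.

Definition W2' (h x : R) := 2 * (sin x * (h - cos x)).

Lemma W2_taylor h x y : `|W2 h (x + y) - W2 h x - W2' h x * y| <= (2 * `|h| + 4) * y ^+ 2.
Proof.
apply: (taylor1 (F := W2 h) (F' := W2' h)) => [u|u v].
  have dc := is_derive_cos u.
  have := derB (derD (derB (derX 1 dc) (derZ (2 * h) dc)) (der_cst (2 * h) u)) (der_cst 1 u).
  by move=> /is_derive_val; apply; rewrite /W2'; ring.
rewrite /W2'; have -> : 2 * (sin u * (h - cos u)) - 2 * (sin v * (h - cos v)) =
  2 * h * (sin u - sin v) - 2 * ((sin u - sin v) * cos u + sin v * (cos u - cos v)) by ring.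
apply: (le_trans (ler_normB _ _)).
have s := sin_lip u v; have c := cos_lip u v.
have h1 : `|2 * h * (sin u - sin v)| <= 2 * `|h| * `|u - v|.
  by rewrite !normrM (ger0_norm (_ : 0 <= 2))// ler_wpM2l// mulr_ge0.
have h2 : `|(sin u - sin v) * cos u| <= `|u - v|.
  by rewrite normrM; apply: le_trans s; rewrite ler_piMr// cos_max.
have h3 : `|sin v * (cos u - cos v)| <= `|u - v|.
  by rewrite normrM; apply: le_trans c; rewrite ler_piMl// sin_norm_le1.
have h4 : `|2 * ((sin u - sin v) * cos u + sin v * (cos u - cos v))| <= 4 * `|u - v|.
  rewrite normrM ger0_norm//; have := ler_normD ((sin u - sin v) * cos u) (sin v * (cos u - cos v)); lra.
by rewrite [leRHS]mulrDl; exact: lerD.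
Qed.

Lemma trace_sqI z : test_function2 z -> sqI (fun x => z (x, 0)).
Proof.
move=> tz; have [sz _] := tz; have [M M0 hM] := test2_supp tz.
have cz : continuous (fun x => z (x, 0)) by apply: cont_slice1; exact: smooth2_cont.
apply: (integ_sqI mT1); first exact: continuous_measurable_fun.
apply: (@integ_supp _ _ M); first by apply: loc_cont => x; apply: cvgM; exact: cz.
by move=> x xM; have [|-> _ _] := hM (x, 0); [move=> [/=]; rewrite leNgt xM|rewrite expr0n].
Qed.

Lemma harmonic_diff a b G D : sqI a -> sqI b -> harmonic_gradient a G -> harmonic_gradient b D ->
  harmonic_gradient (fun x => a x - b x) (fieldB G D).
Proof.
move=> sa sb [hG eG] [hD eD]; split; first exact: hom_diff.
move=> z tz; have sz := trace_sqI tz.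
rewrite (ip_diffl (hom_L2 hG) (hom_L2 hD) (L2_grad tz)) (eG z tz) (eD z tz).
rewrite -(RintegralB mT1 (sqIM mT1 sa sz) (sqIM mT1 sb sz)).
by apply: eq_Rintegral => x _; rewrite mulrBl.
Qed.

(** Minimality among profiles with the same limits.  It constrains a profile
    only through its energy and its limits, so that it passes to the
    reflection of a profile after a zero. *)
Definition least (h c : R) (phi p : R -> R) := [/\ profile phi p,
  phi x @[x --> -oo] --> c, phi x @[x --> +oo] --> 0 &
  forall psi q, profile psi q -> psi x @[x --> -oo] --> c -> psi x @[x --> +oo] --> 0 ->
    (energy h (circ phi) <= energy h (circ psi))%E].

Section Variation.
Variables (h c : R) (phi p eta eta' : R -> R) (M : R).
Hypothesis (L : least h c phi p).
Hypotheses (peta : prim eta eta') (seta : sqI eta').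
Hypotheses (eta0 : forall x, M < `|x| -> eta x = 0) (eta'0 : forall x, M < `|x| -> eta' x = 0).

Let f x := cos (phi x) - 1.
Let f' x := - sin (phi x) * p x.
Let pr : profile phi p. Proof. by case: L. Qed.
Let pphi : prim phi p. Proof. by case: pr. Qed.
Let sp : sqI p. Proof. by case: pr. Qed.
Let lp : loc p. Proof. by case: pphi. Qed.
Let leta' : loc eta'. Proof. by case: peta. Qed.
Let ceta : continuous eta := prim_cont peta.
Let cphi : continuous phi := prim_cont pphi.
Let pf : prim f f' := profile_prim pr.
Let fi : integT f. Proof. by case: pr. Qed.
Let fi' : integT f' := profile_integ_f' pr.
Let sf' : sqI f' := profile_sqI_f' pr.

Let psi t x := phi x + t * eta x.
Let q t x := p x + t * eta' x.

Let sqeta : sqI eta. Proof. by have [] := prim_supp_integ peta eta0 eta'0. Qed.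

Let ppsi t : prim (psi t) (q t). Proof. exact: primD pphi (primZ t peta). Qed.

Let g t x := cos (psi t x) - cos (phi x).
Let g' t x := - sin (psi t x) * q t x - f' x.

Let pg t : prim (g t) (g' t). Proof. exact: primB (cos_comp_prim (ppsi t)) (cos_comp_prim pphi). Qed.

Let g0 t x : M < `|x| -> g t x = 0.
Proof. by move=> xM; rewrite /g /psi eta0// mulr0 addr0 subrr. Qed.
Let g'0 t x : M < `|x| -> g' t x = 0.
Proof. by move=> xM; rewrite /g' /f' /psi /q eta0// eta'0// mulr0 !addr0 subrr. Qed.

Let prt t : profile (psi t) (q t).
Proof.
split; [exact: ppsi|exact: (sqID mT1 sp (sqIZ mT1 t seta))|].
have ig : integT (g t) by have [] := prim_supp_integ (pg t) (@g0 t) (@g'0 t).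
by apply: (eq_integ mT1 _ (integD mT1 fi ig)) => x _; rewrite /f /g; ring.
Qed.

Let sg' t : sqI (g' t). Proof. exact: (sqIB mT1 (profile_sqI_f' (prt t)) sf'). Qed.

Let psi_cvg t : psi t x @[x --> -oo] --> c /\ psi t x @[x --> +oo] --> 0.
Proof.
have [_ h1 h2 _] := L; split.
- apply: cvg_trans h1; apply: near_eq_cvg; near=> x.
  rewrite /psi eta0 ?mulr0 ?addr0//.
  have : x < - M by near: x; apply: nbhs_ninfty_lt; exact: num_real.
  by move=> xM; rewrite ltr_normr; apply/orP; right; lra.
- apply: cvg_trans h2; apply: near_eq_cvg; near=> x.
  rewrite /psi eta0 ?mulr0 ?addr0//.
  have : M < x by near: x; apply: nbhs_pinfty_gt; exact: num_real.
  by move=> xM; rewrite ltr_normr xM.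
Unshelve. all: by end_near. Qed.

Let energy_le t : exists G D, [/\ harmonic_gradient f' G, harmonic_gradient (g' t) D &
  0 <= \int[mu]_x (q t x ^+ 2 + W2 h (psi t x)) - \int[mu]_x (p x ^+ 2 + W2 h (phi x))
       + 2 * << D, G >> + << D, D >>].
Proof.
have [_ _ _ hmin] := L; have [c1 c2] := psi_cvg t.
have := hmin _ _ (prt t) c1 c2.
have [G hG ->] := profile_energy pr h; have [Gt hGt ->] := profile_energy (prt t) h.
rewrite lee_fin => hle; exists G, (fieldB Gt G); split=> //.
  exact: (harmonic_diff (profile_sqI_f' (prt t)) sf' hGt hG).
have LG := hom_L2 hG.1; have LGt := hom_L2 hGt.1.
have e1 : << fieldB Gt G, G >> = << Gt, G >> - << G, G >> := ip_diffl LGt LG LG.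
have e2 : << fieldB Gt G, fieldB Gt G >> = << Gt, Gt >> - 2 * << Gt, G >> + << G, G >> := dist2E LGt LG.
rewrite e1 e2; move: hle; move: << Gt, Gt >> << G, G >> << Gt, G >> => A B C; lra.
Qed.

Let bounded_eta : exists B, forall x, `|eta x| <= B.
Proof. by apply: (prim_bounded peta); have [] := prim_supp_integ peta eta0 eta'0. Qed.

Let H := Hilb f.
Let hf : exists C, hold f C := prim_hold pf sf'.
Let cH : continuous H. Proof. by have [C hC] := hf; exact: (hold_cont (Hilb_hold fi hC)). Qed.
Let bounded_H : exists B, forall x, `|H x| <= B.
Proof. by have [C hC] := hf; exists (\int[mu]_s `|f s| + 6 * C) => x; exact: (Hilb_bounded fi hC). Qed.

Let isupp (F : R -> R) : loc F -> (forall x, M < `|x| -> F x = 0) -> integT F.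
Proof. exact: integ_supp. Qed.

(** [H] enters through [harmonic_pairing], with the variation of [cos phi] as
    compactly supported datum. *)
Definition first_variation x :=
  (p x + sin (phi x) * H x) * eta' x + (sin (phi x) * (h - cos (phi x)) + cos (phi x) * p x * H x) * eta x.

Let cs := cont_sin cphi.
Let cc := cont_cos cphi.

Let i1 : integT (fun x => p x * eta' x). Proof. exact: (sqIM mT1 sp seta). Qed.

Let i2 : integT (fun x => W2' h (phi x) * eta x).
Proof.
apply: isupp => [|x /eta0 ->]; last by rewrite mulr0.
apply: loc_cont => x; apply: cvgM; last exact: ceta.
apply: cvgM; first exact: cvg_cst.
by apply: cvgM; [exact: cs|apply: cvgB; [exact: cvg_cst|exact: cc]].
Qed.

Let v x := - cos (phi x) * eta x * p x - sin (phi x) * eta' x.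

Let lv : loc v.
Proof.
apply: locB.
  have : continuous (fun x => - cos (phi x) * eta x).
    by move=> x; apply: cvgM; [apply: cvgN; exact: cc|exact: ceta].
  by move=> /(locM lp); apply: eq_loc => x; rewrite mulrC.
by have := locM leta' cs; apply: eq_loc => x; rewrite mulrC.
Qed.

Let i3 : integT (fun x => v x * H x).
Proof.
apply: isupp => [|x xM]; last by rewrite /v eta0// eta'0// !(mulr0, mul0r) subrr mul0r.
exact: locM lv cH.
Qed.

Let first_variationE : \int[mu]_x first_variation x =
  \int[mu]_x (p x * eta' x) + 2^-1 * (\int[mu]_x (W2' h (phi x) * eta x)) - \int[mu]_x (v x * H x).
Proof.
rewrite -(RintegralZl 2^-1 mT1 i2) -(RintegralD mT1 i1 (integZ mT1 2^-1 i2)).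
rewrite -(RintegralB mT1 (integD mT1 i1 (integZ mT1 2^-1 i2)) i3).
by apply: eq_Rintegral => x _; rewrite /first_variation /v /W2'; field.
Qed.

(** The energy of [phi + t eta] is, up to [O(t^2)], linear in [t]. *)
Let quadratic : exists K, forall t, `|t| <= 1 -> 0 <= t * (\int[mu]_x first_variation x) + t ^+ 2 * K.
Proof.
have [Be hBe] := bounded_eta; have [BH hBH] := bounded_H.
have BH0 : 0 <= BH := le_trans (normr_ge0 _) (hBH 0).
have lpn := loc_norm lp; have len := loc_norm leta'.
have cen : continuous (fun x => `|eta x|) by move=> x; apply: cvg_norm; exact: ceta.
pose rr x := eta x ^+ 2 * `|p x| + `|eta x| * `|eta' x|.
have irr : integT rr.
  apply: isupp => [|x xM]; last by rewrite /rr eta0// normr0 expr0n !mul0r addr0.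
  apply: locD.
    have : continuous (fun x => eta x ^+ 2) by move=> x; apply: cvgM; exact: ceta.
    by move=> /(locM lpn); apply: eq_loc => x; rewrite mulrC.
  by have := locM len cen; apply: eq_loc => x; rewrite mulrC.
have mabs F : meas F -> meas (fun x => `|F x|) by move=> mF; exact: measurableT_comp.
have sw1 : sqI (fun x => `|eta x| * `|p x|).
  have sp' : sqI (fun x => `|p x|).
    apply: (sqI_le mT1 _ sp); first exact: (mabs _ (loc_meas lp)).
    by move=> x _; rewrite normr_id.
  apply: (sqI_bounded (M := Be) sp') => [|x]; last by rewrite normr_id.
  exact: continuous_measurable_fun.
have sw2 : sqI (fun x => `|eta' x|).
  apply: (sqI_le mT1 _ seta); first exact: (mabs _ (loc_meas leta')).
  by move=> x _; rewrite normr_id.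
have sw := sqID mT1 sw1 sw2.
pose S1 := \int[mu]_x (eta' x ^+ 2); pose S2 := \int[mu]_x (eta x ^+ 2).
pose S3 := \int[mu]_x rr x; pose S4 := \int[mu]_x ((`|eta x| * `|p x| + `|eta' x|) ^+ 2).
pose K := 2^-1 * S1 + 2^-1 * ((2 * `|h| + 4) * S2) + BH * S3 + 4^-1 * (S2 + S4).
exists K => t t1.
have [G [D [hG hD hle]]] := energy_le t.
have [C hC] := hf.
have sgt : sqI (g t) by have [] := prim_supp_integ (pg t) (@g0 t) (@g'0 t).
have eDG := harmonic_pairing ltr01 pf fi fi' hC hG (pg t) (sg' t) (@g0 t) (@g'0 t) hD.
have nD := harmonic_norm_le ltr01 (pg t) sgt (sg' t) hD.
have hg x : `|g t x| <= `|t| * `|eta x|.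
  by apply: (le_trans (cos_lip _ _)); rewrite /psi addrC addKr normrM.
have gE x : g' t x = - ((sin (psi t x) - sin (phi x)) * p x) - t * (sin (psi t x) * eta' x).
  by rewrite /g' /f' /q; ring.
have hg' x : `|g' t x| <= `|t| * (`|eta x| * `|p x| + `|eta' x|).
  rewrite gE mulrDr; apply: (le_trans (ler_normB _ _)); rewrite normrN; apply: lerD.
    rewrite normrM [leRHS]mulrA ler_wpM2r//; apply: (le_trans (sin_lip _ _)).
    by rewrite /psi addrC addKr normrM.
  by rewrite normrM ler_wpM2l// normrM ler_piMl// sin_norm_le1.
have n1 : \int[mu]_x (g t x ^+ 2) <= t ^+ 2 * S2.
  rewrite -(RintegralZl _ mT1 (sqI_integ sqeta)); apply: le_Rintegral => //.
  - exact: (sqI_integ sgt).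
  - exact: (integZ mT1 _ (sqI_integ sqeta)).
  - move=> x _; rewrite -exprMn -(real_normK (num_real (g t x))) -(real_normK (num_real (t * eta x))).
    by rewrite lerXn2r ?nnegrE// normrM.
have n2 : \int[mu]_x (g' t x ^+ 2) <= t ^+ 2 * S4.
  rewrite -(RintegralZl _ mT1 (sqI_integ sw)); apply: le_Rintegral => //.
  - exact: (sqI_integ (sg' t)).
  - exact: (integZ mT1 _ (sqI_integ sw)).
  - move=> x _; rewrite -exprMn -(real_normK (num_real (g' t x))).
    rewrite -(real_normK (num_real (t * _))) lerXn2r ?nnegrE//.
    have w0 : 0 <= `|eta x| * `|p x| + `|eta' x| by rewrite addr_ge0// mulr_ge0.
    by rewrite normrM (ger0_norm w0) hg'.
have q2 := sqI_integ (sqID mT1 sp (sqIZ mT1 t seta)).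
have iW := W2_integ pr h; have iWt := W2_integ (prt t) h.
have ip2 := sqI_integ sp; have ie2 := sqI_integ seta.
have d1 : \int[mu]_x (q t x ^+ 2 + W2 h (psi t x)) - \int[mu]_x (p x ^+ 2 + W2 h (phi x)) =
   2 * t * (\int[mu]_x (p x * eta' x)) + t ^+ 2 * S1 + \int[mu]_x (W2 h (psi t x) - W2 h (phi x)).
  rewrite (RintegralD mT1 q2 iWt) (RintegralD mT1 ip2 iW) (RintegralB mT1 iWt iW).
  have -> : \int[mu]_x (q t x ^+ 2) = \int[mu]_x ((p x ^+ 2 + 2 * t * (p x * eta' x)) + t ^+ 2 * eta' x ^+ 2).
    by apply: eq_Rintegral => x _; rewrite /q; ring.
  have j1 := integZ mT1 (2 * t) i1; have j2 := integZ mT1 (t ^+ 2) ie2.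
  rewrite (RintegralD mT1 (integD mT1 ip2 j1) j2) (RintegralD mT1 ip2 j1).
  rewrite (RintegralZl _ mT1 i1) (RintegralZl _ mT1 ie2) -/S1.
  move: (\int[mu]_x (p x ^+ 2)) (\int[mu]_x (p x * eta' x)) => A B; ring.
have iWW := integB mT1 iWt iW.
have d2 : \int[mu]_x (W2 h (psi t x) - W2 h (phi x)) <=
    t * (\int[mu]_x (W2' h (phi x) * eta x)) + t ^+ 2 * ((2 * `|h| + 4) * S2).
  have j1 := integZ mT1 t i2; have j2 := integZ mT1 (t ^+ 2 * (2 * `|h| + 4)) (sqI_integ sqeta).
  rewrite mulrA -(RintegralZl _ mT1 i2) -(RintegralZl _ mT1 (sqI_integ sqeta)) -(RintegralD mT1 j1 j2).
  apply: le_Rintegral => //; first exact: (integD mT1 j1 j2).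
  move=> x _; have := W2_taylor h (phi x) (t * eta x).
  by rewrite ler_norml /psi => /andP[_]; rewrite exprMn; lra.
have cgH : integT (fun x => g' t x * H x).
  apply: isupp => [|x xM]; last by rewrite g'0// mul0r.
  by apply: locM; [case: (pg t)|exact: cH].
have d3 : - (\int[mu]_x (g' t x * H x)) <= - (t * (\int[mu]_x (v x * H x))) + t ^+ 2 * (BH * S3).
  have j1 := integZ mT1 t i3; have j2 := integZ mT1 (t ^+ 2 * BH) irr.
  rewrite mulrA -(RintegralZl _ mT1 i3) -(RintegralZl _ mT1 irr) -lerBlDl opprK addrC.
  rewrite -(RintegralB mT1 j1 cgH); apply: le_Rintegral => //; first exact: (integB mT1 j1 cgH).
  move=> x _; apply: (le_trans (ler_norm _)).
  have -> : t * (v x * H x) - g' t x * H x =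
     (((sin (psi t x) - sin (phi x) - cos (phi x) * (t * eta x)) * p x) +
      t * ((sin (psi t x) - sin (phi x)) * eta' x)) * H x.
    by rewrite gE /v; ring.
  have -> : t ^+ 2 * BH * rr x = (t ^+ 2 * rr x) * BH by ring.
  rewrite normrM; apply: ler_pM => //; apply: (le_trans (ler_normD _ _)); rewrite /rr mulrDr; apply: lerD.
    by rewrite normrM [leRHS]mulrA ler_wpM2r// -exprMn; exact: sin_taylor.
  rewrite normrM normrM -(real_normK (num_real t)) expr2 -mulrA ler_wpM2l// [leRHS]mulrA ler_wpM2r//.
  by apply: (le_trans (sin_lip _ _)); rewrite /psi addrC addKr normrM.
rewrite first_variationE.
move: hle; rewrite d1 eDG; rewrite expr1n mul1r mulr1 in nD.
have nD' : << D, D >> <= 2^-1 * (t ^+ 2 * S2 + t ^+ 2 * S4).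
  by apply: (le_trans nD); rewrite mulrC ler_wpM2l//; exact: lerD.
rewrite /K -/H; move: nD' d2 d3; rewrite -/H.
move: (\int[mu]_x (g' t x * H x)) (\int[mu]_x (v x * H x)) (\int[mu]_x (W2' h (phi x) * eta x))
  (\int[mu]_x (W2 h (psi t x) - W2 h (phi x))) (\int[mu]_x (p x * eta' x)) << D, D >> => A B E0 F0 G0 D0.
move: ((2 * `|h| + 4) * S2) (BH * S3) => X Y.
move: (t ^+ 2) => T; lra.
Qed.

(** A function [t J + t^2 K] that is nonnegative near [0] has [J = 0]. *)
Lemma euler_lagrange_weak : \int[mu]_x first_variation x = 0.
Proof.
have [K hK] := quadratic; set J := \int[mu]_x _ in hK *.
have key s : `|s| = 1 -> 0 <= s * J.
  move=> s1; rewrite leNgt; apply/negP => sJ.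
  pose a := - (s * J); have a0 : 0 < a by rewrite /a; lra.
  pose r := Num.min 1 (a / (2 * (`|K| + 1))).
  have k0 : 0 < 2 * (`|K| + 1) by rewrite mulr_gt0// ltr_wpDl.
  have r0 : 0 < r by rewrite lt_min ltr01 divr_gt0.
  have rl : r <= 1 by rewrite ge_min lexx.
  have ra : r * (2 * (`|K| + 1)) <= a by rewrite -ler_pdivlMr// ge_min lexx orbT.
  have := hK (r * s); rewrite normrM s1 mulr1 ger0_norm ?(ltW r0)// => /(_ rl).
  have s2 : s ^+ 2 = 1 by rewrite -(real_normK (num_real s)) s1 expr1n.
  rewrite exprMn s2 mulr1 => h1.
  have h2 : r * s * J = - (r * a) by rewrite /a; ring.
  have h3 : r * K <= a / 2.
    have : r * K <= r * (`|K| + 1) by apply: ler_wpM2l; [exact: ltW|have := ler_norm K; lra].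
    lra.
  have h4 : r ^+ 2 * K = r * (r * K) by ring.
  have h5 : r * (r * K) <= r * (a / 2) by rewrite ler_wpM2l// ltW.
  have h6 : 0 < r * a by rewrite mulr_gt0.
  move: h1; rewrite h2 h4; lra.
have := key 1 ltac:(by rewrite normr1); have := key (-1) ltac:(by rewrite normrN normr1); lra.
Qed.

End Variation.

End EulerLagrange.

(** * Regularity of energy-minimising profiles *)

Section Regularity.
Context {R : realType}.
Local Notation mu := (@lebesgue_measure R).
Local Notation RM := (measurableTypeR R).
Local Notation meas g := (measurable_fun (setT : set RM) g).
Local Notation integT g := (mu.-integrable (setT : set RM) (EFin \o g)).
Local Notation sqI f := (sq_integrable mu (setT : set RM) f).
Implicit Types (x y t u v r e C M : R) (F g : R -> R).

Let mT1 : measurable (setT : set RM). Proof. exact: measurableT. Qed.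
Hint Resolve mT1 : core.

Lemma prim_exists g : loc g -> exists F, prim F g.
Proof.
move=> lg; exists (fun x => if 0 <= x then \int[mu]_(t in `[0, x]) g t else - \int[mu]_(t in `[x, 0]) g t).
split=> // a b ab; have [a0|a0] := leP 0 a; have [b0|b0] := leP 0 b.
- by rewrite (IntS lg a0 ab); ring.
- by move: (lt_le_trans b0 (le_trans a0 ab)); rewrite ltxx.
- by rewrite (IntS lg (ltW a0) b0) opprK addrC.
- by rewrite (IntS lg ab (ltW b0)); ring.
Qed.

Lemma supported_prim g M : 0 < M -> loc g -> (forall x, M < `|x| -> g x = 0) ->
  \int[mu]_(x in `[- M, M]) g x = 0 -> exists2 F, prim F g & forall x, M < `|x| -> F x = 0.
Proof.
move=> M0 lg g0 gM; have [F pF] := prim_exists lg.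
have zero a b : (forall x, a < x < b -> M < `|x|) -> \int[mu]_(x in `[a, b]) g x = 0.
  move=> h; have [ab|ba] := leP a b; last first.
    by rewrite set_itv_ge ?Rintegral_set0//= bnd_simp -ltNge.
  rewrite -(Rintegral_itv_obnd_cbnd); last first.
    by apply: (Int_sub (a := a) (b := b) lg); [exact: measurable_itv|exact: subset_itv_oc_cc].
  rewrite -Rintegral_itv_bndo_bndc; last first.
    by apply: (Int_sub (a := a) (b := b) lg); [exact: measurable_itv|exact: subset_itv_oo_cc].
  by apply: Rint_zero => x /=; rewrite in_itv /= => /h /g0.
exists (fun x => F x - F (- M)).
  by apply: eq_prim (primB pF (prim_cst (F (- M)))) => x //=; rewrite subr0.
have [_ h] := pF; move=> x; rewrite ltr_normr => /orP[xM|xM].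
- have -> : F x - F (- M) = (F x - F M) + (F M - F (- M)) by ring.
  rewrite !h ?gM ?addr0 ?(ltW xM) ?ge0_cp//; last lra.
  by apply: zero => y /andP[y1 _]; rewrite ltr_normr y1.
- rewrite -opprB h ?zero ?oppr0//; last lra.
  by move=> y /andP[_ y1]; rewrite ltr_normr; apply/orP; right; lra.
Qed.

Lemma indic_itv_Int (a b M : R) : a <= b -> - M <= a -> b <= M -> forall f, loc f ->
  \int[mu]_(x in `[- M, M]) (f x * \1_(`[a, b]) x) = \int[mu]_(x in `[a, b]) f x.
Proof.
move=> ab Ma bM f lf; rewrite Rintegral_mkcond [RHS]Rintegral_mkcond; apply: eq_Rintegral => x _.
rewrite !patchE indicE; case: ifPn => xM; case: ifPn => xab; rewrite ?mulr1 ?mulr0//.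
exfalso; move: xM xab; rewrite notin_setE inE /= !in_itv /= => h /andP[h1 h2]; apply: h.
by rewrite (le_trans Ma h1) (le_trans h2 bM).
Qed.

Lemma loc_indic (a b : R) : loc (\1_(`[a, b]) : R -> R).
Proof.
apply: (meas_loc_bnd (M := fun _ _ => 1)); first exact: measurable_indic.
by move=> _ _ x _; rewrite indicE; case: (_ \in _); rewrite ?normr1 ?normr0.
Qed.

(** A large value persists on an interval of length one, where it contributes
    more than the integral of [g^2] allows. *)
Lemma hold_sqI_bounded g C : hold g C -> sqI g -> exists B, forall x, `|g x| <= B.
Proof.
move=> hg sg; have i2 := sqI_integ sg; have C0 := hold_ge0 hg; have cg := hold_cont hg.
pose S := \int[mu]_x (g x ^+ 2); have S0 : 0 <= S by apply: Rint_ge0 => x _; exact: sqr_ge0.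
exists (2 * C + 1 + S) => x; rewrite leNgt; apply/negP => gx.
pose a := `|g x| - 2 * C; have a1 : 1 + S < a by rewrite /a; lra.
have low y : x <= y <= x + 1 -> a ^+ 2 <= g y ^+ 2.
  move=> /andP[y1 y2]; have h := hg 0%N x y; rewrite dy0 divr1 in h.
  have d1 : `|x - y| <= 1 by rewrite ler_norml; apply/andP; split; lra.
  have h2 : C * (1 + `|x - y|) <= C * 2 by apply: ler_wpM2l => //; lra.
  have := lerB_dist (g x) (g y); rewrite -(real_normK (num_real (g y))) => h3.
  by rewrite lerXn2r ?nnegrE//; [rewrite /a in a1 *; lra|rewrite /a; lra].
have xx1 : x <= x + 1 by lra.
have l2 : loc (fun y => g y ^+ 2) := loc_integ i2.
have : a ^+ 2 <= S.
  apply: (@le_trans _ _ (\int[mu]_(y in `[x, x + 1]) (g y ^+ 2))).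
    have -> : a ^+ 2 = \int[mu]_(y in `[x, x + 1]) (a ^+ 2) by rewrite Int_cst//; ring.
    apply: le_Rintegral => //; first exact: (@loc_cont _ (fun _ => a ^+ 2) (fun y => cvg_cst _) x (x + 1)).
  rewrite Rintegral_mkcond; apply: le_Rintegral => //.
    by have := (@integrable_mkcond _ RM R mu _ (EFin \o (fun x => g x ^+ 2)) (mitv x (x + 1))).1 (l2 _ _);
       rewrite restrict_EFin.
  by move=> t _; rewrite patchE; case: ifP => _ /=; [exact: lexx|exact: sqr_ge0].
nra.
Qed.

Section Least.
Variables (h c : R) (phi : R -> R).

Let f x := cos (phi x) - 1.
Let H := Hilb f.

(** The factor of the variation itself in [first_variation], as opposed to
    that of its derivative. *)
Definition force (p : R -> R) x := sin (phi x) * (h - cos (phi x)) + cos (phi x) * p x * H x.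

(** Du Bois-Reymond's argument: the variations are those whose derivative is a
    combination of the indicators of [[a, b]] and of [[0, 1]], of total
    integral zero. *)
Lemma euler_lagrange_integrated p : least h c phi p ->
  exists K c0, prim K (force p) /\ prim phi (fun x => c0 + K x - sin (phi x) * H x).
Proof.
move=> L; have [pr _ _ _] := L; have [pphi sp fi] := pr; have [lp hphi] := pphi.
have cphi := prim_cont pphi; have cs := cont_sin cphi; have cc := cont_cos cphi.
have [C hf] := prim_hold (profile_prim pr) (profile_sqI_f' pr).
have cH : continuous H := hold_cont (Hilb_hold fi hf).
have lF : loc (force p).
  apply: locD.
    by apply: loc_cont => x; apply: cvgM; [exact: cs|apply: cvgB; [exact: cvg_cst|exact: cc]].
  have : continuous (fun x => cos (phi x) * H x) by move=> x; apply: cvgM; [exact: cc|exact: cH].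
  by move=> /(locM lp); apply: eq_loc => x; ring.
have [K pK] := prim_exists lF; have cK := prim_cont pK.
pose Q x := p x + sin (phi x) * H x - K x.
have lQ : loc Q.
  apply: locB; last exact: loc_cont.
  by apply: locD => //; apply: loc_cont => x; apply: cvgM; [exact: cs|exact: cH].
pose c0 := \int[mu]_(x in `[0, 1]) Q x.
exists K, c0; split=> //.
have key a b : a <= b -> \int[mu]_(x in `[a, b]) Q x = c0 * (b - a).
  move=> ab; pose M := `|a| + `|b| + 1.
  have M0 : 0 < M by rewrite ltr_wpDl// addr_ge0.
  have Ma : - M <= a by have := ler_norm (- a); rewrite normrN /M; have := normr_ge0 b; lra.
  have bM : b <= M by have := ler_norm b; rewrite /M; have := normr_ge0 a; lra.
  have M1 : 1 <= M by rewrite /M lerDr addr_ge0.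
  have M01 : - M <= 0 by lra.
  pose eta' x : R := \1_(`[a, b]) x - (b - a) * \1_(`[0, 1]) x.
  have leta : loc eta' by apply: locB; [exact: loc_indic|apply: locZ; exact: loc_indic].
  have eta'0 x : M < `|x| -> eta' x = 0.
    move=> xM; rewrite /eta' !indicE.
    have out u v : - M <= u -> v <= M -> (x \in `[u, v]%classic) = false.
      move=> Mu vM; apply/negP; rewrite inE /= in_itv /= => /andP[h1 h2]; move: xM.
      by rewrite ltNge ler_norml (le_trans Mu h1) (le_trans h2 vM).
    by rewrite !out// mulr0 subrr.
  have l1 : loc (fun _ : R => 1) by apply: loc_cont => x; exact: cvg_cst.
  have split_Int F : loc F -> \int[mu]_(x in `[- M, M]) (F x * eta' x) =
      \int[mu]_(x in `[a, b]) F x - (b - a) * \int[mu]_(x in `[0, 1]) F x.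
    move=> lF'; have j1 : loc (fun x => F x * \1_(`[a, b]) x).
      apply: (locMb (M := 1) lF' (loc_meas (@loc_indic _ _))) => x.
      by rewrite indicE; case: (_ \in _); rewrite ?normr1 ?normr0.
    have j2 : loc (fun x => F x * \1_(`[0, 1]) x).
      apply: (locMb (M := 1) lF' (loc_meas (@loc_indic _ _))) => x.
      by rewrite indicE; case: (_ \in _); rewrite ?normr1 ?normr0.
    rewrite -(indic_itv_Int ab Ma bM lF') -(indic_itv_Int ler01 M01 M1 lF').
    rewrite -(RintegralZl _ (mitv _ _) (j2 _ _)).
    have j3 : loc (fun x => (b - a) * (F x * \1_(`[0, 1]) x)) by exact: locZ.
    rewrite -(RintegralB (mitv _ _) (j1 _ _) (j3 _ _)).
    by apply: eq_Rintegral => x _; rewrite /eta'; ring.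
  have eta_mean : \int[mu]_(x in `[- M, M]) eta' x = 0.
    have := split_Int _ l1; rewrite !Int_cst// subr0 !mul1r mulr1 subrr => <-.
    by apply: eq_Rintegral => x _; rewrite mul1r.
  have [eta peta eta0] := supported_prim M0 leta eta'0 eta_mean.
  have seta : sqI eta'.
    apply: (integ_sqI mT1); first exact: loc_meas.
    apply: (@integ_supp _ _ M) => [|x /eta'0 ->]; last by rewrite expr0n.
    apply: (meas_loc_bnd (M := fun _ _ => (1 + `|b - a|) ^+ 2)); first by apply: measurable_funX; exact: loc_meas.
    move=> _ _ x _; rewrite normrX lerXn2r ?nnegrE ?addr_ge0//.
    apply: (le_trans (ler_normB _ _)); rewrite normrM; apply: lerD.
      by rewrite indicE; case: (_ \in _); rewrite ?normr1 ?normr0.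
    by rewrite indicE; case: (_ \in _); rewrite ?normr1 ?normr0 ?mulr1 ?mulr0.
  have := euler_lagrange_weak L peta seta eta0 eta'0.
  have lP : loc (fun x => p x + sin (phi x) * H x).
    by apply: locD => //; apply: loc_cont => x; apply: cvgM; [exact: cs|exact: cH].
  have ceta := prim_cont peta.
  have lPe : loc (fun x => (p x + sin (phi x) * H x) * eta' x).
    apply: (locMb (M := 1 + `|b - a|)) => //; first exact: loc_meas.
    move=> x; apply: (le_trans (ler_normB _ _)); rewrite normrM; apply: lerD.
      by rewrite indicE; case: (_ \in _); rewrite ?normr1 ?normr0.
    by rewrite indicE; case: (_ \in _); rewrite ?normr1 ?normr0 ?mulr1 ?mulr0.
  have iPe : integT (fun x => (p x + sin (phi x) * H x) * eta' x).
    by apply: (integ_supp lPe) => x /eta'0 ->; rewrite mulr0.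
  have iFe : integT (fun x => force p x * eta x).
    by apply: (integ_supp (M := M)) => [|x /eta0 ->]; [exact: locM|rewrite mulr0].
  have iKe : integT (fun x => K x * eta' x).
    apply: (integ_supp (M := M)) => [|x /eta'0 ->]; last by rewrite mulr0.
    by have := locM leta cK; apply: eq_loc => x; rewrite mulrC.
  rewrite (RintegralD mT1 iPe iFe) (prim_ibp_supp pK peta eta0 eta'0) -(RintegralB mT1 iPe iKe).
  have -> : \int[mu]_x ((p x + sin (phi x) * H x) * eta' x - K x * eta' x) = \int[mu]_x (Q x * eta' x).
    by apply: eq_Rintegral => x _; rewrite /Q; ring.
  rewrite (@Rint_supp _ _ M) => [|x /eta'0 ->]; last by rewrite mulr0.
  rewrite (split_Int _ lQ) -/c0; lra.
split.
  apply: loc_cont => x; apply: cvgB; last by apply: cvgM; [exact: cs|exact: cH].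
  by apply: cvgD; [exact: cvg_cst|exact: cK].
move=> a b ab; rewrite hphi//.
have lR : loc (fun x => K x - sin (phi x) * H x).
  by apply: loc_cont => x; apply: cvgB; [exact: cK|apply: cvgM; [exact: cs|exact: cH]].
have -> : \int[mu]_(x in `[a, b]) p x = \int[mu]_(x in `[a, b]) (Q x + (K x - sin (phi x) * H x)).
  by apply: eq_Rintegral => x _; rewrite /Q; ring.
rewrite (RintegralD (mitv a b) (lQ a b) (lR a b)) key// -(Int_cst c0 ab).
have lc : loc (fun _ : R => c0) by apply: loc_cont => x; exact: cvg_cst.
rewrite -(RintegralD (mitv a b) (lc a b) (lR a b)); apply: eq_Rintegral => x _; ring.
Qed.

Lemma sin_hold C : hold phi C -> hold (fun x => sin (phi x)) C.
Proof.
by move=> hphi; have := hold_lip (M := 1) (P := sin) _ ler01 hphi; rewrite mul1r; apply=> x y; rewrite mul1r sin_lip.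
Qed.

(** The integrated equation exhibits a density made of a primitive and of
    [sin phi * H], all of whose constituents are Holder continuous. *)
Lemma least_C1 p : least h c phi p -> exists q : R -> R,
  [/\ least h c phi q, (exists C, hold q C) & (exists B, forall x, `|q x| <= B)].
Proof.
move=> L; have [pr l1 l2 l3] := L; have [pphi sp fi] := pr.
have cphi := prim_cont pphi; have cs := cont_sin cphi; have cc := cont_cos cphi.
have [C hf] := prim_hold (profile_prim pr) (profile_sqI_f' pr).
have cH : continuous H := hold_cont (Hilb_hold fi hf).
have HB x : `|H x| <= \int[mu]_s `|f s| + 6 * C by exact: (Hilb_bounded fi hf).
have [K [c0 [pK pq]]] := euler_lagrange_integrated L.
set q := (fun x => _) in pq; exists q.
have sq : sqI q := prim_ae_sqr pphi pq sp.
have prq : profile phi q by split.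
have sK : sqI (force p).
  have s1 : sqI (fun x => (h - cos (phi x)) * sin (phi x)).
    apply: (sqI_bounded (M := `|h| + 1) (profile_sqI_sin pr)).
      by apply: continuous_measurable_fun => x; apply: cvgB; [exact: cvg_cst|exact: cc].
    by move=> x; apply: (le_trans (ler_normB _ _)); rewrite lerD2l cos_max.
  have s2 : sqI (fun x => H x * (cos (phi x) * p x)).
    by apply: (sqI_bounded (profile_sqI_cosp pr) _ HB); exact: continuous_measurable_fun.
  have := sqID mT1 s1 s2; congr sq_integrable; apply/funext => x; rewrite /force; ring.
have [CK hK] := prim_hold pK sK; have [Cp hp] := prim_hold pphi sp.
have hs := sin_hold hp.
have hq : exists C, hold q C.
  have hm := holdM hs (Hilb_hold fi hf) (fun x => sin_norm_le1 (phi x)) HB.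
  have [C' hh] : exists C', hold (fun x => K x - sin (phi x) * H x) C'.
    by eexists; exact: (holdD hK (holdN hm)).
  exists C' => n x y; have := hh n x y.
  by have -> : q x - q y = K x - sin (phi x) * H x - (K y - sin (phi y) * H y) by rewrite /q; ring.
split=> //.
by have [Cq hq'] := hq; exact: (hold_sqI_bounded hq' sq).
Qed.

(** [f'] is now Holder continuous, so that [H] is differentiable and so is
    every term of the integrated equation; the terms in [H] itself cancel and
    only [H' = Hilb f'] is left. *)
Lemma least_C2 p : least h c phi p -> exists q : R -> R,
  let f' := (fun x => - sin (phi x) * q x) in
  [/\ least h c phi q, (exists C, hold f' C),
      (forall x, is_derive x 1 phi (q x)) &
      (forall x, is_derive x 1 q (sin (phi x) * (h - cos (phi x) - Hilb f' x)))].
Proof.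
move=> L0; have [q [L [Cq hq] [B qB]]] := least_C1 L0.
exists q => f'; have [pr l1 l2 l3] := L; have [pphi sp fi] := pr.
have cphi := prim_cont pphi; have cs := cont_sin cphi; have cc := cont_cos cphi.
have cq := hold_cont hq.
have [C hf] := prim_hold (profile_prim pr) (profile_sqI_f' pr).
have cH : continuous H := hold_cont (Hilb_hold fi hf).
have [Cp hp] := prim_hold pphi sp.
have hf' : hold f' (Cp * B + Cq * 1).
  apply: (holdM (holdN (sin_hold hp)) hq) => // x; by rewrite normrN sin_norm_le1.
have dphi x : is_derive x 1 phi (q x) by exact: (prim_derive pphi (@cq x)).
have fi' := profile_integ_f' pr.
have cH' : continuous (Hilb f') := hold_cont (Hilb_hold fi' hf').
have pH := Hilb_prim (profile_prim pr) fi fi' hf hf'.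
have dH x : is_derive x 1 H (Hilb f' x) := prim_derive pH (@cH' x).
have [K [c0 [pK pq]]] := euler_lagrange_integrated L.
have cK := prim_cont pK.
have cF : continuous (force q).
  move=> x; apply: cvgD; first by apply: cvgM; [exact: cs|apply: cvgB; [exact: cvg_cst|exact: cc]].
  by apply: cvgM; [apply: cvgM; [exact: cc|exact: cq]|exact: cH].
have dK x : is_derive x 1 K (force q x) := prim_derive pK (@cF x).
have qE x : q x = c0 + K x - sin (phi x) * H x.
  have cR : continuous (fun x => c0 + K x - sin (phi x) * H x).
    move=> y; apply: cvgB; last by apply: cvgM; [exact: cs|exact: cH].
    by apply: cvgD; [exact: cvg_cst|exact: cK].
  by have [_ <-] := dphi x; have [_ <-] := prim_derive pq (@cR x).
split=> //; first by exists (Cp * B + Cq * 1).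
move=> x; have ds := der_comp (dphi x) (is_derive_sin (phi x)).
have := derB (derD (der_cst c0 x) (dK x)) (derM ds (dH x)).
move=> d; apply: is_derive_ext (fun y => esym (qE y)) (is_derive_val d _).
rewrite /force; ring.
Qed.

End Least.

End Regularity.

(** * From minimisers to energy-minimising profiles *)

Section Positivity.
Context {R : realType}.
Local Notation mu := (@lebesgue_measure R).
Local Notation mu2 := (@lebesgue_measure R \x @lebesgue_measure R)%E.
Local Notation RM := (measurableTypeR R).
Local Notation meas g := (measurable_fun (setT : set RM) g).
Local Notation integT g := (mu.-integrable (setT : set RM) (EFin \o g)).
Local Notation sqI f := (sq_integrable mu (setT : set RM) f).
Local Notation "<< G , H >>" := (ip mu2 half_plane G H).
Implicit Types (x y t r e C M : R) (F f phi psi p q E : R -> R).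

Let mT1 : measurable (setT : set RM). Proof. exact: measurableT. Qed.
Hint Resolve mT1 : core.

(** The density of a lifting is given by one formula for all liftings, so that
    the difference of two liftings has density zero. *)
Lemma liftings_parallel m phi psi : H1loc_circle m -> is_lifting m phi -> is_lifting m psi ->
  exists k, forall x, psi x = phi x + k.
Proof.
move=> [h1 h2 _] [cphi E1] [cpsi E2].
have [g1 [w1 _]] := h1; have [g2 [w2 _]] := h2.
have c1 x : comp1 m x = cos (phi x) by rewrite /comp1 E1.
have c2 x : comp2 m x = sin (phi x) by rewrite /comp2 E1.
have d1 x : comp1 m x = cos (psi x) by rewrite /comp1 E2.
have d2 x : comp2 m x = sin (psi x) by rewrite /comp2 E2.
have p1 : prim (comp1 m) g1.
  by apply: weak_prim w1; rewrite (funext c1); exact: cont_cos.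
have p2 : prim (comp2 m) g2.
  by apply: weak_prim w2; rewrite (funext c2); exact: cont_sin.
have P := lift_prim cphi (eq_prim c1 (fun=> erefl) p1) (eq_prim c2 (fun=> erefl) p2).
have Q := lift_prim cpsi (eq_prim d1 (fun=> erefl) p1) (eq_prim d2 (fun=> erefl) p2).
have D : prim (fun x => psi x - phi x) (fun _ => 0).
  apply: eq_prim (primB Q P) => x //.
  by rewrite -c1 -c2 -d1 -d2 subrr.
exists (psi 0 - phi 0) => x.
have [_ hD] := D.
have [h|h] := leP 0 x.
  have := hD _ _ h; rewrite Int_cst//; lra.
have := hD _ _ (ltW h); rewrite Int_cst ?ltW//; lra.
Qed.

(** The degree and the limit at plus infinity determine the limit at minus
    infinity, and every profile with these limits is admissible. *)
Lemma minimiser_least h (d : nat) m phi : is_minimiser h (- d%:Z) m -> is_lifting m phi ->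
  phi x @[x --> +oo] --> 0 -> m = circ phi /\ exists p, least h (2 * pi * d%:R) phi p.
Proof.
move=> [[hl hf [phi0 [k [l [lift0 lk ll dE]]]]] hm] lift hlim.
have [mE [p pr]] := lifting_profile hl hf lift.
split=> //; exists p.
have [c cE] := liftings_parallel hl lift lift0.
have cl : c = 2 * pi * l%:~R.
  have h1 : phi0 x @[x --> +oo] --> c.
    have : phi x + c @[x --> +oo] --> 0 + c by apply: cvgD => //; exact: cvg_cst.
    by rewrite add0r (funext cE).
  by apply: (cvg_unique _ h1 ll); exact: Rhausdorff.
have dR : (d%:R : R) = k%:~R - l%:~R.
  have : - ((- d%:Z)%:~R : R) = - (l - k)%:~R by rewrite dE.
  by rewrite rmorphN opprK rmorphB opprB.
have hlm : phi x @[x --> -oo] --> 2 * pi * d%:R.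
  have : phi0 x - c @[x --> -oo] --> 2 * pi * k%:~R - c by apply: cvgB => //; exact: cvg_cst.
  have -> : 2 * pi * k%:~R - c = 2 * pi * d%:R by rewrite cl dR; ring.
  suff -> : phi = (fun x => phi0 x - c) by [].
  by apply/funext => x; rewrite cE addrK.
split; [exact: pr|exact: hlm|exact: hlim|] => psi q pq l1 l2.
have A : admissible (- d%:Z) (circ psi).
  apply: (@profile_admissible _ _ _ pq (- d%:Z) d%:Z 0).
  - by rewrite -pmulrn; exact: l1.
  - by rewrite mulr0; exact: l2.
  - by rewrite sub0r.
rewrite -mE hm; apply: ereal_inf_lbound; exists (circ psi); [exact: A|by []].
Qed.

(** Both fields pair identically with all gradients, hence with each other. *)
Lemma harmonic_energy_unique w G D : harmonic_gradient w G -> harmonic_gradient w D ->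
  << G, G >> = << D, D >>.
Proof.
move=> [hG eG] [hD eD].
have E z : test_function2 z -> << G, grad z >> = << D, grad z >> by move=> tz; rewrite (eG z tz) (eD z tz).
rewrite (closure_ip hG (hom_L2 hG) (hom_L2 hD) E) ipC.
by rewrite (closure_ip hD (hom_L2 hG) (hom_L2 hD) E).
Qed.

(** * Reflection after a zero *)

Definition flip x0 (a : R -> R) x := if x <= x0 then a x else - a x.

Lemma cos_flip x0 phi x : cos (flip x0 phi x) = cos (phi x).
Proof. by rewrite /flip; case: ifP => // _; rewrite cosN. Qed.

(** Continuity at [x0] is where the zero of [phi] is used; at this one point
    the two formulas for the density disagree, on a null set. *)
Lemma flip_prim x0 phi p : prim phi p -> phi x0 = 0 -> prim (flip x0 phi) (flip x0 p).
Proof.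
move=> [lp pp] z0.
have lf : loc (flip x0 p).
  move=> a b; have := @locMb _ 1 p (fun x => if x <= x0 then 1 else -1) lp.
  have ms : meas (fun x => if x <= x0 then 1 else -1 : R).
    apply: measurable_fun_if => //=; first exact: measurable_fun_ler.
  move=> /(_ ms) h; apply: (eq_loc _ (h _)) => x.
    by rewrite /flip; case: ifP; rewrite ?mulr1 ?mulrN1.
  by case: ifP; rewrite ?normrN normr1.
have left a b : a <= b -> b <= x0 -> flip x0 phi b - flip x0 phi a = \int[mu]_(x in `[a, b]) flip x0 p x.
  move=> ab bx; rewrite /flip bx (le_trans ab bx) pp//.
  apply: eq_Rintegral => x; rewrite inE/= in_itv/= => /andP[_ xb].
  by rewrite (le_trans xb bx).
have right a b : x0 <= a -> a <= b -> flip x0 phi b - flip x0 phi a = \int[mu]_(x in `[a, b]) flip x0 p x.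
  move=> xa ab.
  have F x : x0 <= x -> flip x0 phi x = - phi x.
    by rewrite /flip le_eqVlt => /orP[/eqP <-|]; [rewrite lexx z0 oppr0|rewrite ltNge => /negbTE ->].
  rewrite (F _ xa) (F _ (le_trans xa ab)).
  have -> : - phi b - - phi a = (-1) * (phi b - phi a) by ring.
  rewrite pp// -(RintegralZl (-1) (mitv a b) (lp a b)).
  have oc f : loc f -> \int[mu]_(x in `[a, b]) f x = \int[mu]_(x in `]a, b]) f x.
    move=> lf1; rewrite Rintegral_itv_obnd_cbnd//.
    by apply: integrableS (lf1 a b) => //=; apply: subset_itvr; rewrite bnd_simp.
  rewrite (oc _ lf) (oc (fun x => -1 * p x)); last first.
    by apply: (eq_loc (f := fun x => p x * -1)) => [x|]; [ring|apply: locM lp _ => y; exact: cvg_cst].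
  apply: eq_Rintegral => x; rewrite inE/= in_itv/= => /andP[ax _].
  by rewrite /flip leNgt (le_lt_trans xa ax) mulN1r.
split=> // a b ab.
have [bx|xb] := leP b x0; first exact: left.
have [xa|ax] := leP x0 a; first exact: right.
rewrite (IntS lf (ltW ax) (ltW xb)) -(left _ _ (ltW ax) (lexx _)) -(right _ _ (lexx _) (ltW xb)); ring.
Qed.


(** Reflecting the part of a profile after one of its zeros leaves the cosine,
    hence the energy, unchanged. *)
Lemma flip_least h c x0 phi p : least h c phi p -> phi x0 = 0 -> least h c (flip x0 phi) (flip x0 p).
Proof.
move=> [[pphi sp fi] l1 l2 l3] z0; have pf := flip_prim pphi z0.
have pr : profile phi p by split.
have P : profile (flip x0 phi) (flip x0 p).
  split; first exact: pf.
    have [/loc_meas mf _] := pf.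
    by apply: (sqI_le mT1 mf sp) => x _; rewrite /flip; case: ifP => // _; rewrite normrN.
  by apply: (eq_integ mT1 _ fi) => x _ /=; rewrite cos_flip.
split; first exact: P.
- apply: cvg_trans l1; apply: near_eq_cvg; near=> x; rewrite /flip.
  have -> // : x <= x0; near: x; apply: nbhs_ninfty_le; exact: num_real.
- have : - phi x @[x --> +oo] --> - 0 by apply: cvgN; exact: l2.
  rewrite oppr0; apply: cvg_trans; apply: near_eq_cvg; near=> x; rewrite /flip leNgt.
  have -> // : x0 < x; near: x; apply: nbhs_pinfty_gt; exact: num_real.
suff En : energy h (circ (flip x0 phi)) = energy h (circ phi).
  by move=> psi q pq m1 m2; rewrite En; exact: l3 pq m1 m2.
have [D hD ->] := profile_energy P h; have [G hG ->] := profile_energy pr h.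
have E : (fun x => - sin (flip x0 phi x) * flip x0 p x) = (fun x => - sin (phi x) * p x).
  by apply/funext => x; rewrite /flip; case: ifP => // _; rewrite sinN; ring.
rewrite E in hD; rewrite (harmonic_energy_unique hD hG).
congr (_%:E); congr (_ + _); congr (_ * _); apply: eq_Rintegral => x _.
by rewrite /W2 cos_flip; congr (_ + _); rewrite /flip; case: ifP => // _; rewrite sqrrN.
Unshelve. all: by end_near. Qed.

Lemma is_derive_uniq F x (a b : R) : is_derive x 1 F a -> is_derive x 1 F b -> a = b.
Proof. by move=> [_ <-] [_ <-]. Qed.

(** A reflected profile is again least, hence differentiable: it cannot have a
    corner. *)
Lemma least_zero h c x0 phi p q : least h c phi p -> phi x0 = 0 ->
  (forall x, is_derive x 1 phi (q x)) -> continuous q -> q x0 = 0.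
Proof.
move=> L z0 dphi cq.
have [q2 [_ _ d2 dq2]] := least_C2 (flip_least L z0).
have cq2 := derive_cont dq2.
have left x : x < x0 -> q x = q2 x.
  move=> xx; apply: (is_derive_uniq _ (d2 x)); apply: der_local (dphi x).
  near=> y; rewrite /flip; have -> // : y <= x0; apply: ltW; near: y.
  by apply: lt_nbhsl.
have right x : x0 < x -> - q x = q2 x.
  move=> xx; apply: (is_derive_uniq _ (d2 x)); apply: der_local (derN (dphi x)).
  near=> y; rewrite /flip leNgt; have -> // : x0 < y; near: y.
  by apply: lt_nbhsr.
have cn := @nat_inv0 R 1.
have u1 : (fun n : nat => x0 - 1 / n.+1%:R) @ \oo --> x0.
  by have := cvg_sub (@cvg_const R x0) cn; rewrite subr0.
have u2 : (fun n : nat => x0 + 1 / n.+1%:R) @ \oo --> x0.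
  by have := cvg_add (@cvg_const R x0) cn; rewrite addr0.
have E1 : q x0 = q2 x0.
  apply: (cvg_uniq (seq_cont cq u1)).
  apply: cvg_ext (seq_cont cq2 u1) => n /=; rewrite left//.
  by rewrite ltrBlDr ltrDl divr_gt0.
have E2 : - q x0 = q2 x0.
  apply: (cvg_uniq (cvg_opp (seq_cont cq u2))).
  apply: cvg_ext (seq_cont cq2 u2) => n /=; rewrite right//.
  by rewrite ltrDl divr_gt0.
lra.
Unshelve. all: by end_near. Qed.

(** * Differential inequalities *)

Lemma mean_value F f a b : a < b -> (forall x, is_derive x 1 F (f x)) ->
  exists2 t, a < t < b & F b - F a = f t * (b - a).
Proof.
move=> ab dF; have cF := derive_cont dF.
have [t tab E] := @MVT R F f a b ab (fun x _ => dF x) (continuous_subspaceT cF).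
by exists t => //; move: tab; rewrite in_itv.
Qed.

Lemma der_nincr F f a b : a <= b -> (forall x, is_derive x 1 F (f x)) ->
  (forall x, a <= x <= b -> f x <= 0) -> F b <= F a.
Proof.
rewrite le_eqVlt => /orP[/eqP ->//|ab] dF f0.
have [t /andP[at1 tb] E] := mean_value ab dF.
have : f t * (b - a) <= 0 by rewrite mulr_le0_ge0 ?subr_ge0 ?(ltW ab)// f0// !ltW.
by rewrite -E subr_le0.
Qed.

Lemma der_ndecr F f a b : a <= b -> (forall x, is_derive x 1 F (f x)) ->
  (forall x, a <= x <= b -> 0 <= f x) -> F a <= F b.
Proof.
move=> ab dF f0; rewrite -lerN2.
apply: (der_nincr ab (fun x => derN (dF x))) => x /f0; by rewrite oppr_le0.
Qed.

Lemma der_expM s F f x : is_derive x 1 F (f x) ->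
  is_derive x 1 (fun y => F y * expR (s * y)) ((f x + s * F x) * expR (s * x)).
Proof.
move=> dF; have de := der_comp (derZ s (der_id x)) (der_exp (s * x)).
by apply: is_derive_val (derM dF de) _; ring.
Qed.

(** [E e^{- K x}] is nonincreasing and [E e^{K x}] is nondecreasing. *)
Lemma gronwall0 K E E' x0 : (forall x, is_derive x 1 E (E' x)) -> (forall x, 0 <= E x) ->
  (forall x, `|E' x| <= K * E x) -> E x0 = 0 -> forall x, E x = 0.
Proof.
move=> dE E0 hE z x; apply/eqP; rewrite eq_le E0 andbT.
have [xx|xx] := leP x0 x.
  have := der_nincr xx (fun y => der_expM (- K) (dE y)) _.
  rewrite z mul0r pmulr_lle0 ?expR_gt0//; apply=> y _.
  rewrite pmulr_lle0 ?expR_gt0//; have := hE y; rewrite ler_norml => /andP[_]; lra.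
have := der_ndecr (ltW xx) (fun y => der_expM K (dE y)) _.
rewrite z mul0r pmulr_lle0 ?expR_gt0//; apply=> y _.
rewrite pmulr_lge0 ?expR_gt0//; have := hE y; rewrite ler_norml => /andP[+ _]; lra.
Qed.

(** At a zero the derivative would vanish as well, and by uniqueness for the
    second-order equation the profile would vanish identically; so its sign is
    that of its limit at minus infinity. *)
Lemma least_positive h c phi p : 0 < c -> least h c phi p -> forall x, 0 < phi x.
Proof.
move=> c0 L.
have [q [Lq [C hC] d1 d2]] := least_C2 L.
have [pr l1 l2 _] := Lq.
have cphi := derive_cont d1; have cq := derive_cont d2.
have neg : exists y0, forall y, y <= y0 -> 0 < phi y.
  have : \forall y \near -oo, 0 < phi y by apply: (cvgr_gt c).
  by move=> [y0 [_ hy]]; exists (y0 - 1) => y yy; apply: hy; lra.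
have [y0 hy0] := neg.
have no0 x : phi x != 0.
  apply/negP => /eqP zx; have qx := least_zero L zx d1 cq.
  set f' := (fun x => - sin (phi x) * q x) in hC d2.
  have fi := profile_integ_f' pr.
  have VB y : `|h - cos (phi y) - Hilb f' y| <= `|h| + 1 + (\int[mu]_s `|f' s| + 6 * C).
    apply: (le_trans (ler_normB _ _)); apply: lerD; last exact: (Hilb_bounded fi hC).
    by apply: (le_trans (ler_normB _ _)); rewrite lerD2l cos_max.
  move: (`|h| + 1 + _) VB => B VB.
  pose E y := phi y ^+ 2 + q y ^+ 2.
  have dE y := derD (derX 1 (d1 y)) (derX 1 (d2 y)).
  have Z := gronwall0 (K := 1 + B) dE.
  have Ez : E x = 0 by rewrite /E zx qx expr0n addr0.
  have : E (Num.min y0 x) = 0.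
    apply: Z Ez _ => y; first by rewrite addr_ge0 ?sqr_ge0.
    have sb : `|sin (phi y)| <= `|phi y| by have := sin_lip (phi y) 0; rewrite sin0 !subr0.
    move: sb (VB y); move: (phi y) (q y) (sin (phi y)) (h - _ - _) => f w s V sb VBy.
    have B0 : 0 <= B by apply: le_trans VBy.
    have h1 : `|w * (s * V)| <= `|w| * `|f| * B.
      by rewrite !normrM -mulrA ler_wpM2l// ler_pM.
    have h2 : `|w| * `|f| * 2 <= f ^+ 2 + w ^+ 2.
      by rewrite -(real_normK (num_real f)) -(real_normK (num_real w)); have := sqr_ge0 (`|f| - `|w|); nra.
    have -> : 2 * f ^+ 1 * w + 2 * w ^+ 1 * (s * V) = 2 * (f * w) + 2 * (w * (s * V)) by ring.
    apply: (le_trans (ler_normD _ _)); rewrite (normrM 2) (normrM 2) normr_nat.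
    have h3 : `|w| * `|f| * 2 * B <= (f ^+ 2 + w ^+ 2) * B by rewrite ler_wpM2r.
    by rewrite (normrM f); move: h1 h2 h3; move: (`|_ * (_ * _)|) (f ^+ 2 + w ^+ 2) => a b; lra.
  have := hy0 (Num.min y0 x); rewrite ge_min lexx => /(_ isT) pos.
  move/eqP; rewrite /E paddr_eq0 ?sqr_ge0// sqrf_eq0 => /andP[/eqP z _].
  by rewrite z ltxx in pos.
move=> x; rewrite lt_neqAle eq_sym no0/= leNgt; apply/negP => phix.
pose a := Num.min y0 x.
have pa : 0 < phi a by apply: hy0; rewrite /a ge_min lexx.
have ax : a <= x by rewrite /a ge_min lexx orbT.
have [|t _ /eqP] := @IVT R phi a x 0 ax (continuous_subspaceT cphi); last by rewrite (negbTE (no0 t)).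
by rewrite ge_min le_max (ltW phix) (ltW pa) orbT.
Qed.
End Positivity.

(** * Exponential decay *)

Section Decay.
Context {R : realType}.
Local Notation mu := (@lebesgue_measure R).
Implicit Types (x y t e C M : R) (F f phi psi p q r : R -> R).

(** Along [q + s phi] the inequality [q' >= s^2 phi] becomes first order: were
    it positive somewhere it would stay away from zero, and [phi], tending to
    zero, would end up increasing. *)
Lemma convex_decay phi q r (s X : R) : 0 < s ->
  (forall x, is_derive x 1 phi (q x)) -> (forall x, is_derive x 1 q (r x)) ->
  (forall x, X <= x -> 0 < phi x) -> (forall x, X <= x -> s ^+ 2 * phi x <= r x) ->
  phi x @[x --> +oo] --> 0 -> forall x, X <= x -> q x <= - s * phi x.
Proof.
move=> s0 dphi dq pos hr l0 x Xx; rewrite -subr_le0 mulNr opprK leNgt; apply/negP => wx.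
pose w y := q y + s * phi y.
pose w' y := r y + s * q y.
have dw y : is_derive y 1 w (w' y) := derD (dq y) (derZ s (dphi y)).
have wge y : x <= y -> w x <= w y.
  move=> xy; have : w x * expR (- s * x) <= w y * expR (- s * y).
    have := der_ndecr xy (fun z => der_expM (- s) (dw z)); apply=> z /andP[xz _].
    rewrite pmulr_lge0 ?expR_gt0// /w /w'; have := hr z (le_trans Xx xz); lra.
  have es : 0 < expR (- s * x) by exact: expR_gt0.
  have le : expR (- s * y) <= expR (- s * x) by rewrite ler_expR ler_wnM2l// oppr_le0 ltW.
  move=> h; have wy : 0 < w y.
    by rewrite -(pmulr_lgt0 _ (expR_gt0 (- s * y))); apply: lt_le_trans h; rewrite mulr_gt0.
  rewrite -(ler_pM2r es); apply: (le_trans h); exact: ler_wpM2l (ltW wy) _ _ le.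
have w0 : 0 < w x / s / 2 by rewrite !divr_gt0.
have [M [_ hM]] : \forall y \near +oo, phi y < w x / s / 2 by apply: (cvgr_lt 0).
pose y := Num.max (M + 1) x.
have xy : x <= y by rewrite /y le_max lexx orbT.
have My z : y <= z -> phi z < w x / s / 2.
  by move=> yz; apply: hM; apply: lt_le_trans yz; rewrite /y lt_max ltrDl ltr01.
have inc : phi y <= phi (y + 1 / s).
  apply: (der_ndecr _ dphi) => [|z /andP[yz _]]; first by rewrite lerDl divr_ge0// ltW.
  have h1 := wge z (le_trans xy yz); have h2 := My z yz.
  have : s * phi z <= w x / 2.
    by have := ler_wpM2l (ltW s0) (ltW h2); congr (_ <= _); field; rewrite gt_eqF.
  rewrite /w in h1 *; move: wx; lra.
have yy : y < y + 1 / s by rewrite ltrDl divr_gt0.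
have [t /andP[yt _] E] := mean_value yy dphi.
have q1 : w x / 2 <= q t.
  have h1 := wge t (le_trans xy (ltW yt)); have h2 := My t (ltW yt).
  have : s * phi t <= w x / 2.
    by have := ler_wpM2l (ltW s0) (ltW h2); congr (_ <= _); field; rewrite gt_eqF.
  rewrite /w in h1 *; move: wx; lra.
have p1 := pos y (le_trans Xx xy); have p2 := My _ (ltW yy).
have : w x / 2 * (1 / s) <= q t * (y + 1 / s - y).
  by rewrite addrC addKr ler_wpM2r// divr_ge0// ltW.
have -> : w x / 2 * (1 / s) = w x / s / 2 by field; rewrite gt_eqF.
rewrite -E; lra.
Qed.

(** The bound on [q] comes from convexity: [- q x] is at most the decrease of
    [phi] over the preceding unit interval. *)
Lemma convex_exp phi q r (s X : R) : 0 < s ->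
  (forall x, is_derive x 1 phi (q x)) -> (forall x, is_derive x 1 q (r x)) ->
  (forall x, X <= x -> 0 < phi x) -> (forall x, X <= x -> s ^+ 2 * phi x <= r x) ->
  phi x @[x --> +oo] --> 0 -> 
  [/\ (forall x, X <= x -> q x <= 0), (forall x, X <= x -> phi x <= phi X * expR (s * (X - x))) &
      (forall x, X + 1 <= x -> `|q x| <= phi (x - 1))].
Proof.
move=> s0 dphi dq pos hr l0; have hq := convex_decay s0 dphi dq pos hr l0.
have q0 x : X <= x -> q x <= 0.
  by move=> Xx; apply: (le_trans (hq _ Xx)); rewrite mulNr oppr_le0 mulr_ge0 ?ltW ?pos.
split=> // x Xx.
  have := der_nincr Xx (fun y => der_expM s (dphi y)) _.
  have -> : phi X * expR (s * (X - x)) = phi X * expR (s * X) * expR (- (s * x)).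
    by rewrite -mulrA -expRD mulrBr.
  rewrite expRN ler_pdivlMr ?expR_gt0//; apply=> y /andP[Xy _].
  by rewrite pmulr_lle0 ?expR_gt0//; have := hq _ Xy; lra.
have xx : x - 1 < x by lra.
have [t /andP[t1 t2] E] := mean_value xx dphi.
have Xt : X <= t by lra.
have qq : q t <= q x.
  apply: (der_ndecr (ltW t2) dq) => y /andP[ty _].
  have Xy := le_trans Xt ty; apply: le_trans (hr _ Xy).
  by rewrite mulr_ge0 ?sqr_ge0// ltW// pos.
rewrite ler0_norm ?q0//; last lra.
have p0 : 0 < phi x by apply: pos; lra.
have x1 : x - (x - 1) = 1 by ring.
rewrite x1 mulr1 in E; lra.
Qed.

(** [h - cos phi - Hilb f'] is eventually at least [(h - 1) / 2], because
    [Hilb f'] vanishes at infinity, and [sin phi >= phi / 2] for small [phi];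
    the equation becomes [phi'' >= s^2 phi] with [s^2 = (h - 1) / 4]. *)
Lemma least_decay h c phi p : 1 < h -> 0 < c -> least h c phi p ->
  exists (q r : R -> R) (s a : R), [/\ 0 < s, (forall x, is_derive x 1 phi (q x)),
    (forall x, is_derive x 1 q (r x)) & forall x, a <= x ->
      [/\ q x <= 0, `|phi x| <= expR (s * (a - x)), `|q x| <= expR (s * (a - x)) &
          `|r x| <= expR (s * (a - x))]].
Proof.
move=> h1 c0 L; have pos := least_positive c0 L.
have [q [Lq [C hC] d1 d2]] := least_C2 L.
have [pr l1 l2 _] := Lq.
set f' := (fun x => - sin (phi x) * q x) in hC d2.
have fi := profile_integ_f' pr.
exists q, (fun x => sin (phi x) * (h - cos (phi x) - Hilb f' x)).
have VB y : `|h - cos (phi y) - Hilb f' y| <= `|h| + 1 + (\int[mu]_s `|f' s| + 6 * C).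
  apply: (le_trans (ler_normB _ _)); apply: lerD; last exact: (Hilb_bounded fi hC).
  by apply: (le_trans (ler_normB _ _)); rewrite lerD2l cos_max.
move: (`|h| + 1 + _) VB => B VB.
have B0 : 0 <= B by apply: le_trans (VB 0).
have h0 : 0 < (h - 1) / 2 by lra.
have [M hM] := Hilb_vanish fi hC h0.
have [rho rho0 hsin] := @sin_near0 R 1 ltr01.
have [M2 [_ hM2]] : \forall y \near +oo, phi y < rho by apply: (cvgr_lt 0).
pose X := Num.max M (M2 + 1).
have XM x : X <= x -> M <= x by apply: le_trans; rewrite /X le_max lexx.
have XM2 x : X <= x -> phi x < rho.
  by move=> Xx; apply: hM2; apply: lt_le_trans Xx; rewrite /X lt_max ltrDl ltr01 orbT.
pose s := Num.sqrt ((h - 1) / 4).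
have k0 : 0 < (h - 1) / 4 by lra.
have s0 : 0 < s by rewrite sqrtr_gt0.
have hr x : X <= x -> s ^+ 2 * phi x <= sin (phi x) * (h - cos (phi x) - Hilb f' x).
  move=> Xx; rewrite sqr_sqrtr ?(ltW k0)//.
  have := hsin (phi x); rewrite (gtr0_norm (pos x)) mul1r => /(_ (XM2 _ Xx)).
  have := hM _ (XM _ Xx); have := cos_le1 (phi x); have := pos x.
  move: (phi x) (sin _) (cos _) (Hilb _ _) => u S K N u0 K1; rewrite ler_norml => /andP[_ N1] hs.
  have S1 : u / 2 <= S.
    have [S0|S0] := leP 0 S; first by move: hs; rewrite (ger0_norm S0) ler_norml => /andP[_]; lra.
    by move: hs; rewrite (ltr0_norm S0) ler_norml => /andP[_]; lra.
  have V1 : (h - 1) / 2 <= h - K - N by lra.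
  have -> : (h - 1) / 4 * u = u / 2 * ((h - 1) / 2) by field.
  by apply: ler_pM => //; lra.
have [q0 e1 e2] := convex_exp s0 d1 d2 (fun x _ => pos x) hr l2.
(* one constant for the three bounds; it is absorbed by moving the origin of
   the exponential to [a >= A / s] *)
pose A := phi X * expR (s * X) * (expR s + 1 + B).
have px := pos X.
have e0 : 0 < phi X * expR (s * X) by rewrite mulr_gt0// expR_gt0.
pose a := Num.max (X + 1) (A / s).
have Aa : A <= expR (s * a).
  have : A / s <= a by rewrite /a le_max lexx orbT.
  rewrite ler_pdivrMr// => h2; apply: (le_trans h2); rewrite mulrC.
  by apply: le_trans (expR_ge1Dx (s * a)); lra.
exists s, a; split=> // x ax.
have Xx1 : X + 1 <= x by apply: le_trans ax; rewrite /a le_max lexx.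
have Xx : X <= x by lra.
have Ex : expR (s * (a - x)) = expR (s * a) * expR (- (s * x)) by rewrite -expRD mulrBr.
have bound k v : 0 <= k -> k <= expR s + 1 + B -> v <= phi X * expR (s * X) * k * expR (- (s * x)) ->
    v <= expR (s * (a - x)).
  move=> k0' kle hv; apply: (le_trans hv); rewrite Ex; apply: ler_wpM2r; first exact: expR_ge0.
  by apply: le_trans Aa; rewrite /A ler_wpM2l// ltW.
have es := expR_gt0 s.
have f1 y : X <= y -> phi y <= phi X * expR (s * X) * expR (- (s * y)).
  by move=> /e1; rewrite mulrBr expRD mulrA.
split; first exact: q0.
- apply: (bound 1) => //; first by lra.
  by rewrite (gtr0_norm (pos x)) mulr1 f1.
- apply: (bound (expR s)); [exact: ltW|lra|].
  apply: (le_trans (e2 _ Xx1)); have Xm : X <= x - 1 by lra.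
  apply: (le_trans (f1 _ Xm)); rewrite -!mulrA -!expRD.
  suff -> : s + - (s * x) = - (s * (x - 1)) by [].
  ring.
- apply: (bound B) => //; first by lra.
  rewrite normrM mulrAC; apply: ler_pM => //; apply: le_trans (f1 _ Xx).
  by have := sin_lip (phi x) 0; rewrite sin0 !subr0 (gtr0_norm (pos x)).
Qed.

End Decay.

(** * The half Laplacian of a decaying function *)

Section HalfLaplacian.
Context {R : realType}.
Local Notation mu := (@lebesgue_measure R).
Local Notation RM := (measurableTypeR R).
Local Notation meas g := (measurable_fun (setT : set RM) g).
Local Notation integT g := (mu.-integrable (setT : set RM) (EFin \o g)).
Implicit Types (x y t u v s e C M : R) (F f phi psi p q r g : R -> R).

Let mT1 : measurable (setT : set RM). Proof. exact: measurableT. Qed.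
Hint Resolve mT1 : core.

Definition reflect_at x : RM -> RM := fun t => x - t.

Lemma meas_reflect x : measurable_fun (setT : set RM) (reflect_at x).
Proof. by apply: measurable_funB; [exact: measurable_cst|exact: measurable_id]. Qed.

HB.instance Definition _ x := isMeasurableFun.Build _ _ RM RM (reflect_at x) (meas_reflect x).

Lemma lebesgue_reflect x (A : set RM) : measurable A -> pushforward mu (reflect_at x) A = mu A.
Proof.
move=> mA; apply/esym/lebesgue_measure_unique => //= _ [[a b]] _ <-.
rewrite /pushforward.
have -> : reflect_at x @^-1` `]a, b]%classic = `[x - b, x - a[%classic.
  apply/seteqP; split => t; rewrite /reflect_at /= !in_itv/= => /andP[h1 h2]; apply/andP; split; lra.
rewrite /= !lebesgue_measure_itv/= !lte_fin ltrD2l ltrN2; case: ifP => // _.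
by rewrite -!EFinB; congr (_%:E); ring.
Qed.

Lemma Rint_reflect x g : integT g ->
  integT (fun t => g (x - t)) /\ \int[mu]_t g (x - t) = \int[mu]_t g t.
Proof.
move=> gi; have mg : measurable_fun [set: RM] (EFin \o g) by apply/measurable_EFinP; exact: integ_meas gi.
have gi' : integT (fun t => g (x - t)).
  apply/integrableP; split.
    by apply: (measurableT_comp mg); exact: meas_reflect.
  have [_] := integrableP _ _ _ gi; congr (_ < _)%E.
  have := @ge0_integral_pushforward _ _ _ _ R _ (meas_reflect x) mu setT (fun t => `|(g t)%:E|)%E measurableT.
  rewrite preimage_setT => <- //.
  - by apply: eq_measure_integral => A mA _; exact/esym/lebesgue_reflect.
  - by apply: measurableT_comp => //; exact: measurable_funTS.
split=> //; rewrite /Rintegral; congr fine.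
have := @integral_pushforward _ _ _ _ R _ (meas_reflect x) mu setT (EFin \o g) mg.
rewrite preimage_setT => /(_ gi' measurableT) /= <-.
by apply: eq_measure_integral => A mA _; exact: lebesgue_reflect.
Qed.


Section SecondDifference.
Variables (f : R -> R) (x rho L : R).
Hypotheses (cf : continuous f) (fi : integT f) (rho0 : 0 < rho).

Definition diff2 u := f (x + u) + f (x - u) - 2 * f x.

Hypothesis (hL : forall u, `|u| <= rho -> `|diff2 u| <= L * u ^+ 2).

Definition far e u := if e < `|u| then u ^- 2 else 0.
Definition near_part e u := if e < `|u| then 0 else diff2 u * u ^- 2.

Lemma meas_abs_gt e : measurable_fun (setT : set RM) (fun u : RM => e < `|u|).
Proof.
apply: measurable_fun_ltr; first exact: measurable_cst.
by apply: continuous_measurable_fun; exact: norm_continuous.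
Qed.

Lemma rec_cont e : 0 < e -> continuous (rec e).
Proof.
move=> e0 u; apply: cvgV; first by rewrite gt_eqF// ltr_wpDl ?sqr_ge0 ?exprn_gt0.
by apply: cvgD; [exact: exprn_continuous|exact: cvg_cst].
Qed.

(** A limit of continuous functions, also at the origin where the inverse of
    [0] is [0]. *)
Lemma meas_inv_sqr : meas (fun u => u ^- 2).
Proof.
have e0 (n : nat) : 0 < n.+1%:R^-1 :> R by rewrite invr_gt0.
have mh (n : nat) : meas (fun u => u ^+ 2 * (rec n.+1%:R^-1 u * rec n.+1%:R^-1 u)).
  apply: continuous_measurable_fun => u.
  by apply: cvgM; [exact: exprn_continuous|apply: cvgM; exact: rec_cont].
apply: (measurable_fun_cvg mh) => u _; have [->|u0] := eqVneq u 0.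
  rewrite expr0n invr0; apply: cvg_ext (@cvg_const R 0) => n /=; by rewrite mul0r.
have u2 : u ^+ 2 != 0 by rewrite sqrf_eq0.
have c1 : (fun n : nat => rec n.+1%:R^-1 u) @ \oo --> u ^- 2.
  apply: cvgV => //; rewrite -[X in _ --> X]addr0; apply: cvg_add (@cvg_const R _) _.
  have inv0 : (fun n : nat => n.+1%:R^-1 : R) @ \oo --> 0 by exact: cvg_harmonic.
  by have := cvg_mul inv0 inv0; rewrite mul0r.
have := cvg_mul (@cvg_const R (u ^+ 2)) (cvg_mul c1 c1).
by rewrite mulrA divff// mul1r.
Qed.

Lemma meas_far e : meas (far e).
Proof.
apply: measurable_fun_if => //; first exact: meas_abs_gt.
  by apply: measurable_funTS; exact: meas_inv_sqr.
Qed.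

Lemma far_ge0 e u : 0 <= far e u.
Proof. by rewrite /far; case: ifP => // _; rewrite invr_ge0 sqr_ge0. Qed.

Lemma farN e u : far e (- u) = far e u.
Proof. by rewrite /far normrN sqrrN. Qed.

Lemma far_le e u : 0 < e -> far e u <= e ^- 2.
Proof.
move=> e0; rewrite /far; case: ifP => [eu|_]; last by rewrite invr_ge0 sqr_ge0.
have u0 := lt_trans e0 eu.
by rewrite -(real_normK (num_real u)) lef_pV2 ?posrE ?exprn_gt0// lerXn2r ?nnegrE// ltW.
Qed.

Lemma far_rec e u : 0 < e -> far e u <= 2 * rec e u.
Proof.
move=> e0; rewrite /far; case: ifP => [eu|_]; last by rewrite mulr_ge0 ?rec_ge0.
have u0 := lt_trans e0 eu; have u2 : 0 < u ^+ 2 by rewrite -(real_normK (num_real u)) exprn_gt0.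
have h : e ^+ 2 <= u ^+ 2 by rewrite -(real_normK (num_real u)) lerXn2r ?nnegrE// ltW.
have e2 : 0 < e ^+ 2 by rewrite exprn_gt0.
by rewrite /rec ler_pdivlMr ?addr_gt0// ler_pdivrMl//; lra.
Qed.

Lemma rec0_integ e : 0 < e -> integT (rec e) /\ \int[mu]_u rec e u = pi / e.
Proof.
move=> e0; have [i1 h1] := rec_integ 0 e0.
have E s : rec e (0 - s) = rec e s by rewrite sub0r /rec sqrrN.
split; first by apply: (eq_integ mT1 _ i1) => t _; rewrite E.
by rewrite -h1; apply: eq_Rintegral => t _; rewrite E.
Qed.

Lemma far_integ e : 0 < e -> integT (far e).
Proof.
move=> e0; apply: (integ_le mT1 (meas_far e) (integZ mT1 2 (rec0_integ e0).1)) => u _.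
by rewrite ger0_norm ?far_ge0// far_rec.
Qed.

Lemma truncated_integ e : 0 < e ->
  integT (fun t => (f t - f x) * far e (x - t)).
Proof.
move=> e0; have mf := meas_far e.
have mr : meas (fun t => far e (x - t)) by exact: (measurableT_comp mf (meas_reflect x)).
have i1 := @integM_bounded _ _ _ _ _ mT1 (e ^- 2) _ _ fi mr.
have i2 := integZ mT1 (f x) (Rint_reflect x (far_integ e0)).1.
apply: (eq_integ mT1 _ (integB mT1 (i1 _) i2)) => [t _|t _]; first by rewrite /=; ring.
by rewrite ger0_norm ?far_ge0// far_le.
Qed.

(** Averaging the truncated integral with its reflection about [x] makes the
    singularity integrable. *)
Lemma truncated_symmetric e : 0 < e ->
  integT (fun u => diff2 u * far e u) /\
  Lambda_truncated f x e = (2 * pi)^-1 * \int[mu]_u (diff2 u * far e u).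
Proof.
move=> e0; have i0 := truncated_integ e0.
have [i1 h1] := Rint_reflect x i0.
have [i2 h2] := Rint_reflect 0 i1.
have E u : diff2 u * far e u = (f (x - u) - f x) * far e (x - (x - u)) +
    (f (x - (0 - u)) - f x) * far e (x - (x - (0 - u))).
  have -> : x - (x - u) = u by ring.
  have -> : x - (0 - u) = x + u by ring.
  have -> : x - (x + u) = - u by ring.
  rewrite farN /diff2; ring.
split; first by apply: (eq_integ mT1 _ (integD mT1 i1 i2)) => u _; rewrite E.
under [in RHS]eq_Rintegral do rewrite E.
rewrite (RintegralD mT1 i1 i2) h2 h1.
have -> : Lambda_truncated f x e = pi^-1 * \int[mu]_t ((f t - f x) * far e (x - t)).
  rewrite /Lambda_truncated; congr (_ * _); rewrite [LHS]Rintegral_mkcond.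
  have in_ t : (t \in ([set t | e < `|t - x|] : set RM)) = (e < `|t - x|) by apply/idP/idP; rewrite inE.
  apply: eq_Rintegral => t _; rewrite patchE in_ /far distrC.
  have -> : (x - t) ^+ 2 = (t - x) ^+ 2 by ring.
  by case: ifP => _; rewrite ?mulr0.
move: (\int[mu]_t _) => I; have := @pi0 R; move: (@pi R) => q q0; field; exact: q0.
Qed.

(** On [|u| <= e] the factor [2 * e ^+ 2 * rec e u] is at least [1], and
    [rec e] has an explicit integral. *)
Lemma near_bound e u : 0 < e -> e <= rho -> `|near_part e u| <= 2 * e ^+ 2 * L * rec e u.
Proof.
move=> e0 er; have L0 : 0 <= L.
  have := hL (u := rho); rewrite (gtr0_norm rho0) => /(_ (lexx _)).
  by move=> /(le_trans (normr_ge0 _)); rewrite pmulr_lge0// exprn_gt0.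
have B0 : 0 <= 2 * e ^+ 2 * L * rec e u.
  by apply: mulr_ge0 (rec_ge0 _ e0); apply: mulr_ge0 L0; apply: mulr_ge0 => //; exact: sqr_ge0.
rewrite /near_part; case: ltP => [_|ue]; first by rewrite normr0.
have [uz|u0] := eqVneq u 0; first by rewrite {1 2}uz expr0n invr0 mulr0 normr0.
have u2 : 0 < u ^+ 2 by rewrite exprn_even_gt0//= u0.
apply: (@le_trans _ _ L).
  by rewrite normrM normfV (ger0_norm (ltW u2)) ler_pdivrMr// hL// (le_trans ue).
have h : u ^+ 2 <= e ^+ 2 by rewrite -(real_normK (num_real u)) lerXn2r ?nnegrE// ltW.
rewrite mulrAC ler_peMl// /rec mulrC; move: (u ^+ 2) u2 h => U U0 h.
have e2 : 0 < e ^+ 2 by rewrite exprn_gt0.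
rewrite ler_pdivlMl ?addr_gt0//; lra.
Qed.

Lemma diff2_cont : continuous diff2.
Proof.
move=> u; apply: cvgB; last exact: cvg_cst.
apply: cvgD; last exact: (cont_comp_sub cf).
apply: (continuous_comp (f := fun u => x + u)); last exact: cf.
by apply: cvgD; [exact: cvg_cst|exact: cvg_id].
Qed.

Lemma near_integ e : 0 < e -> e <= rho -> integT (near_part e) /\
  `|\int[mu]_u near_part e u| <= 2 * pi * (L * e).
Proof.
move=> e0 er; have [i1 h1] := rec0_integ e0.
have mn : meas (near_part e).
  apply: measurable_fun_if => //; first exact: meas_abs_gt.
  apply: measurable_funTS; apply: measurable_funM; last exact: meas_inv_sqr.
  by apply: continuous_measurable_fun; exact: diff2_cont.
have i2 := integZ mT1 (2 * e ^+ 2 * L) i1.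
have i3 : integT (near_part e) by apply: (integ_le mT1 mn i2) => u _; exact: near_bound.
split=> //; have := Rint_norm_le mT1 i3 i2 (fun u _ => near_bound u e0 er).
rewrite (RintegralZl _ mT1 i1) h1; congr (_ <= _).
move: (@pi R) => q; field; by rewrite gt_eqF.
Qed.

(** Removing the truncation [e <= rho] changes the integral by [O(e)], since
    the second difference is quadratic; at the truncation [rho] the kernel is
    at most [rho^-2], which is paired with [|f|], and its integral is paired
    with the value [f x]. *)
Lemma half_laplacian_bound : exists2 l : R, is_Lambda f x l &
  `|l| <= L * rho + (\int[mu]_t `|f t|) / rho ^+ 2 + 2 * `|f x| / rho.
Proof.
have E e u : near_part e u + diff2 u * far e u = diff2 u * u ^- 2.
  by rewrite /near_part /far; case: ifP; rewrite ?mulr0 ?addr0 ?add0r.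
pose S u := diff2 u * u ^- 2.
pose k : R := (2 * pi)^-1.
have pp := pi_gt0 R; have p1 := @pi_ge1 R.
have k0 : 0 < k by rewrite invr_gt0 mulr_gt0.
have split_at e : 0 < e -> e <= rho -> k * \int[mu]_u S u - Lambda_truncated f x e = k * \int[mu]_u near_part e u.
  move=> e0 er; have [i1 ->] := truncated_symmetric e0; have [i2 _] := near_integ e0 er.
  have -> : \int[mu]_u S u = \int[mu]_u (near_part e u + diff2 u * far e u).
    by apply: eq_Rintegral => u _; rewrite E.
  rewrite (RintegralD mT1 i2 i1) -/k; ring.
have small e : 0 < e -> e <= rho -> `|k * \int[mu]_u S u - Lambda_truncated f x e| <= L * e.
  move=> e0 er; rewrite split_at// normrM (gtr0_norm k0) /k.
  by rewrite ler_pdivrMl ?mulr_gt0//; have [] := near_integ e0 er.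
exists (k * \int[mu]_u S u).
  apply/cvgrPdist_le => eta eta0; near=> e.
  have e0 : 0 < e by [].
  have er : e <= rho by near: e; exact: nbhs_right_le.
  apply: (le_trans (small e e0 er)).
  have : e <= eta / (`|L| + 1) by near: e; apply: nbhs_right_le; rewrite divr_gt0// ltr_wpDl.
  rewrite ler_pdivlMr ?ltr_wpDl//; apply: le_trans; rewrite mulrC ler_wpM2l ?(ltW e0)//.
  by rewrite (le_trans (ler_norm _))// lerDl.
have [i1 h1] := truncated_symmetric rho0.
have bt : `|Lambda_truncated f x rho| <= (\int[mu]_t `|f t|) / rho ^+ 2 + 2 * `|f x| / rho.
  have ni := integ_norm fi.
  have [j1 g1] := Rint_reflect x ni; have [j2 g2] := Rint_reflect 0 j1.
  have [j3 g3] := rec0_integ rho0.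
  have b u : `|diff2 u * far rho u| <= rho ^- 2 * (`|f (x - u)| + `|f (x - (0 - u))|) + 4 * `|f x| * rec rho u.
    rewrite normrM (ger0_norm (far_ge0 _ _)) /diff2.
    have -> : x - (0 - u) = x + u by ring.
    have F1 := far_le u rho0; have F2 := far_rec u rho0; have F0 := far_ge0 rho u.
    have a1 : `|f (x + u) + f (x - u) - 2 * f x| <= `|f (x + u)| + `|f (x - u)| + 2 * `|f x|.
      apply: (le_trans (ler_normB _ _)); rewrite normrM normr_nat lerD2r; exact: ler_normD.
    apply: (le_trans (ler_wpM2r F0 a1)).
    have a2 := ler_wpM2l (addr_ge0 (normr_ge0 (f (x + u))) (normr_ge0 (f (x - u)))) F1.
    have a3 := ler_wpM2l (normr_ge0 (f x)) F2.
    by move: a2 a3; nra.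
  have j4 := integZ mT1 (rho ^- 2) (integD mT1 j1 j2).
  have j5 := integZ mT1 (4 * `|f x|) j3.
  have := Rint_norm_le mT1 i1 (integD mT1 j4 j5) (fun u _ => b u).
  rewrite (RintegralD mT1 j4 j5) (RintegralZl _ mT1 (integD mT1 j1 j2)) (RintegralZl _ mT1 j3).
  rewrite (RintegralD mT1 j1 j2) g2 g1 g3 => h2.
  rewrite h1 -/k normrM (gtr0_norm k0) /k ler_pdivrMl ?mulr_gt0//; apply: (le_trans h2).
  have N0 : 0 <= \int[mu]_t `|f t| by apply: Rint_ge0.
  have X0 : 0 <= (\int[mu]_t `|f t|) / rho ^+ 2 by rewrite divr_ge0// sqr_ge0.
  move: X0 p1; rewrite mulrDr (mulrC (rho ^- 2)) -/(_ / _).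
  move: (\int[mu]_t _) (@pi R) => I q X0 p1.
  have -> : 4 * `|f x| * (q / rho) = 2 * q * (2 * `|f x| / rho) by field; rewrite gt_eqF.
  rewrite mulrDl; nra.
have := small rho rho0 (lexx _); move: bt.
move: (Lambda_truncated _ _ _) (k * _) => T l hT hl.
rewrite -addrA; apply: le_trans (lerD hl hT); have := ler_normD (l - T) T.
by rewrite subrK.
Unshelve. all: by end_near. Qed.

End SecondDifference.

(** The mean value theorem is applied to [v |-> F (x + v) + F (x - v)], then
    to [f]. *)
Lemma second_difference F f g x rho L : (forall t, is_derive t 1 F (f t)) ->
  (forall t, is_derive t 1 f (g t)) -> (forall t, x - rho <= t -> `|g t| <= L) ->
  forall u, `|u| <= rho -> `|F (x + u) + F (x - u) - 2 * F x| <= 2 * L * u ^+ 2.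
Proof.
move=> dF df gL.
have pos u : 0 < u -> u <= rho -> `|F (x + u) + F (x - u) - 2 * F x| <= 2 * L * u ^+ 2.
  move=> u0 ur.
  have dp t : is_derive t 1 (fun v => x + v) (0 + 1) := derD (der_cst x t) (der_id t).
  have dm t : is_derive t 1 (fun v => x - v) (0 - 1) := derB (der_cst x t) (der_id t).
  pose g1 t := f (x + t) - f (x - t).
  have dG t : is_derive t 1 (fun v => F (x + v) + F (x - v)) (g1 t).
    by apply: is_derive_val (derD (der_comp (dp t) (dF (x + t))) (der_comp (dm t) (dF (x - t)))) _; rewrite /g1; ring.
  have [z /andP[z0 zu] E1] := mean_value u0 dG.
  have zz : x - z < x + z by lra.
  have [w /andP[w1 w2] E2] := mean_value zz df.
  have -> : F (x + u) + F (x - u) - 2 * F x = F (x + u) + F (x - u) - (F (x + 0) + F (x - 0)).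
    by rewrite addr0 subr0; ring.
  rewrite E1 /g1 E2 !normrM subr0 (gtr0_norm u0).
  have -> : `|x + z - (x - z)| = 2 * z by rewrite gtr0_norm; lra.
  have gw : `|g w| <= L by apply: gL; lra.
  have L0 : 0 <= L by apply: le_trans gw.
  have h1 : `|g w| * (2 * z) <= L * (2 * u) by apply: ler_pM => //; lra.
  by have := ler_wpM2r (ltW u0) h1; congr (_ <= _); ring.
move=> u; have [u0|u0|->] := ltgtP u 0.
- rewrite (ltr0_norm u0) => ur; have := pos (- u); rewrite oppr_gt0 sqrrN opprK => /(_ u0 ur).
  by rewrite (addrC (F (x - u))).
- by rewrite (gtr0_norm u0); exact: pos.
- move=> _; have -> : F (x + 0) + F (x - 0) - 2 * F x = 0 by rewrite addr0 subr0; ring.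
  by rewrite normr0 expr0n mulr0.
Qed.

Lemma expRN_le v : 0 < v -> expR (- v) <= v^-1 /\ expR (- v) <= 27 * v ^- 3.
Proof.
move=> v0; rewrite expRN; split.
  by rewrite lef_pV2 ?posrE ?expR_gt0//; have := expR_ge1Dx v; lra.
have E : expR v = expR (v / 3) ^+ 3 by rewrite -expRM_natl; congr expR; field.
have h : (v / 3) ^+ 3 <= expR v.
  rewrite E lerXn2r ?nnegrE ?expR_ge0//; first lra.
  by have := expR_ge1Dx (v / 3); lra.
have e0 := expR_gt0 v; have v3 : 0 < v ^+ 3 by rewrite exprn_gt0.
rewrite -[_^-1]mul1r ler_pdivrMr// mulrAC ler_pdivlMr// mul1r.
by have := ler_wpM2l (ler0n R 27) h; congr (_ <= _); field.
Qed.


(** Near the point the second difference is controlled by the decaying second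
    derivative, and at distance comparable to [x - a] by the inverse square of
    the kernel; this gives quadratic decay away from [a].  Starting from
    [a + 1] keeps the bound finite at the starting point. *)
Lemma decaying_half_laplacian F f g (s a : R) : 0 < s -> integT F ->
  (forall t, is_derive t 1 F (f t)) -> (forall t, is_derive t 1 f (g t)) ->
  (forall t, a <= t -> `|F t| <= expR (s * (a - t)) /\ `|g t| <= 2 * expR (s * (a - t))) ->
  exists2 C : R, 0 < C & forall x, a + 1 < x ->
    exists2 l : R, is_Lambda F x l & `|l| <= C / (x - (a + 1) + 1) ^+ 2.
Proof.
move=> s0 iF dF df dec; have cF := derive_cont dF.
set N := \int[mu]_t `|F t|.
have N0 : 0 <= N by apply: Rint_ge0.
exists (4 * (108 / s ^+ 3 + N + 2 / s)).
  by apply: mulr_gt0 => //; rewrite ltr_wpDl ?divr_gt0// addr_ge0// divr_ge0// exprn_ge0// ltW.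
move=> x ax; set y := x - (a + 1); have y0 : 0 < y by rewrite subr_gt0.
(* half the distance from [x] to [a]: the decay is available on the whole
   interval of radius [rho] about [x] *)
pose rho := (y + 1) / 2; have rho0 : 0 < rho by rewrite /rho; lra.
pose L := 2 * expR (- (s * rho)).
have gL t : x - rho <= t -> `|g t| <= L.
  move=> xt; have at_ : a <= t by move: xt; rewrite /rho /y; lra.
  have [_ h] := dec t at_; apply: (le_trans h).
  by rewrite /L ler_pM2l// ler_expR -mulrN ler_wpM2l ?(ltW s0)//; move: xt; rewrite /rho /y; lra.
have [l il hl] := half_laplacian_bound cF iF rho0 (second_difference dF df gL).
exists l => //; apply: (le_trans hl); rewrite -/N.
have ax' : a <= x by lra.
have [Fx _] := dec x ax'.
have sr : 0 < s * rho by rewrite mulr_gt0.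
have [b1 b3] := expRN_le sr.
have Fr : `|F x| <= (s * rho)^-1.
  apply: (le_trans Fx); apply: le_trans b1; rewrite ler_expR -mulrN ler_wpM2l ?(ltW s0)//.
  by move: y0; rewrite /rho /y; lra.
have -> : y + 1 = 2 * rho by rewrite /rho; field.
rewrite /L; move: (expR _) (`|F x|) b3 Fr => e v b3 Fr.
have r2 : 0 <= rho ^- 2 by rewrite invr_ge0 exprn_ge0// ltW.
have -> : 4 * (108 / s ^+ 3 + N + 2 / s) / (2 * rho) ^+ 2 = 108 / s ^+ 3 / rho ^+ 2 + N / rho ^+ 2 + 2 / s / rho ^+ 2.
  by field; rewrite !gt_eqF.
apply: lerD; first apply: lerD => //.
  have := ler_wpM2r (ltW rho0) b3; rewrite -(ler_pM2l (ltr0n R 4)).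
  congr (_ <= _); first ring.
  by field; rewrite !gt_eqF.
have := ler_wpM2r (ltW (divr_gt0 (ltr0n R 2) rho0)) Fr; congr (_ <= _); first by field; rewrite gt_eqF.
by field; rewrite !gt_eqF.
Qed.

End HalfLaplacian.

Lemma least_half_laplacian (R : realType) (h c : R) (phi p q r : R -> R) (s a : R) : least h c phi p -> 0 < s ->
  (forall x : R, is_derive x 1 phi (q x)) -> (forall x : R, is_derive x 1 q (r x)) ->
  (forall x, a <= x -> [/\ `|phi x| <= expR (s * (a - x)), `|q x| <= expR (s * (a - x)) &
          `|r x| <= expR (s * (a - x))]) ->
  exists2 C : R, 0 < C & forall x, a + 1 < x ->
    exists2 l : R, is_Lambda (fun y => cos (phi y) - 1) x l & `|l| <= C / (x - (a + 1) + 1) ^+ 2.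
Proof.
move=> [[_ _ fi] _ _ _] s0 d1 d2 dec.
have dc x := der_comp (d1 x) (is_derive_cos (phi x)).
have ds x := der_comp (d1 x) (is_derive_sin (phi x)).
pose f x := - sin (phi x) * q x; pose g x := - (cos (phi x) * q x) * q x + - sin (phi x) * r x.
apply: (@decaying_half_laplacian R _ f g s a s0 fi) => [x|x|x ax].
- by apply: is_derive_val (derB (dc x) (der_cst 1 x)) _; rewrite subr0.
- exact: (derM (derN (ds x)) (d2 x)).
have [h1 h2 h3] := dec x ax; split.
  by apply: le_trans h1; have := cos_lip (phi x) 0; rewrite cos0 subr0.
have e1 : expR (s * (a - x)) <= 1 by rewrite -expR0 ler_expR mulr_ge0_le0 ?(ltW s0)// subr_le0.
have c1 := cos_max (phi x); have s1 := sin_norm_le1 (phi x).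
apply: (le_trans (ler_normD _ _)); rewrite !(normrM, normrN) mulr2n mulrDl mul1r; apply: lerD.
  rewrite -[leRHS]mul1r; apply: ler_pM => //.
  by rewrite mulr_ile1// (le_trans h2).
by rewrite -[leRHS]mul1r; apply: ler_pM.
Qed.

Lemma power_bound (R : realType) (beta y : R) : 0 < beta < 2 -> 0 < y -> y `^ beta <= (y + 1) ^+ 2.
Proof.
move=> /andP[b0 b2] y0; rewrite -powR_mulrn; last lra.
apply: (@le_trans _ _ ((y + 1) `^ beta)).
  by apply: ge0_ler_powR; rewrite ?nnegrE; lra.
by apply: ler_powR; lra.
Qed.

Theorem theorem31 (R : realType) (h : R) (hh : 1 < h)
  (d : nat) (hd : (0 < d)%N) (beta : R) (hbeta : 0 < beta < 2)
  (m : R -> R * R) (phi : R -> R)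
  (hmin : is_minimiser h (- d%:Z) m)
  (hlift : is_lifting m phi)
  (hlim : phi x @[x --> +oo] --> 0) :
  exists a c C : R, [/\ 0 < c, 0 < C,
    (forall x, a <= x ->
       [/\ derivable phi x 1, derivable phi^`() x 1, phi^`() x <= 0 &
           Num.max `|phi x| (Num.max `|phi^`() x| `|phi^`(2) x|)
             <= expR (c * (a - x))]) &
    (forall x, a < x -> exists2 l : R,
       is_Lambda (fun y => comp1 m y - 1) x l &
       `|l| <= C / (x - a) `^ beta)].
Proof.
have [mE [p L]] := minimiser_least hmin hlift hlim.
have c0 : 0 < 2 * pi * d%:R :> R by rewrite !mulr_gt0// ?pi_gt0// ltr0n.
have [q [r [s [a [s0 d1 d2 dec]]]]] := least_decay hh c0 L.
have Eq : phi^`()%classic = q by apply/funext => x; rewrite derive1E; have [_ ->] := d1 x.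
have Er : phi^`(2)%classic = r by rewrite derive1nS derive1n1 Eq; apply/funext => x; rewrite derive1E; have [_ ->] := d2 x.
have [C C0 hC] := least_half_laplacian L s0 d1 d2 (fun x ax => let: And4 _ u v w := dec x ax in And3 u v w).
exists (a + 1), s, C; split=> // x ax.
  have ax' : a <= x by lra.
  have [q0 h1 h2 h3] := dec x ax'.
  have le : expR (s * (a - x)) <= expR (s * (a + 1 - x)) by rewrite ler_expR ler_wpM2l ?(ltW s0)//; lra.
  split; [by have [] := d1 x|by rewrite Eq; have [] := d2 x|by rewrite Eq|].
  by rewrite Eq Er !ge_max (le_trans h1 le) (le_trans h2 le) (le_trans h3 le).
have [l il hl] := hC x ax; exists l; first by rewrite mE.
have y0 : 0 < x - (a + 1) by rewrite subr_gt0.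
apply: (le_trans hl); rewrite ler_pM2l// lef_pV2 ?posrE ?exprn_gt0 ?powR_gt0//; last lra.
exact: power_bound.
Qed.
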